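(* Let $X$ be a normal projective variety of dimension $n$ over an algebraically closed field $\Bbbk$ of characteristic zero, and let $L$ be a very ample and projectively normal line bundle on $X$. Let $F$ be a non-finitely generated admissible filtration of $R=\bigoplus_{k\ge0}H^0(X,kL)$ with $\|F\|_{L^2}\neq0$. Then the sequence $(p_m)$ of points of $\Delta_\infty(\mathbb{Q})$ associated to the sequence of test configurations $(\mathcal{X}^{(m)},\mathcal{L}^{(m)})$ approximating $F$ is a Cauchy sequence for the pseudo-metric $d_\infty$.
   Context: Line bundles are written additively. Put $R_r=H^0(X,rL)$. **Admissible filtrations.** A filtration $F$ of $R$ is an increasing filtration $(F_iR_k)_{i\in\mathbb{Z}}$ of each $R_k$ by subspaces. It is admissible if it is multiplicative ($F_iR_a\cdot F_jR_b\subseteq F_{i+j}R_{a+b}$ for all $a,b,i,j$), pointwise right bounded (for each $k$, $F_iR_k=R_k$ for $i\gg0$), and linearly left bounded (there is a constant $C<0$ with $F_{Ck}R_k=0$ for all $k$). With $F_iR=\bigoplus_kF_iR_k$, it is finitely generated if its Rees algebra $\mathrm{Rees}(F)=\bigoplus_iF_iR\,t^i$ is a finitely generated algebra. **Approximating test configurations.** For $m\ge1$ let $\chi^{(m)}\subset\bigoplus_kR_{mk}[t,t^{-1}]$ be the $\Bbbk[t]$-subalgebra generated by $\bigoplus_iF_iR_m\,t^i$, graded by $k$, and let $F^{(m)}_iR_{mk}=\{s\in R_{mk}: s\,t^i\in\chi^{(m)}\}$. The test configuration $(\mathcal{X}^{(m)},\mathcal{L}^{(m)})$ is $\mathrm{Proj}_{\Bbbk[t]}\chi^{(m)}\to\mathbb{A}^1$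 with $\mathcal{O}(1)$ and the $\mathbb{G}_m$-action for which $s\,t^i$ has weight $-i$. It has exponent $m$, i.e. its fibre over $1$ is $(X,mL)$. **$L^2$ norm.** For an exponent $r$ test configuration $(\mathcal{X},\mathcal{L})$ let $T_k$ be the infinitesimal generator of the $\mathbb{G}_m$-action on $H^0(\mathcal{X}_0,k\mathcal{L}_0)$ and $\underline{T}_k$ its traceless part. The $L^2$ norm is defined by $\|(\mathcal{X},\mathcal{L})\|^2_{L^2}=\lim_{k\to\infty}(kr)^{-n-2}\mathrm{Tr}(\underline{T}_k^2)$. For an admissible filtration, $\|F\|_{L^2}=\liminf_{m\to\infty}\|(\mathcal{X}^{(m)},\mathcal{L}^{(m)})\|_{L^2}$ (known to be a limit). **Tits buildings.** Let $V$ be a finite-dimensional $\Bbbk$-vector space of dimension $\ge3$. A weighted flag on $V$ is a flag $0\subsetneq G_1\subsetneq\cdots\subsetneq G_l=V$, $l\ge2$, with weights $w_1<\dots<w_l$ such that $\sum_iw_i\dim(G_i/G_{i-1})=0$ (where $G_0=0$). Two are equivalent if the flags coincide and the weights differ by a factor $c>0$. $\Delta(V)(\mathbb{Q})$ is the set of equivalence classes of weighted flags with rational weights. Any exhaustive bounded increasing filtration of $V$ indexed by $\mathbb{Z}$ with at least two jumps gives a point of $\Delta(V)(\mathbb{Q})$: give weight $i$ to the $i$-th piece, then subtract a common constant to make the trace zero. The Tits metric $d$ on $\Delta(V)(\mathbb{Q})$: given $p,q$, choose a basis of $V$ adapted to both flags (each step of each flag is spanned by a subset of the basis; such a basis exists),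 let $A,B$ be the diagonal trace-zero matrices whose entries are the weights of the basis vectors (the weight of $v$ is the least $w_i$ with $v\in G_i$) for $p$ and $q$; then $d(p,q)=\arccos\frac{\mathrm{Tr}(AB)}{\sqrt{\mathrm{Tr}(A^2)\mathrm{Tr}(B^2)}}$, independently of choices. **The space $\Delta_\infty(\mathbb{Q})$ and $d_\infty$.** Let $\Delta_r(\mathbb{Q})=\Delta(R_r)(\mathbb{Q})$ with Tits metric $d_r$. Points of $\Delta_r(\mathbb{Q})$ correspond to very ample exponent $r$ test configurations $(\mathcal{X},\mathcal{L})$, modulo base change $z\mapsto z^p$ on $\mathbb{A}^1$ and twisting the linearisation, by the Proj construction above applied to a filtration of $R_r$. The map $\iota_{r,k}\colon\Delta_r(\mathbb{Q})\to\Delta_{rk}(\mathbb{Q})$ sends $(\mathcal{X},\mathcal{L})$ to $(\mathcal{X},k\mathcal{L})$. Concretely, it sends a weighted flag on $R_r$ to the weighted flag on $R_{rk}$ given by the image, under the surjection $\mathrm{Sym}^kR_r\to R_{rk}$, of the induced filtration on $\mathrm{Sym}^kR_r$. $\Delta_\infty(\mathbb{Q})=\varinjlim_r\Delta_r(\mathbb{Q})$ over positive integers ordered by divisibility. For $p,q\in\Delta_\infty(\mathbb{Q})$, both represented in $\Delta_{r_0}(\mathbb{Q})$, $d_\infty(p,q)=\limsup_r d_r(p,q)$, with $r\to\infty$ through multiples of $r_0$ and $p,q$ mapped to $\Delta_r(\mathbb{Q})$ by $\iota_{r_0,r/r_0}$. **The sequence $p_m$.** $p_m\in\Delta_\infty(\mathbb{Q})$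 is the image of the point of $\Delta_m(\mathbb{Q})$ given by the filtration $(F_iR_m)_i$ of $R_m$. It is the point corresponding to $(\mathcal{X}^{(m)},\mathcal{L}^{(m)})$. It is defined whenever this filtration has at least two jumps, which holds for all large $m$ when $\|F\|_{L^2}\ne0$. *)

(* Defs.v *)
From HB Require Import structures.
From mathcomp Require Import all_boot all_order all_algebra.
From mathcomp Require Import all_classical all_reals all_analysis.
(* Some notations of mpoly clash with those of all_analysis. *)
From mathcomp Require Import -(notations) mpoly.

Set Implicit Arguments.
Unset Strict Implicit.
Unset Printing Implicit Defensive.

Import Order.TTheory GRing.Theory Num.Theory.
Import numFieldNormedType.Exports.

Local Open Scope classical_set_scope.
Local Open Scope ring_scope.

Section LinearAlgebra.
Variables (K : fieldType) (E : lmodType K).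
Implicit Types (S U V : set E).

Definition is_subspace V :=
  V 0 /\ forall a u v, V u -> V v -> V (a *: u + v).

Definition span S : set E :=
  [set v | forall V, is_subspace V -> S `<=` V -> V v].

(* The classes of b 0, ..., b (d - 1) form a basis of V / U. *)
Definition basis_mod U V d (b : 'I_d -> E) :=
  (forall i, V (b i)) /\
  forall v, V v -> exists! c : 'rV[K]_d, U (v - \sum_i c ord0 i *: b i).

(* dim (V / U); a meaningless value if V / U is infinite-dimensional. *)
Definition qdim U V : nat :=
  get [set d | exists b : 'I_d -> E, basis_mod U V b].

Definition vdim V : nat := qdim [set 0] V.

End LinearAlgebra.

(* K^o rather than K, so that these functions form a K-module. *)
Notation fn K T := (T -> K^o).

Section Subalgebra.
Variables (K : fieldType) (T : Type).

Definition is_subalgebra (A : set (fn K T)) :=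
  [/\ is_subspace A, A 1 & forall u v, A u -> A v -> A (u * v)].

Definition subalgebra_gen (S : set (fn K T)) : set (fn K T) :=
  [set v | forall A, is_subalgebra A -> S `<=` A -> A v].

End Subalgebra.

(* A subset of the projective space P^N is represented by the set of all
   nonzero vectors lying above it. *)
Section Varieties.
Variables (K : closedFieldType) (N : nat).
Local Notation point := 'rV[K]_N.+1.
Local Notation form := (mpoly N.+1 K).
Implicit Types (X Y Z : set point) (a b p : form).

Definition pval p (x : point) : K := meval (x ord0) p.

Definition homogeneous d p : Prop := p \is ishomog1 d mdeg.

Definition zclosed Z :=
  exists S : set form,
    (forall p, S p -> exists d, homogeneous d p) /\
    forall x, Z x <-> x != 0 /\ forall p, S p -> pval p x = 0.

Definition irreducible_closed Z :=
  [/\ zclosed Z, Z !=set0 &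
      forall Y Y', zclosed Y -> zclosed Y' -> Z `<=` Y `|` Y' ->
        Z `<=` Y \/ Z `<=` Y'].

Definition projective_variety X := irreducible_closed X.

Definition chain_in X l :=
  exists Z : nat -> set point,
    (forall i, (i <= l)%N -> irreducible_closed (Z i) /\ Z i `<=` X) /\
    forall i, (i < l)%N -> Z i `<` Z i.+1.

Definition variety_dim X n := chain_in X n /\ ~ chain_in X n.+1.

(* Rational functions on X are represented by functions on X of the form a / b,
   where division by 0 returns 0; two of them are the same element of K(X) if
   they agree on a nonempty principal open set. *)
Definition ratfun X (f : fn K {x | X x}) :=
  exists d a b, [/\ homogeneous d a, homogeneous d b,
    exists x, X x /\ pval b x != 0 &
    forall y, f y = pval a (sval y) / pval b (sval y)].

Definition ratfun_eq X (f g : fn K {x | X x}) :=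
  exists d b, [/\ homogeneous d b,
    exists x, X x /\ pval b x != 0 &
    forall y, pval b (sval y) != 0 -> f y = g y].

Definition regular_at X (x : point) (f : fn K {x | X x}) :=
  exists d a b, [/\ homogeneous d a, homogeneous d b, pval b x != 0 &
    ratfun_eq f (fun y => pval a (sval y) / pval b (sval y))].

(* Each local ring O_{X,x} is integrally closed in K(X). *)
Definition normal_variety X :=
  forall x, X x -> forall f, @ratfun X f ->
  forall l (c : 'I_l -> fn K {x | X x}), (forall j, regular_at x (c j)) ->
  ratfun_eq (f ^+ l + \sum_(j < l) c j * f ^+ j) 0 ->
  regular_at x f.

(* H^0(X, kL) for L the restriction of O(1) to X: sections of kL are the
   functions of the homogeneous coordinates which are locally of the form a / b
   with deg a - deg b = k. *)
Definition H0 X (k : nat) : set (fn K {x | X x}) :=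
  [set s | forall x, X x -> exists d a b,
    [/\ homogeneous (d + k)%N a, homogeneous d b, pval b x != 0 &
      forall y, pval b (sval y) != 0 ->
        s y = pval a (sval y) / pval b (sval y)]].

Arguments H0 : clear implicits.

(* Sym^k H^0(X, L) -> H^0(X, kL) is surjective for all k >= 1. *)
Definition projectively_normal X :=
  forall k, (0 < k)%N ->
    H0 X k `<=` span [set s | exists u : 'I_k -> fn K {x | X x},
      (forall j, H0 X 1%N (u j)) /\ s = \prod_j u j].

End Varieties.

Arguments H0 {K N} X k.

Section Filtrations.
Variables (K : closedFieldType) (T : Type).
(* The graded algebra \bigoplus_k R k, inside the algebra of functions on T. *)
Variable R : nat -> set (fn K T).
(* F k i is the subspace F_i R_k. *)
Implicit Types (F : nat -> int -> set (fn K T)).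

Definition is_filtration F :=
  forall k, [/\ forall i, is_subspace (F k i), forall i, F k i `<=` R k &
    forall i j, i <= j -> F k i `<=` F k j].

Definition admissible F :=
  [/\ is_filtration F,
      forall a b i j u v, F a i u -> F b j v -> F (a + b)%N (i + j) (u * v),
      forall k, exists i0, forall i, i0 <= i -> F k i = R k &
      exists C : int, C < 0 /\ forall k, (0 < k)%N -> F k (C * k%:Z) = [set 0]].

(* Elements of (\bigoplus_k R k)[t, t^-1] are seen as functions on
   T * (K \ {0}), t being the second coordinate. When T is a nonempty cone and
   R k consists of functions homogeneous of degree k, this loses nothing, since
   K is infinite. *)
Local Notation Tt := (T * {t : K | t != 0})%type.

Definition monom (s : fn K T) (i : int) : fn K Tt :=
  fun z => s z.1 * (sval z.2) ^ i.

Definition Rees F : set (fn K Tt) :=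
  span [set g | exists k i s, F k i s /\ g = monom s i].

Definition finitely_generated F :=
  exists S, finite_set S /\ Rees F = subalgebra_gen S.

Definition chi F (m : nat) : set (fn K Tt) :=
  subalgebra_gen (monom 1 1%Z |` [set g | exists i s, F m i s /\ g = monom s i]).

(* approx_filtration F m k i is the subspace F^(m)_i R_{mk}. *)
Definition approx_filtration F (m k : nat) (i : int) : set (fn K T) :=
  [set s | R (m * k)%N s /\ chi F m (monom s i)].

End Filtrations.

(* G k i stands for the subspace G_{k,i} in a K[t]-algebra
   chi = \bigoplus_{k,i} G_{k,i} t^i generated by its part of degree k = 1. The
   test configuration is Proj chi; its central fibre X_0 is Proj A, where
   A = chi / t chi = \bigoplus_{k,i} A_{k,i} with A_{k,i} = G_{k,i} / G_{k,i-1},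
   and L_0 = O(1). *)
Section CentralFibre.
Variables (K : closedFieldType) (T : Type).
Variable G : nat -> int -> set (fn K T).

(* X_0 is covered by the open sets D_+(f), f in A_{1,j}, and the sections of
   O(k) over D_+(f) form the degree k part of the localization A_f, which is the
   colimit of A_k -> A_{k+1} -> A_{k+2} -> ..., all the maps being
   multiplication by f. So such a section is given by a sequence
   (sigma j f e)_e with sigma j f e in A_{k+e} and
   sigma j f (e+1) = f * sigma j f e for all large e, thought of as
   f^e * sigma, up to equality for all large e. The part of H^0(X_0, k L_0) of
   weight -i consists of the families with sigma j f e in A_{k+e,i+ej} that
   agree on the intersections D_+(f f'), modulo the families that vanish on
   every D_+(f). *)
Definition sections0 (k : nat) (i : int) : set (int -> fn K T -> nat -> fn K T) :=
  [set sigma |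
    (forall j f, G 1%N j f -> \forall e \near \oo,
       G (k + e)%N (i + e%:Z * j) (sigma j f e) /\
       G (k + e.+1)%N (i + e.+1%:Z * j - 1) (sigma j f e.+1 - f * sigma j f e)) /\
    (forall j f j' f', G 1%N j f -> G 1%N j' f' -> \forall e \near \oo,
       G (k + e + e)%N (i + e%:Z * (j + j') - 1)
         (f' ^+ e * sigma j f e - f ^+ e * sigma j' f' e))].

Definition null_sections0 (k : nat) (i : int) : set (int -> fn K T -> nat -> fn K T) :=
  [set sigma | sections0 k i sigma /\
    forall j f, G 1%N j f -> \forall e \near \oo,
      G (k + e)%N (i + e%:Z * j - 1) (sigma j f e)].

(* dimension of the part of weight -i of H^0(X_0, k L_0) *)
Definition h0 k i : nat := qdim (null_sections0 k i) (sections0 k i).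

End CentralFibre.

Section L2Norm.
Variables (K : closedFieldType) (T : Type) (RR : realType).
Implicit Types (G : nat -> int -> set (fn K T)).

(* T_k is diagonalizable, with eigenvalue -i on the part of weight -i; the sums
   over i have finite support. *)
Definition trace_id G (k : nat) : RR := \sum_(i \in [set: int]) ((h0 G k i)%:R : RR).

Definition trace_T G (k : nat) : RR :=
  \sum_(i \in [set: int]) ((- i)%:~R * (h0 G k i)%:R : RR).

Definition trace_T2 G (k : nat) : RR :=
  \sum_(i \in [set: int])
    (((- i)%:~R - trace_T G k / trace_id G k) ^+ 2 * (h0 G k i)%:R : RR).

(* norm of an exponent r test configuration on a variety of dimension n *)
Definition tc_L2norm (n r : nat) G : RR :=
  Num.sqrt (lim ((fun k : nat => trace_T2 G k / (k * r)%:R ^+ (n + 2)) @ \oo)).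

Definition filtration_L2norm (n : nat) (R : nat -> set (fn K T))
    (F : nat -> int -> set (fn K T)) : \bar RR :=
  limn_einf (fun m => (tc_L2norm n m (approx_filtration R F m))%:E).

End L2Norm.

Section Buildings.
Variables (K : closedFieldType) (T : Type) (RR : realType).
Implicit Types (V : set (fn K T)).

(* the list of the pairs (w_i, G_i) *)
Definition flag := seq (rat * set (fn K T)).
Implicit Types (p q : flag).

Definition fweight p (i : nat) : rat := (nth (0, [set 0]) p i).1.
(* fstep p i = G_i, with G_0 = 0 and the other steps numbered from 1 *)
Definition fstep p (i : nat) : set (fn K T) := nth [set 0] ([set 0] :: unzip2 p) i.

Definition flag_trace p : rat :=
  \sum_(i < size p) fweight p i * (qdim (fstep p i) (fstep p i.+1))%:R.

(* p is a weighted flag on V with rational weights *)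
Definition weighted_flag V p :=
  (3 <= vdim V)%N /\
  [/\ (2 <= size p)%N,
      (forall i, (i < size p)%N ->
         is_subspace (fstep p i.+1) /\ fstep p i `<` fstep p i.+1),
      fstep p (size p) = V,
      (forall i, (i.+1 < size p)%N -> fweight p i < fweight p i.+1) &
      flag_trace p = 0].

Definition flag_equiv p q :=
  exists c : rat, 0 < c /\ q = [seq (c * g.1, g.2) | g <- p].

(* weight of a vector: the least w_i with v in G_i *)
Definition vweight p (v : fn K T) : rat :=
  fweight p (find (fun g => `[< g.2 v >]) p).

Definition adapted d (b : 'I_d -> fn K T) p :=
  forall i, (i < size p)%N -> exists J : set 'I_d, fstep p i.+1 = span (b @` J).

(* The set below is a singleton for weighted flags p, q on V. *)
Definition tits_dist V p q : RR :=
  get [set r | exists d (b : 'I_d -> fn K T),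
    [/\ basis_mod [set 0] V b, adapted b p, adapted b q &
      r = acos (ratr (\sum_i vweight p (b i) * vweight q (b i)) /
        Num.sqrt (ratr (\sum_i vweight p (b i) ^+ 2) *
                  ratr (\sum_i vweight q (b i) ^+ 2)))]].

(* From an exhaustive bounded increasing filtration W of V with finitely many
   jumps to a flag of trace zero. *)
Definition jump (W : rat -> set (fn K T)) : set rat :=
  [set w | exists v, W w v /\ forall w', w' < w -> ~ W w' v].

Definition jumps (W : rat -> set (fn K T)) : seq rat :=
  xget [::] [set s | sorted <%R s /\ [set` s] = jump W].

Definition flag_of V (W : rat -> set (fn K T)) : flag :=
  let p := [seq (w, W w) | w <- jumps W] in
  [seq (g.1 - flag_trace p / (vdim V)%:R, g.2) | g <- p].

(* the subspace of weights <= w *)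
Definition flag_filtration p (w : rat) : set (fn K T) :=
  fstep p (count (fun g => g.1 <= w) p).

Variable R : nat -> set (fn K T).

Definition Delta (r : nat) : set flag := weighted_flag (R r).

(* iota_{r,k}: the flag on R (r * k) given by the image of the induced filtration on
   Sym^k (R r), for p a flag on R r. *)
Definition veronese_map (r k : nat) p : flag :=
  flag_of (R (r * k)%N) (fun w =>
    span [set s | exists (u : 'I_k -> fn K T) (a : 'I_k -> rat),
      [/\ forall j, flag_filtration p (a j) (u j), \sum_j a j <= w &
        s = \prod_j u j]]).

(* A point of the direct limit is the class, in the disjoint union of the
   Delta r, of some p in Delta r: the set of all (s, q) with q in Delta s such
   that p and q become equal in some Delta (r a) = Delta (s b). *)
Definition limit_pt (r : nat) p : set (nat * flag) :=
  [set x | [/\ (0 < x.1)%N, Delta x.1 x.2 &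
    exists a b, [/\ (0 < a)%N, (0 < b)%N, (r * a = x.1 * b)%N &
      flag_equiv (veronese_map r a p) (veronese_map x.1 b x.2)]]].

Definition Delta_inf : set (set (nat * flag)) :=
  [set P | exists r p, [/\ (0 < r)%N, Delta r p & P = limit_pt r p]].

Definition limsup_dist (r0 : nat) p q : \bar RR :=
  limn_esup (fun l => (tits_dist (R (r0 * l.+1)%N)
    (veronese_map r0 l.+1 p) (veronese_map r0 l.+1 q))%:E).

(* p, q range over the representatives of P, Q in a common Delta r0; the
   limsup does not depend on them. *)
Definition dist_inf (P Q : set (nat * flag)) : \bar RR :=
  get [set d | exists r0 p q, [/\ P (r0, p), Q (r0, q) &
    d = limsup_dist r0 p q]].

Variable F : nat -> int -> set (fn K T).

Definition approx_flag (m : nat) : flag :=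
  flag_of (R m) (fun w => F m (Num.floor w)).

Definition approx_pt (m : nat) : set (nat * flag) := limit_pt m (approx_flag m).

End Buildings.

Arguments filtration_L2norm {K T} RR n R F.
Arguments dist_inf {K T} RR R P Q.

(* Main.v *)
(* Count the weights of a filtration of R_r downwards from a slope bounding those
   of F. The resulting mass grows under inclusion of filtrations, and under
   multiplication by a section. For F^(m), the mass divided by r dim R_r converges as
   r goes to infinity, because the weights are those of the monomials in a downset and
   the sums over its degrees are eventually polynomial. The limit S_m is nearly
   increasing for divisibility of m, so it converges to its supremum.

   Let P, P' be representatives of p_m, p_m' on R_(r0), for large m, m'. Some powers
   of P and P' are F^(m) and F^(m'), and both are contained in a common F^(M). The
   masses of the three filtrations differ by o(r dim R_r), so in a basis adapted to P
   and P' the weights are close in l^1, hence in l^2 since they are O(r). Finally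
   ||F|| <> 0 bounds the variance of the weights of F^(m) below by a multiple of
   r^2 dim R_r: this uses dim R_r = O(r^n), and the fact that H^0(X_0, k L_0) is the
   degree k part of the coordinate ring of X_0 for large k. So the angle is small. *)

(* Three obstacles shape the proof. (1) A representative of p_m agrees with F^(m) only on powers
   divisible by some B, up to an affine change of weights, whereas d_infty runs over all multiples
   of r0. At level l = B q + c, multiplication by powers of a fixed nonzero section of R_1 embeds
   level B q into level l and level l into level B (q + 1). As R is a domain, dimensions can be
   compared; the cost is O(1) in the weights, which are of size r. (2) The norm is defined with the
   sections of a possibly non-reduced X_0, so the comparison with its coordinate ring is Serre's
   theorem in large degree; sections are lifted through a chain of torsion ideals. (3) The dimension
   n is given by chains of subvarieties, so dim R_r = O(r^n) requires a chain of length n + 1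
   whenever n + 2 coordinates are independent; Chevalley's theorem provides it. In all these rings
   the standard monomials form a downset; Dickson's lemma then gives both noetherianity and the
   shape of the Hilbert functions. *)
Require Import Defs.
From mathcomp Require Import all_boot all_order all_algebra.
From mathcomp Require Import all_classical all_reals all_analysis.
From mathcomp Require Import -(notations) mpoly.
From mathcomp Require Import ring lra zify.

Set Implicit Arguments.
Unset Strict Implicit.
Unset Printing Implicit Defensive.

Import Order.TTheory GRing.Theory Num.Theory.
Import numFieldNormedType.Exports.
Import Defs.

Local Open Scope classical_set_scope.
Local Open Scope ring_scope.

(** * Linear algebra modulo a subspace *)

Section LinAlg.
Variables (K : fieldType) (E : lmodType K).
Implicit Types (S U V W : set E).

Lemma subsp0 V : is_subspace V -> V 0. Proof. by case. Qed.

Lemma subspD V u v : is_subspace V -> V u -> V v -> V (u + v).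
Proof. by case=> _ h Vu Vv; rewrite -[u]scale1r; apply: h. Qed.

Lemma subspZ V a u : is_subspace V -> V u -> V (a *: u).
Proof. by case=> V0 h Vu; rewrite -[_ *: _]addr0; apply: h. Qed.

Lemma subspN V u : is_subspace V -> V u -> V (- u).
Proof. by move=> hV Vu; rewrite -scaleN1r; apply: subspZ. Qed.

Lemma subspB V u v : is_subspace V -> V u -> V v -> V (u - v).
Proof. by move=> hV Vu Vv; apply: subspD => //; apply: subspN. Qed.

Lemma subsp_sum V I (r : seq I) (P : pred I) (F : I -> E) : is_subspace V ->
  (forall i, P i -> V (F i)) -> V (\sum_(i <- r | P i) F i).
Proof.
move=> hV h; apply: (big_ind V) => //; first exact: subsp0.
by move=> x y; apply: subspD.
Qed.

Lemma subsp_sum_seq V (I : eqType) (r : seq I) (P : pred I) (F : I -> E) :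
  is_subspace V -> (forall i, i \in r -> P i -> V (F i)) ->
  V (\sum_(i <- r | P i) F i).
Proof.
move=> hV h; rewrite big_seq_cond; apply: subsp_sum => // i /andP[]; exact: h.
Qed.

Lemma subsp_set0 : is_subspace [set 0 : E].
Proof. by split=> // a u v -> ->; rewrite scaler0 addr0. Qed.

Lemma subsp_span S : is_subspace (span S).
Proof.
split=> [V hV _|a u v hu hv V hV hS]; first exact: subsp0.
by apply: subspD => //; [apply: subspZ => //; apply: hu|apply: hv].
Qed.

Lemma span_mem S v : S v -> span S v.
Proof. by move=> Sv V _; apply. Qed.

Lemma span_min S V : is_subspace V -> S `<=` V -> span S `<=` V.
Proof. by move=> hV hS v; apply. Qed.

Lemma span_mono S S' : S `<=` S' -> span S `<=` span S'.
Proof.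
by move=> h; apply: span_min (@subsp_span _) _ => v /h; apply: span_mem.
Qed.

Lemma subsp_lin V d (c : 'I_d -> K) (b : 'I_d -> E) : is_subspace V ->
  (forall i, V (b i)) -> V (\sum_i c i *: b i).
Proof. by move=> hV hb; apply: subsp_sum => // i _; apply: subspZ. Qed.

Definition free_mod U d (b : 'I_d -> E) :=
  forall c : 'rV[K]_d, U (\sum_i c ord0 i *: b i) -> c = 0.

Definition gen_mod U V d (b : 'I_d -> E) :=
  forall v, V v -> exists c : 'rV[K]_d, U (v - \sum_i c ord0 i *: b i).

Definition fg U V := exists d (b : 'I_d -> E), gen_mod U V b.

Lemma basis_modP U V d (b : 'I_d -> E) : is_subspace U -> is_subspace V ->
  basis_mod U V b <-> [/\ forall i, V (b i), free_mod U b & gen_mod U V b].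
Proof.
move=> hU hV; split=> [[h1 h2]|[h1 h2 h3]]; split=> //.
- move=> c Uc; have [c' [_ uc]] := h2 _ (subsp_lin (c ord0) hV h1).
  have -> : c = c' by rewrite (uc c) // subrr; apply: subsp0.
  apply: uc; rewrite [X in _ - X]big1 ?subr0 // => i _.
  by rewrite mxE scale0r.
- by move=> v /h2[c [? _]]; exists c.
- move=> v /h3[c Uc]; exists c; split=> // c' Uc'.
  apply/eqP; rewrite -subr_eq0; apply/eqP/h2.
  have -> : \sum_i (c - c') ord0 i *: b i
    = (v - \sum_i c' ord0 i *: b i) - (v - \sum_i c ord0 i *: b i).
    rewrite [RHS]addrC opprB [RHS]addrA subrK -sumrB; apply: eq_bigr => i _.
    by rewrite !mxE scalerBl.
  exact: subspB.
Qed.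

(** If d < d', the d' x d coefficient matrix has a nonzero left kernel vector, and this is a
    dependence of [b'] modulo [U]. *)
Lemma steinitz U d (b : 'I_d -> E) d' (b' : 'I_d' -> E) : is_subspace U ->
  (forall i, exists c : 'rV[K]_d, U (b' i - \sum_j c ord0 j *: b j)) ->
  free_mod U b' -> (d' <= d)%N.
Proof.
move=> hU /choice[f hf] fr; rewrite leqNgt; apply/negP => lt.
pose M : 'M[K]_(d', d) := \matrix_i f i.
have /rowV0Pn[c] : kermx M != 0.
  rewrite kermx_eq0 /row_free neq_ltn; apply/orP; left.
  exact: leq_ltn_trans (rank_leq_col M) lt.
move/sub_kermxP => cM /eqP; apply; apply: fr.
have -> : \sum_i c ord0 i *: b' i =
   \sum_i c ord0 i *: (b' i - \sum_j f i ord0 j *: b j).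
  under [RHS]eq_bigr do rewrite scalerBr scaler_sumr.
  rewrite sumrB exchange_big /= [X in _ - X]big1 ?subr0 // => j _.
  under eq_bigr do rewrite scalerA.
  rewrite -scaler_suml; move/rowP/(_ j): cM; rewrite !mxE => e.
  rewrite [X in X *: _](_ : _ = 0) ?scale0r // -[RHS]e.
  by apply: eq_bigr => i _; rewrite !mxE.
by apply: (subsp_lin _ hU).
Qed.

Lemma basis_dim_unique U V d (b : 'I_d -> E) d' (b' : 'I_d' -> E) :
  is_subspace U -> is_subspace V ->
  basis_mod U V b -> basis_mod U V b' -> d = d'.
Proof.
move=> hU hV /(basis_modP _ hU hV)[b1 b2 b3] /(basis_modP _ hU hV)[b'1 b'2 b'3].
by apply/eqP; rewrite eqn_leq; apply/andP; split;
  [apply: (steinitz (b := b') hU _ b2) => i; apply: b'3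
  |apply: (steinitz (b := b) hU _ b'2) => i; apply: b3].
Qed.

Lemma qdimE U V d (b : 'I_d -> E) : is_subspace U -> is_subspace V ->
  basis_mod U V b -> qdim U V = d.
Proof.
move=> hU hV hb; rewrite /qdim.
have : [set d | exists b : 'I_d -> E, basis_mod U V b] (qdim U V).
  by apply: getPex; exists d, b.
by case=> b' hb'; apply: (basis_dim_unique hU hV hb' hb).
Qed.

(** A free family of maximal length generates [V] modulo [U]. Only a bound on free families is
    asked, so that finite dimension can be a conclusion, as in [fg_inj]. *)
Lemma bounded_free_basis U V d0 : is_subspace U -> is_subspace V ->
  (forall d (b : 'I_d -> E), (forall i, V (b i)) -> free_mod U b -> (d <= d0)%N) ->
  exists d (b : 'I_d -> E), basis_mod U V b.
Proof.
move=> hU hV hd0.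
pose P n := `[< exists b : 'I_n -> E, (forall i, V (b i)) /\ free_mod U b >].
have P0 : exists n, P n.
  exists 0%N; apply/asboolP; exists (fun=> 0); split=> [[]//|c _].
  by apply/rowP => -[].
have Pb n : P n -> (n <= d0)%N.
  by move=> /asboolP[b [b1 b2]]; apply: hd0 b2.
case: (ex_maxnP P0 Pb) => n /asboolP[b [b1 b2]] hmax.
exists n, b; apply/basis_modP => //; split=> // v Vv.
pose b' (i : 'I_n.+1) := oapp b v (unlift ord_max i).
have b'E c : \sum_i c i *: b' i = \sum_i c (lift ord_max i) *: b i + c ord_max *: v.
  rewrite big_ord_recr /= /b' unlift_none /=; congr (_ + _).
  apply: eq_bigr => i _.
  have -> : widen_ord (leqnSn n) i = lift ord_max i by apply: val_inj; exact/esym/lift_max.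
  by rewrite liftK.
have : ~ P n.+1 by move=> /hmax; rewrite ltnn.
move=> hn; have [c [Uc c0]] : exists c : 'rV[K]_n.+1,
    U (\sum_i c ord0 i *: b' i) /\ c != 0.
  apply: contrapT => hc; apply: hn; apply/asboolP; exists b'; split.
    by move=> i; rewrite /b'; case: unlift => //=.
  by move=> c Uc; apply/eqP/negP => c0; apply: hc; exists c; split=> //; apply/negP.
have cm : c ord0 ord_max != 0.
  apply: contra_neq c0 => cm; apply/rowP => i; rewrite mxE.
  move: Uc; rewrite b'E cm scale0r addr0 => Uc.
  have /rowP h := b2 (\row_i c ord0 (lift ord_max i)) (ltac:(
    by under eq_bigr do rewrite mxE)).
  by case: (unliftP ord_max i) => [j|] -> //; move: (h j); rewrite !mxE.
exists (\row_i (- (c ord0 ord_max)^-1 * c ord0 (lift ord_max i))).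
move/(subspZ (c ord0 ord_max)^-1 hU): Uc; rewrite b'E scalerDr scalerA.
rewrite mulVf // scale1r addrC scaler_sumr -[X in _ + X]opprK -sumrN.
congr (U (_ - _)); apply: eq_bigr => i _.
by rewrite mxE mulNr scaleNr scalerA.
Qed.

Lemma fg_basis U V : is_subspace U -> is_subspace V -> fg U V ->
  exists d (b : 'I_d -> E), basis_mod U V b.
Proof.
move=> hU hV [d0 [b0 hb0]]; apply: (@bounded_free_basis _ _ d0) => // d b b1 b2.
by apply: (steinitz hU _ b2) => i; apply: hb0.
Qed.

Lemma qdim_basis U V : is_subspace U -> is_subspace V -> fg U V ->
  exists b : 'I_(qdim U V) -> E, basis_mod U V b.
Proof.
move=> hU hV h; apply: (@getPex _ [set d | exists b : 'I_d -> E, basis_mod U V b]).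
exact: fg_basis.
Qed.

Lemma qdim_free_le U V d (b : 'I_d -> E) : is_subspace U -> is_subspace V ->
  fg U V -> (forall i, V (b i)) -> free_mod U b -> (d <= qdim U V)%N.
Proof.
move=> hU hV /(qdim_basis hU hV)[b' /(basis_modP _ hU hV)[h1 h2 h3]] h4 h5.
by apply: (steinitz hU _ h5) => i; apply: h3.
Qed.

Lemma qdim_gen_le U V d (b : 'I_d -> E) : is_subspace U -> is_subspace V ->
  gen_mod U V b -> (qdim U V <= d)%N.
Proof.
move=> hU hV hb.
have [|b' /(basis_modP _ hU hV)[h1 h2 h3]] := qdim_basis hU hV; first by exists d, b.
by apply: (steinitz hU _ h2) => i; apply: hb.
Qed.

Lemma sum_ord_seq (T : eqType) (us : seq T) (f : T -> E) (c : T -> K) t0 :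
  \sum_(i < size us) c (nth t0 us i) *: f (nth t0 us i) =
  \sum_(u <- us) c u *: f u.
Proof. by rewrite [RHS](big_nth t0) big_mkord. Qed.

Lemma sum_ord_seq_index (T : eqType) (us : seq T) (f : T -> E)
  (c : 'I_(size us) -> K) t0 : uniq us -> exists c' : T -> K,
  (forall i : 'I_(size us), c' (nth t0 us i) = c i) /\
  \sum_(i < size us) c i *: f (nth t0 us i) = \sum_(u <- us) c' u *: f u.
Proof.
move=> Uus; exists (fun u => oapp c 0 (insub (index u us))).
have h (i : 'I_(size us)) : oapp c 0 (insub (index (nth t0 us i) us)) = c i.
  by rewrite index_uniq // valK.
split=> //; rewrite -(sum_ord_seq _ _ _ t0); apply: eq_bigr => i _.
by rewrite h.
Qed.

Definition free_seq U (T : eqType) (us : seq T) (f : T -> E) :=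
  forall c : T -> K, U (\sum_(u <- us) c u *: f u) -> forall u, u \in us -> c u = 0.

Definition gen_seq U V (T : eqType) (us : seq T) (f : T -> E) :=
  forall v, V v -> exists c : T -> K, U (v - \sum_(u <- us) c u *: f u).

Lemma free_seq_mod U (T : eqType) (us : seq T) (f : T -> E) t0 : uniq us ->
  free_seq U us f -> free_mod U (fun i : 'I_(size us) => f (nth t0 us i)).
Proof.
move=> Uus h c; have [c' [h1 ->]] := sum_ord_seq_index f (c ord0) t0 Uus.
move=> /h h2; apply/rowP => i; rewrite mxE -h1; apply: h2; exact: mem_nth.
Qed.

Lemma gen_seq_mod U V (T : eqType) (us : seq T) (f : T -> E) t0 :
  gen_seq U V us f -> gen_mod U V (fun i : 'I_(size us) => f (nth t0 us i)).
Proof.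
move=> h v /h[c hc]; exists (\row_i c (nth t0 us i)).
by under eq_bigr do rewrite mxE; rewrite sum_ord_seq.
Qed.

Lemma free_seq_le U V (T : eqType) (us : seq T) (f : T -> E) :
  is_subspace U -> is_subspace V -> fg U V -> uniq us ->
  (forall u, u \in us -> V (f u)) -> free_seq U us f -> (size us <= qdim U V)%N.
Proof.
case: us => [//|t0 us'] hU hV hf Uus hVf fr.
have := free_seq_mod (t0 := t0) Uus fr; move/(qdim_free_le hU hV hf); apply => i.
by apply: hVf; apply: mem_nth.
Qed.

Lemma gen_seq_fg U V (T : eqType) (us : seq T) (f : T -> E) :
  gen_seq U V us f -> fg U V.
Proof.
case: us => [|t0 us'] h; last by eexists; eexists; apply: (gen_seq_mod t0 h).
exists 0%N, (fun=> 0) => v /h[c]; rewrite big_nil => hv; exists 0.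
by rewrite big_ord0.
Qed.

Lemma gen_seq_le U V (T : eqType) (us : seq T) (f : T -> E) :
  is_subspace U -> is_subspace V -> gen_seq U V us f -> (qdim U V <= size us)%N.
Proof.
move=> hU hV; case: us => [|t0 us'] h; last exact: (qdim_gen_le hU hV (gen_seq_mod t0 h)).
apply: (@qdim_gen_le _ _ 0 (fun=> 0)) => // v /h[c]; rewrite big_nil => hv.
by exists 0; rewrite big_ord0.
Qed.

Lemma qdim_seq U V (T : eqType) (us : seq T) (f : T -> E) :
  is_subspace U -> is_subspace V -> uniq us ->
  (forall u, u \in us -> V (f u)) -> free_seq U us f -> gen_seq U V us f ->
  qdim U V = size us.
Proof.
move=> hU hV Uus h1 h2 h3; apply/eqP; rewrite eqn_leq (gen_seq_le hU hV h3) /=.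
by apply: free_seq_le h2 => //; apply: gen_seq_fg h3.
Qed.

Lemma fg_sub U V V' : V `<=` V' -> fg U V' -> fg U V.
Proof. by move=> h [d [b hb]]; exists d, b => v /h /hb. Qed.

Lemma fg_mod U U' V : U `<=` U' -> fg U V -> fg U' V.
Proof. by move=> h [d [b hb]]; exists d, b => v /hb[c /h]; exists c. Qed.

Lemma vdim_qdim U V : is_subspace U -> is_subspace V -> U `<=` V ->
  fg [set 0] V -> vdim V = (vdim U + qdim U V)%N.
Proof.
move=> hU hV h hf; have h0 := subsp_set0.
have [b /(basis_modP _ h0 hU)[h1 h2 h3]] := qdim_basis h0 hU (fg_sub h hf).
have [|b' /(basis_modP _ hU hV)[h1' h2' h3']] := qdim_basis hU hV.
  by apply: fg_mod hf => v ->; apply: subsp0.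
pose B (i : 'I_(vdim U + qdim U V)) : E :=
  match fintype.split i with inl j => b j | inr j => b' j end.
have BE c : \sum_i c i *: B i = \sum_i c (lshift _ i) *: b i +
    \sum_i c (rshift _ i) *: b' i.
  rewrite big_split_ord /=; congr (_ + _); apply: eq_bigr => i _; rewrite /B.
    by have /= -> := unsplitK (inl i : 'I_(vdim U) + 'I_(qdim U V)).
  by have /= -> := unsplitK (inr i : 'I_(vdim U) + 'I_(qdim U V)).
apply: (qdimE (b := B)) => //; apply/basis_modP => //; split.
- by move=> i; rewrite /B; case: fintype.split => // j; apply: h.
- move=> c; rewrite BE => c0.
  have c2 : \row_i c ord0 (rshift (vdim U) i) = 0.
    apply: h2'; under eq_bigr do rewrite mxE.
    move/eqP: c0; rewrite addrC addr_eq0 => /eqP ->; apply: subspN => //.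
    exact: (subsp_lin _ hU).
  have c1 : \row_i c ord0 (lshift (qdim U V) i) = 0.
    apply: h2; under eq_bigr do rewrite mxE.
    move: c0; rewrite [X in _ + X]big1 ?addr0 // => i _.
    by move/rowP/(_ i): c2; rewrite !mxE => ->; rewrite scale0r.
  apply/rowP => i; rewrite -(splitK i) mxE; case: fintype.split => j /=.
    by move/rowP/(_ j): c1; rewrite !mxE.
  by move/rowP/(_ j): c2; rewrite !mxE.
- move=> v /h3'[c' Uc']; have [c /= /eqP] := h3 _ Uc'; rewrite subr_eq0 => /eqP e.
  exists (row_mx c c'); rewrite BE.
  under eq_bigr do rewrite row_mxEl.
  under [X in _ - (_ + X)]eq_bigr do rewrite row_mxEr.
  by rewrite -e subrK subrr.
Qed.

Lemma vdim_eq_sub V V' : is_subspace V -> is_subspace V' -> V `<=` V' ->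
  fg [set 0] V' -> (vdim V' <= vdim V)%N -> V' `<=` V.
Proof.
move=> hV hV' h hf le v V'v.
have := vdim_qdim hV hV' h hf => e.
have q0 : qdim V V' = 0%N by lia.
have [|b] := qdim_basis hV hV'; first by apply: fg_mod hf => w ->; apply: subsp0.
case=> _ /(_ _ V'v)[c [+ _]]; rewrite big1 ?subr0 // => i.
by move: i b c; rewrite q0 => -[].
Qed.

Lemma span_seq_nodup (T : eqType) (us : seq T) (f : T -> E) v :
  span [set f u | u in [set` us]] v -> exists c : T -> K,
    v = \sum_(u <- undup us) c u *: f u.
Proof.
apply: (span_min (V := [set v | exists c, v = \sum_(u <- undup us) c u *: f u])).
  split; first by exists (fun=> 0); rewrite big1 // => i _; rewrite scale0r.
  move=> a _ _ [c ->] [c' ->]; exists (fun u => a * c u + c' u).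
  rewrite scaler_sumr -big_split /=; apply: eq_bigr => u _.
  by rewrite scalerA scalerDl.
move=> w [u uus <-]; exists (fun u' => (u' == u)%:R).
rewrite (bigD1_seq u) ?undup_uniq ?mem_undup //= eqxx scale1r big1 ?addr0 //.
by move=> i /negbTE ->; rewrite scale0r.
Qed.

Lemma span_seq (T : eqType) (us : seq T) (f : T -> E) v : uniq us ->
  span [set f u | u in [set` us]] v -> exists c : T -> K,
    v = \sum_(u <- us) c u *: f u.
Proof. by move=> Uus /span_seq_nodup; rewrite undup_id. Qed.

(** Serves to pull finiteness and dimension bounds back along multiplication by a nonzero section:
    free families are sent to free families. *)
Lemma fg_inj (f : E -> E) V V' : is_subspace V -> is_subspace V' ->
  (forall a u v, f (a *: u + v) = a *: f u + f v) ->
  (forall v, V v -> V' (f v)) -> (forall v, V v -> f v = 0 -> v = 0) ->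
  fg [set 0] V' -> fg [set 0] V /\ (vdim V <= vdim V')%N.
Proof.
move=> hV hV' lf fV fi fgV'; have h0 := subsp_set0.
have f0 : f 0 = 0.
  have := lf 1 0 0; rewrite !scale1r addr0 => /eqP.
  by rewrite -{1}[f 0]addr0 (inj_eq (addrI _)) eq_sym => /eqP.
have fs d (b : 'I_d -> E) (c : 'rV[K]_d) :
    f (\sum_i c ord0 i *: b i) = \sum_i c ord0 i *: f (b i).
  elim/big_rec2: _ => [|i x y _ <-]; first exact: f0.
  by rewrite lf.
have free d (b : 'I_d -> E) : (forall i, V (b i)) -> free_mod [set 0] b ->
    free_mod [set 0] (fun i => f (b i)).
  move=> Vb fb c /=; rewrite -fs => h; apply: fb; apply: fi => //.
  exact: (subsp_lin _ hV).
have bd d (b : 'I_d -> E) : (forall i, V (b i)) -> free_mod [set 0] b -> (d <= vdim V')%N.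
  move=> Vb fb; apply: (qdim_free_le h0 hV' fgV' _ (free _ _ Vb fb)) => i.
  exact: fV.
have [d [b hb]] := bounded_free_basis h0 hV bd.
have /(basis_modP _ h0 hV)[h1 h2 h3] := hb.
by split; [exists d, b|rewrite /vdim (qdimE h0 hV hb); apply: bd].
Qed.

End LinAlg.

(** * Monomials, downsets and ideals *)

Section Monos.

(** Exponents of the monomials of degree [k] in [d] variables. Grouping them by the first exponent
    is what the inductions on [d] through slices rely on. *)
Fixpoint monos (d k : nat) : seq (seq nat) :=
  if d is d'.+1 then
    flatten [seq [seq j :: u | u <- monos d' (k - j)] | j <- iota 0 k.+1]
  else if k == 0%N then [:: [::]] else [::].

Lemma monosSE d k : monos d.+1 k =
  flatten [seq [seq j :: u | u <- monos d (k - j)] | j <- iota 0 k.+1].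
Proof. by []. Qed.

Lemma mem_monos d k u : (u \in monos d k) = (size u == d) && (sumn u == k).
Proof.
elim: d k u => [|d IH] k u.
  rewrite /=; case: u => [|a u] /=; first by case: k.
  by case: (k == 0%N).
rewrite monosSE.
have := mem_iota 0 k.+1; move: (iota 0 k.+1) => s ms.
apply/flatten_mapP/idP => [[j]|].
  rewrite ms add0n ltnS => /andP[_ jk] /mapP[v]; rewrite IH.
  by move=> /andP[/eqP <- /eqP vk] -> /=; rewrite eqxx vk subnKC /=.
case: u => [//|a u] /= /andP[/eqP[ud] /eqP uk].
exists a; first by rewrite ms add0n ltnS -uk leq_addr.
by apply/mapP; exists u => //; rewrite IH ud eqxx -uk addKn eqxx.
Qed.

Lemma monos_uniq d k : uniq (monos d k).
Proof.
elim: d k => [|d IH] k; first by rewrite /=; case: (k == 0%N).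
rewrite monosSE.
elim: (iota 0 k.+1) (iota_uniq 0 k.+1) => [//|a s IHs] /= /andP[as_ us].
rewrite cat_uniq IHs // andbT map_inj_uniq ?IH /=; last by move=> u v [].
apply/hasPn => u /flatten_mapP[j js /mapP[v _ ->]].
by apply/mapP => -[v' _ [ja _]]; rewrite -ja js in as_.
Qed.

(** Meant for exponents of equal length, where it is a total order compatible with multiplication by
    a variable. *)
Fixpoint ltlex (u v : seq nat) : bool :=
  match u, v with
  | a :: u', b :: v' => (a < b)%N || ((a == b) && ltlex u' v')
  | _, _ => false
  end.

Lemma ltlexx u : ltlex u u = false.
Proof. by elim: u => //= a u ->; rewrite ltnn eqxx. Qed.

Lemma ltlex_trans v u w : ltlex u v -> ltlex v w -> ltlex u w.
Proof.
elim: v u w => [|b v IH] [|a u] [|c w] //=.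
case/orP=> [ab|/andP[/eqP -> uv]] /orP[bc|/andP[/eqP <- vw]].
- by rewrite (ltn_trans ab bc).
- by rewrite ab.
- by rewrite bc.
- by rewrite eqxx (IH _ _ uv vw) orbT.
Qed.

Lemma ltlex_total u v : size u = size v -> [|| u == v, ltlex u v | ltlex v u].
Proof.
elim: u v => [|a u IH] [|b v] //= [/IH h].
by rewrite eqseq_cons; case: (ltngtP a b) => //= ab; rewrite ?orbT // orbF.
Qed.

Lemma ltlex_incr u v j : size u = size v -> (j < size u)%N ->
  ltlex u v -> ltlex (incr_nth u j) (incr_nth v j).
Proof.
elim: u v j => [|a u IH] [|b v] [|j] //= [suv] ju; rewrite ?eqSS ?ltnS //.
case/orP=> [->//|/andP[-> /(IH _ _ suv ju) ->]]; exact: orbT.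
Qed.

Lemma ltlex_max d (s : seq (seq nat)) : s != [::] -> (forall u, u \in s -> size u = d) ->
  exists2 u, u \in s & forall v, v \in s -> v != u -> ltlex v u.
Proof.
elim: s => [//|a [|b s] IH] _ h.
  by exists a; rewrite ?inE // => v; rewrite inE => ->.
have [//|u us|u us hu] := IH; first by apply: h; rewrite inE us orbT.
have := ltlex_total (etrans (h a (mem_head _ _)) (esym (h u (ltac:(by rewrite inE us orbT))))).
case/or3P=> [/eqP au|au|ua].
- exists u; first by rewrite inE us orbT.
  by move=> v; rewrite inE => /orP[/eqP ->|/hu//]; rewrite au eqxx.
- exists u; first by rewrite inE us orbT.
  by move=> v; rewrite inE => /orP[/eqP ->|/hu//].
- exists a; first exact: mem_head.
  move=> v; rewrite inE => /orP[/eqP ->|vs]; first by rewrite eqxx.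
  move=> _; have [->//|vu] := eqVneq v u.
  by apply: ltlex_trans ua; apply: hu.
Qed.

Lemma ltlex_ind d k (P : seq nat -> Prop) :
  (forall u, u \in monos d k ->
    (forall v, v \in monos d k -> ltlex v u -> P v) -> P u) ->
  forall u, u \in monos d k -> P u.
Proof.
move=> h u; have [n] := ubnP (size [seq v <- monos d k | ltlex v u]).
elim: n u => // n IH u le um; apply: h => // v vm vu; apply: IH => //.
move: le; rewrite !size_filter ltnS.
have : (count (ltlex^~ v) (monos d k) < count (ltlex^~ u) (monos d k))%N; last first.
  exact: leq_trans.
have <- : count (predU (ltlex^~ v) (pred1 v)) (monos d k)
   = (count (ltlex^~ v) (monos d k)).+1.
  have := count_predUI (ltlex^~ v) (pred1 v) (monos d k).
  rewrite (@eq_count _ (predI _ _) pred0) ?count_pred0 ?addn0.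
    by rewrite count_uniq_mem ?monos_uniq // vm addn1.
  by move=> w /=; apply/negbTE/negP => /andP[h' /eqP e]; rewrite e ltlexx in h'.
by apply: sub_count => w /= /orP[/ltlex_trans|/eqP ->//]; apply.
Qed.

Lemma sumn_incr u j : sumn (incr_nth u j) = (sumn u).+1.
Proof. by elim: u j => [|a u IH] [|j] //=; rewrite ?IH ?addnS //; elim: j. Qed.

Lemma mem_monos_incr d k u j : (j < d)%N -> u \in monos d k ->
  incr_nth u j \in monos d k.+1.
Proof.
rewrite !mem_monos => jd /andP[/eqP su /eqP uk].
by rewrite sumn_incr uk eqxx andbT size_incr_nth su jd eqxx.
Qed.

Lemma monosS d k v j : v \in monos d k.+1 -> (0 < nth 0 v j)%N ->
  exists2 u, u \in monos d k & v = incr_nth u j.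
Proof.
rewrite mem_monos => /andP[/eqP sv /eqP vk] vj.
have jd : (j < d)%N by rewrite -sv ltnNge; apply: contraL vj => h; rewrite nth_default.
have e : v = incr_nth (set_nth 0 v j (nth 0 v j).-1) j.
  apply: (@eq_from_nth _ 0%N).
    by rewrite size_incr_nth size_set_nth sv (maxn_idPr jd) jd.
  move=> i; rewrite sv => id; rewrite nth_incr_nth nth_set_nth /= eq_sym.
  by case: eqVneq => [->|]; rewrite ?add1n ?prednK.
exists (set_nth 0 v j (nth 0 v j).-1) => //.
rewrite mem_monos size_set_nth sv (maxn_idPr jd) eqxx /=.
by apply/eqP/succn_inj; rewrite -vk [in RHS]e sumn_incr.
Qed.

Lemma monosS_ex d k v : v \in monos d k.+1 ->
  exists2 j, (j < d)%N & exists2 u, u \in monos d k & v = incr_nth u j.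
Proof.
move=> vm; have [/hasP[a av a0]|] := boolP (has (fun a => 0 < a)%N v).
  exists (index a v).
    by move: vm; rewrite mem_monos => /andP[/eqP <- _]; rewrite index_mem.
  by apply: monosS => //; rewrite nth_index.
rewrite -all_predC => /allP h; move: vm; rewrite mem_monos => /andP[_ /eqP].
have -> : sumn v = 0%N; last by [].
elim: v h => //= a v IH h; rewrite IH ?addn0; last first.
  by move=> b bv; apply: h; rewrite inE bv orbT.
by have := h a (mem_head _ _); rewrite /= -eqn0Ngt => /eqP.
Qed.

Lemma sumn_nth u d : size u = d -> sumn u = (\sum_(j < d) nth 0 u j)%N.
Proof. by move=> <-; rewrite sumnE (big_nth 0%N) big_mkord. Qed.

Definition downset d (D : set (seq nat)) :=
  forall u j, size u = d -> (j < d)%N -> D (incr_nth u j) -> D u.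

Lemma downset_slice d D a : downset d.+1 D -> downset d [set u | D (a :: u)].
Proof. by move=> h u j su jd; apply: (h (a :: u) j.+1); rewrite //= su. Qed.

Lemma downset_slice_mono d D a b u : downset d.+1 D -> size u = d -> (a <= b)%N ->
  D (b :: u) -> D (a :: u).
Proof.
move=> h su; elim: b => [|b IH]; first by rewrite leqn0 => /eqP ->.
rewrite leq_eqVlt => /orP[/eqP ->//|]; rewrite ltnS => /IH {}IH hb; apply: IH.
by apply: (h (b :: u) 0%N); rewrite //= su.
Qed.

Lemma seq_stab (P : nat -> set (seq nat)) d :
  (forall n u, size u = d -> P n.+1 u -> P n u) ->
  forall n m u, (n <= m)%N -> size u = d -> P m u -> P n u.
Proof.
move=> h n m u /subnK <- su; elim: (m - n)%N => // r IH; rewrite addSn => /h.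
by move=> /(_ su).
Qed.

(* Dickson's lemma. *)
Lemma downset_dcc d (D : nat -> set (seq nat)) : (forall n, downset d (D n)) ->
  (forall n u, size u = d -> D n.+1 u -> D n u) ->
  exists n0, forall n u, size u = d -> D n0 u -> D n u.
Proof.
elim: d D => [|d IH] D hD dec.
  have [h|/existsNP[n0 h]] := pselect (forall n, D n [::]).
    by exists 0%N => n u /size0nil ->.
  by exists n0 => n u /size0nil ->.
have mono := seq_stab dec.
(* The diagonal slices decrease with n. From the index n1 where they are stable, they control all
   slices with first exponent at least n1, and only finitely many slices remain. *)
have [|n u su|n1 h1] := IH (fun n => [set u | D n (n :: u)]).
- by move=> n; apply: downset_slice (hD n).
- move=> /= hu.
  apply: (downset_slice_mono (hD n) su (leqnSn n)); apply: dec => //=.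
  by rewrite su.
have /choice[f hf] : forall a, exists n0, forall n u, size u = d ->
    D n0 (a :: u) -> D n (a :: u).
  move=> a; apply: (IH (fun n => [set u | D n (a :: u)])) => [n|n u su /=].
    exact: downset_slice (hD n).
  by apply: dec; rewrite /= su.
pose N := (n1 + \sum_(a < n1) f a)%N.
have fN a : (a < n1)%N -> (f a <= N)%N.
  by move=> lt; rewrite /N (bigD1 (Ordinal lt)) //= addnCA leq_addr.
exists N => n [//|a u] [su] h.
have [lt|ge] := ltnP a n1.
  by apply: hf => //; apply: mono h; rewrite /= ?su // fN.
apply: (mono n (maxn n a)); rewrite /= ?su ?leq_maxl //.
apply: (downset_slice_mono (hD _) su (leq_maxr n a)).
apply: h1 => //=.
apply: (downset_slice_mono (hD _) su ge).
by apply: mono h; rewrite /= ?su // leq_addr.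
Qed.

(** Double counting of the pairs (v, j), weighted by the exponent v_j, over v in [D] of degree k +
    1. Summing over j first gives k + 1 for each v. Writing v as u times the j-th variable, where u
    is again in [D], gives u_j + 1, with sum k + d over j. *)
Lemma downset_count_le d k (D : pred (seq nat)) : downset d [set` D] ->
  (k.+1 * count D (monos d k.+1) <= (k + d) * count D (monos d k))%N.
Proof.
move=> hD.
have e r n : (\sum_(v <- monos d r | D v) n = n * count D (monos d r))%N.
  by rewrite big_const_seq iter_addn_0.
rewrite -!e.
have -> : (\sum_(v <- monos d k.+1 | D v) k.+1 =
  \sum_(j < d) \sum_(v <- monos d k.+1 | D v) nth 0 v j)%N.
  rewrite exchange_big /= big_seq_cond [RHS]big_seq_cond; apply: eq_bigr => v.
  by rewrite mem_monos => /andP[/andP[/eqP sv /eqP <-] _]; rewrite (sumn_nth sv).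
have -> : (\sum_(v <- monos d k | D v) (k + d) =
  \sum_(j < d) \sum_(v <- monos d k | D v) (nth 0 v j).+1)%N.
  rewrite exchange_big /= big_seq_cond [RHS]big_seq_cond; apply: eq_bigr => v.
  rewrite mem_monos => /andP[/andP[/eqP sv /eqP <-] _].
  under eq_bigr do rewrite -addn1.
  by rewrite big_split /= sum_nat_const card_ord muln1 (sumn_nth sv).
apply: leq_sum => j _.
have pe : perm_eq [seq v <- monos d k.+1 | 0 < nth 0 v j]%N
    [seq incr_nth u j | u <- monos d k].
  apply: uniq_perm; first by rewrite filter_uniq ?monos_uniq.
    rewrite map_inj_in_uniq ?monos_uniq // => u v; rewrite !mem_monos.
    move=> /andP[/eqP su _] /andP[/eqP sv _] e1.
    apply: (@eq_from_nth _ 0%N); first by rewrite su sv.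
    move=> i _; apply/eqP; rewrite -(eqn_add2l (nat_of_ord j == i)).
    by rewrite -!nth_incr_nth e1.
  move=> v; rewrite mem_filter; apply/andP/mapP => [[vj vm]|[u um ->]].
    by have [u um ->] := monosS vm vj; exists u.
  by rewrite nth_incr_nth eqxx mem_monos_incr.
have -> : (\sum_(v <- monos d k.+1 | D v) nth 0 v j =
   \sum_(v <- [seq v <- monos d k.+1 | 0 < nth 0 v j] | D v) nth 0 v j)%N.
  rewrite big_filter_cond [RHS]big_mkcond [LHS]big_mkcond /=; apply: eq_bigr => v _.
  by case: (D v); rewrite ?andbF // andbT; case: posnP.
rewrite (perm_big _ pe) big_map /= [X in (X <= _)%N]big_mkcond
  [X in (_ <= X)%N]big_mkcond /= big_seq [X in (_ <= X)%N]big_seq.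
apply: leq_sum => u; rewrite mem_monos => /andP[/eqP su _].
case: ifP => // hu; rewrite nth_incr_nth eqxx add1n.
by have /= -> : D u by apply: (hD u j).
Qed.

End Monos.

Section FnAlgebra.
Variables (K : fieldType) (T : Type).
Implicit Types (a : K) (u v : fn K T).

Lemma fn_scalerAl a u v : a *: (u * v) = (a *: u) * v.
Proof.
by apply/funext => t; change (a * (u t * v t) = a * u t * v t); rewrite mulrA.
Qed.

Lemma fn_scalerAr a u v : a *: (u * v) = u * (a *: v).
Proof. by rewrite mulrC fn_scalerAl mulrC. Qed.

Lemma fn_sumr_scale I (r : seq I) (P : pred I) (c : I -> K) (f : I -> fn K T) u :
  u * (\sum_(i <- r | P i) c i *: f i) = \sum_(i <- r | P i) c i *: (u * f i).
Proof. by rewrite mulr_sumr; apply: eq_bigr => i _; rewrite fn_scalerAr. Qed.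

Lemma subsp_mull u (V : set (fn K T)) : is_subspace V -> is_subspace [set v | V (u * v)].
Proof.
move=> hV; split=> [|a v w /= hv hw]; first by rewrite /= mulr0; apply: subsp0.
by rewrite mulrDr -fn_scalerAr; apply: subspD => //; apply: subspZ.
Qed.

End FnAlgebra.

(** * Standard monomials modulo a bihomogeneous ideal *)

Section Standard.
Variables (K : fieldType) (T : Type).
Variables (x : nat -> fn K T) (d : nat) (w : nat -> int).
Implicit Types (u v : seq nat) (I Q : nat -> int -> set (fn K T)).

Definition mon u : fn K T := \prod_(j < d) x j ^+ nth 0%N u j.

Definition mwt u : int := \sum_(j < d) (nth 0%N u j)%:Z * w j.

Lemma mon_incr u j : (j < d)%N -> mon (incr_nth u j) = x j * mon u.
Proof.
move=> jd; rewrite /mon (bigD1 (Ordinal jd)) //= [in RHS](bigD1 (Ordinal jd)) //=.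
rewrite nth_incr_nth eqxx add1n exprS mulrA; congr (_ * _).
apply: eq_bigr => i ij; rewrite nth_incr_nth [_ == _ :> nat](_ : _ = false) //.
by apply/negbTE; rewrite eq_sym; apply: contra_neq ij => ij; apply: val_inj.
Qed.

Lemma mwt_incr u j : (j < d)%N -> mwt (incr_nth u j) = mwt u + w j.
Proof.
move=> jd; rewrite /mwt (bigD1 (Ordinal jd)) //= [in RHS](bigD1 (Ordinal jd)) //=.
rewrite nth_incr_nth eqxx add1n -addn1 PoszD mulrDl mul1r addrAC; congr (_ + _ + _).
apply: eq_bigr => i ij; rewrite nth_incr_nth [_ == _ :> nat](_ : _ = false) //.
by apply/negbTE; rewrite eq_sym; apply: contra_neq ij => ij; apply: val_inj.
Qed.

(* [x j] has bidegree [(1, w j)]. *)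
Definition bideal I :=
  (forall k i, is_subspace (I k i)) /\
  forall j k i g, (j < d)%N -> I k i g -> I k.+1 (i + w j) (x j * g).

(** The ambient bigraded piece in which [I] is studied: the linear span of the monomials when [I] is
    zero, a full piece of chi when [I] is [chi_lower]. *)
Definition addmon I k i : set (fn K T) :=
  span (I k i `|` [set mon u | u in [set u | u \in monos d k /\ mwt u = i]]).

(** Macaulay's notion of standard monomial is built on this: [std] holds when the monomial is not
    congruent modulo [I] to a combination of [ltlex]-smaller monomials of its own bidegree. *)
Definition low I u : set (fn K T) :=
  span (I (sumn u) (mwt u) `|` [set mon v | v in
    [set v | [/\ v \in monos d (sumn u), mwt v = mwt u & ltlex v u]]]).

Definition std I u := `[< ~ low I u (mon u) >].

Definition stdw I k i := [seq u <- monos d k | std I u && (mwt u == i)].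

Lemma addmon_sub I k i : I k i `<=` addmon I k i.
Proof. by move=> g Ig; apply: span_mem; left. Qed.

Lemma addmon_mono I I' k i : I k i `<=` I' k i -> addmon I k i `<=` addmon I' k i.
Proof. by move=> h; apply: span_mono => g [/h|]; [left|right]. Qed.

Lemma addmon_mull I : bideal I -> bideal (addmon I).
Proof.
move=> [I1 I2]; split=> [k i|j k i g jd]; first exact: subsp_span.
apply: (span_min (V := [set g | addmon I k.+1 (i + w j) (x j * g)])).
  exact/subsp_mull/subsp_span.
move=> h [Ih|[u [um <-] <-]] /=; apply: span_mem; first by left; apply: I2.
right; exists (incr_nth u j); last exact: mon_incr.
by split; [apply: mem_monos_incr|rewrite mwt_incr].
Qed.

Lemma low_mono I I' u : (forall k i, I k i `<=` I' k i) -> low I u `<=` low I' u.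
Proof. by move=> h; apply: span_mono => g [/h|]; [left|right]. Qed.

Lemma std_mono I I' u : (forall k i, I k i `<=` I' k i) -> std I' u -> std I u.
Proof. by move=> h /asboolP h1; apply/asboolP => /(low_mono h). Qed.

(** Multiplication by [x j] turns a reduction of a monomial to smaller ones into a reduction of its
    multiple, [ltlex] being compatible with products. *)
Lemma std_down I : bideal I -> downset d [set` std I].
Proof.
move=> [I1 I2] u j su jd /= /asboolP h; apply/asboolP => lu; apply: h.
rewrite mon_incr //.
move: lu; apply: (span_min (V := [set g | low I (incr_nth u j) (x j * g)])).
  exact/subsp_mull/subsp_span.
move=> g [Ig|[v [vm vw vu] <-]] /=; apply: span_mem.
  by left; rewrite sumn_incr mwt_incr //; apply: I2.
have sv : size v = d by move: vm; rewrite mem_monos => /andP[/eqP].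
right; exists (incr_nth v j); last exact: mon_incr.
split; first by rewrite sumn_incr; apply: mem_monos_incr.
  by rewrite !mwt_incr // vw.
by apply: ltlex_incr => //; rewrite ?sv.
Qed.

Lemma stdw_uniq I k i : uniq (stdw I k i).
Proof. by rewrite filter_uniq ?monos_uniq. Qed.

Lemma mem_stdw I k i u :
  u \in stdw I k i = [&& std I u, mwt u == i & u \in monos d k].
Proof. by rewrite mem_filter -andbA. Qed.

Lemma stdw_mem I k i u : u \in stdw I k i -> addmon I k i (mon u).
Proof.
rewrite mem_stdw => /and3P[_ /eqP ui um]; apply: span_mem.
by right; exists u.
Qed.

(** Induction along [ltlex]: a nonstandard monomial is rewritten with smaller ones, which already
    have a normal form. *)
Lemma gen_stdw I k i : bideal I -> gen_seq (I k i) (addmon I k i) (stdw I k i) mon.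
Proof.
move=> [I1 I2].
pose V : set (fn K T) := [set g | exists c : seq nat -> K,
  I k i (g - \sum_(u <- stdw I k i) c u *: mon u)].
have hV : is_subspace V.
  split=> [|a g h [c hc] [c' hc']].
    by exists (fun=> 0); rewrite big1 ?subrr => [|u _]; [apply: subsp0|rewrite scale0r].
  exists (fun u => a * c u + c' u).
  have -> : \sum_(u <- stdw I k i) (a * c u + c' u) *: mon u =
    a *: (\sum_(u <- stdw I k i) c u *: mon u) + \sum_(u <- stdw I k i) c' u *: mon u.
    rewrite scaler_sumr -big_split; apply: eq_bigr => u _.
    by rewrite scalerDl scalerA.
  by rewrite opprD addrACA -scalerBr; apply: subspD => //; apply: subspZ.
have IV : I k i `<=` V.
  by move=> g Ig; exists (fun=> 0); rewrite big1 ?subr0 // => u _; rewrite scale0r.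
apply: span_min => // g [/IV//|[u [um ui] <-]]; move: u um ui.
apply: ltlex_ind => u um IH ui.
have /andP[/eqP su /eqP uk] : (size u == d) && (sumn u == k) by rewrite -mem_monos.
have [su'|/negbTE/asboolP/contrapT] := boolP (std I u).
  exists (fun v => (v == u)%:R); rewrite (bigD1_seq u) ?stdw_uniq //=; last first.
    by rewrite mem_stdw su' ui eqxx.
  rewrite eqxx scale1r big1 ?addr0 ?subrr; first exact: subsp0.
  by move=> v /negbTE ->; rewrite scale0r.
rewrite -[X in _ -> X]/(V (mon u)) /low uk ui.
by apply: span_min => // g' [/IV//|[v [vm vi vu] <-]]; apply: IH.
Qed.

(** In a relation, the [ltlex]-largest monomial with a nonzero coefficient would be a combination of
    smaller ones modulo [I], hence not standard. *)
Lemma free_stdw I k i : bideal I -> free_seq (I k i) (stdw I k i) mon.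
Proof.
move=> [I1 I2] c hc; apply: contrapT => /existsNP[u0] /not_implyP[u0m /eqP u0c].
pose s := [seq u <- stdw I k i | c u != 0].
have [||u us hu] := @ltlex_max d s.
- by rewrite -has_filter; apply/hasP; exists u0.
- move=> u; rewrite mem_filter mem_stdw mem_monos => /andP[_ /and3P[_ _]].
  by case/andP=> /eqP.
move: us; rewrite mem_filter => /andP[uc um].
move: (um); rewrite mem_stdw => /and3P[/asboolP nlow /eqP ui umm].
have /andP[/eqP su /eqP uk] : (size u == d) && (sumn u == k) by rewrite -mem_monos.
have hlow : is_subspace (low I u) by apply: subsp_span.
refine (nlow _).
have -> : mon u = (c u)^-1 *: (\sum_(v <- stdw I k i) c v *: mon v
   - \sum_(v <- stdw I k i | v != u) c v *: mon v).
  rewrite (bigD1_seq u) ?stdw_uniq //= addrK scalerA mulVf // scale1r.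
  by [].
apply: (subspZ _ hlow).
apply: (subspB hlow).
  by apply: span_mem; left; rewrite uk ui.
apply: (subsp_sum_seq hlow).
move=> v vm vu; have [->|cv] := eqVneq (c v) 0.
  by rewrite scale0r; apply: (subsp0 hlow).
apply: (subspZ _ hlow).
apply: span_mem; right; exists v => //.
move: (vm); rewrite mem_stdw => /and3P[_ /eqP vi vmm].
by rewrite uk ui; split=> //; apply: hu => //; rewrite mem_filter cv.
Qed.

Lemma qdim_stdw I k i : bideal I -> qdim (I k i) (addmon I k i) = size (stdw I k i).
Proof.
move=> hI; apply: (@qdim_seq _ _ _ _ _ _ mon).
- exact: hI.1.
- exact: subsp_span.
- exact: stdw_uniq.
- exact: stdw_mem.
- exact: free_stdw.
- exact: gen_stdw.
Qed.

(** Modulo [I], g is a combination of standard monomials of [I]. These are also standard for [I'],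
    hence free modulo [I'], so the combination vanishes. *)
Lemma bideal_std_eq I I' k i g : bideal I -> bideal I' ->
  (forall k i, I k i `<=` I' k i) -> (forall u, size u = d -> std I u -> std I' u) ->
  addmon I k i g -> I' k i g -> I k i g.
Proof.
move=> hI hI' h hs /(gen_stdw hI)[c hc] I'g.
have I's : I' k i (\sum_(u <- stdw I k i) c u *: mon u).
  rewrite -[X in I' k i X](subKr g); apply: subspB => //; first exact: hI'.1.
  exact: h.
have e : stdw I' k i = stdw I k i.
  apply: eq_in_filter => u; rewrite mem_monos => /andP[/eqP su _].
  congr (_ && _); apply/idP/idP => [|/hs]; last exact.
  exact: std_mono.
move: hc; rewrite big1_seq ?subr0 // => u /= us.
by rewrite (free_stdw hI' (c := c) (k := k) (i := i)) ?e // scale0r.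
Qed.

(** Noetherianity: an increasing chain of ideals has a decreasing chain of downsets of standard
    monomials, stationary by Dickson's lemma, and [bideal_std_eq] recovers the ideals from them. *)
Lemma bideal_acc (I : nat -> nat -> int -> set (fn K T)) (J : nat -> int -> set (fn K T)) :
  (forall n, bideal (I n)) -> (forall n k i, I n k i `<=` I n.+1 k i) ->
  (forall n k i, I n k i `<=` addmon J k i) -> (forall n k i, J k i `<=` I n k i) ->
  exists n0, forall n k i, I n k i `<=` I n0 k i.
Proof.
move=> hI hS hJ hJ'.
have mono n m k i : (n <= m)%N -> I n k i `<=` I m k i.
  move=> /subnK <-; elim: (m - n)%N => // r IH g /IH; exact: hS.
have [||n0 hn0] := @downset_dcc d (fun n => [set` std (I n)]).
- by move=> n; apply: std_down.
- by move=> n u su /=; apply: std_mono => k i; apply: hS.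
exists n0 => n k i g ng; have [nn0|n0n] := leqP n n0; first exact: mono ng.
apply: (bideal_std_eq (hI n0) (hI n)) => //.
- by move=> k' i'; apply: mono; apply: ltnW.
- by move=> u su; apply: hn0.
- by apply: addmon_mono (hJ _ _ _ _ ng); apply: hJ'.
Qed.

Lemma bideal_mon I u k i g : bideal I -> size u = d -> I k i g ->
  I (k + sumn u)%N (i + mwt u) (mon u * g).
Proof.
move=> hI su Ig; have [r] := ubnP (sumn u).
elim: r u su => // r IH u su; case ur : (sumn u) => [|r'] lt.
  have u0 j : nth 0%N u j = 0%N.
    have [jd|jd] := ltnP j d; last by rewrite nth_default ?su.
    move: ur; rewrite (sumn_nth su) (bigD1 (Ordinal jd)) //= => /eqP.
    by rewrite addn_eq0 => /andP[/eqP].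
  rewrite addn0 /mwt big1 => [|j _]; last by rewrite u0 mul0r.
  by rewrite addr0 /mon big1 ?mul1r // => j _; rewrite u0.
have [|j jd [v vm e]] := @monosS_ex d r' u; first by rewrite mem_monos su ur !eqxx.
move: vm; rewrite mem_monos => /andP[/eqP sv /eqP vr'].
rewrite e mwt_incr // mon_incr // addnS -mulrA addrA; apply: hI.2 => //.
by rewrite -vr'; apply: IH => //; rewrite vr' -ltnS.
Qed.

(** The ideal quotient of [I] by the e-th power of the irrelevant ideal. *)
Definition satur I e k i : set (fn K T) :=
  [set g | addmon I k i g /\ forall v, v \in monos d e ->
     I (k + e)%N (i + mwt v) (mon v * g)].

Lemma satur_bideal I e : bideal I -> bideal (satur I e).
Proof.
move=> hI; split=> [k i|j k i g jd [h1 h2]].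
  have hA : is_subspace (addmon I k i) by apply: subsp_span.
  split=> [|a g h [g1 g2] [h1 h2]].
    split=> [|v vm]; first by apply: subsp0; apply: subsp_span.
    by rewrite mulr0; apply: subsp0; apply: hI.1.
  split=> [|v vm]; first exact: hA.2.
  rewrite mulrDr -fn_scalerAr; have hs := hI.1 (k + e)%N (i + mwt v).
  by apply: subspD => //; [apply: subspZ => //; apply: g2|apply: h2].
split=> [|v vm]; first by apply: (addmon_mull hI).2.
by rewrite addSn addrAC mulrCA; apply: hI.2 => //; apply: h2.
Qed.

Lemma saturS I e k i : bideal I -> satur I e k i `<=` satur I e.+1 k i.
Proof.
move=> hI g [h1 h2]; split=> // v /monosS_ex[j jd [u um ->]].
by rewrite addnS mwt_incr // addrA mon_incr // -mulrA; apply: hI.2 => //; apply: h2.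
Qed.

Lemma satur_mono I e e' k i : bideal I -> (e <= e')%N ->
  satur I e k i `<=` satur I e' k i.
Proof.
by move=> hI /subnK <-; elim: (e' - e)%N => // r IH g /IH; apply: saturS.
Qed.

Lemma bideal_sub_satur I e k i : bideal I -> I k i `<=` satur I e k i.
Proof.
move=> hI g Ig; split; first exact: addmon_sub.
move=> v; rewrite mem_monos => /andP[/eqP sv /eqP <-]; exact: bideal_mon.
Qed.

(** The ideal generated by [I] and the part of [satur I e] of degree at most [a]. That it is
    stationary in [a] means that [satur I e] is generated in bounded degree. *)
Definition truncgen I e a k i : set (fn K T) :=
  span (I k i `|` [set g | exists k' i' v h, [/\ (k' <= a)%N, satur I e k' i' h,
    size v = d & [/\ k = (k' + sumn v)%N, i = i' + mwt v & g = mon v * h]]]).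

Lemma mon_nseq0 : mon (nseq d 0%N) = 1.
Proof. by rewrite /mon big1 // => j _; rewrite nth_nseq if_same. Qed.

Lemma mwt_nseq0 : mwt (nseq d 0%N) = 0.
Proof. by rewrite /mwt big1 // => j _; rewrite nth_nseq if_same mul0r. Qed.

(* The torsion of the quotient by an ideal vanishes in large degree: the
   saturation is finitely generated and killed by a fixed power of the
   irrelevant ideal. *)
Lemma bideal_saturated I : bideal I -> exists k0, forall k i g, (k0 <= k)%N ->
  addmon I k i g ->
  (forall j, (j < d)%N -> exists e, I (k + e)%N (i + e%:Z * w j) (x j ^+ e * g)) ->
  I k i g.
Proof.
move=> hI.
have [|n k i|n k i g []|n k i|e0 he0] //:= @bideal_acc (satur I) I.
- by move=> n; apply: satur_bideal.
- exact: saturS.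
- exact: bideal_sub_satur.
have [|||n k i|a0 ha0] := @bideal_acc (truncgen I e0) I.
- move=> a; split=> [k i|j k i g jd]; first exact: subsp_span.
  apply: (span_min (V := [set g | truncgen I e0 a k.+1 (i + w j) (x j * g)])).
    exact/subsp_mull/subsp_span.
  move=> h [Ih|[k' [i' [v [h' [le h1 sv [-> -> ->]]]]]]] /=; apply: span_mem.
    by left; apply: hI.2.
  right; exists k', i', (incr_nth v j), h'; split=> //.
    by rewrite size_incr_nth sv jd.
  by rewrite sumn_incr mwt_incr // mon_incr // addnS addrA mulrA.
- move=> a k i; apply: span_mono => g [|[k' [i' [v [h [le h1 h2 h3]]]]]]; first by left.
  by right; exists k', i', v, h; split=> //; apply: leqW.
- move=> a k i; apply: span_min; first exact: subsp_span.
  move=> g [|[k' [i' [v [h [le [h1 _] sv [-> -> ->]]]]]]]; first exact: addmon_sub.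
  exact: (bideal_mon (addmon_mull hI) sv h1).
- by move=> g Ig; apply: span_mem; left.
exists (a0 + e0)%N => k i g lek hg hx.
have : satur I e0 k i g.
  have [f hf] : exists f : nat -> nat, forall j, (j < d)%N ->
      I (k + f j)%N (i + (f j)%:Z * w j) (x j ^+ f j * g).
    have /choice[f hf] : forall j, exists e, (j < d)%N ->
      I (k + e)%N (i + e%:Z * w j) (x j ^+ e * g).
      move=> j; case: (ltnP j d) => [/hx[e he]|_]; first by exists e.
      by exists 0%N.
    by exists f.
  apply: (he0 (\sum_(j < d) f j).+1); split=> // v.
  rewrite mem_monos => /andP[/eqP sv /eqP vk].
  (* Pigeonhole: a monomial of degree larger than the sum of the [f j] is divisible by some
     [x j ^+ f j], which already sends g into [I]. *)
  have [j fj] : exists j : 'I_d, (f j <= nth 0%N v j)%N.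
    apply: contrapT => /forallNP hn; have : (sumn v <= \sum_(j < d) f j)%N.
      rewrite (sumn_nth sv); apply: leq_sum => j _; apply: ltnW; rewrite ltnNge.
      by apply/negP/hn.
    by rewrite vk ltnn.
  pose v' := set_nth 0%N v j (nth 0%N v j - f j)%N.
  have sv' : size v' = d by rewrite size_set_nth sv (maxn_idPr (ltn_ord j)).
  have v'E (i' : 'I_d) : i' != j -> nth 0%N v' i' = nth 0%N v i'.
    move=> ne; rewrite nth_set_nth /= [_ == _ :> nat](_ : _ = false) //.
    by apply/negbTE; apply: contra_neq ne => ij; apply: val_inj.
  have v'j : nth 0%N v' j = (nth 0%N v j - f j)%N by rewrite nth_set_nth /= eqxx.
  have -> : mon v * g = mon v' * (x j ^+ f j * g).
    rewrite mulrA; congr (_ * _); rewrite /mon (bigD1 j) //= [in RHS](bigD1 j) //=.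
    rewrite v'j mulrAC -exprD subnK //; congr (_ * _).
    by apply: eq_bigr => i' /v'E ->.
  have -> : i + mwt v = i + (f j)%:Z * w j + mwt v'.
    rewrite -addrA; congr (_ + _); rewrite /mwt (bigD1 j) //= [in RHS](bigD1 j) //=.
    rewrite v'j addrA -mulrDl -PoszD subnKC //; congr (_ + _).
    by apply: eq_bigr => i' /v'E ->.
  have -> : (k + (\sum_(j < d) f j).+1 = k + f j + sumn v')%N.
    rewrite -vk -addnA; congr (_ + _)%N.
    rewrite (sumn_nth sv) (sumn_nth sv') (bigD1 j) //= [in RHS](bigD1 j) //=.
    rewrite v'j addnA subnKC //; congr (_ + _)%N.
    by apply: eq_bigr => i' /v'E ->.
  by apply: bideal_mon => //; apply: hf.
move=> hs.
have : truncgen I e0 k k i g.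
  apply: span_mem; right; exists k, i, (nseq d 0%N), g; split=> //.
    by rewrite size_nseq.
  by rewrite sumn_nseq mul0n addn0 mwt_nseq0 addr0 mon_nseq0 mul1r.
(* A generator of degree k' <= a0 appears in degree k multiplied by a monomial of degree k - k' >=
   e0, and such monomials send [satur I e0] into [I]. *)
move/ha0; apply: span_min; first exact: hI.1.
move=> h [//|[k' [i' [v [h' [le h1 sv [kE iE ->]]]]]]].
have : satur I (sumn v) k' i' h'.
  by apply: satur_mono h1 => //; lia.
by case=> _ /(_ v); rewrite mem_monos sv !eqxx kE iE; apply.
Qed.

End Standard.

(** * Hilbert functions of downsets *)

Section EventuallyPolynomial.
Variable RR : realType.
Implicit Types (f g p q : nat -> RR).

Definition fdiff f k := f k.+1 - f k.

(* i.e. f k is a polynomial in k for large k *)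
Definition epolyn n f := exists k0, forall k, (k0 <= k)%N -> iter n fdiff f k = 0.

Definition epoly f := exists n, epolyn n f.

Lemma epolynS n f : epolyn n.+1 f <-> epolyn n (fdiff f).
Proof. by rewrite /epolyn iterSr. Qed.

Lemma epoly_fdiff f : epoly (fdiff f) -> epoly f.
Proof. by case=> n h; exists n.+1; apply/epolynS. Qed.

Lemma epolynW n f : epolyn n f -> epolyn n.+1 f.
Proof.
case=> k0 h; exists k0 => k lek; rewrite iterS /fdiff !h ?subrr //.
exact: leqW.
Qed.

Lemma epolyn_le n m f : (n <= m)%N -> epolyn n f -> epolyn m f.
Proof. by move=> /subnK <- h; elim: (m - n)%N => // r; apply: epolynW. Qed.

Lemma iter_fdiffD n f g k :
  iter n fdiff (fun k => f k + g k) k = iter n fdiff f k + iter n fdiff g k.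
Proof. by elim: n k => // n IH k; rewrite !iterS /fdiff !IH; ring. Qed.

Lemma epolynD n f g : epolyn n f -> epolyn n g -> epolyn n (fun k => f k + g k).
Proof.
move=> [k0 h0] [k1 h1]; exists (maxn k0 k1) => k; rewrite geq_max => /andP[l0 l1].
by rewrite iter_fdiffD h0 // h1 // addr0.
Qed.

Lemma epolyD f g : epoly f -> epoly g -> epoly (fun k => f k + g k).
Proof.
move=> [n hn] [m hm]; exists (maxn n m).
by apply: epolynD; [apply: epolyn_le hn|apply: epolyn_le hm];
  rewrite (leq_maxl, leq_maxr).
Qed.

Lemma epoly_eq k0 f g : (forall k, (k0 <= k)%N -> g k = f k) -> epoly f -> epoly g.
Proof.
move=> e [n [k1 h]]; exists n, (maxn k0 k1) => k; rewrite geq_max => /andP[l0 l1].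
rewrite -(h k l1); elim: n {h} k l0 {l1} => [|n IH] k l0; first exact: e.
by rewrite !iterS /fdiff !IH // leqW.
Qed.

Lemma epoly0 : epoly (fun=> 0).
Proof. by exists 0%N, 0%N. Qed.

Lemma epoly_cst c : epoly (fun=> c).
Proof.
by apply: epoly_fdiff; apply: (epoly_eq (k0 := 0) _ epoly0) => k _; rewrite /fdiff subrr.
Qed.

Lemma epoly_id : epoly (fun k => k%:R).
Proof.
apply: epoly_fdiff; apply: (epoly_eq (k0 := 0) _ (epoly_cst 1)) => k _.
by rewrite /fdiff -natr1 addrAC subrr add0r.
Qed.

Lemma epolyn_shift n c f : epolyn n f -> epolyn n (fun k => f (k + c)%N).
Proof.
move=> [k0 h]; exists k0 => k lek; rewrite -(h (k + c)%N); last exact: leq_trans lek (leq_addr _ _).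
elim: n k {h lek} => // n IH k; rewrite !iterS /fdiff !IH.
by rewrite addSn.
Qed.

Lemma epoly_shift c f : epoly f -> epoly (fun k => f (k + c)%N).
Proof. by case=> n h; exists n; apply: epolyn_shift. Qed.

Lemma epoly_unshift c f : epoly f -> epoly (fun k => f (k - c)%N).
Proof.
move=> [n [k0 h]]; exists n, (c + k0)%N => k lek.
rewrite -(h (k - c)%N); last by lia.
elim: n k {h} lek => // n IH k lek; rewrite !iterS /fdiff !IH ?(leqW lek) //.
by rewrite subSn //; lia.
Qed.

(** Discrete Leibniz rule, with induction on the sum of the orders of the differences that
    vanish. *)
Lemma epolyM f g : epoly f -> epoly g -> epoly (fun k => f k * g k).
Proof.
move=> [n hn] [m hm]; have [N] := ubnP (n + m); elim: N n m f g hn hm => // N IH.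
case=> [|n] [|m] f g hn hm lt.
- case: hn => k0 h; apply: (epoly_eq (k0 := k0) _ epoly0) => k /h /= ->.
  by rewrite mul0r.
- case: hn => k0 h; apply: (epoly_eq (k0 := k0) _ epoly0) => k /h /= ->.
  by rewrite mul0r.
- case: hm => k0 h; apply: (epoly_eq (k0 := k0) _ epoly0) => k /h /= ->.
  by rewrite mulr0.
apply: epoly_fdiff.
apply: (epoly_eq (k0 := 0) (f := fun k => fdiff f k * g (k + 1)%N + f k * fdiff g k)).
  by move=> k _; rewrite /fdiff addn1; ring.
apply: epolyD.
  by apply: (IH n m.+1); [apply/epolynS|apply: epolyn_shift|lia].
by apply: (IH n.+1 m); [|apply/epolynS|lia].
Qed.

Lemma epolyZ c f : epoly f -> epoly (fun k => c * f k).
Proof. by move=> h; apply: epolyM (epoly_cst c) h. Qed.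

Lemma epoly_psum f : epoly f -> epoly (fun k => \sum_(i < k) f i).
Proof.
move=> h; apply: epoly_fdiff; apply: (epoly_eq (k0 := 0)) h => k _.
by rewrite /fdiff big_ord_recr /= addrAC subrr add0r.
Qed.

Lemma epoly_sum J (f : nat -> nat -> RR) : (forall j, epoly (f j)) ->
  epoly (fun k => \sum_(j < J) f j k).
Proof.
move=> h; elim: J => [|J IH].
  by apply: (epoly_eq (k0 := 0) _ epoly0) => k _; rewrite big_ord0.
by apply: (epoly_eq (k0 := 0) _ (epolyD IH (h J))) => k _; rewrite big_ord_recr.
Qed.

(** By induction the difference has a constant sign for large k, so the sequence is eventually
    monotone, hence eventually of constant sign itself. *)
Lemma epoly_sign f : epoly f ->
  (exists k0, forall k, (k0 <= k)%N -> 0 <= f k) \/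
  (exists k0, forall k, (k0 <= k)%N -> f k <= 0).
Proof.
move=> [n]; elim: n f => [|n IH] f; first by move=> [k0 h]; left; exists k0 => k /h /= ->.
move=> /epolynS/IH[|] [k0 h].
  have mono k k' : (k0 <= k)%N -> (k <= k')%N -> f k <= f k'.
    move=> lek /subnK <-; elim: (k' - k)%N => // r /le_trans; apply.
    by rewrite -subr_ge0; apply: h; rewrite (leq_trans lek) ?leq_addl.
  have [[k1 [l1 f1]]|hn] := pselect (exists k, (k0 <= k)%N /\ 0 <= f k).
    by left; exists k1 => k l; apply: (le_trans f1); apply: mono.
  right; exists k0 => k l; rewrite leNgt; apply/negP => fk; apply: hn.
  by exists k; split=> //; apply: ltW.
have mono k k' : (k0 <= k)%N -> (k <= k')%N -> f k' <= f k.
  move=> lek /subnK <-; elim: (k' - k)%N => // r; apply: le_trans.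
  by rewrite -subr_le0; apply: h; rewrite (leq_trans lek) ?leq_addl.
have [[k1 [l1 f1]]|hn] := pselect (exists k, (k0 <= k)%N /\ f k <= 0).
  by right; exists k1 => k l; apply: le_trans f1; apply: mono.
left; exists k0 => k l; rewrite leNgt; apply/negP => fk; apply: hn.
by exists k; split=> //; apply: ltW.
Qed.

(** The increments of p / q have an eventually polynomial numerator, hence a constant sign for large
    k. The ratio is thus eventually monotone, and it is bounded. *)
Lemma epoly_ratio_cvg p q C k0 : epoly p -> epoly q ->
  (forall k, (k0 <= k)%N -> 0 < q k /\ `|p k| <= C * q k) ->
  cvgn (fun k => p k / q k).
Proof.
move=> hp hq hb.
pose s k := p (k + 1)%N * q k + (-1 * p k) * q (k + 1)%N.
have hs : epoly s.
  apply: epolyD; apply: epolyM => //; [exact: epoly_shift| |exact: epoly_shift].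
  exact: epolyZ.
have step k : (k0 <= k)%N -> p k.+1 / q k.+1 - p k / q k = s k / (q k * q k.+1).
  move=> l; have [qk _] := hb _ l; have [qk1 _] := hb _ (leqW l).
  by rewrite /s addn1; field; rewrite !gt_eqF.
have qq k : (k0 <= k)%N -> 0 < q k * q k.+1.
  by move=> l; apply: mulr_gt0; [have [] := hb _ l|have [] := hb _ (leqW l)].
have bd k : (k0 <= k)%N -> `|p k / q k| <= C.
  move=> l; have [qk h] := hb _ l.
  by rewrite normrM normfV (gtr0_norm qk) ler_pdivrMr.
have [] := epoly_sign hs => -[k1 h].
- suff : cvgn ([sequence p (k + (k0 + k1))%N / q (k + (k0 + k1))%N]_k).
    by move=> /cvg_ex[l /= hl]; apply/cvg_ex; exists l; rewrite -(cvg_shiftn (k0 + k1)).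
  apply: nondecreasing_is_cvgn.
    apply/nondecreasing_seqP => k /=; rewrite -subr_ge0 addSn step; last by lia.
    by apply: mulr_ge0; [apply: h; lia|rewrite invr_ge0 ltW // qq //; lia].
  by exists C => _ [k _ <-] /=; apply: le_trans (ler_norm _) _; apply: bd; lia.
- suff : cvgn ([sequence p (k + (k0 + k1))%N / q (k + (k0 + k1))%N]_k).
    by move=> /cvg_ex[l /= hl]; apply/cvg_ex; exists l; rewrite -(cvg_shiftn (k0 + k1)).
  apply: nonincreasing_is_cvgn.
    apply/nonincreasing_seqP => k /=; rewrite -subr_le0 addSn step; last by lia.
    by apply: mulr_le0_ge0; [apply: h; lia|rewrite invr_ge0 ltW // qq //; lia].
  exists (- C) => _ [k _ <-] /=.
  have := bd (k + (k0 + k1))%N; rewrite ler_norml => /(_ ltac:(lia)).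
  by case/andP.
Qed.

(** Summation over the first exponent j of a monomial. The J first terms are shifts of eventually
    polynomial sequences; the others form a partial sum of the single sequence [c J]. *)
Lemma epoly_conv J (c : nat -> nat -> RR) : (forall j, epoly (c j)) ->
  (forall j k, (J <= j)%N -> c j k = c J k) ->
  epoly (fun k => \sum_(j < k.+1) c j (k - j)%N) /\
  epoly (fun k => \sum_(j < k.+1) j%:R * c j (k - j)%N).
Proof.
move=> hc st.
have e (a : nat -> nat -> RR) k : (J <= k)%N -> \sum_(j < k.+1) a j (k - j)%N =
    \sum_(j < J) a j (k - j)%N + \sum_(i < k.+1 - J) a (k - i)%N i.
  move=> l; rewrite -(big_mkord xpredT (fun j => a j (k - j)%N)).
  rewrite (big_cat_nat (leq0n J) (leqW l)) /= big_mkord; congr (_ + _).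
  rewrite -{1}[J]add0n big_addn big_nat_rev add0n /= big_mkord.
  by apply: eq_bigr => i _; have := ltn_ord i; move=> li; congr (a _ _); lia.
split.
- apply: (epoly_eq (k0 := J) (f := fun k => \sum_(j < J) c j (k - j)%N +
     (fun r => \sum_(i < r) c J i) (k + 1 - J)%N)).
    move=> k l; rewrite (e (fun j k => c j k)) // addn1; congr (_ + _).
    by apply: eq_bigr => i _; apply: st; have := ltn_ord i; lia.
  apply: epolyD.
    by apply: (@epoly_sum J (fun j k => c j (k - j)%N)) => j; apply: epoly_unshift.
  apply: (@epoly_shift 1 (fun k => \sum_(i < k - J) c J i)).
  exact/(epoly_unshift J (f := fun r => \sum_(i < r) c J i))/epoly_psum.
- apply: (epoly_eq (k0 := J) (f := fun k => \sum_(j < J) j%:R * c j (k - j)%N +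
     (k%:R * (fun r => \sum_(i < r) c J i) (k + 1 - J)%N +
      -1 * (fun r => \sum_(i < r) i%:R * c J i) (k + 1 - J)%N))).
    move=> k l; rewrite (e (fun j k => j%:R * c j k)) // addn1; congr (_ + _).
    rewrite mulN1r mulr_sumr -sumrB; apply: eq_bigr => i _.
    have li : (i < k.+1 - J)%N by [].
    rewrite -mulrBl -natrB; last by lia.
    by rewrite st //; lia.
  apply: epolyD; first by apply: (@epoly_sum J (fun j k => j%:R * c j (k - j)%N)) => j;
    apply/epolyZ/epoly_unshift.
  apply: epolyD; [apply: epolyM; first exact: epoly_id|apply: epolyZ].
    apply: (@epoly_shift 1 (fun k => \sum_(i < k - J) c J i)).
    exact/(epoly_unshift J (f := fun r => \sum_(i < r) c J i))/epoly_psum.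
  apply: (@epoly_shift 1 (fun k => \sum_(i < k - J) i%:R * c J i)).
  apply/(epoly_unshift J (f := fun r => \sum_(i < r) i%:R * c J i)).
  apply: (@epoly_psum (fun i => i%:R * c J i)).
  by apply: epolyM; [exact: epoly_id|exact: hc].
Qed.

Lemma sum_monosS d k (D : pred (seq nat)) (f : seq nat -> RR) :
  \sum_(u <- monos d.+1 k | D u) f u =
  \sum_(j < k.+1) \sum_(u <- monos d (k - j) | D (nat_of_ord j :: u)) f (nat_of_ord j :: u).
Proof.
have e : iota 0 k.+1 = index_iota 0 k.+1 by rewrite /index_iota subn0.
rewrite monosSE e big_flatten big_map big_mkord.
by apply: eq_bigr => j _; rewrite big_map.
Qed.

(** Induction on d by slicing along the first exponent; Dickson's lemma makes the slices stationary,
    as [epoly_conv] asks. The first exponent contributes j times the count of its slice to the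
    weighted sum. *)
Lemma hilbert_epoly d (D : pred (seq nat)) (w : nat -> RR) : downset d [set` D] ->
  epoly (fun k => \sum_(u <- monos d k | D u) 1) /\
  epoly (fun k => \sum_(u <- monos d k | D u) \sum_(j < d) (nth 0%N u j)%:R * w j).
Proof.
elim: d D w => [|d IH] D w hD.
  split; apply: (epoly_eq (k0 := 1) _ epoly0) => -[//|k] _ /=; by rewrite big_nil.
have [|n u su|J hJ] := @downset_dcc d (fun n => [set u | D (n :: u)]).
- by move=> n; apply: downset_slice hD.
- exact: (downset_slice_mono hD su (leqnSn n)).
have st j k (f : seq nat -> RR) : (J <= j)%N ->
    \sum_(u <- monos d k | D (j :: u)) f u = \sum_(u <- monos d k | D (J :: u)) f u.
  move=> l; rewrite big_seq_cond [RHS]big_seq_cond; apply: eq_bigl => u.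
  rewrite mem_monos; case: eqP => //= su; congr (_ && _); apply/idP/idP.
    exact: (downset_slice_mono hD su l).
  exact: hJ.
have slice j : downset d [set` [pred u | D (j :: u)]] by apply: downset_slice hD.
have := epoly_conv (fun j => (IH [pred u | D (j :: u)] (fun i => w i.+1) (slice j)).1)
  (fun j k => st j k (fun=> 1)).
move=> [c1 c2].
have := epoly_conv (fun j => (IH [pred u | D (j :: u)] (fun i => w i.+1) (slice j)).2)
  (fun j k => st j k (fun u => \sum_(i < d) (nth 0%N u i)%:R * w i.+1)).
move=> [c3 _]; split.
  by apply: (epoly_eq (k0 := 0)) c1 => k _; rewrite sum_monosS.
apply: (epoly_eq (k0 := 0) _ (epolyD (epolyZ (w 0%N) c2) c3)) => k _.
rewrite sum_monosS mulr_sumr -big_split /=; apply: eq_bigr => j _.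
rewrite !mulr_sumr -big_split /=; apply: eq_bigr => u _.
by rewrite big_ord_recl /= mulr1 mulrC.
Qed.

End EventuallyPolynomial.

(** * Chevalley's theorem *)

Section PrimeIdeals.
Variable D : comNzRingType.

Definition prime_ideal (P : set D) :=
  [/\ P 0, forall a b, P a -> P b -> P (a + b), forall a b, P b -> P (a * b),
     ~ P 1 & forall a b, P (a * b) -> P a \/ P b].

Variables (P : set D) (hP : prime_ideal P).

Lemma prime_ideal0 : P 0. Proof. by case: hP. Qed.

Lemma prime_idealD a b : P a -> P b -> P (a + b).
Proof. by case: hP => _ h _ _ _; apply: h. Qed.

Lemma prime_ideal_mull a b : P b -> P (a * b).
Proof. by case: hP => _ _ h _ _; apply: h. Qed.

Lemma prime_ideal_mulr a b : P a -> P (a * b).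
Proof. by rewrite mulrC; apply: prime_ideal_mull. Qed.

Lemma prime_idealN a : P a -> P (- a).
Proof. by rewrite -mulN1r; apply: prime_ideal_mull. Qed.

Lemma prime_idealB a b : P a -> P b -> P (a - b).
Proof. by move=> Pa Pb; apply: prime_idealD => //; apply: prime_idealN. Qed.

Lemma prime_ideal1 : ~ P 1. Proof. by case: hP. Qed.

Lemma prime_idealM a b : ~ P a -> ~ P b -> ~ P (a * b).
Proof. by case: hP => _ _ _ _ h na nb /h[]. Qed.

Lemma prime_idealX a n : ~ P a -> ~ P (a ^+ n).
Proof.
move=> na; elim: n => [|n IH]; first by rewrite expr0; apply: prime_ideal1.
by rewrite exprS; apply: prime_idealM.
Qed.

End PrimeIdeals.

Lemma prime_ideal_preim (D D' : comNzRingType) (f : {rmorphism D -> D'}) (P : set D') :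
  prime_ideal P -> prime_ideal (f @^-1` P).
Proof.
move=> [h1 h2 h3 h4 h5]; split=> [|a b ha hb|a b hb||a b] /=; rewrite ?rmorph0 //.
- by rewrite rmorphD; apply: h2.
- by rewrite rmorphM; apply: h3.
- by rewrite rmorph1.
- by rewrite rmorphM => /h5.
Qed.

Section ClosedFieldExtension.
Variable K : closedFieldType.

(** A root c of p X + 1 satisfies c p(c) = -1. *)
Lemma closed_nonroot (p : {poly K}) : p != 0 -> exists c, p.[c] != 0.
Proof.
move=> p0; have /closed_rootP[c /rootP] : size (p * 'X + 1) != 1%N.
  by rewrite size_MXaddC (negbTE p0) /= eqSS size_poly_eq0.
rewrite !hornerE => h; exists c; apply/eqP => pc; move/eqP: h.
by rewrite pc mul0r add0r oner_eq0.
Qed.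

Section PolyStep.
Variables (B : comNzRingType) (P : set {poly B}).
Hypothesis hP : prime_ideal P.

Let Q : set B := [set b | P b%:P].

Let hQ : prime_ideal Q.
Proof. exact: (prime_ideal_preim (polyC : {rmorphism B -> {poly B}}) hP). Qed.

(** Polynomials over the domain B / Q are handled through representatives in [{poly B}]: [Qnull]
    stands for being zero there, [proper] for having a leading coefficient that survives. *)
Let Qnull (p : {poly B}) := forall i, Q p`_i.

Let Qnull_P p : Qnull p -> P p.
Proof.
move=> h; rewrite -(coefK p) poly_def.
apply: (big_ind P); [exact: prime_ideal0|exact: prime_idealD|move=> i _].
by rewrite -mul_polyC; apply: (prime_ideal_mulr hP); apply: h.
Qed.

Let proper (p : {poly B}) := ~ Q (lead_coef p).

Let truncate p : ~ Qnull p -> exists p', [/\ proper p', (size p' <= size p)%N & Qnull (p - p')].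
Proof.
have [n] := ubnP (size p); elim: n p => // n IH p; rewrite ltnS => le np.
have [h|h] := pselect (Q (lead_coef p)); last first.
  by exists p; split=> // i; rewrite subrr coef0; apply: (prime_ideal0 hQ).
have p0 : p != 0.
  by apply/eqP => p0; apply: np => i; rewrite p0 coef0; apply: (prime_ideal0 hQ).
pose q := \poly_(i < (size p).-1) p`_i.
have sp : (size p = (size p).-1.+1)%N by rewrite prednK // size_poly_gt0.
have sq : (size q < size p)%N by rewrite sp ltnS size_poly.
have pq : Qnull (p - q).
  move=> i; rewrite coefB coef_poly; case: ltnP => l.
    by rewrite subrr; apply: (prime_ideal0 hQ).
  rewrite subr0; have [->//|/eqP ne] := pselect (i = (size p).-1).
  rewrite nth_default; first exact: (prime_ideal0 hQ).
  by rewrite {1}sp ltn_neqAle eq_sym ne.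
have [||p' [h1 h2 h3]] := IH q.
- exact: leq_trans sq le.
- by move=> hq; apply: np => i; rewrite -[p](subrK q) coefD; apply: (prime_idealD hQ).
exists p'; split=> //; first exact: leq_trans h2 (ltnW sq).
by move=> i; rewrite -[p](subrK q) -addrA coefD; apply: (prime_idealD hQ).
Qed.

Let proper_neq0 p : proper p -> p != 0.
Proof.
by move=> h; apply/eqP => p0; apply: h; rewrite p0 lead_coef0; apply: (prime_ideal0 hQ).
Qed.

(** Pseudo-division by g. If the remainder were nonzero modulo Q, dropping its top terms that vanish
    modulo Q would give a proper element of [J] shorter than g. *)
Let divide (J : set {poly B}) g : (forall a b, J a -> J b -> J (a + b)) ->
  (forall a b, J b -> J (a * b)) -> P `<=` J ->
  J g -> proper g -> (forall g', J g' -> proper g' -> size g <= size g')%N ->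
  forall p, J p -> exists e h, Qnull ((lead_coef g ^+ e)%:P * p - h * g).
Proof.
move=> JD JM PJ Jg pg gmin p Jp.
have g0 := proper_neq0 pg.
have := Pdiv.ComRing.rdivp_eq g p.
set e := Pdiv.Ring.rscalp _ _; set h := Pdiv.Ring.rdivp _ _; set r := Pdiv.Ring.rmodp _ _ => eq1.
have rE : (lead_coef g ^+ e)%:P * p - h * g = r by rewrite mul_polyC eq1 addrAC subrr add0r.
exists e, h; rewrite rE; apply: contrapT => /truncate[r' [h1 h2 h3]].
have : (size r < size g)%N by apply: Pdiv.Ring.ltn_rmodpN0.
apply/negP; rewrite -leqNgt; apply: leq_trans h2; apply: gmin => //.
have -> : r' = r + - 1 * (r - r') by rewrite mulN1r opprB addrCA subrr addr0.
apply: (JD); last exact/(JM)/PJ/Qnull_P.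
by rewrite -rE -mulNr; apply: (JD); apply: (JM).
Qed.

Let min_proper (J : set {poly B}) f : J f -> proper f ->
  exists g, [/\ J g, proper g & forall g', J g' -> proper g' -> (size g <= size g')%N].
Proof.
move=> Jf pf; pose S n := `[< exists g, [/\ J g, proper g & size g = n] >].
have [|n /asboolP[g [h1 h2 h3]] hmin] := @ex_minnP S.
  by exists (size f); apply/asboolP; exists f.
by exists g; split=> // g' h1' h2'; rewrite h3; apply: hmin; apply/asboolP; exists g'.
Qed.

(** Over the fraction field of B / Q, either P is zero and c has only to avoid the roots of a, or P
    is generated by some f, hence maximal, and a is invertible modulo P. In the second case c can be
    any root of the image of f. The element u keeps the relevant coefficients nonzero: one of a in
    the first case, the leading ones of f and g in the second. *)
Lemma prime_poly_extension (a : {poly B}) : ~ P a -> exists u : B, ~ P u%:P /\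
  forall phi : {rmorphism B -> K}, (forall b, P b%:P -> phi b = 0) -> phi u != 0 ->
  exists c : K, (forall p, P p -> (map_poly phi p).[c] = 0) /\ (map_poly phi a).[c] != 0.
Proof.
move=> na; have [hn|/existsNP[f0 /not_implyP[Pf0 nf0]]] := pselect (forall p, P p -> Qnull p).
  have /existsNP[i ai] : ~ Qnull a by move/Qnull_P.
  exists a`_i; split=> // phi phiQ phia.
  have [|c hc] := @closed_nonroot (map_poly phi a).
    by apply: contraNneq phia => /polyP/(_ i); rewrite coef_map coef0 => ->.
  exists c; split=> // p /hn hp; rewrite [map_poly phi p](_ : _ = 0) ?horner0 //.
  by apply/polyP => j; rewrite coef_map coef0; apply/phiQ/hp.
have [f1 [pf1 _ nf1]] := truncate nf0.
have Pf1 : P f1.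
  have -> : f1 = f0 - (f0 - f1) by rewrite subKr.
  by apply: (prime_idealB hP) => //; apply: Qnull_P.
have [f [Pf pf fmin]] := min_proper Pf1 pf1.
(* The ideal P + (a). A proper element g of least degree turns out to be constant, which makes a
   invertible modulo P. *)
pose J : set {poly B} := [set p | exists v, P (p - v * a)].
have JD p q : J p -> J q -> J (p + q).
  move=> [v hv] [v' hv']; exists (v + v').
  by rewrite mulrDl opprD addrACA; apply: (prime_idealD hP).
have JM p q : J q -> J (p * q).
  by move=> [v hv]; exists (p * v); rewrite -mulrA -mulrBr; apply: (prime_ideal_mull hP).
have PJ : P `<=` J by move=> p Pp; exists 0; rewrite mul0r subr0.
have Ja : J a by exists 1; rewrite mul1r subrr; apply: (prime_ideal0 hP).
have [g [Jg pg gmin]] := min_proper (PJ _ Pf) pf.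
have divf := divide (prime_idealD hP) (prime_ideal_mull hP) (@subset_refl _ P) Pf pf fmin.
have divg := divide JD JM PJ Jg pg gmin.
have lcP q n p : proper q -> ~ P p -> ~ P ((lead_coef q ^+ n)%:P * p).
  move=> pq np; apply: (prime_idealM hP) => //.
  by rewrite polyC_exp; apply: (prime_idealX hP).
(* Otherwise f is h g modulo Q, up to a power of the leading coefficient of g, so h or g lies in P.
   If g does, so does a. If h does, its degree is too small for the minimality of f. *)
have sg : size g = 1%N.
  apply/eqP; rewrite eqn_leq size_poly_gt0 proper_neq0 // andbT leqNgt; apply/negP => sg.
  have [e [h hh]] := divg _ (PJ _ Pf).
  have : P (h * g).
    rewrite -[h * g](subKr ((lead_coef g ^+ e)%:P * f)).
    by apply: (prime_idealB hP); [apply: (prime_ideal_mull hP)|apply: Qnull_P].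
  case: (hP) => _ _ _ _ /[apply]; case=> [Ph|Pg]; last first.
    have [e' [h' /Qnull_P]] := divg _ Ja.
    move=> hh'; apply: (lcP g e' a) => //.
    rewrite -[_ * a](subrK (h' * g)); apply: (prime_idealD hP) => //.
    exact: (prime_ideal_mull hP).
  have hnull : ~ Qnull h.
    move=> hnull; have := hh (size f).-1.
    rewrite coefB coefCM -lead_coefE => hh1.
    have : Q (lead_coef g ^+ e * lead_coef f).
      rewrite -[_ * _](subrK (h * g)`_(size f).-1); apply: (prime_idealD hQ) => //.
      rewrite coefM; apply: (big_ind Q); [exact: prime_ideal0|exact: prime_idealD|].
      by move=> i _; apply: (prime_ideal_mulr hQ).
    by apply: (prime_idealM hQ) => //; apply: (prime_idealX hQ).
  have [h' [ph' _ nh']] := truncate hnull.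
  have Ph' : P h'.
    have -> : h' = h - (h - h') by rewrite subKr.
    by apply: (prime_idealB hP) => //; apply: Qnull_P.
  have le := fmin _ Ph' ph'.
  have := hh (size h' + size g).-2.
  have s1 : (0 < size h')%N by rewrite size_poly_gt0 proper_neq0.
  rewrite coefB coefCM (@nth_default _ _ f); last by move: sg le; lia.
  rewrite mulr0 sub0r => /(prime_idealN hQ); rewrite opprK.
  rewrite -[h](subrK h') mulrDl coefD => hq.
  have : Q ((h' * g)`_(size h' + size g).-2).
    rewrite -[_`__](addKr (((h - h') * g)`_(size h' + size g).-2)).
    apply: (prime_idealD hQ) => //; apply: (prime_idealN hQ).
    rewrite coefM; apply: (big_ind Q); [exact: prime_ideal0|exact: prime_idealD|].
    by move=> i _; apply: (prime_ideal_mulr hQ).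
  by rewrite -mul_lead_coef; apply: (prime_idealM hQ).
have gE : g = (lead_coef g)%:P.
  by rewrite [LHS]size1_polyC ?sg // lead_coefE sg.
case: Jg => v hv; exists (lead_coef g * lead_coef f); split.
  exact: (prime_idealM hQ).
move=> phi phiQ; rewrite rmorphM mulf_eq0 negb_or => /andP[phig phif].
have sf : size (map_poly phi f) = size f.
  by apply: size_map_poly_id0.
have /closed_rootP[c /rootP rc] : size (map_poly phi f) != 1%N.
  rewrite sf; apply/eqP => sf1; apply: pf; change (P (lead_coef f)%:P).
  have <- : f = (lead_coef f)%:P; last exact: Pf.
  by rewrite [LHS]size1_polyC ?sf1 // lead_coefE sf1.
have van p : P p -> (map_poly phi p).[c] = 0.
  move=> Pp; have [e [h hh]] := divf _ Pp.
  have : map_poly phi ((lead_coef f ^+ e)%:P * p - h * f) = 0.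
    by apply/polyP => i; rewrite coef_map coef0; apply: phiQ; apply: hh.
  move/(congr1 (horner^~ c)); rewrite rmorphB !rmorphM /= map_polyC /= !hornerE rc.
  rewrite mulr0 subr0 rmorphXn => /eqP.
  by rewrite mulf_eq0 expf_eq0 (negbTE phif) andbF => /eqP.
exists c; split=> //; have := van _ hv.
rewrite gE rmorphB rmorphM /= map_polyC !hornerE /= => /eqP; rewrite subr_eq0 => /eqP e.
by apply: contraNneq phig => a0; rewrite e a0 mulr0.
Qed.

End PolyStep.

Lemma mpoly_rmorph_eq n (R S : comNzRingType) (f g : {rmorphism mpoly n R -> S}) :
  (forall c, f (mpolyC n c) = g (mpolyC n c)) ->
  (forall i, f (mpolyX R (mnm1 i)) = g (mpolyX R (mnm1 i))) -> f =1 g.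
Proof.
move=> hc hx p; rewrite (mpolyE p) !rmorph_sum; apply: eq_bigr => m _.
rewrite -mul_mpolyC !rmorphM hc; congr (_ * _).
rewrite mpolyXE_id !rmorph_prod; apply: eq_bigr => i _.
by rewrite !rmorphXn hx.
Qed.

(* Chevalley's theorem on images, for the projection of a closed subset of an
   affine space over [B]. *)
Theorem prime_mpoly_extension (B : comNzRingType) n (P : set (mpoly n B)) (a : mpoly n B) :
  prime_ideal P -> ~ P a -> exists u : B, ~ P (mpolyC n u) /\
  forall phi : {rmorphism B -> K}, (forall b, P (mpolyC n b) -> phi b = 0) -> phi u != 0 ->
  exists c : 'I_n -> K, (forall p, P p -> mmap phi c p = 0) /\ mmap phi c a != 0.
Proof.
elim: n P a => [|n IH] P a hP na.
  have pE (p : mpoly 0 B) : p = mpolyC 0 (mcoeff (@mnm0 0) p).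
    apply/mpolyP => m; rewrite mcoeffC.
    have -> : m = @mnm0 0 by apply/mnmP => -[].
    by rewrite eqxx mulr1.
  exists (mcoeff (@mnm0 0) a); split; first by rewrite -pE.
  move=> phi phiP phia; exists (fun=> 0); split=> [p|]; last by rewrite (pE a) mmapC.
  by rewrite {1}(pE p) => /phiP h; rewrite (pE p) mmapC.
pose X := mpolyX B (mnm1 (ord_max : 'I_n.+1)).
pose back : {rmorphism {poly mpoly n B} -> mpoly n.+1 B} :=
  horner_eval X \o map_poly (@mwiden n B).
have backK p : back (muni p) = p.
  pose f : {rmorphism mpoly n.+1 B -> mpoly n.+1 B} := back \o @muni n B.
  have := @mpoly_rmorph_eq n.+1 B _ f idfun; apply=> [c|i] /=.
    by rewrite muniC map_polyC /horner_eval /= hornerC mwidenC.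
  rewrite /muni mmapX mmap1U; case: fintype.splitP => j ij.
    rewrite map_polyC /horner_eval /= hornerC mwidenX mnmwiden1.
    by congr (mpolyX _ (mnm1 _)); apply: val_inj.
  rewrite map_polyX /horner_eval hornerX; congr (mpolyX _ (mnm1 _)).
  by apply: val_inj => /=; have := ij; rewrite (ord1 j) addn0 /= => ->.
pose P1 := back @^-1` P.
have P1E q : P1 q = P (back q) by [].
have hP1 : prime_ideal P1 by apply: prime_ideal_preim.
have na1 : ~ P1 (muni a) by rewrite P1E backK.
(* The last variable is eliminated first: [u1], a polynomial in the other n variables, is what the
   induction hypothesis has to keep nonzero. *)
have [u1 [nu1 hu1]] := prime_poly_extension hP1 na1.
pose P2 := [set b | P1 b%:P].
have P2E q : P2 q = P (back q%:P) by [].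
have hP2 : prime_ideal P2.
  exact: (prime_ideal_preim (polyC : {rmorphism mpoly n B -> {poly mpoly n B}}) hP1).
have [u [nu hu]] := IH P2 u1 hP2 nu1.
have backC b : back (mpolyC n b)%:P = mpolyC n.+1 b.
  by rewrite /back /= map_polyC /horner_eval /= hornerC mwidenC.
exists u; split; first by move: nu; rewrite P2E backC.
move=> phi phiP phiu; have [b hb|//|c [c1 c2]] := hu phi.
  by apply: phiP; move: hb; rewrite P2E backC.
have [b hb|//|c' [c'1 c'2]] := hu1 (mmap phi c : {rmorphism mpoly n B -> K}).
  exact: c1.
pose cc (i : 'I_n.+1) := oapp c c' (unlift ord_max i).
have ccE q : mmap phi cc (back q) = (map_poly (mmap phi c) q).[c'].
  have e b : mmap phi cc (mwiden b) = mmap phi c b.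
    pose f : {rmorphism mpoly n B -> K} := mmap phi cc \o @mwiden n B.
    apply: (@mpoly_rmorph_eq n B _ f (mmap phi c)) => [d|i] /=.
      by rewrite mwidenC !mmapC.
    rewrite mwidenX mnmwiden1 !mmapX !mmap1U /cc.
    have -> : widen_ord (leqnSn n) i = lift ord_max i by apply: val_inj; exact/esym/lift_max.
    by rewrite liftK.
  rewrite /back /= /horner_eval -(horner_map (mmap phi cc)) -map_poly_comp.
  have eX : mmap phi cc X = c' by rewrite mmapX mmap1U /cc unlift_none.
  by apply: (congr2 (fun p z => horner p z)); [apply: eq_map_poly => b; apply: e|exact: eX].
exists cc; split=> [p Pp|]; last by rewrite -[a]backK ccE.
by rewrite -[p]backK ccE; apply: c'1; rewrite P1E backK.
Qed.

End ClosedFieldExtension.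

(** * Sections over a projective variety *)

Lemma poly_vanish (K : closedFieldType) (p : {poly K}) :
  (forall a, a != 0 -> p.[a] = 0) -> p = 0.
Proof.
move=> h; apply/eqP; apply: contraT => p0.
have [|a] := @closed_nonroot _ (p * 'X); first by rewrite mulf_neq0 // polyX_eq0.
rewrite !hornerE mulf_eq0 negb_or => /andP[pa a0].
by rewrite h ?eqxx in pa.
Qed.

Lemma span0 (K : fieldType) (E : lmodType K) (S : set E) : span S 0.
Proof. exact: (subsp0 (@subsp_span _ _ _)). Qed.

Lemma fg_fin (K : fieldType) (T : Type) (x : nat -> fn K T) d w k i :
  fg [set 0] (addmon x d w (fun _ _ => [set 0]) k i).
Proof.
apply: (@gen_seq_fg _ _ _ _ _ [seq u <- monos d k | mwt d w u == i] (mon x d)).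
move=> v hv; have : span [set mon x d u | u in
    [set` [seq u <- monos d k | mwt d w u == i]]] v.
  move: hv; apply: span_min; first exact: subsp_span.
  move=> g [->|[u [um ui] <-]]; first exact: span0.
  by apply: span_mem; exists u => //=; rewrite mem_filter ui eqxx.
move=> /span_seq[|c ->]; first by rewrite filter_uniq ?monos_uniq.
by exists c; rewrite /= subrr.
Qed.

Lemma bideal0 (K : fieldType) (T : Type) (x : nat -> fn K T) d w :
  bideal x d w (fun _ _ => [set 0]).
Proof.
by split=> [k i|j k i g jd /= ->]; [exact: subsp_set0|rewrite mulr0].
Qed.

Section Forms.
Variables (K : closedFieldType) (N : nat).
Local Notation point := 'rV[K]_N.+1.
Local Notation form := (mpoly N.+1 K).
Local Notation var i := (mpolyX K (mnm1 i)).
Implicit Types (p q : form) (x : point).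

Lemma pvalD p q x : pval (p + q) x = pval p x + pval q x.
Proof. exact: mevalD. Qed.

Lemma pvalB p q x : pval (p - q) x = pval p x - pval q x.
Proof. exact: mevalB. Qed.

Lemma pvalM p q x : pval (p * q) x = pval p x * pval q x.
Proof. exact: mevalM. Qed.

Lemma pvalZ a p x : pval (a *: p) x = a * pval p x.
Proof. exact: mevalZ. Qed.

Lemma pval0 x : pval 0 x = 0.
Proof. exact: meval0. Qed.

Lemma pval1 x : pval 1 x = 1.
Proof. exact: meval1. Qed.

Lemma pvalXn p n x : pval (p ^+ n) x = pval p x ^+ n.
Proof. by elim: n => [|n IH]; rewrite ?expr0 ?pval1 // !exprS pvalM IH. Qed.

Lemma pval_sum I (r : seq I) (P : pred I) (F : I -> form) x :
  pval (\sum_(i <- r | P i) F i) x = \sum_(i <- r | P i) pval (F i) x.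
Proof.
by elim/big_rec2: _ => [|i y z _ <-]; [exact: pval0|exact: pvalD].
Qed.

Lemma pval_prod I (r : seq I) (P : pred I) (F : I -> form) x :
  pval (\prod_(i <- r | P i) F i) x = \prod_(i <- r | P i) pval (F i) x.
Proof.
by elim/big_rec2: _ => [|i y z _ <-]; [exact: pval1|exact: pvalM].
Qed.

Lemma pval_var i x : pval (var i) x = x ord0 i.
Proof. exact: mevalXU. Qed.

Lemma homogeneousM d e p q : homogeneous d p -> homogeneous e q ->
  homogeneous (d + e)%N (p * q).
Proof. exact: dhomogM. Qed.

Lemma homogeneousD d p q : homogeneous d p -> homogeneous d q ->
  homogeneous d (p + q).
Proof. exact: rpredD. Qed.

Lemma homogeneousB d p q : homogeneous d p -> homogeneous d q ->
  homogeneous d (p - q).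
Proof. exact: rpredB. Qed.

Lemma homogeneousZ d a p : homogeneous d p -> homogeneous d (a *: p).
Proof. exact: rpredZ. Qed.

Lemma homogeneous0 d : homogeneous d (0 : form).
Proof. exact: rpred0. Qed.

Lemma homogeneous1 : homogeneous 0 (1 : form).
Proof. exact: dhomog1. Qed.

Lemma homogeneous_var (i : 'I_N.+1) : @homogeneous K N 1 (var i).
Proof. by rewrite /homogeneous dhomogX; apply/eqP; apply: mdeg1. Qed.

Lemma homogeneousX d p n : homogeneous d p -> homogeneous (d * n)%N (p ^+ n).
Proof. exact: dhomogMn. Qed.

Lemma homogeneous_prod I (r : seq I) (P : pred I) (d : I -> nat) (F : I -> form) :
  (forall i, P i -> homogeneous (d i) (F i)) ->
  homogeneous (\sum_(i <- r | P i) d i)%N (\prod_(i <- r | P i) F i).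
Proof.
move=> h; elim/big_rec2: _ => [|i y z Pi]; first exact: homogeneous1.
by apply: homogeneousM; apply: h.
Qed.

Lemma homogeneous_sum I (r : seq I) (P : pred I) d (F : I -> form) :
  (forall i, P i -> homogeneous d (F i)) ->
  homogeneous d (\sum_(i <- r | P i) F i).
Proof. by move=> h; apply: rpred_sum. Qed.

Definition hcomp d p : form := \sum_(m <- msupp p | mdeg m == d) mcoeff m p *: mpolyX K m.

Lemma homogeneous_hcomp d p : homogeneous d (hcomp d p).
Proof.
apply: homogeneous_sum => m /eqP <-; apply: homogeneousZ.
by rewrite /homogeneous dhomogX.
Qed.

(** The restriction of p to the line through 0 and x. Its coefficients are the values at x of the
    homogeneous components of p, which are therefore determined by the values of p on that line, K
    being infinite. *)
Definition line_poly p x : {poly K} :=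
  \sum_(m <- msupp p) (mcoeff m p * \prod_i x ord0 i ^+ m i) *: 'X^(mdeg m).

Lemma horner_line p x a : (line_poly p x).[a] = pval p (a *: x).
Proof.
rewrite /pval mevalE horner_sum; apply: eq_bigr => m _.
rewrite !hornerE -mulrA; congr (_ * _).
rewrite mdegE -prodrXr mulrC -big_split /=; apply: eq_bigr => i _.
by rewrite mxE exprMn.
Qed.

Lemma coef_line p x d : (line_poly p x)`_d = pval (hcomp d p) x.
Proof.
rewrite coef_sum pval_sum [RHS]big_mkcond; apply: eq_bigr => m _.
rewrite coefZ coefXn eq_sym; case: eqP => _; last by rewrite mulr0.
by rewrite mulr1 pvalZ /pval mevalX.
Qed.

Lemma hcomp_homogeneous d p : homogeneous d p -> hcomp d p = p.
Proof.
move=> /dhomogP h; rewrite [RHS]mpolyE /hcomp big_seq_cond [RHS]big_seq.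
by apply: eq_bigl => m; case: (boolP (m \in msupp p)) => //= /h ->; rewrite eqxx.
Qed.

Lemma hcomp_homogeneous_neq d e p : homogeneous d p -> e != d -> hcomp e p = 0.
Proof.
move=> /dhomogP h ne; rewrite /hcomp big_seq_cond big1 // => m /andP[/h -> /eqP de].
by rewrite de eqxx in ne.
Qed.

Lemma pval_scale d p x a : homogeneous d p -> pval p (a *: x) = a ^+ d * pval p x.
Proof.
move=> h; rewrite -horner_line.
have -> : line_poly p x = pval p x *: 'X^d.
  apply/polyP => e; rewrite coef_line coefZ coefXn; have [->|ne] := eqVneq e d.
    by rewrite hcomp_homogeneous // mulr1.
  by rewrite (hcomp_homogeneous_neq h ne) pval0 mulr0.
by rewrite !hornerE mulrC.
Qed.

Lemma pval_hcomp_scale p x d c : (forall a, a != 0 -> pval p (a *: x) = a ^+ d * c) ->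
  pval (hcomp d p) x = c.
Proof.
move=> h; rewrite -coef_line.
have -> : line_poly p x = c *: 'X^d.
  apply/eqP; rewrite -subr_eq0; apply/eqP/poly_vanish => a a0.
  by rewrite !hornerE horner_line h // mulrC subrr.
by rewrite coefZ coefXn eqxx mulr1.
Qed.

Lemma pval_hcomp_vanish p x : (forall a, a != 0 -> pval p (a *: x) = 0) ->
  forall d, pval (hcomp d p) x = 0.
Proof. by move=> h d; apply: pval_hcomp_scale => a /h ->; rewrite mulr0. Qed.

Lemma pval_sum_hcomp p x : pval p x = \sum_(d < size (line_poly p x)) pval (hcomp d p) x.
Proof.
rewrite -{1}[x]scale1r -horner_line horner_coef; apply: eq_bigr => d _.
by rewrite coef_line expr1n mulr1.
Qed.

Lemma pval_mon p x : pval p x = \sum_(m <- msupp p) mcoeff m p * \prod_i x ord0 i ^+ m i.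
Proof. exact: mevalE. Qed.

End Forms.

Section Variety.
Variables (K : closedFieldType) (N : nat) (X : set 'rV[K]_N.+1).
Hypothesis varX : irreducible_closed X.
Local Notation form := (mpoly N.+1 K).
Local Notation var i := (mpolyX K (mnm1 i)).
Local Notation sec := (fn K {x | X x}).
Implicit Types (p q : form) (x : 'rV[K]_N.+1) (y : {x | X x}).

Lemma variety_scale x a : X x -> a != 0 -> X (a *: x).
Proof.
case: varX => -[S [hS XS]] _ _ /XS[x0 hx] a0; apply/XS; split.
  by rewrite scaler_eq0 negb_or a0.
by move=> p Sp; have [d hd] := hS p Sp; rewrite (pval_scale _ _ hd) hx // mulr0.
Qed.

Lemma variety_neq0 x : X x -> x != 0.
Proof. by case: varX => -[S [hS XS]] _ _ /XS[]. Qed.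

Lemma variety_zeros x : x != 0 ->
  (forall p, (forall z, X z -> pval p z = 0) -> pval p x = 0) -> X x.
Proof.
case: varX => -[S [hS XS]] _ _ x0 h; apply/XS; split=> // p Sp; apply: h => z.
by move=> /XS[_]; apply.
Qed.

Lemma zclosed_form p d : homogeneous d p -> zclosed [set x | x != 0 /\ pval p x = 0].
Proof.
move=> hp; exists [set p]; split=> [q -> |x]; first by exists d.
by split=> [[x0 px]|[x0 h]]; split=> //; [move=> q ->|apply: h].
Qed.

(** Otherwise the zero sets of the two forms would cover X, against irreducibility. *)
Lemma forms_common_nonroot d e p q : homogeneous d p -> homogeneous e q ->
  (exists x, X x /\ pval p x != 0) -> (exists x, X x /\ pval q x != 0) ->
  exists x, [/\ X x, pval p x != 0 & pval q x != 0].
Proof.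
move=> hp hq [x [Xx px]] [z [Xz qz]]; apply: contrapT => hn.
case: varX => _ _ /(_ _ _ (zclosed_form hp) (zclosed_form hq)) [].
- move=> t Xt; have t0 := variety_neq0 Xt.
  have [pt|pt] := eqVneq (pval p t) 0; first by left.
  have [qt|qt] := eqVneq (pval q t) 0; first by right.
  by exfalso; apply: hn; exists t.
- by move=> /(_ _ Xx) [_ /eqP]; rewrite (negbTE px).
- by move=> /(_ _ Xz) [_ /eqP]; rewrite (negbTE qz).
Qed.

Definition hcoord (j : nat) : sec := fun y => sval y ord0 (inord j).

Local Notation co := hcoord.

(* The second degree is trivial; it makes the results on [bideal] apply to the
   restrictions of forms to X. *)
Definition forms_bigraded (k : nat) (i : int) : set sec :=
  addmon co N.+1 (fun=> 0) (fun _ _ => [set 0]) k i.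
Definition forms_on (k : nat) : set sec := forms_bigraded k 0.

Local Notation A := forms_on.

Lemma mwt0 d u : mwt d (fun=> 0) u = 0.
Proof. by rewrite /mwt big1 // => j _; rewrite mulr0. Qed.

Lemma subsp_A k : is_subspace (A k).
Proof. exact: subsp_span. Qed.

Lemma fn_sumE I (r : seq I) (P : pred I) (F : I -> sec) y :
  (\sum_(i <- r | P i) F i) y = \sum_(i <- r | P i) F i y.
Proof. by elim/big_rec2: _ => // i a b _ <-. Qed.

Lemma fn_prodE I (r : seq I) (P : pred I) (F : I -> sec) y :
  (\prod_(i <- r | P i) F i) y = \prod_(i <- r | P i) F i y.
Proof. by elim/big_rec2: _ => // i a b _ <-. Qed.

Lemma fn_expE (u : sec) n y : (u ^+ n) y = u y ^+ n.
Proof. by elim: n => // n IH; rewrite !exprS -IH. Qed.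

Lemma mon_coE u y : mon co N.+1 u y = \prod_(j < N.+1) sval y ord0 j ^+ nth 0%N u j.
Proof.
rewrite /mon fn_prodE; apply: eq_bigr => j _.
by rewrite fn_expE /hcoord inord_val.
Qed.

Lemma A_form k (g : sec) : A k g <-> exists p, homogeneous k p /\ forall y, g y = pval p (sval y).
Proof.
split.
  pose V : set sec := [set g | exists p, homogeneous k p /\ forall y, g y = pval p (sval y)].
  apply: (span_min (V := V)).
    split; first by exists 0; split=> [|y]; [exact: homogeneous0|rewrite pval0].
    move=> a u v [p [hp up]] [q [hq vq]]; exists (a *: p + q); split.
      by apply: homogeneousD => //; apply: homogeneousZ.
    by move=> y; rewrite pvalD pvalZ -up -vq.
  move=> _ [->|[u [um _] <-]].
    by exists 0; split=> [|y]; [exact: homogeneous0|rewrite pval0].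
  exists (\prod_(j < N.+1) var j ^+ nth 0%N u j); split.
    move: um; rewrite mem_monos => /andP[/eqP su /eqP <-].
    rewrite (sumn_nth su); apply: homogeneous_prod => j _.
    by rewrite -[X in homogeneous X]mul1n; apply/homogeneousX/homogeneous_var.
  move=> y; rewrite mon_coE pval_prod; apply: eq_bigr => j _.
  by rewrite pvalXn pval_var.
move=> [p [/dhomogP hp gp]].
have -> : g = \sum_(m <- msupp p) (mcoeff m p *: mon co N.+1 [seq m i | i <- enum 'I_N.+1] : sec).
  apply/funext => y; rewrite gp pval_mon fn_sumE; apply: eq_bigr => m _.
  change (mcoeff m p * \prod_i sval y ord0 i ^+ m i =
    mcoeff m p * mon co N.+1 [seq m i | i <- enum 'I_N.+1] y).
  rewrite mon_coE; congr (_ * _); apply: eq_bigr => i _; congr (_ ^+ _).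
  by rewrite (nth_map i) ?size_enum_ord // nth_ord_enum.
apply: subsp_sum_seq; first exact: subsp_A.
move=> m mp _; apply: (subspZ _ (subsp_A k)).
apply: span_mem; right; eexists => //; split; last exact: mwt0.
rewrite mem_monos size_map size_enum_ord eqxx /=.
have <- : mdeg m = k by apply: (hp _ mp).
by rewrite mdegE sumnE big_map big_enum.
Qed.

Lemma subsp_H0 k : is_subspace (H0 X k).
Proof.
split=> [x Xx|a u v hu hv x Xx].
  exists 0%N, 0, 1; split=> [|||z _]; rewrite ?pval0 ?mul0r ?pval1 ?oner_eq0 //.
    exact: homogeneous0.
  exact: homogeneous1.
have [d1 [a1 [b1 [ha1 hb1 b1x uE]]]] := hu x Xx.
have [d2 [a2 [b2 [ha2 hb2 b2x vE]]]] := hv x Xx.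
exists (d1 + d2)%N, (a *: (a1 * b2) + a2 * b1), (b1 * b2); split.
- apply: homogeneousD.
    by rewrite addnAC; apply/homogeneousZ/homogeneousM.
  rewrite (_ : (d1 + d2 + k)%N = (d2 + k + d1)%N); last by lia.
  exact: homogeneousM.
- exact: homogeneousM.
- by rewrite pvalM mulf_neq0.
- move=> y; rewrite pvalM mulf_eq0 negb_or => /andP[b1y b2y].
  change (a * u y + v y = pval (a *: (a1 * b2) + a2 * b1) (sval y) /
    (pval b1 (sval y) * pval b2 (sval y))).
  rewrite uE // vE // pvalD pvalZ !pvalM.
  by field; rewrite b1y b2y.
Qed.

Lemma H0_mul k l (u v : sec) : H0 X k u -> H0 X l v -> H0 X (k + l)%N (u * v).
Proof.
move=> hu hv x Xx.
have [d1 [a1 [b1 [ha1 hb1 b1x uE]]]] := hu x Xx.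
have [d2 [a2 [b2 [ha2 hb2 b2x vE]]]] := hv x Xx.
exists (d1 + d2)%N, (a1 * a2), (b1 * b2); split.
- by rewrite addnACA; apply: homogeneousM.
- exact: homogeneousM.
- by rewrite pvalM mulf_neq0.
- move=> y; rewrite pvalM mulf_eq0 negb_or => /andP[b1y b2y].
  change (u y * v y = pval (a1 * a2) (sval y) / (pval b1 (sval y) * pval b2 (sval y))).
  rewrite uE // vE // !pvalM.
  by field; rewrite b1y b2y.
Qed.

Lemma A_H0 k : A k `<=` H0 X k.
Proof.
move=> g /A_form[p [hp gp]] x Xx; exists 0%N, p, 1; split=> //.
- exact: homogeneous1.
- by rewrite pval1 oner_eq0.
- by move=> y _; rewrite pval1 divr1 gp.
Qed.

Lemma H0_one : H0 X 0 1.
Proof.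
apply: A_H0; apply/A_form; exists 1; split; first exact: homogeneous1.
by move=> y; rewrite pval1.
Qed.

Lemma H0_exp k (u : sec) n : H0 X k u -> H0 X (n * k)%N (u ^+ n).
Proof.
move=> hu; elim: n => [|n IH]; first by rewrite mul0n; apply: H0_one.
by rewrite mulSn exprS; apply: H0_mul.
Qed.

Lemma H0_scale k (u : sec) y y' a : H0 X k u -> a != 0 -> sval y' = a *: sval y ->
  u y' = a ^+ k * u y.
Proof.
move=> hu a0 e; have [d [p [q [hp hq qx uE]]]] := hu _ (proj2_sig y).
rewrite (uE y) // (uE y'); last by rewrite e (pval_scale _ _ hq) mulf_neq0 ?expf_neq0.
rewrite e (pval_scale _ _ hp) (pval_scale _ _ hq) exprD.
by field; rewrite qx expf_neq0.
Qed.

Lemma H0_nonzero k (u : sec) : H0 X k u -> u != 0 -> exists d p,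
  [/\ homogeneous d p, exists x, X x /\ pval p x != 0 &
    forall y, pval p (sval y) != 0 -> u y != 0].
Proof.
move=> hu u0; have [y uy] : exists y, u y != 0.
  apply: contrapT => /forallNP hn; move/eqP: u0; apply; apply/funext => y.
  by apply/eqP; apply: contraT => /hn.
have [d [p [q [hp hq qx uE]]]] := hu _ (proj2_sig y).
exists (d + k + d)%N, (p * q); split; first exact: homogeneousM.
  exists (sval y); split; first exact: (proj2_sig y).
  rewrite pvalM mulf_neq0 //; apply: contra_neq uy => py.
  by rewrite uE // py mul0r.
move=> z; rewrite pvalM mulf_eq0 negb_or => /andP[pz qz].
by rewrite uE // mulf_neq0 // invr_eq0.
Qed.

Lemma H0_domain k l (u v : sec) : H0 X k u -> H0 X l v -> u * v = 0 -> u = 0 \/ v = 0.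
Proof.
move=> hu hv uv; have [|u0] := eqVneq u 0; first by left.
have [|v0] := eqVneq v 0; first by right.
have [d [p [hp xp up]]] := H0_nonzero hu u0.
have [e [q [hq xq vq]]] := H0_nonzero hv v0.
have [x [Xx px qx]] := forms_common_nonroot hp hq xp xq.
have := congr1 (fun f : sec => f (exist _ x Xx)) uv.
change (u (exist _ x Xx) * v (exist _ x Xx) = 0 -> u = 0 \/ v = 0) => /eqP.
by rewrite mulf_eq0 (negbTE (up (exist _ x Xx) px)) (negbTE (vq (exist _ x Xx) qx)).
Qed.

Lemma co_A j : (j < N.+1)%N -> A 1 (co j).
Proof.
move=> jN; apply/A_form; exists (var (inord j)); split; first exact: homogeneous_var.
by move=> y; rewrite pval_var.
Qed.

(* An ideal of the polynomial ring without zeros in the chart x_j <> 0 contains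
   a power of x_j. *)
Lemma nullstellensatz_chart (J : set form) (j : 'I_N.+1) :
  (forall a b, J a -> J b -> J (a + b)) -> (forall a b, J b -> J (a * b)) -> J 0 ->
  (forall x, (forall p, J p -> pval p x = 0) -> x ord0 j = 0) ->
  exists e, J (var j ^+ e).
Proof.
move=> JD JM J0 hJ; apply: contrapT => /forallNP hn.
pose I (P : set form) := [/\ (forall a b, P a -> P b -> P (a + b)),
  (forall a b, P b -> P (a * b)) & forall e, ~ P (var j ^+ e)].
have [F hF tot|P [hP Pmax]] := @Zorn_bigcup form [set P | P = set0 \/ (J `<=` P /\ I P)].
  have [[P0 [FP0 P0n]]|hne] := pselect (exists P, F P /\ P !=set0); last first.
    left; apply/seteqP; split=> // p [P FP Pp].
    by exfalso; apply: hne; exists P; split=> //; exists p.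
  have h P : F P -> P !=set0 -> J `<=` P /\ I P.
    by move=> FP [p Pp]; case: (hF _ FP) => // P0'; rewrite P0' in Pp.
  right; split.
    by move=> p Jp; exists P0 => //; have [/(_ _ Jp)] := h _ FP0 P0n.
  split=> [a b [P FP Pa] [Q FQ Qb]|a b [P FP Pb]|e [P FP Pe]].
  - have [PQ|QP] := tot _ _ FP FQ.
      exists Q => //; have [_ [QD _ _]] := h Q FQ (ex_intro _ _ Qb).
      by apply: QD => //; apply: PQ.
    exists P => //; have [_ [PD _ _]] := h P FP (ex_intro _ _ Pa).
    by apply: PD => //; apply: QP.
  - exists P => //; have [_ [_ PM _]] := h P FP (ex_intro _ _ Pb).
    exact: PM.
  - by have [_ [_ _ /(_ e)]] := h P FP (ex_intro _ _ Pe).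
have [JP [PD PM PN]] : J `<=` P /\ I P.
  case: hP => [P0|//]; exfalso; apply: (Pmax J); last by right; split=> //; split.
  by split; rewrite P0 // => /(_ _ J0).
have P0 := JP _ J0.
have step a : ~ P a -> exists e b, P (var j ^+ e - b * a).
  move=> na; pose P' := [set p | exists b, P (p - b * a)].
  have PP' : P `<=` P' by move=> p Pp; exists 0; rewrite mul0r subr0.
  have P'a : P' a by exists 1; rewrite mul1r subrr.
  apply: contrapT => hn'; apply: (Pmax P'); first by split=> // /(_ _ P'a).
  right; split; first by move=> p /JP /PP'.
  split=> [p q [b hb] [c hc]|p q [b hb]|e [b hb]].
  - by exists (b + c); rewrite mulrDl opprD addrACA; apply: PD.
  - by exists (p * b); rewrite -mulrA -mulrBr; apply: PM.
  - by apply: hn'; exists e, b.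
(* By maximality, P + (a) contains a power of [var j] for every a outside P; the product of two such
   powers shows that P is prime. *)
have primeP : prime_ideal P.
  split=> //; first by have := PN 0%N; rewrite expr0.
  move=> a b Pab; apply: contrapT => /not_orP[/step[e [c hc]] /step[e' [c' hc']]].
  apply: (PN (e + e')%N); rewrite exprD.
  have -> : var j ^+ e * var j ^+ e' = var j ^+ e' * (var j ^+ e - c * a) +
     ((c * a) * (var j ^+ e' - c' * b) + (c * c') * (a * b)) by ring.
  by apply: (PD); [apply: (PM)|apply: (PD); apply: (PM)].
have nx : ~ P (var j) by have := PN 1%N; rewrite expr1.
(* Over the field K, extending the identity means finding a zero of P at which [var j] does not
   vanish. *)
have [u [nu hu]] := @prime_mpoly_extension K K N.+1 P (var j) primeP nx.
have [b Pb||c [c1 c2]] := hu (idfun : {rmorphism K -> K}).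
- apply/eqP; apply: contraT => b0; exfalso; apply: (PN 0%N).
  have -> : var j ^+ 0 = mpolyC N.+1 b^-1 * mpolyC N.+1 b; last exact: PM.
  by rewrite -mpolyCM mulVf.
- by apply/eqP => /= u0; apply: nu; rewrite u0 mpolyC0.
have := hJ (\row_i c i); have e p : pval p (\row_i c i) = mmap idfun c p.
  by rewrite /pval; apply: meval_eq => i; rewrite mxE.
rewrite mxE => h; move: c2; rewrite mmapX mmap1U h ?eqxx //.
by move=> p /JP /c1; rewrite e.
Qed.

(** The polynomials p for which p s is given by a polynomial form an ideal. It has no zero with x_j
    <> 0: outside X because it contains the ideal of X, on X because s is locally a fraction. The
    Nullstellensatz then provides a power of x_j. *)
Lemma H0_coord_torsion k (s : sec) (j : 'I_N.+1) : H0 X k s ->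
  exists e, A (k + e)%N (co j ^+ e * s).
Proof.
move=> hs.
pose J : set form := [set p | exists q, forall y, pval p (sval y) * s y = pval q (sval y)].
have [a b [p hp] [q hq]|a b [p hp]||x hx|e [q hq]] := @nullstellensatz_chart J j.
- by exists (p + q) => y; rewrite !pvalD mulrDl hp hq.
- by exists (a * p) => y; rewrite !pvalM -mulrA hp.
- by exists 0 => y; rewrite !pval0 mul0r.
- apply/eqP; apply: contraT => xj.
  have x0 : x != 0 by apply: contra_neq xj => ->; rewrite mxE.
  have Xx : X x.
    apply: variety_zeros => // p hp; apply: hx; exists 0 => y.
    by rewrite hp ?mul0r ?pval0 //; apply: (proj2_sig y).
  have [d [a [b [ha hb bx sE]]]] := hs x Xx.
  (* The square matters: b s = a may fail where b vanishes, whereas b^2 s = b a holds on all of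
     X. *)
  have : pval (b * b) x = 0.
    apply: hx; exists (b * a) => y; rewrite !pvalM.
    have [->|by0] := eqVneq (pval b (sval y)) 0; first by rewrite !mul0r.
    by rewrite sE //; field.
  by move/eqP; rewrite pvalM mulf_eq0 orbb (negbTE bx).
(* The polynomial q need not be homogeneous. As x_j^e s scales with degree k + e, the component of q
   of that degree represents it too. *)
exists e; apply/A_form; exists (hcomp (k + e) q); split; first exact: homogeneous_hcomp.
move=> y; symmetry; apply: pval_hcomp_scale => a a0.
pose y' : {x | X x} := exist _ (a *: sval y) (variety_scale (proj2_sig y) a0).
transitivity (pval (var j ^+ e) (sval y') * s y'); first by rewrite hq.
rewrite pvalXn pval_var (H0_scale (y := y) hs a0 (erefl (sval y'))) /= mxE.
change ((a * sval y ord0 j) ^+ e * (a ^+ k * s y) = a ^+ (k + e) * ((co j ^+ e) y * s y)).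
by rewrite fn_expE /hcoord inord_val exprMn exprD; ring.
Qed.

Lemma coord_nonzero : exists j : 'I_N.+1, co j != 0.
Proof.
case: varX => _ [x Xx] _; have x0 := variety_neq0 Xx.
have /rV0Pn[j xj] := x0; exists j; apply/eqP => /(congr1 (fun f : sec => f (exist _ x Xx))).
by rewrite /hcoord /= inord_val => /eqP; rewrite (negbTE xj).
Qed.

Lemma A_mull j k g : (j < N.+1)%N -> A k g -> A k.+1 (co j * g).
Proof.
move=> jN hg; have := (addmon_mull (bideal0 co N.+1 (fun=> 0))).2 j k 0 g jN hg.
by rewrite addr0.
Qed.

Lemma A_mull_exp j k g e : (j < N.+1)%N -> A k g -> A (k + e)%N (co j ^+ e * g).
Proof.
move=> jN hg; elim: e => [|e IH]; first by rewrite addn0 expr0 mul1r.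
by rewrite addnS exprS -mulrA; apply: A_mull.
Qed.

(** Some x_j^e s is a form, and the exponent is lowered one step at a time: powers of all
    coordinates send x_j^(e+1) s into the ideal x_j A, which is saturated in large degree; so
    x_j^(e+1) s lies in it, and x_j can be cancelled. *)
Lemma H0_A : exists k0, forall k, (k0 <= k)%N -> H0 X k `<=` A k.
Proof.
have [j xj] := coord_nonzero.
have H0co : H0 X 1 (co j) by apply: A_H0; apply: co_A.
(* The principal ideal generated by x_j in the ring of forms on X; the condition at k = 0
   compensates for [k.-1] being 0 there. *)
pose I (k : nat) (i : int) : set sec :=
  [set g | exists2 h, A k.-1 h & (if k == 0%N then h = 0 else True) /\ g = co j * h].
have hI : bideal co N.+1 (fun=> 0) I.
  split=> [k i|j' k i _ j'N [h hA [h0 ->]]].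
    split; first by exists 0; [exact: (subsp0 (subsp_A _))|case: (k == 0%N); rewrite mulr0].
    move=> a u v [h hA [h0 ->]] [h' hA' [h0' ->]]; exists (a *: h + h').
      exact: (subsp_A _).2.
    split; last by rewrite mulrDr -fn_scalerAr.
    by move: h0 h0'; case: (k == 0%N) => // -> ->; rewrite scaler0 addr0.
  exists (co j' * h); last by split => //; rewrite mulrCA.
  rewrite /=; case: k hA h0 => [|k] hA h0; last exact: A_mull.
  by rewrite h0 mulr0; apply: (subsp0 (subsp_A _)).
have [k0 hk0] := bideal_saturated hI.
exists k0 => k lek s hs.
have [e he] := H0_coord_torsion j hs.
elim: e he => [|e IH] he; first by move: he; rewrite addn0 expr0 mul1r.
apply: IH.
have : I (k + e.+1)%N 0 (co j ^+ e.+1 * s).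
  apply: hk0; first by rewrite (leq_trans lek) ?leq_addr.
    by apply: addmon_mono he => g ->; apply: (subsp0 (hI.1 _ _)).
  move=> j' j'N; have [e' he'] := H0_coord_torsion (Ordinal j'N) hs; exists e'.
  exists (co j ^+ e * (co j' ^+ e' * s)).
    have -> : ((k + e.+1 + e').-1 = k + e' + e)%N by lia.
    exact: A_mull_exp.
  split; first by have /negbTE -> : (k + e.+1 + e')%N != 0%N by lia.
  by rewrite exprS; ring.
rewrite addnS => -[h hA [_ eq]].
have : co j * (h - co j ^+ e * s) = 0 by rewrite mulrBr -eq exprS; ring.
have hH : H0 X (k + e)%N (h - co j ^+ e * s).
  apply: (subspB (subsp_H0 _)); first exact: A_H0.
  by rewrite addnC; apply: H0_mul => //; rewrite -{1}[e]muln1; apply: H0_exp.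
move=> /(H0_domain H0co hH)[/eqP|/eqP]; first by rewrite (negbTE xj).
by rewrite subr_eq0 => /eqP <-.
Qed.

Lemma fg_A k : fg [set 0] (A k).
Proof. exact: fg_fin. Qed.

Lemma H0_exp_neq0 k (u : sec) n : H0 X k u -> u != 0 -> u ^+ n != 0.
Proof.
move=> hu u0; elim: n => [|n IH].
  case: varX => _ [x Xx] _; apply/eqP => /(congr1 (fun f : sec => f (exist _ x Xx))).
  by move/eqP; rewrite expr0; change ((1 : K) == 0 -> False); rewrite oner_eq0.
apply/eqP; rewrite exprS => /(H0_domain hu (H0_exp n hu))[/eqP|/eqP]; exact/negP.
Qed.

Lemma fg_H0_le k l : exists2 k0, (l <= k0)%N &
  fg [set 0] (H0 X k) /\ (vdim (H0 X k) <= vdim (A (k0 + k)))%N.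
Proof.
have [k0 hk0] := H0_A; have [j xj] := coord_nonzero.
have H0co : H0 X 1 (co j) by apply: A_H0; apply: co_A.
have H0coX := H0_exp (k0 + l) H0co; rewrite muln1 in H0coX.
exists (k0 + l)%N; first by rewrite leq_addl.
apply: (fg_inj (f := fun v => co j ^+ (k0 + l) * v)).
- exact: subsp_H0.
- exact: subsp_A.
- by move=> a u v; rewrite mulrDr -fn_scalerAr.
- by move=> v hv; apply: hk0; [rewrite -addnA leq_addr|apply: H0_mul].
- move=> v hv /(H0_domain H0coX hv)[/eqP|//].
  by rewrite (negbTE (H0_exp_neq0 _ H0co xj)).
- exact: fg_A.
Qed.

Lemma fg_H0 k : fg [set 0] (H0 X k).
Proof. by have [k0 _ []] := fg_H0_le k 0. Qed.

Lemma vdim_H0_A : exists k0, forall k, (k0 <= k)%N -> vdim (H0 X k) = vdim (A k).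
Proof.
have [k0 hk0] := H0_A; exists k0 => k lek; congr vdim; apply/seteqP; split.
  exact: hk0.
exact: A_H0.
Qed.

End Variety.

Lemma leq_exp2r_le m n e : (m <= n -> m ^ e <= n ^ e)%N.
Proof. by move=> h; case: e => [|e]; rewrite ?expn0 // leq_exp2r. Qed.

(** * Polynomial growth of downsets *)

Section SparseMonomials.
Local Open Scope nat_scope.
Variable E : nat.

Definition nsparse d s k := count (fun u => count (leq E) u <= s) (monos d k).

Lemma count_monosS (D : pred (seq nat)) d k :
  count D (monos d.+1 k) = \sum_(j < k.+1) count (fun u => D (nat_of_ord j :: u)) (monos d (k - j)).
Proof.
have e : iota 0 k.+1 = index_iota 0 k.+1 by rewrite /index_iota subn0.
rewrite monosSE count_flatten -map_comp sumnE big_map e big_mkord.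
by apply: eq_bigr => j _ /=; rewrite count_map; apply: eq_count.
Qed.

Lemma nsparseS d s k : nsparse d.+1 s k <=
  \sum_(j < E | j <= k) nsparse d s (k - j) +
  (if s is s'.+1 then \sum_(j < k.+1) nsparse d s' (k - j) else 0).
Proof.
rewrite /nsparse count_monosS.
have h (j : nat) : count (fun u => count (leq E) (j :: u) <= s) (monos d (k - j)) <=
   (if j < E then nsparse d s (k - j) else 0) +
   (if s is s'.+1 then nsparse d s' (k - j) else 0).
  case: ltnP => jE.
    apply: leq_trans (leq_addr _ _); apply: sub_count => u /=.
    by have -> : (E <= j) = false by rewrite leqNgt jE.
  case: s => [|s]; last by rewrite add0n; apply: sub_count => u /=; rewrite jE.
  by rewrite -[X in _ <= X](count_pred0 (monos d (k - j))); apply: sub_count => u /=; rewrite jE.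
apply: (@leq_trans (\sum_(j < k.+1) ((if j < E then nsparse d s (k - j) else 0) +
   (if s is s'.+1 then nsparse d s' (k - j) else 0)))).
  by apply: leq_sum => j _; apply: h.
rewrite -!/(nsparse _ _ _).
rewrite big_split /=; apply: leq_add; last by case: s {h} => [|s] //; rewrite sum_nat_const muln0.
rewrite -big_mkcond /= -(big_mkord (fun j => j < E) (fun j => nsparse d s (k - j))).
rewrite -(big_mkord (fun j => j <= k) (fun j => nsparse d s (k - j))).
rewrite big_nat_cond [X in _ <= X]big_nat_cond.
rewrite -big_filter -[X in _ <= X]big_filter; apply/eq_leq/perm_big.
apply: uniq_perm; rewrite ?filter_uniq ?iota_uniq // => j.
by rewrite !mem_filter !mem_index_iota /= ltnS; lia.
Qed.

(** With the degree bounded instead of fixed, s large exponents leave s degrees of freedom. *)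
Lemma nsparse_sum_le d s : exists C, forall k, \sum_(i < k.+1) nsparse d s i <= C * k.+1 ^ s.
Proof.
elim: d s => [|d IH] s.
  exists 1 => k; rewrite big_ord_recl mul1n [X in _ + X]big1 => [|i _] //.
  by rewrite addn0 /nsparse /= addn0 expn_gt0.
have [C hC] := IH s.
have [C' hC'] : exists C', forall k,
    (if s is s'.+1 then \sum_(i < k.+1) nsparse d s' i else 0) <= C' * k.+1 ^ s.-1.
  by case: s {C hC} => [|s]; [exists 0|apply: IH].
have le k i : i <= k -> \sum_(l < i.+1) nsparse d s l <= C * k.+1 ^ s.
  move=> ik; apply: (leq_trans (hC i)); rewrite leq_mul2l; apply/orP; right.
  by apply: leq_exp2r_le; rewrite ltnS.
exists (E * C + C') => k.
apply: (@leq_trans (\sum_(i < k.+1) (\sum_(j < E | j <= i) nsparse d s (i - j) +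
   (if s is s'.+1 then \sum_(j < i.+1) nsparse d s' (i - j) else 0)))).
  by apply: leq_sum => i _; apply: nsparseS.
rewrite big_split mulnDl /=; apply: leq_add.
  apply: (@leq_trans (\sum_(j < E) \sum_(i < k.+1 | j <= i) nsparse d s (i - j))).
    under eq_bigr do rewrite big_mkcond.
    rewrite exchange_big /=; apply/eq_leq/eq_bigr => j _.
    by rewrite -big_mkcond.
  have -> : E * C * k.+1 ^ s = \sum_(j < E) (C * k.+1 ^ s) by rewrite sum_nat_const card_ord mulnA.
  apply: leq_sum => j _.
  have [kj|jk] := ltnP k j.
    rewrite big1 // => i ji; have := ltn_ord i; lia.
  apply: leq_trans (le k (k - j) (leq_subr _ _)).
  rewrite -(big_mkord (fun i => j <= i) (fun i => nsparse d s (i - j))).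
  rewrite (big_cat_nat (leq0n j)) /=; last by lia.
  rewrite big_nat_cond big1 ?add0n; last by move=> i; lia.
  rewrite big_nat_cond (eq_bigl (fun i => j <= i < k.+1)); last by move=> i; lia.
  rewrite -big_nat -{1}[nat_of_ord j]add0n big_addn subSn // big_mkord.
  by apply: leq_sum => i _; rewrite addnK.
case: s hC' {C hC le} => [|s] hC'; first by rewrite big1.
have -> : C' * k.+1 ^ s.+1 = \sum_(i < k.+1) (C' * k.+1 ^ s).
  by rewrite sum_nat_const card_ord expnS mulnCA.
apply: leq_sum => i _.
have := hC' i; rewrite (reindex_inj rev_ord_inj) /=.
have -> : \sum_(j < i.+1) nsparse d s (i.+1 - j.+1) = \sum_(j < i.+1) nsparse d s (i - j).
  by apply: eq_bigr => j _; rewrite subSS.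
move=> /leq_trans; apply; rewrite leq_mul2l; apply/orP; right.
by apply: leq_exp2r_le; rewrite ltnS -ltnS.
Qed.

(** With s + 1 large exponents and the degree fixed, s degrees of freedom remain. *)
Lemma nsparse_le d s : exists C, forall k, nsparse d s.+1 k <= C * k.+1 ^ s.
Proof.
elim: d => [|d [C hC]].
  exists 1 => k; rewrite mul1n (@leq_trans 1) ?expn_gt0 //.
  by rewrite /nsparse /=; case: (k == 0).
have [C' hC'] := nsparse_sum_le d s.
exists (E * C + C') => k; apply: (leq_trans (nsparseS _ _ _)).
rewrite mulnDl; apply: leq_add.
  have -> : E * C * k.+1 ^ s = \sum_(j < E) (C * k.+1 ^ s) by rewrite sum_nat_const card_ord mulnA.
  rewrite big_mkcond; apply: leq_sum => j _.
  case: ifP => // jk; apply: (leq_trans (hC _)); rewrite leq_mul2l; apply/orP; right.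
  by apply: leq_exp2r_le; rewrite ltnS leq_subr.
have := hC' k; rewrite (reindex_inj rev_ord_inj) /=; apply: leq_trans.
by apply/eq_leq/eq_bigr => j _; rewrite subSS.
Qed.

End SparseMonomials.

Lemma downset_le d (D : set (seq nat)) (u v : seq nat) : downset d D ->
  size u = d -> size v = d -> (forall j, (nth 0 u j <= nth 0 v j)%N) -> D v -> D u.
Proof.
elim: d D u v => [|d IH] D u v hD; first by move=> /size0nil -> /size0nil ->.
case: u => // a u; case: v => // b v [su] [sv] h Dv.
apply: (downset_slice_mono hD su (h 0%N)) => /=.
apply: (IH [set u | D (b :: u)] u v) => //; first exact: downset_slice hD.
by move=> j; apply: (h j.+1).
Qed.

(** If more than n + 1 exponents of u are at least E, and T is the set of their positions, then the
    monomial [f T], which is outside [D], divides u. Hence all monomials of [D] are sparse. For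
    this, E has to bound the exponents of all the [f T]. *)
Lemma downset_growth d n (D : pred (seq nat)) : downset d [set` D] ->
  (forall T : {set 'I_d}, (n.+1 < #|T|)%N -> exists u, [/\ size u = d,
     forall j : 'I_d, j \notin T -> nth 0%N u j = 0%N & ~~ D u]) ->
  exists C, forall k, (count D (monos d k) <= C * k.+1 ^ n)%N.
Proof.
move=> hD hT.
have /choice[f hf] : forall T : {set 'I_d}, exists u, (n.+1 < #|T|)%N ->
  [/\ size u = d, forall j : 'I_d, j \notin T -> nth 0%N u j = 0%N & ~~ D u].
  move=> T; have [/hT[u hu]|_] := boolP (n.+1 < #|T|)%N; first by exists u.
  by exists [::].
pose E := (\sum_(T : {set 'I_d}) sumn (f T))%N.
have fE T j : (nth 0 (f T) j <= E)%N.
  rewrite /E (bigD1 T) //=; apply: leq_trans (leq_addr _ _).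
  have [jl|jl] := ltnP j (size (f T)); last by rewrite nth_default.
  by rewrite (sumn_nth (erefl (size (f T)))) (bigD1 (Ordinal jl)) //= leq_addr.
have [C hC] := nsparse_le E d n.
exists C => k; apply: leq_trans (hC k); rewrite /nsparse.
rewrite -!size_filter; apply: uniq_leq_size; first by rewrite filter_uniq ?monos_uniq.
move=> u; rewrite !mem_filter => /andP[Du um]; rewrite um andbT leqNgt; apply/negP => h.
have su : size u = d by move: um; rewrite mem_monos => /andP[/eqP].
pose T := finset (fun j : 'I_d => (E <= nth 0 u j)%N).
have cT : count (leq E) u = #|T|.
  rewrite -sum1_count -sum1_card (big_nth 0%N) su big_mkord.
  by apply: eq_bigl => j; rewrite inE.
have [|s1 s2] := hf T; first by rewrite -cT.
move/negP; apply; apply: (downset_le hD s1 su _ Du) => j.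
have [jd|jd] := ltnP j d; last by rewrite nth_default ?s1.
have [|jT] := boolP (Ordinal jd \in T); last by rewrite (s2 _ jT).
by rewrite inE /=; apply: leq_trans.
Qed.

(** * From independent coordinates to chains of subvarieties *)

Section Independence.
Variables (K : closedFieldType) (N : nat).
Local Notation point := 'rV[K]_N.+1.
Local Notation form := (mpoly N.+1 K).
Local Notation var i := (mpolyX K (mnm1 i)).
Implicit Types (p q : form) (x : point) (Z W : set point).

Lemma mpoly_nonroot n (q : mpoly n K) : q != 0 -> exists y, meval y q != 0.
Proof.
move=> q0.
have h : prime_ideal [set 0 : mpoly n K].
  split=> //= [a b -> ->|a b ->|/eqP|a b /eqP]; rewrite ?addr0 ?mulr0 ?oner_eq0 //.
  by rewrite mulf_eq0 => /orP[/eqP|/eqP]; [left|right].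
have [|u [u0 hu]] := @prime_mpoly_extension K K n _ q h; first exact/eqP.
have [b /= /eqP|/=|c [_ c2]] := hu (idfun : {rmorphism K -> K}).
- by rewrite mpolyC_eq0 => /eqP.
- by apply/eqP => u00; apply: u0; rewrite u00 /= mpolyC0.
- by exists c.
Qed.

Definition vanishing Z : set form := [set p | forall z, Z z -> pval p z = 0].

(** For forms this is irreducibility. In general, choose components of p and of q that are nonzero
    at one point x of Z: the restrictions of p and q to the line through x are then nonzero
    polynomials with product zero. *)
Lemma vanishing_prime Z : irreducible_closed Z -> prime_ideal (vanishing Z).
Proof.
move=> varZ; split=> [z _|p q hp hq z Zz|p q hq z Zz||p q hpq].
- exact: pval0.
- by rewrite pvalD hp // hq // addr0.
- by rewrite pvalM hq // mulr0.
- case: varZ => _ [z Zz] _ /(_ z Zz)/eqP; rewrite pval1 oner_eq0 //.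
have comp p' : ~ vanishing Z p' -> exists d x, Z x /\ pval (hcomp d p') x != 0.
  move=> /existsNP[x /not_implyP[Zx /eqP px]]; apply: contrapT => hn.
  move/eqP: px; apply; rewrite pval_sum_hcomp big1 // => d _; apply/eqP.
  by apply: contraT => h; exfalso; apply: hn; exists (nat_of_ord d), x.
apply: contrapT => /not_orP[/comp[d hp] /comp[e hq]].
have [x [Zx px qx]] := forms_common_nonroot varZ (homogeneous_hcomp d p)
  (homogeneous_hcomp e q) hp hq.
have : line_poly p x * line_poly q x = 0.
  apply: poly_vanish => a a0; rewrite hornerM !horner_line -pvalM.
  by apply: hpq; apply: (variety_scale varZ).
move/eqP; rewrite mulf_eq0 => /orP[/eqP|/eqP] e0.
  by move: px; rewrite -coef_line e0 coef0 eqxx.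
by move: qx; rewrite -coef_line e0 coef0 eqxx.
Qed.

(** Algebraic independence of the coordinates [tau] on the affine cone over Z; s + 1 such
    coordinates thus correspond to projective dimension s. *)
Definition indep s (tau : 'I_s -> 'I_N.+1) Z :=
  forall q : mpoly s K, q != 0 -> exists z, Z z /\ meval (fun i => z ord0 (tau i)) q != 0.

(** Projection of the cone to independent coordinates is dominant, so by Chevalley's theorem its
    image contains a principal open set. The condition that some [y i] is nonzero keeps the preimage
    away from the vertex. *)
Lemma indep_dominant Z s (tau : 'I_s.+1 -> 'I_N.+1) : irreducible_closed Z -> indep tau Z ->
  exists2 u : mpoly s.+1 K, u != 0 & forall y, meval y u != 0 -> (exists i, y i != 0) ->
    exists z, Z z /\ forall i, z ord0 (tau i) = y i.
Proof.
move=> varZ ind; pose B := mpoly s.+1 K.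
pose sub : {rmorphism B -> form} := mmap (@mpolyC N.+1 K) (fun i => var (tau i)).
pose Phi : {rmorphism mpoly N.+1 B -> form} := mmap sub (fun i => var i).
(* The ideal of the graph of the projection, over the coordinate ring B of the target. *)
have hP : prime_ideal (Phi @^-1` vanishing Z).
  exact/prime_ideal_preim/vanishing_prime.
have subE b z : pval (sub b) z = meval (fun i => z ord0 (tau i)) b.
  pose f : {rmorphism B -> K} := meval (z ord0) \o sub.
  apply: (@mpoly_rmorph_eq s.+1 K K f (meval (fun i => z ord0 (tau i)))) => [c|i] /=.
    by rewrite /sub /= mmapC !mevalC.
  by rewrite /sub /= mmapX mmap1U !mevalXU.
have PhiC b : Phi (mpolyC N.+1 b) = sub b by rewrite /Phi /= mmapC.
have PhiX i : Phi (mpolyX B (mnm1 i)) = var i by rewrite /Phi /= mmapX mmap1U.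
have [u [nu hu]] := @prime_mpoly_extension K B N.+1 _ 1 hP (prime_ideal1 hP).
exists u.
  apply/eqP => u0; apply: nu; rewrite u0 mpolyC0.
  exact: (prime_ideal0 hP).
move=> y uy [i0 yi0].
have [b hb||c [c1 _]] := hu (meval y : {rmorphism B -> K}).
- apply/eqP; apply: contraT => by0; exfalso.
  have b0 : b != 0 by apply: contra_neq by0 => ->; exact: meval0.
  have [z [Zz /eqP]] := ind _ b0; apply; rewrite -subE -PhiC.
  exact: hb.
- exact: uy.
have ctau i : c (tau i) = y i.
  have := c1 (mpolyX B (mnm1 (tau i)) - mpolyC N.+1 (mpolyX K (mnm1 i))).
  have -> : mmap (meval y) c (mpolyX B (mnm1 (tau i)) -
      mpolyC N.+1 (mpolyX K (mnm1 i))) = c (tau i) - y i.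
    by rewrite rmorphB /= mmapX mmap1U mmapC /= mevalXU.
  move=> h.
  apply/eqP; rewrite -subr_eq0; apply/eqP/h => z Zz.
  by rewrite rmorphB PhiX PhiC pvalB subE pval_var mevalXU subrr.
exists (\row_i c i); split; last by move=> i; rewrite mxE ctau.
apply: (variety_zeros varZ).
  by apply/eqP => /rowP/(_ (tau i0)); rewrite !mxE ctau => /eqP; rewrite (negbTE yi0).
move=> p hp.
pose lift : {rmorphism form -> mpoly N.+1 B} :=
  mmap (@mpolyC N.+1 B \o @mpolyC s.+1 K) (fun i => mpolyX B (mnm1 i)).
have liftC c' : lift (mpolyC N.+1 c') = mpolyC N.+1 (mpolyC s.+1 c') by rewrite /lift /= mmapC.
have liftX i : lift (var i) = mpolyX B (mnm1 i) by rewrite /lift /= mmapX mmap1U.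
have PhiK : Phi (lift p) = p.
  pose f : {rmorphism form -> form} := Phi \o lift.
  apply: (@mpoly_rmorph_eq N.+1 K _ f idfun) => [c'|i] /=.
    by rewrite [X in Phi X]liftC PhiC /sub /= mmapC.
  by rewrite [X in Phi X]liftX PhiX.
have : mmap (meval y) c (lift p) = 0.
  by apply: c1; rewrite /preimage /= PhiK.
have -> : mmap (meval y) c (lift p) = pval p (\row_i c i) => //.
pose f : {rmorphism form -> K} := mmap (meval y) c \o lift.
pose g : {rmorphism form -> K} := meval ((\row_i c i : point) ord0).
apply: (@mpoly_rmorph_eq N.+1 K _ f g) => [c'|i].
  rewrite /f /g /= [X in mmap _ _ X]liftC mmapC mevalC; exact: mevalC.
by rewrite /f /g /= [X in mmap _ _ X]liftX mmapX mmap1U mevalXU mxE.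
Qed.

(** The forms vanishing on [W n] make an increasing chain of ideals in the coordinate ring of Z, to
    which [bideal_acc] applies. *)
Lemma closed_dcc Z (W : nat -> set point) : irreducible_closed Z ->
  (forall n, zclosed (W n)) -> (forall n, W n.+1 `<=` W n) -> W 0%N `<=` Z ->
  exists n, W n `<=` W n.+1.
Proof.
move=> varZ cW WS WZ.
have WnZ n : W n `<=` Z by elim: n => // n IH x /WS /IH.
pose I n (k : nat) (i : int) : set (fn K {x | Z x}) :=
  [set g | forms_bigraded k i g /\ forall y, W n (sval y) -> g y = 0].
have hA := addmon_mull (bideal0 (hcoord (X := Z)) N.+1 (fun=> 0)).
have [|n k i g [hg h]|n k i g [hg _]|n k i g ->|n0 hn0] :=
  @bideal_acc _ _ (hcoord (X := Z)) N.+1 (fun=> 0) I (fun _ _ => [set 0]).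
- move=> n; split=> [k i|j k i g jN [hg h]].
    split; first by split=> //; exact: (subsp0 (hA.1 _ _)).
    move=> a u v [hu u0] [hv v0]; split; first exact: (hA.1 _ _).2.
    by move=> y Wy; change (a * u y + v y = 0); rewrite u0 // v0 // mulr0 addr0.
  split; first exact: hA.2.
  by move=> y Wy; change (hcoord j y * g y = 0); rewrite h // mulr0.
- by split=> // y Wy; apply: h; apply: WS.
- exact: hg.
- by split=> //; exact: (subsp0 (hA.1 _ _)).
exists n0 => x Wx; have Zx := WnZ _ _ Wx.
have [S [hS WE]] := cW n0.+1; apply/WE; split; first exact: (variety_neq0 varZ Zx).
move=> p Sp; have [d hd] := hS p Sp.
pose g : fn K {x | Z x} := fun y => pval p (sval y).
have : I n0.+1 d 0 g.
  split; first by apply/A_form; exists p.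
  by move=> y /WE[_]; apply.
by move=> /hn0[_ /(_ (exist _ x Zx))]; apply.
Qed.

Lemma zclosedI Z W : zclosed Z -> zclosed W -> zclosed (Z `&` W).
Proof.
move=> [S [hS ZE]] [S' [hS' WE]]; exists (S `|` S'); split.
  by move=> p [/hS|/hS'].
move=> x; split=> [[/ZE[x0 h] /WE[_ h']]|[x0 h]].
  by split=> // p [/h|/h'].
by split; [apply/ZE|apply/WE]; split=> // p Sp; apply: h; [left|right].
Qed.

(** A minimal closed subset on which [tau] is independent is irreducible: two proper closed parts
    covering it would each satisfy a nontrivial relation, and the product of these relations would
    hold everywhere. *)
Lemma minimal_indep Z W s (tau : 'I_s -> 'I_N.+1) : irreducible_closed Z ->
  zclosed W -> W `<=` Z -> indep tau W ->
  exists Z', [/\ irreducible_closed Z', Z' `<=` W & indep tau Z'].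
Proof.
move=> varZ cW WZ iW.
pose good W' := [/\ zclosed W', W' `<=` W & indep tau W'].
have [[Z' [gZ' Zmin]]|hn] := pselect (exists Z', good Z' /\
    forall Z'', good Z'' -> Z'' `<=` Z' -> Z' `<=` Z''); last first.
  have /choice[f hf] : forall U : {U | good U}, exists U' : {U | good U},
      sval U' `<=` sval U /\ ~ sval U `<=` sval U'.
    move=> [U gU]; apply: contrapT => /forallNP hU; apply: hn; exists U; split=> //.
    move=> U' gU' U'U; apply: contrapT => nUU'.
    by apply: (hU (exist _ U' gU')).
  pose V n := iter n f (exist _ W (And3 cW (@subset_refl _ W) iW)).
  have [|n|//|n] := @closed_dcc Z (fun n => sval (V n)) varZ.
  - by move=> n; case: (proj2_sig (V n)).
  - by rewrite /=; case: (hf (V n)).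
  by case: (hf (V n)).
case: gZ' => cZ' Z'W iZ'; exists Z'; split=> //; split=> //.
  by have [|z [Zz _]] := iZ' 1; [exact: oner_neq0|exists z].
move=> Y Y' cY cY' hYY'; apply: contrapT => /not_orP[nY nY'].
have bad U : zclosed U -> ~ Z' `<=` U ->
    exists2 q : mpoly s K, q != 0 & forall z, Z' z -> U z -> meval (fun i => z ord0 (tau i)) q = 0.
  move=> cU nU; apply: contrapT => hq; apply: nU.
  have : Z' `<=` Z' `&` U; last by move=> h z /h[].
  apply: Zmin; last by move=> z [].
  split; [exact: zclosedI|by move=> z [/Z'W]|].
  move=> q q0; apply: contrapT => hz; apply: hq; exists q => // z Zz Uz.
  by apply/eqP; apply: contraT => qz; exfalso; apply: hz; exists z.
have [q q0 hq] := bad _ cY nY; have [q' q'0 hq'] := bad _ cY' nY'.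
have [|z [Zz]] := iZ' (q * q'); first exact: mulf_neq0.
rewrite mevalM mulf_eq0 negb_or => /andP[/eqP qz /eqP q'z].
by case: (hYY' z Zz) => ?; [apply/qz/hq|apply/q'z/hq'].
Qed.

(** Z is cut by a hyperplane x_(tau 0) = c x_(tau 1) that meets the open set of [indep_dominant].
    The other coordinates still take general values on the section, and [minimal_indep] extracts an
    irreducible subset of it. *)
Lemma indep_hyperplane Z s (tau : 'I_s.+2 -> 'I_N.+1) : irreducible_closed Z ->
  indep tau Z -> exists Z', [/\ irreducible_closed Z', Z' `<` Z &
    indep (fun i => tau (lift ord0 i)) Z'].
Proof.
move=> varZ ind; have [u u0 hu] := indep_dominant varZ ind.
pose X0 : 'I_s.+2 := ord0; pose X1 : 'I_s.+2 := lift ord0 ord0.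
have [|y0] := @mpoly_nonroot s.+2 (u * var X1).
  by rewrite mulf_neq0 // -msupp_eq0 msuppX.
rewrite mevalM mulf_eq0 negb_or mevalXU => /andP[uy0 y01].
(* The hyperplane passes through y0, where u does not vanish, so that u stays nonzero after the
   substitution [sg]. *)
pose c := y0 X0 / y0 X1.
pose ex (y : 'I_s.+1 -> K) (i : 'I_s.+2) := oapp y (c * y ord0) (unlift ord0 i).
have ex0 y : ex y X0 = c * ex y X1 by rewrite /ex unlift_none liftK.
have exl y i : ex y (lift ord0 i) = y i by rewrite /ex liftK.
pose sg : {rmorphism mpoly s.+2 K -> mpoly s.+1 K} := mmap (@mpolyC s.+1 K)
  (fun i => oapp (fun j => mpolyX K (mnm1 j)) (c *: mpolyX K (mnm1 ord0)) (unlift ord0 i)).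
have sgE y (q : mpoly s.+2 K) : meval y (sg q) = meval (ex y) q.
  pose f : {rmorphism mpoly s.+2 K -> K} := meval y \o sg.
  apply: (@mpoly_rmorph_eq s.+2 K K f (meval (ex y))) => [c'|i] /=.
    by rewrite /sg /= mmapC !mevalC.
  rewrite /sg /= mmapX mmap1U mevalXU /ex; case: unliftP => [j|] _ /=.
    by rewrite mevalXU.
  by rewrite mevalZ mevalXU.
pose h : form := var (tau X0) - c *: var (tau X1).
have hh : homogeneous 1 h.
  by apply: homogeneousB; [|apply: homogeneousZ]; apply: homogeneous_var.
pose W := Z `&` [set x | x != 0 /\ pval h x = 0].
have cW : zclosed W by apply: zclosedI; [case: varZ|exact: zclosed_form hh].
have [] := @minimal_indep Z W _ (fun i => tau (lift ord0 i)) varZ cW.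
- by move=> x [].
- move=> q q0.
  have v0 : sg u != 0.
    apply/eqP => e; move/eqP: uy0; apply.
    have <- : meval (fun i => y0 (lift ord0 i)) (sg u) = meval y0 u.
      rewrite sgE; apply: meval_eq => i; rewrite /ex; case: unliftP => [j ->//|->] /=.
      by rewrite /c divfK.
    by rewrite e meval0.
  have [|y] := @mpoly_nonroot s.+1 (sg u * q * mpolyX K (mnm1 ord0)).
    by rewrite !mulf_neq0 // -msupp_eq0 msuppX.
  rewrite !mevalM !mulf_eq0 !negb_or mevalXU sgE => /andP[/andP[uy qy] y00].
  have [|z [Zz zE]] := hu (ex y) uy; first by exists X1; rewrite /X1 exl.
  have z1 : z ord0 (tau X1) = y ord0 by rewrite zE /X1 exl.
  exists z; split; last first.
    by rewrite (@meval_eq _ _ _ y) // => i; rewrite zE exl.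
  split=> //; split.
    by apply: contra_neq y00 => z0; rewrite -z1 z0 mxE.
  by rewrite pvalB pvalZ !pval_var !zE ex0 subrr.
move=> Z' [varZ' Z'W iZ']; exists Z'; split=> //; split; first by move=> x /Z'W[].
move=> ZZ'.
have [|z [Zz]] := ind (var X0 - c *: var X1).
  apply/eqP => /(congr1 (mcoeff (mnm1 X0))); rewrite mcoeff0 mcoeffB mcoeffZ !mcoeffX.
  rewrite eqxx (_ : (mnm1 X1 == mnm1 X0) = false) ?mulr0 ?subr0; last first.
    by apply/negbTE/eqP => /mnmP/(_ X1); rewrite !mnm1E.
  by move/eqP; rewrite oner_eq0.
have [_ [_]] := Z'W _ (ZZ' _ Zz).
by rewrite pvalB pvalZ !pval_var mevalB mevalZ !mevalXU => ->; rewrite eqxx.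
Qed.

Lemma indep_chain Z s (tau : 'I_s.+1 -> 'I_N.+1) : irreducible_closed Z ->
  indep tau Z -> chain_in Z s.
Proof.
elim: s Z tau => [|s IH] Z tau varZ ind.
  by exists (fun=> Z); split=> [i _|//]; split.
have [Z' [varZ' Z'Z iZ']] := indep_hyperplane varZ ind.
have [C [C1 C2]] := IH _ _ varZ' iZ'.
exists (fun i => if (i <= s)%N then C i else Z); split=> i.
  move=> _; case: leqP => [le|_]; last by split.
  have [h1 h2] := C1 i le; split=> //.
  by apply: (subset_trans h2); case: Z'Z.
rewrite ltnS => le; rewrite le; case: ltnP => // le'; first exact: C2.
have [_ h2] := C1 i le; split; first by apply: (subset_trans h2); case: Z'Z.
by move=> h; case: Z'Z => _; apply; apply: subset_trans h2.
Qed.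

Lemma vdim_A (X : set point) k : vdim (@forms_on K N X k) =
  count (std (hcoord (X := X)) N.+1 (fun=> 0) (fun _ _ => [set 0])) (monos N.+1 k).
Proof.
rewrite /vdim /forms_on /forms_bigraded.
rewrite (qdim_stdw k 0 (bideal0 (hcoord (X := X)) N.+1 (fun=> 0))).
rewrite size_filter; apply: eq_count => u.
by rewrite mwt0 eqxx andbT.
Qed.

(** If all monomials in some n + 2 coordinates were standard, these coordinates would be
    algebraically independent on X, and [indep_chain] would give a chain of length n + 1. Hence
    [downset_growth] applies to the standard monomials. *)
Lemma vdim_A_growth (X : set point) n : irreducible_closed X -> ~ chain_in X n.+1 ->
  exists C, forall k, (vdim (@forms_on K N X k) <= C * k.+1 ^ n)%N.
Proof.
move=> varX nch.
pose D := std (hcoord (X := X)) N.+1 (fun=> 0) (fun _ _ => [set 0]).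
have hb := bideal0 (hcoord (X := X)) N.+1 (fun=> 0).
have [||C hC] := @downset_growth N.+1 n D; first exact: std_down.
  move=> T cT; apply: contrapT => hT.
  have stdT u : size u = N.+1 -> (forall j : 'I_N.+1, j \notin T -> nth 0%N u j = 0%N) -> D u.
    by move=> su hu; apply: contraT => nD; exfalso; apply: hT; exists u.
  pose tau (i : 'I_n.+2) : 'I_N.+1 := enum_val (widen_ord cT i).
  have tau_inj : injective tau by move=> i j /enum_val_inj /(congr1 val) /= /val_inj.
  have tauT i : tau i \in T by apply: enum_valP.
  apply: nch; apply: (@indep_chain X n.+1 tau varX) => q q0.
  apply: contrapT => hz.
  have van z : X z -> meval (fun i => z ord0 (tau i)) q = 0.
    by move=> Xz; apply/eqP; apply: contraT => h; exfalso; apply: hz; exists z.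
  pose rest (z : point) : 'rV[K]_n.+2 := \row_i z ord0 (tau i).
  have vanh d z : X z -> pval (hcomp d q) (rest z) = 0.
    move=> Xz; apply: pval_hcomp_vanish => a a0.
    rewrite -(van _ (variety_scale varX Xz a0)); apply: meval_eq => i.
    by rewrite !mxE.
  have [m mq] : exists m, m \in msupp q.
    by have := mlead_supp q0; exists (mlead q).
  pose d := mdeg m.
  (* Exponents in the n + 2 chosen variables are spread over all N + 1 variables. The component of
     degree d of a relation q then becomes a linear relation between standard monomials. *)
  pose U (m' : multinom n.+2) : seq nat :=
    [seq (if [pick i | tau i == j] is Some i then m' i else 0%N) | j <- enum 'I_N.+1].
  have sU m' : size (U m') = N.+1 by rewrite size_map size_enum_ord.
  have Uj m' (j : 'I_N.+1) : nth 0%N (U m') j =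
      if [pick i | tau i == j] is Some i then m' i else 0%N.
    by rewrite (nth_map j) ?size_enum_ord // nth_ord_enum.
  have Utau m' i : nth 0%N (U m') (tau i) = m' i.
    by rewrite Uj; case: pickP => [i' /eqP/tau_inj ->//|/(_ i)]; rewrite eqxx.
  have Uinj : injective U.
    by move=> m1 m2 e; apply/mnmP => i; rewrite -!Utau e.
  have UT m' (j : 'I_N.+1) : j \notin T -> nth 0%N (U m') j = 0%N.
    by move=> jT; rewrite Uj; case: pickP => // i /eqP e; rewrite -e tauT in jT.
  have prodU (R : comPzSemiRingType) m' (f : 'I_N.+1 -> nat -> R) : (forall j, f j 0%N = 1) ->
      \prod_j f j (nth 0%N (U m') j) = \prod_i f (tau i) (m' i).
    move=> f0; rewrite (bigID (fun j => j \in codom tau)) /= [X in _ * X]big1 ?mulr1; last first.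
      move=> j jc; rewrite Uj; case: pickP => // i /eqP e.
      by rewrite -e codom_f in jc.
    rewrite -big_filter (perm_big (codom tau)) /=; last first.
      apply: uniq_perm; rewrite ?filter_uniq ?index_enum_uniq //.
        by rewrite map_inj_uniq ?enum_uniq.
      by move=> j; rewrite mem_filter mem_index_enum andbT.
    by rewrite /codom big_map big_enum /=; apply: eq_bigr => i _; rewrite Utau.
  have sumU m' : sumn (U m') = mdeg m'.
    rewrite (sumn_nth (sU m')) mdegE.
    transitivity (\sum_(j < N.+1) nth 0%N (U m') j)%N; first by [].
    rewrite (bigID (fun j => j \in codom tau)) /= [X in (_ + X)%N]big1 ?addn0; last first.
      move=> j jc; rewrite Uj; case: pickP => // i /eqP e.
      by rewrite -e codom_f in jc.
    rewrite -big_filter (perm_big (codom tau)) /=; last first.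
      apply: uniq_perm; rewrite ?filter_uniq ?index_enum_uniq //.
        by rewrite map_inj_uniq ?enum_uniq.
      by move=> j; rewrite mem_filter mem_index_enum andbT.
    by rewrite /codom big_map big_enum /=; apply: eq_bigr => i _; rewrite Utau.
  pose M (u : seq nat) : multinom n.+2 := Multinom [tuple nth 0%N u (tau i) | i < n.+2].
  have MU m' : M (U m') = m'.
    by apply/mnmP => i; rewrite /M multinomE tnth_mktuple Utau.
  pose L := [seq U m' | m' <- msupp q & mdeg m' == d].
  have LU : {subset L <= stdw (hcoord (X := X)) N.+1 (fun=> 0) (fun _ _ => [set 0]) d 0}.
    move=> u /mapP[m' + ->]; rewrite mem_filter => /andP[/eqP md _].
    rewrite mem_stdw mwt0 eqxx mem_monos sU sumU md !eqxx.
    by have := stdT _ (sU m') (UT m'); rewrite /D => ->.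
  have uL : uniq L by rewrite map_inj_uniq ?filter_uniq.
  have := free_stdw (k := d) (i := 0) hb
     (c := fun u => if u \in L then mcoeff (M u) q else 0).
  move=> /(_ _ (U m)) h.
  have UmL : U m \in L by apply: map_f; rewrite mem_filter mq /d eqxx.
  have := h _ (LU _ UmL); rewrite UmL MU => h'.
  move: mq; rewrite mcoeff_msupp => /eqP; apply; apply: h'.
  rewrite (bigID (fun u => u \in L)) /= [X in _ + X]big1 ?addr0; last first.
    by move=> u /negbTE ->; rewrite scale0r.
  rewrite -big_filter (perm_big L) /=; last first.
    apply: uniq_perm; rewrite ?filter_uniq ?monos_uniq // => u.
    by rewrite mem_filter; case: (boolP (u \in L)) => // /LU ->.
  rewrite big_seq (eq_bigr (fun u => mcoeff (M u) q *: mon (hcoord (X := X)) N.+1 u)); last first.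
    by move=> u ->.
  rewrite -big_seq /L big_map.
  apply/funext => y; rewrite fn_sumE -[RHS](vanh d _ (proj2_sig y)).
  rewrite /hcomp pval_sum big_filter; apply: eq_bigr => m' _.
  change (mcoeff (M (U m')) q * mon (hcoord (X := X)) N.+1 (U m') y =
    pval (mcoeff m' q *: mpolyX K m') (rest (sval y))).
  rewrite MU pvalZ mon_coE /pval mevalX; congr (_ * _).
  rewrite (prodU K m' (fun j e => sval y ord0 j ^+ e)) //.
  by apply: eq_bigr => i _; rewrite mxE.
by exists C => k; rewrite vdim_A.
Qed.

Lemma vdim_H0_growth (X : set point) n : irreducible_closed X -> ~ chain_in X n.+1 ->
  exists C k0, forall k, (k0 <= k)%N -> (vdim (H0 X k) <= C * k.+1 ^ n)%N.
Proof.
move=> varX /(vdim_A_growth varX)[C hC]; have [k0 hk0] := vdim_H0_A varX.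
by exists C, k0 => k /hk0 ->.
Qed.

End Independence.

(** * Powers of filtrations and weighted flags *)

Section Powers.
Variables (K : closedFieldType) (T : Type).
Implicit Types (W : rat -> set (fn K T)) (V : set (fn K T)) (u v : fn K T).

(** The filtration used in [veronese_map], freed from flags: the image of the one induced on the
    k-th symmetric power. *)
Definition pow (k : nat) W (w : rat) : set (fn K T) :=
  span [set s | exists (u : 'I_k -> fn K T) (a : 'I_k -> rat),
      [/\ forall j, W (a j) (u j), \sum_j a j <= w & s = \prod_j u j]].

Lemma subsp_pow k W w : is_subspace (pow k W w).
Proof. exact: subsp_span. Qed.

Lemma pow_ext k W W' w : (forall w, W w = W' w) -> pow k W w = pow k W' w.
Proof. by move=> e; congr (pow k _ w); apply/funext. Qed.

Lemma pow_mono k W W' w w' : (forall w, W w `<=` W' w) -> w <= w' ->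
  pow k W w `<=` pow k W' w'.
Proof.
move=> h ww'; apply: span_mono => s [u [a [ha hs ->]]]; exists u, a.
by split=> // [j|]; [apply/h/ha|apply: le_trans ww'].
Qed.

Lemma pow_le k W w w' : w <= w' -> pow k W w `<=` pow k W w'.
Proof. by move=> h; apply: pow_mono h => w0 g. Qed.

Lemma pow_prod k W (u : 'I_k -> fn K T) (a : 'I_k -> rat) w :
  (forall j, W (a j) (u j)) -> \sum_j a j <= w -> pow k W w (\prod_j u j).
Proof. by move=> h1 h2; apply: span_mem; exists u, a. Qed.

Lemma pow0 W w : 0 <= w -> pow 0 W w 1.
Proof.
move=> w0; have -> : 1 = \prod_(j < 0) (fun=> 1 : fn K T) j by rewrite big_ord0.
by apply: (@pow_prod _ _ _ (fun=> 0)) => [[]|] //; rewrite big_ord0.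
Qed.

Lemma pow_cons k W a b w u v : W a u -> pow k W b v -> a + b <= w ->
  pow k.+1 W w (u * v).
Proof.
move=> Wu hv le; move: hv.
apply: (span_min (V := [set v | pow k.+1 W w (u * v)])).
  exact/subsp_mull/subsp_pow.
move=> _ [u' [a' [h1 h2 ->]]] /=.
pose U (j : 'I_k.+1) := oapp u' u (unlift ord0 j).
pose A (j : 'I_k.+1) := oapp a' a (unlift ord0 j).
have -> : u * \prod_j u' j = \prod_j U j.
  rewrite big_ord_recl /U unlift_none /=; congr (_ * _).
  by apply: eq_bigr => j _; rewrite liftK.
apply: (@pow_prod _ _ _ A).
  by move=> j; rewrite /A /U; case: unliftP => [i _|_] /=; [exact: h1|exact: Wu].
rewrite big_ord_recl /A unlift_none /=; apply: le_trans le; rewrite lerD2l.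
by under eq_bigr do rewrite liftK.
Qed.

Lemma pow_mul k l W a b u v : pow k W a u -> pow l W b v -> pow (k + l) W (a + b) (u * v).
Proof.
move=> hu hv.
suff h (us : 'I_k -> fn K T) (as_ : 'I_k -> rat) : (forall j, W (as_ j) (us j)) ->
    \sum_j as_ j <= a -> pow (k + l) W (a + b) (v * \prod_j us j).
  move: hu; rewrite mulrC; apply: (span_min (V := [set u | pow (k + l) W (a + b) (v * u)])).
    exact/subsp_mull/subsp_pow.
  by move=> _ [us [as_ [h1 h2 ->]]] /=; apply: h h2.
elim: k a us as_ {hu} => [|k IH] a us as_ h1 h2.
  rewrite big_ord0 mulr1; rewrite big_ord0 in h2.
  by apply: pow_le hv; rewrite lerDr.
rewrite big_ord_recl mulrCA addSn.
apply: (@pow_cons _ _ (as_ ord0) (a - as_ ord0 + b)) => //; last first.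
  by rewrite addrA addrCA subrr addr0.
apply: (IH _ _ (fun j => as_ (lift ord0 j))) => //.
by move: h2; rewrite big_ord_recl lerBrDl.
Qed.

Lemma pow1 W w : (forall w, is_subspace (W w)) -> (forall w w', w <= w' -> W w `<=` W w') ->
  pow 1 W w = W w.
Proof.
move=> h1 h2; apply/seteqP; split.
  apply: span_min => // _ [u [a [ha hs ->]]]; rewrite big_ord1.
  by apply: h2 (ha ord0); rewrite big_ord1 in hs.
move=> u Wu; rewrite -[u]mulr1; apply: (pow_cons (b := 0) Wu); rewrite ?addr0 //.
exact: pow0.
Qed.

Lemma pow_pow k l W w : pow l (pow k W) w = pow (k * l) W w.
Proof.
apply/seteqP; split.
  apply: span_min; first exact: subsp_pow.
  move=> _ [u [a [ha hs ->]]]; apply: pow_le hs _ _.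
  elim: l u a ha => [|l IH] u a ha; first by rewrite !big_ord0 muln0; apply: pow0.
  rewrite !big_ord_recl mulnS; apply: pow_mul => //.
  exact: (IH _ (fun j => a (lift ord0 j))).
apply: span_min; first exact: subsp_pow.
move=> _ [u [a [ha hs ->]]]; apply: pow_le hs _ _.
elim: l u a ha => [|l IH]; first by rewrite muln0 => u a ha; rewrite !big_ord0; apply: pow0.
rewrite mulnS => u a ha; rewrite !big_split_ord /=.
apply: (@pow_cons _ _ (\sum_i a (lshift (k * l) i))) => //.
  by apply: (@pow_prod _ _ _ (fun i => a (lshift (k * l) i))) => // j; apply: ha.
exact: (IH _ (fun i => a (rshift k i))).
Qed.

Lemma pow_rescale k W c mu w : 0 < c ->
  pow k (fun w => W (c * w + mu)) w = pow k W (c * w + k%:R * mu).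
Proof.
move=> c0; apply/seteqP; split; apply: span_min; try exact: subsp_pow.
  move=> _ [u [a [ha hs ->]]]; apply: (@pow_prod _ _ _ (fun j => c * a j + mu)) => //.
  rewrite big_split /= -mulr_sumr sumr_const card_ord mulr_natl lerD2r.
  by rewrite ler_pM2l.
move=> _ [u [a [ha hs ->]]]; apply: (@pow_prod _ _ _ (fun j => (a j - mu) / c)).
  by move=> j; rewrite mulrC divfK ?gt_eqF // subrK.
rewrite -mulr_suml sumrB sumr_const card_ord ler_pdivrMr // lerBlDr mulrC.
by rewrite -[mu *+ k]mulr_natl.
Qed.

Lemma seq_max (s : seq rat) : s != [::] -> exists2 m, m \in s & forall x, x \in s -> x <= m.
Proof.
elim: s => // a [|b s] IH _.
  by exists a; rewrite ?mem_head // => x; rewrite inE => /eqP ->.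
have [//|m ms mmax] := IH; have [am|ma] := leP m a.
  exists a; first exact: mem_head.
  by move=> x; rewrite inE => /orP[/eqP -> //|/mmax h]; apply: le_trans am.
exists m; first by rewrite inE ms orbT.
by move=> x; rewrite inE => /orP[/eqP -> |/mmax//]; exact: ltW.
Qed.

(** The common framework for flags and for F. By the last condition the jumps lie in a finite set
    and are attained, so every nonzero vector of [V] has a least weight. *)
Definition filt V W :=
  [/\ forall w, is_subspace (W w), forall w, W w `<=` V,
     forall w w', w <= w' -> W w `<=` W w', exists hi, V `<=` W hi &
     exists S : seq rat, forall w v, W w v -> v <> 0 -> exists s, [/\ s \in S, s <= w & W s v]].

(** For a constant filtration the weights impose nothing: this is the span of the k-fold
    products. *)
Definition prods k V : set (fn K T) := pow k (fun=> V) 0.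

Lemma prods_prods k l V : prods l (prods k V) = prods (k * l) V.
Proof.
rewrite /prods; have e k' V' w : (0 < k')%N -> pow k' (fun=> V') w = pow k' (fun=> V') 0.
  case: k' => // k' _; apply/seteqP; split; apply: span_min; try exact: subsp_pow.
    move=> _ [u [a [ha hs ->]]]; apply: (@pow_prod _ _ _ (fun=> 0)) => //.
    by rewrite big1.
  move=> _ [u [a [ha hs ->]]].
  apply: (@pow_prod _ _ _ (fun j => if j == ord0 then w else 0)) => //.
  by rewrite big_ord_recl eqxx big1 ?addr0.
rewrite -pow_pow; case: k => [|k]; last by apply: pow_ext => w; rewrite [RHS]e.
apply/seteqP; split; apply: span_min; try exact: subsp_pow.
  move=> _ [u [a [ha hs ->]]]; apply: (@pow_prod _ _ _ (fun=> 0)) => //.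
  by rewrite big1.
move=> _ [u [a [ha hs ->]]]; apply: (@pow_prod _ _ _ (fun=> 0)); last by rewrite big1.
move=> j; move: (ha j); apply: span_min; first exact: subsp_pow.
by move=> _ [u' [a' [_ _ ->]]]; rewrite big_ord0; apply: pow0.
Qed.

Lemma pow_sub_prods k V W w : (forall w, W w `<=` V) -> pow k W w `<=` prods k V.
Proof.
move=> h; apply: span_min; first exact: subsp_pow.
move=> _ [u [a [ha _ ->]]]; apply: (@pow_prod _ _ _ (fun=> 0)); last by rewrite big1.
by move=> j; apply: h (ha j).
Qed.

(** The jumps of the power are among the sums of k jumps of [W], a finite set. *)
Lemma filt_pow k V W : filt V W -> filt (prods k V) (pow k W).
Proof.
move=> [h1 h2 h3 [hi h4] [S h5]]; split.
- by move=> w; apply: subsp_pow.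
- by move=> w; apply: pow_sub_prods.
- by move=> w w'; apply: pow_le.
- exists (\sum_(j < k) hi); apply: span_min; first exact: subsp_pow.
  move=> _ [u [a [ha _ ->]]]; apply: (@pow_prod _ _ _ (fun=> hi)) => // j.
  exact/h4/ha.
pose Sk' := [seq \sum_(j < k) val (f j) | f : {ffun 'I_k -> seq_sub S}].
exists Sk' => w v hv v0.
(* v lies in the step of the largest element of Sk' below w *)
pose L := [seq s <- Sk' | s <= w].
have key v' : (exists (u : 'I_k -> fn K T) (a : 'I_k -> rat),
      [/\ forall j, W (a j) (u j), \sum_j a j <= w & v' = \prod_j u j]) ->
    v' = 0 \/ exists2 s, s \in L & pow k W s v'.
  move=> [u [a [ha hs ->]]].
  have [[j uj]|hn] := pselect (exists j, u j = 0).
    by left; rewrite (bigD1 j) //= uj mul0r.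
  right; have /choice[f hf] : forall j, exists s : seq_sub S, val s <= a j /\ W (val s) (u j).
    move=> j; have [|s [sS sa Ws]] := h5 _ _ (ha j); first by move=> uj; apply: hn; exists j.
    by exists (SeqSub sS).
  exists (\sum_j val (f j)).
    rewrite mem_filter; apply/andP; split.
      by apply: le_trans hs; apply: ler_sum => j _; have [] := hf j.
    apply/mapP; exists [ffun j => f j]; first by rewrite mem_enum.
    by apply: eq_bigr => j _; rewrite ffunE.
  by apply: (@pow_prod _ _ _ (fun j => val (f j))) => // j; have [] := hf j.
have [L0|] := eqVneq L [::].
  exfalso; apply: v0; move: hv; apply: (span_min (V := [set 0])); first exact: subsp_set0.
  by move=> v' /key[->//|[s]]; rewrite L0.
move=> /seq_max[s sL smax]; exists s; move: (sL).
rewrite mem_filter => /andP[sw sSk]; split=> //.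
move: hv; apply: span_min; first exact: subsp_pow.
move=> v' /key[->|[s' /smax le]]; first exact: (subsp0 (subsp_pow _ _ _)).
exact: pow_le.
Qed.

End Powers.

Section Weights.
Variables (K : closedFieldType) (T : Type).
Implicit Types (W : rat -> set (fn K T)) (V : set (fn K T)) (u v : fn K T).

Lemma seq_min (s : seq rat) : s != [::] -> exists2 m, m \in s & forall x, x \in s -> m <= x.
Proof.
elim: s => // a [|b s] IH _.
  by exists a; rewrite ?mem_head // => x; rewrite inE => /eqP ->.
have [//|m ms mmin] := IH; have [am|ma] := leP a m.
  exists a; first exact: mem_head.
  by move=> x; rewrite inE => /orP[/eqP -> //|/mmin]; apply: le_trans.
exists m; first by rewrite inE ms orbT.
by move=> x; rewrite inE => /orP[/eqP -> |/mmin//]; exact: ltW.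
Qed.

Lemma filt_weight V W v : filt V W -> V v -> v <> 0 ->
  exists w, forall w', W w' v <-> w <= w'.
Proof.
move=> [h1 h2 h3 [hi h4] [S h5]] Vv v0.
pose L := [seq s <- S | `[< W s v >]].
have hL w : W w v -> exists2 s, s \in L & s <= w.
  move=> /h5/(_ v0)[s [sS sw Ws]]; exists s => //.
  by rewrite mem_filter sS andbT; apply/asboolP.
have [|m mL mmin] := @seq_min L.
  by have [s sL _] := hL hi (h4 _ Vv); apply: contraTneq sL => ->.
exists m => w'; split=> [/hL[s /mmin]|]; first exact: le_trans.
move=> /h3; apply; move: mL; rewrite mem_filter => /andP[/asboolP].
by [].
Qed.

(* junk value unless v is a nonzero vector of V *)
Definition weight W v : rat := get [set w | forall w', W w' v <-> w <= w'].

Lemma weightP V W v : filt V W -> V v -> v <> 0 -> forall w, W w v <-> weight W v <= w.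
Proof.
by move=> hf Vv v0; have := getPex (filt_weight hf Vv v0).
Qed.

Lemma filt_jumps V W : filt V W ->
  [/\ sorted <%R (jumps W), forall w, w \in jumps W <-> jump W w &
   forall v, V v -> v <> 0 -> weight W v \in jumps W].
Proof.
move=> hf; have hw := weightP hf; case: (hf) => [h1 h2 h3 [hi h4] [S h5]].
have jumpE w : jump W w <-> exists v, [/\ V v, v <> 0 & w = weight W v].
  split=> [[v [Wv hv]]|[v [Vv v0 ->]]].
    have v0 : v <> 0.
      by move=> v0; apply: (hv (w - 1)); [rewrite ltrBlDr ltrDl|rewrite v0; apply: subsp0].
    have Vv := h2 _ _ Wv; exists v; split=> //.
    apply/eqP; rewrite eq_le (hw v Vv v0 w).1 // andbT leNgt; apply/negP => lt.
    by apply: (hv _ lt); apply/hw.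
  exists v; split; first exact/hw.
  by move=> w' lt /(hw _ Vv v0); rewrite leNgt lt.
have jS w : jump W w -> w \in S.
  move=> /jumpE[v [Vv v0 ->]].
  have [|s [sS sw /(hw _ Vv v0) ws]] := h5 (weight W v) v _ v0; first exact/hw.
  by have -> : weight W v = s by apply/eqP; rewrite eq_le ws.
have : [set s | sorted <%R s /\ [set` s] = jump W] (jumps W).
  rewrite /jumps; case: xgetP => // /(_ (sort <=%R (undup [seq w <- S | `[< jump W w >]]))) [].
  split.
    rewrite lt_sorted_uniq_le sort_uniq undup_uniq /=.
    exact: sort_le_sorted.
  apply/seteqP; split=> w /=; rewrite mem_sort mem_undup mem_filter.
    by move=> /andP[/asboolP].
  by move=> h; rewrite jS // andbT; apply/asboolP.
case=> js jE; split=> // [w|v Vv v0].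
  by rewrite -jE.
have : jump W (weight W v) by apply/jumpE; exists v.
by rewrite -jE.
Qed.

End Weights.

Lemma sorted_nth_le (J : seq rat) x i : sorted <%R J -> (i < size J)%N ->
  (nth 0 J i <= x) = (i < count (fun w => (w <= x)%R) J)%N.
Proof.
elim: J i => [|a J IH] i //= sJ; have sJ' := path_sorted sJ.
have [ax|xa] /= := leP a x; first by case: i => [|i] //= iJ; rewrite IH.
have hall : all (fun w => ~~ (w <= x)) J.
  move: sJ; rewrite lt_path_sortedE => /andP[/allP h _]; apply/allP => w /h aw.
  by rewrite -ltNge (lt_trans xa).
have -> : count (fun w => w <= x) J = 0%N.
  by apply/eqP; rewrite -leqn0 leqNgt -has_count -all_predC.
case: i => [|i] iJ /=; first by rewrite leNgt xa.
by apply/negbTE; move/allP: hall; apply; rewrite mem_nth.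
Qed.

Lemma sorted_count_nth (J : seq rat) i : sorted <%R J -> (i < size J)%N ->
  count (fun w => (w <= nth 0 J i)%R) J = i.+1.
Proof.
move=> sJ iJ; apply/eqP; rewrite eqn_leq -sorted_nth_le // lexx andbT leqNgt; apply/negP => h.
have iJ' : (i.+1 < size J)%N by apply: leq_trans h _; exact: count_size.
move: h; rewrite -sorted_nth_le // leNgt => /negP; apply.
by apply: (sortedP 0 sJ).
Qed.

Section Flags.
Variables (K : closedFieldType) (T : Type).
Implicit Types (W : rat -> set (fn K T)) (V : set (fn K T)) (v : fn K T) (p q : flag K T).

Definition mean V W : rat := flag_trace [seq (w, W w) | w <- jumps W] / (vdim V)%:R.

Lemma flag_ofE V W : flag_of V W = [seq (w - mean V W, W w) | w <- jumps W].
Proof. by rewrite /flag_of -map_comp. Qed.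

Lemma fstep_map (J : seq rat) (f : rat -> rat) W i : fstep [seq (f w, W w) | w <- J] i =
  nth [set 0] ([set 0] :: [seq W w | w <- J]) i.
Proof. by rewrite /fstep /unzip2 -map_comp. Qed.

Lemma fweight_map (J : seq rat) (f : rat -> rat) W i : (i < size J)%N ->
  fweight [seq (f w, W w) | w <- J] i = f (nth 0 J i).
Proof. by move=> iJ; rewrite /fweight (nth_map 0). Qed.

Lemma flag_trace_map (J : seq rat) (f : rat -> rat) W :
  flag_trace [seq (f w, W w) | w <- J] = \sum_(k < size J) f (nth 0 J k) *
    (qdim (nth [set 0] ([set 0] :: [seq W w | w <- J]) k)
       (nth [set 0] ([set 0] :: [seq W w | w <- J]) k.+1))%:R.
Proof.
rewrite /flag_trace size_map; apply: eq_bigr => k _.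
by rewrite fweight_map // !fstep_map.
Qed.

Lemma filt_jump_step V W w : filt V W ->
  W w = nth [set 0] ([set 0] :: [seq W w' | w' <- jumps W])
    (count (fun w' => w' <= w) (jumps W)).
Proof.
move=> hf; have [sJ _ hJ] := filt_jumps hf; have hw := weightP hf.
case: (hf) => h1 h2 h3 _ _.
case c: (count _ _) => [|c'] /=.
  apply/seteqP; split=> v; last by move=> ->; exact: subsp0.
  move=> Wv; apply: contrapT => v0; have Vv := h2 _ _ Wv.
  have : has (fun w' => w' <= w) (jumps W).
    by apply/hasP; exists (weight W v); [exact: hJ|apply/hw].
  by rewrite has_count c.
have c'J : (c' < size (jumps W))%N by rewrite -c count_size.
rewrite (nth_map 0) //; apply/seteqP; split=> v; last first.
  by apply: h3; rewrite sorted_nth_le // c.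
move=> Wv; have [->|/eqP v0] := eqVneq v 0; first exact: subsp0.
have Vv := h2 _ _ Wv; apply/hw => //.
have iJ : (index (weight W v) (jumps W) < size (jumps W))%N by rewrite index_mem hJ.
have wJ := nth_index 0 (hJ v Vv v0).
rewrite -[X in X <= _]wJ; apply: sorted_leq_nth => //; first exact: le_trans.
  by apply: sub_sorted sJ => a b; apply: ltW.
by rewrite -ltnS -c -sorted_nth_le // wJ; apply/hw.
Qed.

Lemma flag_filtration_flag_of V W w : filt V W ->
  flag_filtration (flag_of V W) w = W (w + mean V W).
Proof.
move=> hf; rewrite [RHS](filt_jump_step _ hf) /flag_filtration flag_ofE fstep_map.
by congr nth; rewrite count_map; apply: eq_count => w' /=; rewrite lerBlDr.
Qed.

Lemma vweight_flag_of V W v : filt V W -> V v -> v <> 0 ->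
  vweight (flag_of V W) v = weight W v - mean V W.
Proof.
move=> hf Vv v0; have [sJ _ hJ] := filt_jumps hf; have hw := weightP hf Vv v0.
rewrite /vweight flag_ofE find_map.
set i := find _ _; have hi : has (preim (fun w => (w - mean V W, W w))
    (fun g => `[< g.2 v >])) (jumps W).
  by apply/hasP; exists (weight W v); [exact: hJ|apply/asboolP/hw].
have iJ : (i < size (jumps W))%N by rewrite -has_find.
rewrite fweight_map //; congr (_ - _).
have /asboolP /= /hw le1 := nth_find 0 hi.
apply/eqP; rewrite eq_le le1 andbT.
have wJ := nth_index 0 (hJ v Vv v0).
rewrite -[X in _ <= X]wJ; apply: sorted_leq_nth; rewrite ?inE ?index_mem ?hJ //.
- exact: le_trans.
- by apply: sub_sorted sJ => a b; apply: ltW.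
rewrite leqNgt; apply/negP => /(before_find 0)/asboolP /=; apply.
by apply/hw; rewrite wJ.
Qed.

Lemma weighted_flag_filt V p : weighted_flag V p -> filt V (flag_filtration p).
Proof.
move=> [_ [s2 steps last_ wlt _]].
have sp : sorted <%R (unzip1 p).
  apply/(sortedP 0) => i; rewrite size_map => ip.
  by have := wlt i ip; rewrite /fweight !(nth_map (0, [set 0])) //; apply: ltnW.
have cp w : (count (fun g : rat * _ => (g.1 <= w)%R) p <= size p)%N by rewrite count_size.
have mono i j : (i <= j)%N -> (j <= size p)%N -> fstep p i `<=` fstep p j.
  move=> /subnK <-; elim: (j - i)%N => [_ v //|r IH lt v hv].
  have [_ [+ _]] := steps (r + i)%N lt; apply; apply: IH => //; exact: ltnW.
have sub i : (i <= size p)%N -> is_subspace (fstep p i).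
  by case: i => [_|i /steps[]//]; exact: subsp_set0.
split.
- by move=> w; apply: sub.
- by move=> w v hv; rewrite -last_; apply: mono hv.
- by move=> w w' ww'; apply: mono => //; apply: sub_count => g /= /le_trans; apply.
- have hi := @seq_max (unzip1 p); have [|m _ hm] := hi.
    by case: (p) s2.
  exists m; rewrite /flag_filtration (_ : count _ _ = size p) ?last_ //.
  by apply/eqP; rewrite -all_count; apply/allP => g gp; apply: hm; apply: map_f.
- exists (unzip1 p) => w v; rewrite /flag_filtration.
  set c := count _ _ => hv v0.
  have c0 : (0 < c)%N by case: (c) hv.
  have cs : (c.-1 < size (unzip1 p))%N.
    by rewrite size_map prednK // /c count_size.
  have cE x : count (fun g : rat * _ => (g.1 <= x)%R) p = count (fun y => y <= x) (unzip1 p).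
    by rewrite /unzip1 count_map.
  exists (nth 0 (unzip1 p) c.-1); split; first exact: mem_nth.
    by rewrite sorted_nth_le // -cE prednK.
  apply: mono hv => //; rewrite cE -(prednK c0) -sorted_nth_le //.
Qed.

(** A rescaling of trace zero weights becomes an affine change of the index of the filtration, the
    constant term coming from the two means. *)
Lemma flag_equiv_filt V W1 W2 : filt V W1 -> filt V W2 ->
  flag_equiv (flag_of V W1) (flag_of V W2) ->
  exists c nu : rat, 0 < c /\ forall w, W2 (c * w + nu) = W1 w.
Proof.
move=> hf1 hf2 [c [c0 e]]; exists c, (mean V W2 - c * mean V W1); split=> // w.
have -> : c * w + (mean V W2 - c * mean V W1) = c * (w - mean V W1) + mean V W2 by ring.
rewrite -(flag_filtration_flag_of _ hf2) e.
rewrite -[w in RHS](subrK (mean V W1)) -(flag_filtration_flag_of _ hf1).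
rewrite /flag_filtration /fstep /unzip2 -map_comp count_map; congr nth.
by apply: eq_count => g /=; rewrite ler_pM2l.
Qed.

Lemma filt_steps V W (f : rat -> rat) k : filt V W -> (k < size (jumps W))%N ->
  let p := [seq (f w, W w) | w <- jumps W] in
  [/\ is_subspace (fstep p k), is_subspace (fstep p k.+1),
     fstep p k `<=` fstep p k.+1 & fstep p k.+1 `<=` V].
Proof.
move=> hf kJ /=; have [sJ _ _] := filt_jumps hf; case: (hf) => h1 h2 h3 _ _.
rewrite !fstep_map /= (nth_map 0) //; split=> //.
  by case: k kJ => [|k] kJ /=; [exact: subsp_set0|rewrite (nth_map 0) 1?ltnW].
case: k kJ => [|k] kJ /=; first by move=> v ->; apply: subsp0.
rewrite (nth_map 0) 1?ltnW //; apply: h3; apply/ltW.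
exact: (sortedP 0 sJ).
Qed.

Section Adapted.
Variables (V : set (fn K T)) (W : rat -> set (fn K T)) (d : nat) (b : 'I_d -> fn K T).
Hypotheses (hf : filt V W) (hV : is_subspace V) (fgV : fg [set 0] V)
  (hb : basis_mod [set 0] V b) (ab : adapted b (flag_of V W)).

Let bP : [/\ forall i, V (b i), free_mod [set 0] b & gen_mod [set 0] V b].
Proof. exact/(basis_modP b (@subsp_set0 _ _) hV). Qed.

Lemma adapted_neq0 i : b i <> 0.
Proof.
move=> bi; have [_ fb _] := bP.
have /rowP/(_ i) : \row_j (j == i)%:R = 0 :> 'rV[K]_d.
  apply: fb; rewrite /= (bigD1 i) //= mxE eqxx scale1r bi add0r big1 // => j /negbTE ji.
  by rewrite mxE ji scale0r.
by rewrite !mxE eqxx => /eqP; rewrite oner_eq0.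
Qed.

Lemma adapted_span w v : W w v -> span (b @` [set i | W w (b i)]) v.
Proof.
have e := filt_jump_step w hf; have : (count (fun w' => (w' <= w)%R) (jumps W) <= size (jumps W))%N.
  exact: count_size.
case: (count _ _) e => [|c'] /= e c'J; first by rewrite e => ->; exact: span0.
have [J hJ] : exists J : set 'I_d, W w = span (b @` J).
  have [|J hJ] := ab (i := c'); first by rewrite flag_ofE size_map.
  by exists J; rewrite -hJ flag_ofE fstep_map.
rewrite {1}hJ; apply: span_mono => _ [j Jj <-]; exists j => //=.
by rewrite hJ; apply: span_mem; exists j.
Qed.

Lemma adapted_count w : #|[pred i | weight W (b i) <= w]| = vdim (W w).
Proof.
have [bV fb gb] := bP; case: (hf) => h1 h2 _ _ _; have h0 := @subsp_set0 K (fn K T).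
have hw i := weightP hf (bV i) (@adapted_neq0 i).
pose us := [seq i <- enum 'I_d | weight W (b i) <= w].
have usE i : (i \in us) = (weight W (b i) <= w) by rewrite mem_filter mem_enum andbT.
have uus : uniq us by rewrite filter_uniq ?enum_uniq.
have -> : #|[pred i | weight W (b i) <= w]| = size us.
  by rewrite -(card_uniqP uus); apply: eq_card => i; rewrite usE inE.
rewrite /vdim (@qdim_seq _ _ [set 0] (W w) _ us b) //.
- by move=> i; rewrite usE => /hw.
- move=> c hc i; rewrite usE => iw.
  have /rowP/(_ i) : \row_j (if j \in us then c j else 0) = 0 :> 'rV[K]_d.
    apply: fb; rewrite (_ : \sum_j _ = \sum_(j <- us) c j *: b j) //.
    rewrite [RHS]big_uniq // [RHS]big_mkcond /=.
    by apply: eq_bigr => j _; rewrite mxE; case: ifP => // _; rewrite scale0r.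
  by rewrite !mxE usE iw.
- move=> v /adapted_span hv.
  have : span [set b i | i in [set` us]] v.
    by apply: span_mono hv => _ [i /= /hw wi <-]; exists i => //=; rewrite usE.
  by move=> /span_seq -/(_ uus)[c ->]; exists c; rewrite /= subrr.
Qed.

(** Grouping the basis vectors by their jump turns the sum over the basis into the trace of the
    flag. So [mean] is the average weight in any adapted basis. *)
Lemma adapted_trace : \sum_i weight W (b i) = d%:R * mean V W.
Proof.
have [bV fb gb] := bP; case: (hf) => h1 h2 _ [hi hhi] _; have h0 := @subsp_set0 K (fn K T).
have [sJ _ hJ] := filt_jumps hf.
have dV : vdim V = d by apply: qdimE hb.
have [d0|d0] := posnP d.
  have e0 : d%:R = 0 :> rat by rewrite d0.
  rewrite e0 mul0r big1 // => i; exfalso.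
  by case: i => i; rewrite d0.
rewrite /mean dV mulrCA divff ?mulr1; last by rewrite pnatr_eq0 -lt0n.
set J := jumps W in sJ hJ *.
pose idx i := index (weight W (b i)) J.
have idxJ i : (idx i < size J)%N by rewrite index_mem; apply: hJ => //; apply: adapted_neq0.
have idxE i : nth 0 J (idx i) = weight W (b i).
  by apply: nth_index; apply: hJ => //; apply: adapted_neq0.
pose p := [seq (w, W w) | w <- J].
have vst k : (k <= size J)%N -> vdim (fstep p k) = #|[pred i | (idx i < k)%N]|.
  move=> kJ; rewrite /p (fstep_map J id).
  case: k kJ => [_|k kJ].
    rewrite eq_card0 //; rewrite /vdim (@qdim_seq _ _ _ _ _ [::] b) //.
    by move=> v -> ; exists (fun=> 0); rewrite big_nil subr0.
  rewrite /= (nth_map 0) // -adapted_count; apply: eq_card => i; rewrite !inE.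
  by rewrite -idxE sorted_nth_le // sorted_count_nth.
have qst (k : 'I_(size J)) : (qdim (fstep p k) (fstep p k.+1))%:R =
    \sum_i (idx i == k)%:R :> rat.
  have [s1 s2 s3 s4] := filt_steps id hf (ltn_ord k).
  have := vdim_qdim s1 s2 s3 (fg_sub s4 fgV); rewrite !vst // 1?ltnW // => e.
  have -> : qdim (fstep p k) (fstep p k.+1) = #|[pred i | idx i == k]|.
    apply/eqP; rewrite -(eqn_add2l #|[pred i | (idx i < k)%N]|) -e -cardUI.
    rewrite [X in (_ + X)%N]eq_card0 ?addn0; last first.
      by move=> i; rewrite !inE; case: ltngtP.
    by apply/eqP/eq_card => i; rewrite !inE ltnS leq_eqVlt orbC.
  rewrite -sum1_card natr_sum big_mkcond /=; apply: eq_bigr => i _.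
  by rewrite inE; case: eqP.
rewrite /flag_trace size_map.
transitivity (\sum_(k < size J) nth 0 J k * \sum_i (idx i == k)%:R); last first.
  by apply: eq_bigr => k _; rewrite (fweight_map id) // qst.
under [RHS]eq_bigr do rewrite mulr_sumr.
rewrite exchange_big /=; apply: eq_bigr => i _.
rewrite (bigD1 (Ordinal (idxJ i))) //= eqxx mulr1 idxE big1 ?addr0 // => k ki.
rewrite (_ : (idx i == k) = false) ?mulr0 //.
by apply/negbTE; apply: contra_neq ki => e; apply: val_inj.
Qed.

End Adapted.

Lemma flag_of_weighted V W : filt V W -> is_subspace V -> fg [set 0] V ->
  (2 < vdim V)%N -> (1 < size (jumps W))%N -> weighted_flag V (flag_of V W).
Proof.
move=> hf hV fgV dV sJ2; have [sJ jE hJ] := filt_jumps hf.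
case: (hf) => h1 h2 h3 [hi h4] _; have hw := weightP hf.
have steps k : (k < size (jumps W))%N -> _ := filt_steps (fun w => w - mean V W) hf.
have last_ : fstep (flag_of V W) (size (jumps W)) = V.
  have [n nE] : exists n, size (jumps W) = n.+1.
    by exists (size (jumps W)).-1; rewrite prednK // ltnW.
  rewrite flag_ofE fstep_map nE /= (nth_map 0) ?nE //.
  apply/seteqP; split=> [v /h2//|v Vv].
  have [->|/eqP v0] := eqVneq v 0; first exact: subsp0.
  apply/hw => //; have iJ : (index (weight W v) (jumps W) < size (jumps W))%N.
    by rewrite index_mem hJ.
  rewrite -[X in X <= _](nth_index 0 (hJ v Vv v0)).
  apply: (sorted_leq_nth (leT := <=%R)); rewrite ?inE ?nE //.
  - exact: le_trans.
  - by apply: sub_sorted sJ => a b; apply: ltW.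
  - by rewrite -nE.
  - by rewrite -ltnS -nE.
split=> //; split.
- by rewrite flag_ofE size_map.
- move=> k; rewrite flag_ofE size_map => kJ; have [s1 s2 s3 s4] := steps k kJ.
  split=> //; split=> // s5.
  have /jE[v [Wv hv]] : nth 0 (jumps W) k \in jumps W by apply: mem_nth.
  have : fstep [seq (w - mean V W, W w) | w <- jumps W] k v.
    by apply: s5; rewrite fstep_map /= (nth_map 0).
  have v0 : v <> 0.
    move=> v0; apply: (hv (nth 0 (jumps W) k - 1)); first by rewrite ltrBlDr ltrDl.
    by rewrite v0; apply: subsp0.
  rewrite fstep_map; case: k kJ {s1 s2 s3 s4 s5 Wv} hv => [|k] kJ hv //=.
  rewrite (nth_map 0) 1?ltnW //; apply: hv.
  exact: (sortedP 0 sJ).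
- by have -> : size (flag_of V W) = size (jumps W) by rewrite flag_ofE size_map.
- move=> k; rewrite flag_ofE size_map => kJ.
  rewrite (@fweight_map (jumps W) (fun w => w - mean V W) W k (ltnW kJ)).
  rewrite (@fweight_map (jumps W) (fun w => w - mean V W) W k.+1 kJ) ltrD2r.
  exact: (sortedP 0 sJ).
have qE n : (n <= size (jumps W))%N ->
    (\sum_(k < n) qdim (fstep (flag_of V W) k) (fstep (flag_of V W) k.+1))%N =
    vdim (fstep (flag_of V W) n).
  elim: n => [_|n IH nJ].
    rewrite big_ord0 /vdim (@qdim_seq _ _ _ _ _ [::] (fun _ : nat => 0)) //.
    - exact: subsp_set0.
    - exact: subsp_set0.
    - by move=> v -> ; exists (fun=> 0); rewrite big_nil subr0.
  rewrite big_ord_recr /= IH 1?ltnW //; have [s1 s2 s3 s4] := steps n nJ.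
  rewrite flag_ofE in IH *.
  by rewrite (vdim_qdim s1 s2 s3 (fg_sub s4 fgV)).
have qV := qE _ (leqnn _); rewrite last_ in qV.
have e : flag_trace (flag_of V W) =
    flag_trace [seq (w, W w) | w <- jumps W] - mean V W * (vdim V)%:R.
  rewrite flag_ofE (flag_trace_map (jumps W) (fun w => w - mean V W) W).
  rewrite (flag_trace_map (jumps W) (fun w => w) W) -qV natr_sum mulr_sumr -sumrB.
  by apply: eq_bigr => k _; rewrite flag_ofE !fstep_map -mulrBl.
rewrite e /mean divfK ?subrr // pnatr_eq0; by lia.
Qed.

End Flags.

(** * Approximating filtrations *)

Section GradedDomain.
Variables (K : closedFieldType) (T : Type).
Implicit Types (R : nat -> set (fn K T)) (F : nat -> int -> set (fn K T)) (u v s : fn K T).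

(* [dil a] is the dilation of the cone T by a. *)
Record section_ring R : Prop := SectionRing {
  sr_sub : forall k, is_subspace (R k);
  sr_one : R 0%N 1;
  sr_mul : forall a b u v, R a u -> R b v -> R (a + b)%N (u * v);
  sr_dom : forall a b u v, R a u -> R b v -> u * v = 0 -> u = 0 \/ v = 0;
  sr_fg : forall k, fg [set 0] (R k);
  sr_gen : forall k, (0 < k)%N -> R k `<=` prods k (R 1%N);
  sr_dil : exists dil : K -> T -> T, forall k s a y, R k s -> a != 0 ->
     s (dil a y) = a ^+ k * s y
}.

Variables (R : nat -> set (fn K T)).
Hypothesis hR : section_ring R.

Lemma sr_prods_sub r k : prods k (R r) `<=` R (r * k)%N.
Proof.
apply: span_min; first exact: (sr_sub hR).
move=> _ [u [a [hu _ ->]]]; elim: k u a hu => [|k IH] u a hu.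
  by rewrite big_ord0 muln0; apply: (sr_one hR).
rewrite big_ord_recl mulnS; apply: (sr_mul hR) => //.
exact: (IH _ (fun j => a (lift ord0 j))).
Qed.

Lemma sr_prods r k : (0 < r * k)%N -> R (r * k)%N = prods k (R r).
Proof.
move=> rk; apply/seteqP; split; last exact: sr_prods_sub.
move=> s /(sr_gen hR rk); rewrite -prods_prods.
have r1 : prods r (R 1%N) `<=` R r by move=> v /sr_prods_sub; rewrite mul1n.
by apply: pow_mono.
Qed.

Lemma sr_exp_neq0 r u n : R r u -> u <> 0 -> u ^+ n <> 0.
Proof.
move=> hu u0; elim: n => [|n IH].
  by move=> /(congr1 (fun f => u * f)); rewrite expr0 mulr1 mulr0.
have hX : R (r * n)%N (u ^+ n).
  elim: n {IH} => [|n IH]; first by rewrite muln0; apply: (sr_one hR).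
  by rewrite mulnS exprS; apply: (sr_mul hR).
by rewrite exprS => /(sr_dom hR hu hX)[].
Qed.

Lemma sr_exp r u n : R r u -> R (r * n)%N (u ^+ n).
Proof.
move=> hu; elim: n => [|n IH]; first by rewrite muln0; apply: (sr_one hR).
by rewrite mulnS exprS; apply: (sr_mul hR).
Qed.

Section Filtered.
Variable F : nat -> int -> set (fn K T).
Hypothesis hF : admissible R F.
Variable m : nat.
Hypothesis m0 : (0 < m)%N.

(** Rounding down turns the filtration of R_m into one indexed by rationals with the same jumps, to
    which [pow] applies. *)
Definition Fw (w : rat) : set (fn K T) := F m (Num.floor w).

Lemma F_sub i : is_subspace (F m i).
Proof. by case: hF => h _ _ _; have [] := h m. Qed.

Lemma F_R i : F m i `<=` R m.
Proof. by case: hF => h _ _ _; have [] := h m. Qed.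

Lemma F_mono i j : i <= j -> F m i `<=` F m j.
Proof. by case: hF => h _ _ _; have [_ _ +] := h m; apply. Qed.

Lemma floor_int (i : int) : Num.floor (i%:~R : rat) = i.
Proof. exact: intrKfloor. Qed.

Lemma Fw_int i : Fw i%:~R = F m i.
Proof. by rewrite /Fw floor_int. Qed.

Lemma Fw_mono w w' : w <= w' -> Fw w `<=` Fw w'.
Proof. by move=> h; apply: F_mono; apply: le_floor. Qed.

Lemma Fw_filt : filt (R m) Fw.
Proof.
case: (hF) => _ _ h3 [C [_ h4]]; have [hi hhi] := h3 m.
split; [by move=> w; apply: F_sub|by move=> w; apply: F_R|exact: Fw_mono| |].
  by exists hi%:~R; rewrite Fw_int hhi.
pose lo := C * m%:Z.
have [lohi|hilo] := leP lo hi; last first.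
  exists [::] => w v hv v0; exfalso; apply: v0.
  have : F m lo v by rewrite hhi; [apply: F_R hv|apply: ltW].
  by rewrite h4.
exists [seq (lo + n%:Z)%:~R | n <- iota 0 `|hi - lo|.+1] => w v hv v0.
have lw : lo < Num.floor w.
  rewrite ltNge; apply/negP => le; apply: v0.
  have : F m lo v := F_mono le hv.
  by rewrite h4.
pose i := Num.min (Num.floor w) hi.
exists i%:~R; split.
- apply/mapP; exists `|i - lo|%N; last first.
    by congr _%:~R; rewrite gez0_abs; [ring|rewrite /i; case: ltP; lia].
  by rewrite mem_iota /i; case: ltP => h; lia.
- by apply: le_trans (floor_le w); rewrite ler_int /i ge_min lexx.
- rewrite Fw_int /i; case: ltP => // _; rewrite hhi //; exact: F_R hv.
Qed.

Lemma pow_floor k (w : rat) : pow k Fw w = pow k Fw (Num.floor w)%:~R.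
Proof.
apply/seteqP; split; last by apply: pow_le; apply: floor_le.
apply: span_min; first exact: subsp_pow.
move=> _ [u [a [hu ha ->]]]; apply: (@pow_prod _ _ _ _ _ (fun j => (Num.floor (a j))%:~R)).
  by move=> j; rewrite Fw_int; apply: hu.
rewrite -rmorph_sum ler_int floor_ge_int; apply: le_trans ha.
by rewrite rmorph_sum; apply: ler_sum => j _; apply: floor_le.
Qed.

Lemma pow_Fw_R k w : pow k Fw w `<=` R (m * k)%N.
Proof.
move=> s h; apply: sr_prods_sub; apply: pow_sub_prods h => w'; exact: F_R.
Qed.

Lemma monomM s s' i j : monom s i * monom s' j = monom (s * s') (i + j).
Proof.
apply/funext => -[y [t t0]].
change (s y * t ^ i * (s' y * t ^ j) = s y * s' y * t ^ (i + j)).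
by rewrite expfzDr //; ring.
Qed.

Lemma subsp_monom i (V : set (fn K (T * {t : K | t != 0}))) : is_subspace V ->
  is_subspace [set s : fn K T | V (monom s i)].
Proof.
move=> hV; split=> [|a u v hu hv] /=.
  rewrite (_ : monom 0 i = 0); first exact: subsp0.
  by apply/funext => -[y [t t0]]; change (0 * t ^ i = 0); rewrite mul0r.
rewrite (_ : monom _ i = a *: monom u i + monom v i).
  by apply: subspD => //; apply: subspZ.
apply/funext => -[y [t t0]].
change ((a * u y + v y) * t ^ i = a * (u y * t ^ i) + v y * t ^ i).
by rewrite mulrDl mulrA.
Qed.

Lemma monom_chi k i s : pow k Fw i%:~R s -> chi F m (monom s i).
Proof.
move=> hs A [hA A1 AM] hS; move: hs.
apply: (span_min (V := [set s | A (monom s i)])); first exact: subsp_monom.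
move=> _ [u [a [hu ha ->]]] /=.
have h : A (monom (\prod_j u j) (\sum_j Num.floor (a j))).
  elim: k u a hu {ha} => [|k IH] u a hu.
    rewrite !big_ord0 (_ : monom 1 0 = 1) //.
    by apply/funext => -[y [t t0]]; change (1 * t ^ 0 = 1); rewrite mul1r expr0z.
  rewrite !big_ord_recl -monomM; apply: AM.
    by apply: hS; right; exists (Num.floor (a ord0)), (u ord0); split=> //; apply: hu.
  exact: (IH _ (fun j => a (lift ord0 j))).
have le : \sum_j Num.floor (a j) <= i.
  rewrite -(ler_int rat); apply: le_trans ha.
  by rewrite rmorph_sum; apply: ler_sum => j _; apply: floor_le.
have hpow n : A (monom 1 (Posz n)).
  elim: n => [|n IH].
    rewrite (_ : monom 1 0 = 1) //.
    by apply/funext => -[y [t t0]]; change (1 * t ^ 0 = 1); rewrite mul1r expr0z.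
  rewrite -(mulr1 (1 : fn K T)) -[n.+1]addn1 PoszD -monomM; apply: AM => //.
  by apply: hS; left.
rewrite -[\prod_j u j]mulr1 -[i](subrKC (\sum_j Num.floor (a j))) -monomM.
apply: AM => //; rewrite -[_ - _]gez0_abs ?subr_ge0 //.
Qed.

Let expansion (g : fn K (T * {t : K | t != 0})) := exists l : seq (nat * int * fn K T),
  all (fun x => `[< pow x.1.1 Fw x.1.2%:~R x.2 >]) l /\
  g = \sum_(x <- l) monom x.2 x.1.2.

(** The finite sums of terms s t^i with s in a power of [Fw] form a subalgebra that contains the
    generators of chi. *)
Lemma chi_expansion : chi F m `<=` expansion.
Proof.
have hE : is_subspace expansion.
  split; first by exists [::]; rewrite big_nil.
  move=> a _ _ [l [hl ->]] [l' [hl' ->]].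
  exists ([seq (x.1, a *: x.2) | x <- l] ++ l'); split.
    rewrite all_cat hl' andbT all_map; apply: sub_all hl => x /asboolP hx.
    by apply/asboolP; apply: (subspZ _ (subsp_pow _ _ _)).
  rewrite big_cat big_map scaler_sumr /=; congr (_ + _); apply: eq_bigr => x _.
  apply/funext => -[y [t t0]].
  by change (a * (x.2 y * t ^ x.1.2) = (a * x.2 y) * t ^ x.1.2); rewrite mulrA.
have h1 k i s : pow k Fw i%:~R s -> expansion (monom s i).
  by move=> hs; exists [:: (k, i, s)]; rewrite /= andbT big_seq1; split=> //; apply/asboolP.
move=> g; apply; last first.
  move=> h [->|[i [s [hs ->]]]].
    by apply: (h1 0%N); apply: pow0; rewrite ler0z.
  apply: (h1 1%N); rewrite pow1 ?Fw_int // => w *; [exact: F_sub|exact: Fw_mono].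
split=> //.
  rewrite (_ : 1 = monom 1 0); first by apply: (h1 0%N); apply: pow0.
  by apply/funext => -[y [t t0]]; change (1 = 1 * t ^ 0); rewrite mul1r expr0z.
move=> _ _ [l [hl ->]] [l' [hl' ->]].
rewrite mulr_suml; elim: l hl => [_|x l IH /= /andP[/asboolP hx hl]].
  by rewrite big_nil; apply: (subsp0 hE).
rewrite big_cons; apply: (subspD hE); last exact: IH.
rewrite mulr_sumr; elim: l' hl' {IH} => [_|x' l' IH' /= /andP[/asboolP hx' hl']].
  by rewrite big_nil; apply: (subsp0 hE).
rewrite big_cons; apply: (subspD hE); last exact: IH'.
rewrite monomM; apply: (h1 (x.1.1 + x'.1.1)%N); rewrite intrD; exact: pow_mul.
Qed.

Lemma poly_exp_coef (I : Type) (r : seq I) (c : I -> K) (e : I -> nat) n c0 :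
  (forall a, a != 0 -> \sum_(i <- r) a ^+ e i * c i = a ^+ n * c0) ->
  \sum_(i <- r | e i == n) c i = c0.
Proof.
move=> h.
have : \sum_(i <- r) c i *: 'X^(e i) - c0 *: 'X^n = 0 :> {poly K}.
  apply: poly_vanish => a a0; rewrite !hornerE horner_sum.
  under eq_bigr do rewrite !hornerE mulrC.
  by rewrite h // mulrC subrr.
move/polyP/(_ n); rewrite coefB coefZ coefXn eqxx mulr1 coef0 coef_sum => /eqP.
rewrite subr_eq0 => /eqP <-; rewrite big_mkcond; apply: eq_bigr => i _.
by rewrite coefZ coefXn eq_sym; case: eqP; rewrite ?mulr1 ?mulr0.
Qed.

(** The expansion of s t^i given by [chi_expansion] may mix degrees and powers of t. Varying t, then
    the dilation of T, isolates the terms of bidegree (k, i). *)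
Lemma approxE k i : approx_filtration R F m k i = pow k Fw i%:~R.
Proof.
apply/seteqP; split; last first.
  by move=> s hs; split; [exact: pow_Fw_R hs|exact: monom_chi hs].
move=> s [hs /chi_expansion[l [hl e]]].
have [dil hdil] := sr_dil hR.
have -> : s = \sum_(x <- l | (x.1.2 == i) && (x.1.1 == k)) x.2.
  apply/funext => y.
  have sumE (r : seq (nat * int * fn K T)) (P : pred (nat * int * fn K T)) :
    (\sum_(x <- r | P x) x.2) y = \sum_(x <- r | P x) x.2 y.
    by elim/big_rec2: _ => // x a b _ <-.
  rewrite sumE.
  have lR x : `[< pow x.1.1 Fw x.1.2%:~R x.2 >] -> R (m * x.1.1)%N x.2.
    by move=> /asboolP; apply: pow_Fw_R.
  (* Shifts all powers of t to nonnegative exponents, so that polynomial identities can be used. *)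
  pose L := (`|i| + \sum_(x <- l) `|x.1.2|)%N.
  have Li : 0 <= i + L%:Z by rewrite /L; lia.
  have Lx : all (fun x => 0 <= x.1.2 + L%:Z) l.
    rewrite /L; elim: (l) (`|i|%N) => //= x l' IH n; rewrite big_cons.
    apply/andP; split; first by lia.
    by rewrite addnA; apply: IH.
  have key (z : int) : 0 <= z + L%:Z -> (z == i) = (`|(z + L%:Z)%R|%N == `|(i + L%:Z)%R|%N).
    by move=> h; apply/eqP/eqP => [->//|]; lia.
  have pw (t : K) (z : int) : t != 0 -> 0 <= z + L%:Z ->
      t ^+ `|(z + L%:Z)%R|%N = t ^ L%:Z * t ^ z.
    by move=> t0 h; rewrite -expfzDr // [L%:Z + z]addrC -[in RHS](gez0_abs h).
  have eval a t : a != 0 -> t != 0 ->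
     \sum_(x <- l) t ^ x.1.2 * (a ^+ (m * x.1.1) * x.2 y) = t ^ i * (a ^+ (m * k) * s y).
    move=> a0 t0; have := congr1 (fun f => f (dil a y, exist _ t t0)) e.
    have -> : (\sum_(x <- l) monom x.2 x.1.2) (dil a y, exist _ t t0) =
      \sum_(x <- l) x.2 (dil a y) * t ^ x.1.2.
      by elim/big_rec2: _ => // x a' b _ <-.
    rewrite /monom /= (hdil _ _ _ _ hs a0) mulrC => ->.
    elim: (l) hl => [|x l' IH /= /andP[hx hl']]; first by rewrite !big_nil.
    by rewrite !big_cons (hdil _ _ _ _ (lR _ hx) a0) mulrC IH.
  symmetry.
  have step a : a != 0 ->
    \sum_(x <- l | x.1.2 == i) a ^+ (m * x.1.1) * x.2 y = a ^+ (m * k) * s y.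
    move=> a0.
    rewrite -(@poly_exp_coef _ l (fun x : nat * int * fn K T => a ^+ (m * x.1.1) * x.2 y)
      (fun x : nat * int * fn K T => `|(x.1.2 + L%:Z)%R|%N) `|(i + L%:Z)%R|%N (a ^+ (m * k) * s y)).
      rewrite big_seq_cond [RHS]big_seq_cond; apply: eq_bigl => x.
      case: (boolP (x \in l)) => //= xl; apply: key; exact: (allP Lx).
    move=> t t0; have := eval a t a0 t0.
    move/(congr1 (fun z => t ^ L%:Z * z)); rewrite mulrA -expfzDr // addrC => e'.
    rewrite -[t ^+ _]/(t ^ `|(i + L%:Z)%R|%N%:Z) gez0_abs // -e' mulr_sumr.
    rewrite big_seq [RHS]big_seq; apply: eq_bigr => x xl.
    have := pw t x.1.2 t0 (allP Lx x xl) => ->.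
    by rewrite -mulrA.
  rewrite -big_filter_cond.
  rewrite -(@poly_exp_coef _ [seq x <- l | x.1.2 == i] (fun x : nat * int * fn K T => x.2 y)
     (fun x : nat * int * fn K T => (m * x.1.1)%N) (m * k)%N (s y)).
    by apply: eq_bigl => x; rewrite eqn_pmul2l.
  by move=> a a0; rewrite big_filter step.
rewrite -big_filter; elim: (l) hl => [_|x l' IH /= /andP[/asboolP hx hl']].
  by rewrite big_nil; apply: (subsp0 (subsp_pow _ _ _)).
case: ifP => [/andP[/eqP xi /eqP xk]|_]; last exact: IH.
rewrite big_cons; apply: (subspD (subsp_pow _ _ _)); last exact: IH.
by rewrite -xi -xk.
Qed.

(** The [x j] may be linearly dependent: [filt_gens_exist] puts together bases of successive F_i
    R_m. Counting only standard monomials takes care of the relations. *)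
Definition filt_gens (x : nat -> fn K T) d (w : nat -> int) :=
  (forall j, (j < d)%N -> F m (w j) (x j)) /\
  forall i, F m i `<=` span [set x j | j in [set j | (j < d)%N /\ w j <= i]].

Lemma filt_gens_exist : exists x d w, filt_gens x d w.
Proof.
case: (hF) => _ _ h3 [C [_ h4]]; have [hi hhi] := h3 m.
pose lo := C * m%:Z; have hlo : F m lo = [set 0] by apply: h4.
have step n : exists (x : nat -> fn K T) d (w : nat -> int),
    (forall j, (j < d)%N -> F m (w j) (x j)) /\
    forall i, i <= lo + n%:Z ->
      F m i `<=` span [set x j | j in [set j | (j < d)%N /\ w j <= i]].
  elim: n => [|n [x [d [w [h1 h2]]]]].
    exists (fun=> 0), 0%N, (fun=> 0); split=> // i; rewrite addr0 => /F_mono h v /h.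
    by rewrite hlo => ->; apply: span0.
  pose i0 := lo + n.+1%:Z.
  have [d' [b]] := fg_basis (@subsp_set0 _ _) (F_sub i0) (fg_sub (@F_R i0) (sr_fg hR m)).
  move=> /(basis_modP b (@subsp_set0 _ _) (F_sub i0))[b1 _ b3].
  pose x' j := if (j < d)%N then x j else oapp b 0 (insub (j - d)%N).
  pose w' j := if (j < d)%N then w j else i0.
  exists x', (d + d')%N, w'; split.
    move=> j jd; rewrite /x' /w'; case: ifP => [/h1//|/negbT]; rewrite -leqNgt => dj.
    by case: insubP => [j' _ _|_] /=; [exact: b1|exact: (subsp0 (F_sub _))].
  move=> i le; have [ii0|i0i] := ltP i i0.
    move=> v /h2 -/(_ (ltac:(rewrite /i0 in ii0; lia))); apply: span_mono.
    move=> _ [j [jd wj] <-]; exists j; last by rewrite /x' jd.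
    by split; [exact: ltn_addr|rewrite /w' jd].
  have -> : i = i0 by apply/eqP; rewrite eq_le le i0i.
  move=> v /b3[c /= /eqP]; rewrite subr_eq0 => /eqP ->.
  set S := span _; have hS : is_subspace S by apply: subsp_span.
  apply: (subsp_lin _ hS) => j; apply: span_mem; exists (d + j)%N => /=.
    by rewrite ltn_add2l ltn_ord /w' ltnNge leq_addr.
  by rewrite /x' ltnNge leq_addr /= addKn valK.
have [x [d [w [h1 h2]]]] := step `|hi - lo|%N; exists x, d, w; split=> // i.
have [le|lt] := leP i hi; first by apply: h2; lia.
move=> v /F_R hv; have : F m hi v by rewrite hhi.
move/h2 => /(_ (ltac:(lia))); apply: span_mono => _ [j [jd wj] <-].
by exists j => //; split=> //; apply: le_trans wj _; apply: ltW.
Qed.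

Section Generators.
Variables (x : nat -> fn K T) (d : nat) (w : nat -> int).
Hypothesis hx : filt_gens x d w.

(** The coefficients of t^i in the part of degree k of chi; weights below i are included because t
    lies in chi. *)
Definition chi_part k i : set (fn K T) := span [set mon x d u | u in
  [set u | u \in monos d k /\ mwt d w u <= i]].

Local Notation G := chi_part.

Lemma subsp_G k i : is_subspace (G k i). Proof. exact: subsp_span. Qed.

Lemma G_le k i j : i <= j -> G k i `<=` G k j.
Proof.
move=> ij; apply: span_mono => _ [u [um ui] <-]; exists u => //; split=> //.
exact: le_trans ij.
Qed.

Lemma G_mull j k i g : (j < d)%N -> G k i g -> G k.+1 (i + w j) (x j * g).
Proof.
move=> jd; apply: (span_min (V := [set g | G k.+1 (i + w j) (x j * g)])).
  exact/subsp_mull/subsp_span.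
move=> _ [u [um ui] <-] /=; rewrite -mon_incr //; apply: span_mem.
exists (incr_nth u j) => //; split; first exact: mem_monos_incr.
by rewrite mwt_incr // lerD2r.
Qed.

Lemma G_mulF k i j f g : F m j f -> G k i g -> G k.+1 (i + j) (f * g).
Proof.
move=> /hx.2 hf hg; rewrite mulrC; move: hf.
apply: (span_min (V := [set f | G k.+1 (i + j) (g * f)])).
  exact/subsp_mull/subsp_span.
move=> _ [l [ld wl] <-] /=; rewrite mulrC.
by apply: (G_le _ (G_mull ld hg)); rewrite lerD2l.
Qed.

Lemma pow_G k i : pow k Fw i%:~R = G k i.
Proof.
apply/seteqP; split.
  apply: span_min; first exact: subsp_G.
  move=> _ [u [a [hu ha ->]]].
  have le : \sum_j Num.floor (a j) <= i.
    rewrite -(ler_int rat); apply: le_trans ha.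
    by rewrite rmorph_sum; apply: ler_sum => j _; apply: floor_le.
  apply: G_le le _ _ => {ha}.
  elim: k u a hu => [|k IH] u a hu.
    rewrite !big_ord0; apply: span_mem; exists (nseq d 0%N); last exact: mon_nseq0.
    by split; rewrite ?mwt_nseq0 // mem_monos size_nseq sumn_nseq mul0n !eqxx.
  rewrite !big_ord_recl addrC; apply: G_mulF; first exact: hu.
  exact: (IH _ (fun j => a (lift ord0 j))).
apply: span_min; first exact: subsp_pow.
move=> _ [u [um ui] <-]; apply: (@pow_le _ _ _ _ (mwt d w u)%:~R); first by rewrite ler_int.
elim: k u um {ui} => [|k IH] u um.
  move: um; rewrite mem_monos => /andP[/eqP su /eqP u0].
  have -> : u = nseq d 0%N.
    apply: (@eq_from_nth _ 0%N); first by rewrite size_nseq.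
    move=> j; rewrite su nth_nseq => jd; rewrite jd.
    by move: u0; rewrite (sumn_nth su) (bigD1 (Ordinal jd)) //=; lia.
  by rewrite mon_nseq0 mwt_nseq0; apply: pow0.
have [j jd [v vm ->]] := monosS_ex um.
rewrite mon_incr // mwt_incr //; apply: (pow_cons (a := (w j)%:~R) (b := (mwt d w v)%:~R)).
- by rewrite Fw_int; apply: hx.1.
- exact: IH.
- by rewrite -intrD addrC.
Qed.

Lemma G1 j : G 1 j = F m j.
Proof.
rewrite -pow_G pow1 ?Fw_int // => w' *; [exact: F_sub|exact: Fw_mono].
Qed.

(** The corresponding piece of t chi, so that the quotients of [chi_part] by it form the coordinate
    ring of the central fibre. *)
Definition chi_lower k i := G k (i - 1).

Local Notation Q := chi_lower.

Lemma bideal_Q : bideal x d w Q.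
Proof.
split=> [k i|j k i g jd hg]; first exact: subsp_G.
by rewrite /chi_lower addrAC; apply: G_mull.
Qed.

Lemma Q_G k i : Q k i `<=` G k i.
Proof. by apply: G_le; rewrite gerBl. Qed.

Lemma addmon_Q k i : addmon x d w Q k i = G k i.
Proof.
apply/seteqP; split.
  apply: span_min; first exact: subsp_G.
  move=> g [/Q_G//|[u [um ui] <-]]; apply: span_mem; exists u => //.
  by split=> //; rewrite ui.
apply: span_min; first exact: subsp_span.
move=> _ [u [um ui] <-]; move: ui; rewrite le_eqVlt => /orP[/eqP ui|ui].
  by apply: span_mem; right; exists u.
apply: addmon_sub; apply: span_mem; exists u => //; split=> //; lia.
Qed.

Definition chi_std := std x d w Q.

Local Notation D := chi_std.

Lemma D_down : downset d [set` D].
Proof. exact/std_down/bideal_Q. Qed.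

Lemma fg_G k i : fg [set 0] (G k i).
Proof.
apply: fg_sub (sr_fg hR (m * k)%N); rewrite -pow_G; exact: pow_Fw_R.
Qed.

Lemma qdim_G k i : qdim (G k (i - 1)) (G k i) =
  count (fun u : seq nat => D u && (mwt d w u == i)) (monos d k).
Proof.
by rewrite -[G k (i - 1)]/(Q k i) -addmon_Q qdim_stdw ?size_filter //; apply: bideal_Q.
Qed.

Lemma vdim_G k i : vdim (G k i) =
  count (fun u : seq nat => D u && (mwt d w u <= i)) (monos d k).
Proof.
pose B := (\sum_(u <- monos d k) `|mwt d w u|)%N.
have hB (u : seq nat) : u \in monos d k -> - B%:Z <= mwt d w u.
  by move=> um; rewrite /B (big_rem u) //=; lia.
have base j : j < - B%:Z ->
    vdim (G k j) = count (fun u : seq nat => D u && (mwt d w u <= j)) (monos d k).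
  move=> jB; have -> : G k j = [set 0].
    apply/seteqP; split; last by move=> v ->; apply: span0.
    apply: span_min; first exact: subsp_set0.
    move=> _ [u [um ui] <-]; have := hB _ um; lia.
  rewrite (@eq_in_count _ _ pred0) ?count_pred0.
    rewrite /vdim (@qdim_seq _ _ _ _ _ [::] (fun _ : nat => 0)) //; try exact: subsp_set0.
    by move=> v -> ; exists (fun=> 0); rewrite big_nil subr0.
  by move=> u um /=; have := hB _ um; case: (D u) => //=; lia.
have [lt|ge] := ltP i (- B%:Z); first exact: base.
have [n ->] : exists n : nat, i = - B%:Z - 1 + n%:Z by exists `|(i + B%:Z + 1)%R|%N; lia.
elim: n => [|n IH]; first by apply: base; lia.
rewrite (vdim_qdim (subsp_G k (- B%:Z - 1 + n%:Z)) (subsp_G _ _) _ (fg_G _ _)); last first.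
  by apply: G_le; lia.
have e : - B%:Z - 1 + n%:Z = - B%:Z - 1 + n.+1%:Z - 1 by lia.
rewrite IH {2}e qdim_G -count_predUI [X in (_ + X)%N](_ : _ = 0%N) ?addn0; last first.
  by apply/eqP; rewrite -leqn0 leqNgt -has_count; apply/hasPn => u _ /=; lia.
by apply: eq_count => u /=; case: (D u) => //=; lia.
Qed.

Lemma pow_count k (q : rat) : vdim (pow k Fw q) =
  count (fun u : seq nat => D u && ((mwt d w u)%:~R <= q)) (monos d k).
Proof.
rewrite pow_floor pow_G vdim_G; apply: eq_count => u.
by rewrite floor_ge_int.
Qed.

Lemma R_count k : (0 < k)%N -> vdim (R (m * k)%N) = count D (monos d k).
Proof.
move=> k0; rewrite sr_prods ?muln_gt0 ?m0 //.
have [_ h2 _ [hi h4] _] := filt_pow k Fw_filt.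
pose B := (\sum_(u <- monos d k) `|mwt d w u|)%N.
have -> : prods k (R m) = pow k Fw (Num.max hi B%:R).
  apply/seteqP; split; last exact: h2.
  by move=> v /h4; apply: pow_le; rewrite le_max lexx.
rewrite pow_count; apply: eq_in_count => u um; case: (D u) => //=.
rewrite le_max; apply/orP; right; rewrite -[B%:R]/(B%:Z%:~R) ler_int.
by rewrite /B (big_rem u) //=; lia.
Qed.

End Generators.
End Filtered.
End GradedDomain.

(** * The central fibre *)

Lemma near_infty (P : nat -> Prop) :
  (\forall e \near \oo, P e) <-> exists N, forall e, (N <= e)%N -> P e.
Proof.
split=> [[N _ h]|[N h]]; first by exists N => e Ne; apply: h.
by exists N => // e; apply: h.
Qed.

Lemma uniform_bound (P : nat -> nat -> Prop) d :
  (forall b, (b < d)%N -> exists N, forall e, (N <= e)%N -> P b e) ->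
  exists N, forall b, (b < d)%N -> forall e, (N <= e)%N -> P b e.
Proof.
elim: d => [|d IH] h; first by exists 0%N.
have [N hN] := IH (fun b bd => h b (ltnW bd)); have [N' hN'] := h d (ltnSn d).
exists (N + N')%N => b; rewrite ltnS leq_eqVlt => /orP[/eqP ->|bd] e ee.
  by apply: hN'; lia.
by apply: hN => //; lia.
Qed.

Lemma qdim_iso (K : fieldType) (E E' : lmodType K) (U V : set E) (U' V' : set E')
  (f : E -> E') : is_subspace U -> is_subspace V -> is_subspace U' -> is_subspace V' ->
  U' 0 -> (forall a u v, f (a *: u + v) = a *: f u + f v) ->
  fg U V -> (forall v, V v -> V' (f v)) -> (forall v, V v -> U' (f v) <-> U v) ->
  (forall v', V' v' -> exists v, V v /\ U' (v' - f v)) ->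
  qdim U' V' = qdim U V.
Proof.
move=> hU hV hU' hV' _ lf fgV h1 h2 h3.
have f0 : f 0 = 0.
  by have := lf 1 0 0; rewrite !scale1r addr0 => h; apply: (addrI (f 0)); rewrite addr0 -h.
have fsum d (c : 'I_d -> K) (b : 'I_d -> E) :
    f (\sum_i c i *: b i) = \sum_i c i *: f (b i).
  by apply: (big_ind2 (fun u v => f u = v)) => // [u v u' v' <- <-|i _];
    [rewrite -[u]scale1r lf !scale1r|rewrite -[_ *: _]addr0 lf f0 !addr0].
have [b /(basis_modP _ hU hV)[b1 b2 b3]] := qdim_basis hU hV fgV.
apply: (qdimE (b := f \o b)) => //; apply/(basis_modP _ hU' hV'); split=> /=.
- by move=> i; apply: h1.
- move=> c; rewrite -fsum => /h2 hc; apply: b2; apply: hc.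
  exact: (subsp_lin _ hV).
- move=> v' /h3[v [Vv hv]]; have [c hc] := b3 v Vv; exists c; rewrite -fsum.
  have Vc : V (v - \sum_i c ord0 i *: b i).
    by apply: (subspB hV) => //; apply: (subsp_lin _ hV).
  have := (h2 _ Vc).2 hc; rewrite -scaleN1r addrC lf scaleN1r addrC => hfc.
  by have := subspD hU' hv hfc; rewrite addrA subrK.
Qed.

Section Serre.
Variables (K : closedFieldType) (T : Type).
Variables (R : nat -> set (fn K T)).
Hypothesis hR : section_ring R.
Variable F : nat -> int -> set (fn K T).
Hypothesis hF : admissible R F.
Variable m : nat.
Hypothesis m0 : (0 < m)%N.
Variables (x : nat -> fn K T) (d : nat) (w : nat -> int).
Hypothesis hx : filt_gens F m x d w.

Local Notation G := (chi_part x d w).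
Local Notation Q := (chi_lower x d w).

Let subG k i : is_subspace (G k i) := subsp_G x d w k i.
Let subQ k i : is_subspace (Q k i) := subsp_G x d w k (i - 1).
Let xF b : (b < d)%N -> G 1 (w b) (x b).
Proof. by move=> bd; rewrite (G1 hF m0 hx); apply: hx.1. Qed.

(** Stability under the [x j] and under t, that is, under chi; [monotone_mul] is the form in which
    this is used. *)
Definition monotone_family (I : nat -> int -> set (fn K T)) :=
  bideal x d w I /\ forall k i j, i <= j -> I k i `<=` I k j.

Lemma monotone_G : monotone_family G.
Proof.
by split=> [|k i j]; [split=> [//|j k i g]; exact: G_mull|exact: G_le].
Qed.

Lemma monotone_Q : monotone_family Q.
Proof.
by split=> [|k i j ij]; [exact: bideal_Q|apply: G_le; rewrite lerD2r].
Qed.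

Lemma monotone_mul I k i j f g : monotone_family I ->
  G 1 j f -> I k i g -> I k.+1 (i + j) (f * g).
Proof.
move=> [[h1 h2] h3]; rewrite (G1 hF m0 hx) => /hx.2 hf hg; rewrite mulrC; move: hf.
apply: (span_min (V := [set f | I k.+1 (i + j) (g * f)])).
  exact/subsp_mull/h1.
move=> _ [l [ld wl] <-] /=; rewrite mulrC.
by apply: (h3 _ _ _ _ _ (h2 _ _ _ _ ld hg)); rewrite lerD2l.
Qed.

Lemma monotone_exp I k i j f g e : monotone_family I ->
  G 1 j f -> I k i g -> I (k + e)%N (i + e%:Z * j) (f ^+ e * g).
Proof.
move=> hI hf hg; elim: e => [|e IH]; first by rewrite addn0 mul0r addr0 mul1r.
rewrite addnS exprS -mulrA (_ : i + _ = i + e%:Z * j + j); last by rewrite -addn1 PoszD; ring.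
exact: (monotone_mul hI).
Qed.

(** The preimage in chi of the elements of A = chi / t chi that vanish on the charts x_b <> 0 for b
    < a. These ideals decrease from [G], for a = 0, to the preimage of the torsion under the
    irrelevant ideal, for a = d. *)
Definition tors a k i : set (fn K T) := [set g | G k i g /\
  forall b, (b < a)%N -> (b < d)%N -> exists e, Q (k + e)%N (i + e%:Z * w b) (x b ^+ e * g)].

Lemma monotone_tors a : monotone_family (tors a).
Proof.
split; first split.
- move=> k i; split=> [|c u v [u1 u2] [v1 v2]].
    split=> [|b _ _]; first exact: (subsp0 (subG _ _)).
    by exists 0%N; rewrite mulr0; apply: (subsp0 (subQ _ _)).
  split=> [|b ba bd]; first exact: (subG k i).2.
  have [e he] := u2 b ba bd; have [e' he'] := v2 b ba bd; exists (e + e')%N.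
  have -> : x b ^+ (e + e') * (c *: u + v) =
      c *: (x b ^+ e' * (x b ^+ e * u)) + x b ^+ e * (x b ^+ e' * v).
    by rewrite mulrDr -fn_scalerAr exprD !mulrA [x b ^+ e' * _]mulrC.
  have e1 : (k + (e + e') = k + e + e')%N by lia.
  have e2 : i + (e + e')%N%:Z * w b = i + e%:Z * w b + e'%:Z * w b.
    by rewrite PoszD; ring.
  rewrite {1}e1 e2; apply: (subQ _ _).2.
    by apply: (monotone_exp _ monotone_Q (xF bd)).
  rewrite -e1 -e2 (_ : (k + (e + e') = k + e' + e)%N); last lia.
  rewrite (_ : i + (e + e')%N%:Z * w b = i + e'%:Z * w b + e%:Z * w b).
    by apply: (monotone_exp _ monotone_Q (xF bd)).
  by rewrite PoszD; ring.
- move=> j k i g jd [g1 g2]; split=> [|b ba bd]; first exact: G_mull.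
  have [e he] := g2 b ba bd; exists e.
  rewrite mulrCA addSn addrAC; exact: (bideal_Q x d w).2.
- move=> k i j ij g [g1 g2]; split=> [|b ba bd]; first exact: G_le g1.
  have [e he] := g2 b ba bd; exists e; apply: monotone_Q.2 he; lia.
Qed.

Lemma tors0 k i : tors 0 k i = G k i.
Proof. by apply/seteqP; split=> [g []//|g hg]; split. Qed.

Lemma Q_tors a k i : Q k i `<=` tors a k i.
Proof.
move=> g hg; split=> [|b _ _]; first exact: Q_G hg.
by exists 0%N; rewrite addn0 mul0r addr0 mul1r.
Qed.

Lemma tors_G a k i : tors a k i `<=` G k i. Proof. by move=> g []. Qed.

(** In other words, [x a] is a nonzerodivisor on the quotient of [tors a] by [tors a.+1]. *)
Lemma torsS_exp a k i e g : (a < d)%N -> tors a k i g ->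
  tors a.+1 (k + e)%N (i + e%:Z * w a) (x a ^+ e * g) -> tors a.+1 k i g.
Proof.
move=> ad [g1 g2] [_ h]; split=> // b; rewrite ltnS leq_eqVlt => /orP[/eqP ->|ba] bd.
  have [e' he'] := h a (ltnSn a) ad; exists (e + e')%N.
  rewrite addnA PoszD mulrDl addrA exprD [x a ^+ e * _]mulrC -mulrA //.
exact: g2.
Qed.

Lemma tors_d : exists k0, forall k, (k0 <= k)%N -> forall i, tors d k i `<=` Q k i.
Proof.
have [k0 hk0] := bideal_saturated (bideal_Q x d w).
exists k0 => k kk i g [g1 g2]; apply: hk0 => //; first by rewrite (addmon_Q m0).
by move=> j jd; apply: g2.
Qed.

(* the ideal x a * tors a + tors (a + 1), where [k.-1] is harmless for k = 0 since
   then h = 0 *)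
Definition torsM a k i : set (fn K T) := [set g | exists h h',
  [/\ tors a k.-1 (i - w a) h, k = 0%N -> h = 0, tors a.+1 k i h' & g = x a * h + h']].

Lemma bideal_torsM a : bideal x d w (torsM a).
Proof.
have [[t1 t2] t3] := monotone_tors a; have [[s1 s2] s3] := monotone_tors a.+1.
split=> [k i|j k i _ jd [h [h' [h1 h2 h3 ->]]]].
  split.
    exists 0, 0; split=> //; last by rewrite mulr0 addr0.
      exact: (subsp0 (t1 _ _)).
    exact: (subsp0 (s1 _ _)).
  move=> c _ _ [u [u' [u1 u2 u3 ->]]] [v [v' [v1 v2 v3 ->]]].
  exists (c *: u + v), (c *: u' + v'); split.
  - exact: (t1 _ _).2.
  - by move=> k0; rewrite u2 // v2 // scaler0 addr0.
  - exact: (s1 _ _).2.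
  - by rewrite mulrDr scalerDr -fn_scalerAr addrACA.
exists (x j * h), (x j * h'); split=> //.
- rewrite /= addrAC; case: k h1 h2 {h3} => [|k] h1 h2; last exact: t2.
  by rewrite h2 // mulr0; apply: (subsp0 (t1 _ _)).
- exact: s2.
- by rewrite mulrDr; congr (_ + _); rewrite mulrCA.
Qed.

Lemma torsM_saturated a : exists k0, forall k i g, (k0 <= k)%N -> G k i g ->
  (forall j, (j < d)%N -> exists e, torsM a (k + e)%N (i + e%:Z * w j) (x j ^+ e * g)) ->
  torsM a k i g.
Proof.
have [k0 hk0] := bideal_saturated (bideal_torsM a).
exists k0 => k i g kk hg; apply: hk0 => //.
have := hg; rewrite -(addmon_Q m0); apply: addmon_mono => {hg}g hg.
have [[t1 t2] t3] := monotone_tors a.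
exists 0, g; split=> //; [exact: (subsp0 (t1 _ _))|exact: Q_tors|by rewrite mulr0 add0r].
Qed.

(* Fixing this structure spares costly unifications. *)
Let S : lmodType K := (int -> fn K T -> nat -> fn K T).

Definition values_in (I : nat -> int -> set (fn K T)) k i
    (sigma : S) :=
  forall j f, G 1 j f -> \forall e \near \oo, I (k + e)%N (i + e%:Z * j) (sigma j f e).

(** The canonical map from A_k to the sections of k L_0, lifted to chi: on the chart of f, the
    fraction f^e g / f^e. *)
Definition theta (g : fn K T) : S := fun j f e => f ^+ e * g.

Lemma subsp_values_in I k i : (forall k i, is_subspace (I k i)) ->
  is_subspace (values_in I k i : set S).
Proof.
move=> hI; split=> [j f _|a s s' h h' j f hf].
  by apply/near_infty; exists 0%N => e _; apply: (subsp0 (hI _ _)).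
move/near_infty: (h j f hf) => [N hN]; move/near_infty: (h' j f hf) => [N' hN'].
apply/near_infty; exists (N + N')%N => e ee; apply: (hI _ _).2; [apply: hN|apply: hN']; lia.
Qed.

Lemma subsp_sections0 k i : is_subspace (sections0 G k i : set S).
Proof.
split.
  split=> [j f hf|j f j' f' hf hf']; apply/near_infty; exists 0%N => e _.
    by rewrite mulr0 subrr; split; apply: (subsp0 (subG _ _)).
  by rewrite !mulr0 subrr; apply: (subsp0 (subG _ _)).
move=> a s s' [h1 h2] [h1' h2']; split.
  move=> j f hf; move/near_infty: (h1 j f hf) => [N hN].
  move/near_infty: (h1' j f hf) => [N' hN'].
  apply/near_infty; exists (N + N')%N => e ee.
  have /hN[p1 p2] : (N <= e)%N by lia.
  have /hN'[p1' p2'] : (N' <= e)%N by lia.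
  split; first exact: (subG _ _).2.
  rewrite (_ : _ - _ = a *: (s j f e.+1 - f * s j f e) + (s' j f e.+1 - f * s' j f e)).
    exact: (subG _ _).2.
  by rewrite mulrDr -fn_scalerAr scalerBr opprD addrACA.
move=> j f j' f' hf hf'; move/near_infty: (h2 j f j' f' hf hf') => [N hN].
move/near_infty: (h2' j f j' f' hf hf') => [N' hN'].
apply/near_infty; exists (N + N')%N => e ee.
rewrite (_ : _ - _ = a *: (f' ^+ e * s j f e - f ^+ e * s j' f' e) +
  (f' ^+ e * s' j f e - f ^+ e * s' j' f' e)).
  by apply: (subG _ _).2; [apply: hN|apply: hN']; lia.
by rewrite !mulrDr -!fn_scalerAr scalerBr opprD addrACA.
Qed.

Lemma subsp_null_sections0 k i : is_subspace (null_sections0 G k i : set S).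
Proof.
have [h1 h2] := subsp_sections0 k i; have [h3 h4] := subsp_values_in k i subQ.
split; first by split.
by move=> a u v [u1 u2] [v1 v2]; split; [exact: h2|exact: h4].
Qed.

Lemma theta_sections0 k i g : G k i g -> sections0 G k i (theta g).
Proof.
move=> hg; split=> [j f hf|j f j' f' hf hf']; apply/near_infty; exists 0%N => e _.
  split; first exact: (monotone_exp _ monotone_G).
  by rewrite /theta exprS mulrA subrr; apply: (subsp0 (subG _ _)).
rewrite /theta !mulrA [f' ^+ e * _]mulrC subrr; exact: (subsp0 (subG _ _)).
Qed.

Lemma theta_values I k i g : monotone_family I -> I k i g -> values_in I k i (theta g).
Proof.
move=> hI hg j f hf; apply/near_infty; exists 0%N => e _.
exact: (monotone_exp _ hI).
Qed.

Lemma sections0_values k i s : sections0 G k i s -> values_in G k i s.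
Proof.
move=> [h _] j f hf; move/near_infty: (h j f hf) => [N hN].
by apply/near_infty; exists N => e /hN[].
Qed.

(* A section s with values in tors a is lifted to g step by step, from
   x a ^ E s down to s, using the saturation of torsM a. *)
Lemma tors_lift a : (a < d)%N -> exists k0, forall k, (k0 <= k)%N -> forall i (s : S),
  sections0 G k i s -> values_in (tors a) k i s ->
  exists g, tors a k i g /\ values_in (tors a.+1) k i (s - theta g).
Proof.
move=> ad; have [k0 hk0] := torsM_saturated a; exists k0 => k kk i s hs vs.
have [[t1 t2] t3] := monotone_tors a; have [[s1 s2] s3] := monotone_tors a.+1.
have xa := xF ad.
pose t := s (w a) (x a).
(* Only the finitely many charts x_b <> 0 enter, so one threshold serves for all these
   conditions. *)
have rel n : exists N, (n <= N)%N /\ forall e, (N <= e)%N ->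
    [/\ tors a (k + e)%N (i + e%:Z * w a) (t e),
        Q (k + e.+1)%N (i + e.+1%:Z * w a) (t e.+1 - x a * t e) &
        forall b, (b < d)%N ->
          tors a (k + e)%N (i + e%:Z * w b) (s (w b) (x b) e) /\
          Q (k + e + e)%N (i + e%:Z * (w a + w b))
            (x b ^+ e * t e - x a ^+ e * s (w b) (x b) e)].
  have [N1 hN1] := (near_infty _).1 (vs _ _ xa).
  have [N2 hN2] := (near_infty _).1 (hs.1 _ _ xa).
  have [N3 hN3] : exists N3, forall b, (b < d)%N -> forall e, (N3 <= e)%N ->
      tors a (k + e)%N (i + e%:Z * w b) (s (w b) (x b) e) /\
      Q (k + e + e)%N (i + e%:Z * (w a + w b))
            (x b ^+ e * t e - x a ^+ e * s (w b) (x b) e).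
    apply: uniform_bound => b bd; have [N4 hN4] := (near_infty _).1 (vs _ _ (xF bd)).
    have [N5 hN5] := (near_infty _).1 (hs.2 _ _ _ _ xa (xF bd)).
    exists (N4 + N5)%N => e ee; split; [apply: hN4|apply: hN5]; lia.
  exists (n + N1 + N2 + N3)%N; split; first lia.
  move=> e ee; split; first by apply: hN1; lia.
    by have [|_] := hN2 e; [lia|].
  by move=> b bd; apply: hN3 => //; lia.
have [E [_ hE]] := rel 0%N.
(* Descent from t E, which represents x_a^E s, to degree k: at stage n, g represents x_a^(E - n) s
   modulo [tors a.+1]. *)
have step n : (n <= E)%N -> exists g, tors a (k + (E - n))%N (i + (E - n)%N%:Z * w a) g /\
    forall e, tors a.+1 (k + E + e)%N (i + (E + e)%N%:Z * w a)
        (x a ^+ (n + e) * g - t (E + e)%N).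
  elim: n => [_|n IH nE].
    exists (t E); rewrite subn0; split; first by have [] := hE E (leqnn E).
    elim=> [|e IHe].
      by rewrite !addn0 mul1r subrr; apply: (subsp0 (s1 _ _)).
    have [_ h _] := hE (E + e)%N (leq_addr _ _).
    have e1 : i + (E + e.+1)%N%:Z * w a = i + (E + e)%N%:Z * w a + w a.
      by rewrite addnS -[(E + e).+1]addn1 PoszD; ring.
    have -> : x a ^+ (0 + e.+1) * t E - t (E + e.+1)%N =
      x a * (x a ^+ (0 + e) * t E - t (E + e)%N) - (t (E + e.+1)%N - x a * t (E + e)%N).
      by rewrite !add0n exprS mulrBr mulrA; ring.
    apply: (subspB (s1 _ _)).
      by rewrite addnS e1; apply: s2.
    by apply: Q_tors; rewrite -addnA addnS; exact: h.
  have [g [g1 g2]] := IH (ltnW nE).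
  (* By the gluing condition, x_b^E g is x_a times a value of s on the chart of x_b, modulo
     [tors a.+1]. Saturation then allows g itself to be divided by x_a. *)
  have : torsM a (k + (E - n))%N (i + (E - n)%N%:Z * w a) g.
    apply: hk0; [lia|exact: tors_G g1|move=> b bd].
    have [_ _ /(_ b bd)[sb1 sb2]] := hE E (leqnn E).
    exists E; pose h := x a ^+ (E - n).-1 * s (w b) (x b) E.
    have hh : tors a (k + E + (E - n).-1)%N (i + E%:Z * w b + (E - n).-1%:Z * w a) h.
      exact: (monotone_exp _ (monotone_tors a)).
    exists h, (x b ^+ E * g - x a * h); split.
    - rewrite (_ : (k + (E - n) + E).-1 = k + E + (E - n).-1)%N; last lia.
      rewrite (_ : _ - w a = i + E%:Z * w b + (E - n).-1%:Z * w a) //.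
      have -> : (E - n)%N = ((E - n).-1 + 1)%N by lia.
      by rewrite addn1 /= -[(E - n).-1.+1]addn1 PoszD; ring.
    - by lia.
    - rewrite [x a * h]mulrA -exprS (_ : (E - n).-1.+1 = E - n)%N; last lia.
      apply: (@torsS_exp _ _ _ n) => //.
        apply: (subspB (t1 _ _)); first exact: (monotone_exp _ (monotone_tors a) (xF bd)).
        rewrite -addnA addrAC [((E - n) + E)%N]addnC addnA.
        exact: (monotone_exp _ (monotone_tors a) xa).
      rewrite mulrBr mulrCA [x a ^+ n * (_ * _)]mulrA -exprD subnKC; last exact: ltnW.
      have -> : x b ^+ E * (x a ^+ n * g) - x a ^+ E * s (w b) (x b) E =
        x b ^+ E * (x a ^+ (n + 0) * g - t (E + 0)%N) +
        (x b ^+ E * t E - x a ^+ E * s (w b) (x b) E).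
        by rewrite !addn0; ring.
      have e1 : (k + (E - n) + E + n = k + E + E)%N by lia.
      have e2 : i + (E - n)%N%:Z * w a + E%:Z * w b + n%:Z * w a = i + E%:Z * (w a + w b).
        by rewrite -subzn ?(ltnW nE) //; ring.
      rewrite e1 e2; apply: (subspD (s1 _ _)); last exact: Q_tors.
      have := monotone_exp E (monotone_tors a.+1) (xF bd) (g2 0%N).
      by rewrite !addn0 -addrA -mulrDr; apply.
    - by rewrite subrKC.
  move=> [h [h' [h1 _ h3 gE]]]; exists h.
  rewrite (_ : (E - n.+1 = (E - n).-1)%N); last lia.
  have e1 : i + (E - n).-1%:Z * w a = i + (E - n)%N%:Z * w a - w a.
    have -> : (E - n)%N = ((E - n).-1 + 1)%N by lia.
    by rewrite addn1 /= -[(E - n).-1.+1]addn1 PoszD; ring.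
  split; first by rewrite e1 (_ : (k + (E - n).-1 = (k + (E - n)).-1)%N) //; lia.
  move=> e.
  have -> : x a ^+ (n.+1 + e) * h - t (E + e)%N =
    (x a ^+ (n + e) * g - t (E + e)%N) - x a ^+ (n + e) * h'.
    by rewrite gE addSn exprSr; ring.
  apply: (subspB (s1 _ _)); first exact: g2.
  have := monotone_exp (n + e) (monotone_tors a.+1) xa h3.
  rewrite (_ : (k + (E - n) + (n + e) = k + E + e)%N); last lia.
  rewrite -addrA -mulrDl -PoszD (_ : (E - n + (n + e) = E + e)%N) //; lia.
have [g] := step E (leqnn E); rewrite subnn addn0 mul0r addr0 => -[g1 g2].
(* For an arbitrary f, the gluing condition with the chart of x_a controls x_a^e times the
   difference, and [torsS_exp] cancels x_a^e. *)
exists g; split=> // j f hf.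
have [N1 hN1] := (near_infty _).1 (vs _ _ hf).
have [N2 hN2] := (near_infty _).1 (hs.2 _ _ _ _ hf xa).
apply/near_infty; exists (N1 + N2 + E)%N => e ee.
have tau1 : tors a (k + e)%N (i + e%:Z * j) ((s - theta g : S) j f e).
  apply: (subspB (t1 _ _)); first by apply: hN1; lia.
  exact: (monotone_exp _ (monotone_tors a)).
apply: (@torsS_exp _ _ _ e) => //.
have -> : x a ^+ e * (s - theta g : S) j f e =
  (x a ^+ e * s j f e - f ^+ e * t e) - f ^+ e * (x a ^+ e * g - t e).
  change ((s - theta g : S) j f e) with (s j f e - f ^+ e * g).
  by rewrite !mulrBr [x a ^+ e * (f ^+ e * g)]mulrCA opprB addrA addrNK.
apply: (subspB (s1 _ _)).
  apply: Q_tors; rewrite -addrA -mulrDr; apply: hN2; lia.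
have /(monotone_exp e (monotone_tors a.+1) hf) := g2 (e - E)%N.
rewrite -(addnA k) !subnKC ?[(e * j)%:Z]addrC; try lia.
by rewrite -!addrA [e%:Z * j + _]addrC; apply.
Qed.

(** [tors_lift] is applied for a = 0, ..., d - 1. Each time the remaining section takes its values
    in a smaller torsion ideal, and in large degree the last one is contained in t chi. *)
Lemma theta_onto : exists k0, forall k, (k0 <= k)%N -> forall i (s : S),
  sections0 G k i s -> exists g, G k i g /\ null_sections0 G k i (s - theta g).
Proof.
have [kd hkd] := tors_d.
have claim a : (a <= d)%N -> exists k0, forall k, (k0 <= k)%N -> forall i (s : S),
  sections0 G k i s -> values_in (tors (d - a)) k i s ->
  exists g, G k i g /\ null_sections0 G k i (s - theta g).
  elim: a => [_|a IH ad].
    exists kd => k kk i s hs; rewrite subn0 => vs; exists 0.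
    split; first exact: (subsp0 (subG _ _)).
    have -> : s - theta 0 = s.
      apply/funext => j; apply/funext => f; apply/funext => e.
      by change (s j f e - f ^+ e * 0 = s j f e); rewrite mulr0 subr0.
    split=> // j f hf; have [N hN] := (near_infty _).1 (vs _ _ hf).
    apply/near_infty; exists N => e /hN; apply: hkd; lia.
  have [k1 hk1] := IH (ltnW ad).
  have [|k2 hk2] := @tors_lift (d - a.+1)%N; first lia.
  exists (k1 + k2)%N => k kk i s hs vs.
  have [|g [g1 g2]] := hk2 k _ i s hs vs; first lia.
  have gG := tors_G g1.
  have [|||g' [g'1 g'2]] := hk1 k _ i (s - theta g); first lia.
  - exact: (subspB (subsp_sections0 _ _) hs (theta_sections0 gG)).
  - by rewrite (_ : (d - a = (d - a.+1).+1)%N) //; lia.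
  exists (g + g'); split; first exact: (subspD (subG _ _)).
  rewrite (_ : s - _ = s - theta g - theta g') //.
  apply/funext => j; apply/funext => f; apply/funext => e.
  change (s j f e - f ^+ e * (g + g') = s j f e - f ^+ e * g - f ^+ e * g').
  by rewrite mulrDr opprD addrA.
have [k0 hk0] := claim d (leqnn d); exists k0 => k kk i s hs.
apply: hk0 => //; rewrite subnn => j f hf.
have [N hN] := (near_infty _).1 (sections0_values hs hf).
by apply/near_infty; exists N => e /hN; rewrite tors0.
Qed.

(** Serre's theorem for A: in large degree, [theta] is onto by [theta_onto], and injective modulo t
    chi because this ideal is saturated there. *)
Lemma h0_count : exists k0, forall k, (k0 <= k)%N -> forall i,
  h0 (approx_filtration R F m) k i =
  count (fun u : seq nat => chi_std x d w u && (mwt d w u == i)) (monos d k).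
Proof.
have -> : approx_filtration R F m = G.
  by apply/funext => k; apply/funext => i; rewrite (approxE hR hF m0) (pow_G m0 hx).
have [k1 hk1] := theta_onto; have [k2 hk2] := bideal_saturated (bideal_Q x d w).
exists (k1 + k2)%N => k kk i; rewrite -(qdim_G m0).
apply: (@qdim_iso _ _ _ _ _ _ _ theta) => //.
- exact: subsp_null_sections0.
- exact: subsp_sections0.
- exact: (subsp0 (subsp_null_sections0 _ _)).
- move=> a u v; apply/funext => j; apply/funext => f; apply/funext => e.
  by rewrite !fctE /theta mulrDr -fn_scalerAr.
- apply: fg_mod (fg_G hR hF m0 hx k i) => _ ->; exact: (subsp0 (subG _ _)).
- by move=> v; apply: theta_sections0.
- move=> v hv; split=> [[_ h]|h]; last first.
    by split; [apply: theta_sections0|apply: (@theta_values Q) => //; apply: monotone_Q].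
  apply: hk2; [lia|by rewrite (addmon_Q m0)|move=> j jd].
  have [N hN] := (near_infty _).1 (h _ _ (xF jd)).
  by exists N; apply: hN.
- by move=> s hs; apply: hk1 => //; lia.
Qed.

End Serre.

(** * Spectra and angles *)

Section CountingFunctions.
Implicit Types (s t : seq rat).

Local Notation cnt s q := (count (fun w => w <= q) s).

(** The hypothesis allows each element of s, taken in increasing order, to be matched with an
    element of t of its own that is not larger. *)
Lemma count_dom_ind (Rel : seq rat -> seq rat -> Prop) :
  (forall t, Rel [::] t) -> (forall a b s t t', b <= a -> perm_eq t' (b :: t) ->
     Rel s t -> Rel (a :: s) t') ->
  forall s t, sorted <=%R s -> (forall q, (cnt s q <= cnt t q)%N) -> Rel s t.
Proof.
move=> h0 h1; elim=> [|a s IH] t //= ss hst.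
have sa x : x \in s -> a <= x.
  by move: ss; rewrite (path_sortedE (@le_trans _ _)) => /andP[/allP h _]; apply: h.
have /hasP[b bt ba] : has (fun w => w <= a) t.
  by rewrite has_count; apply: leq_trans (hst a); rewrite lexx.
have pt := perm_to_rem bt; apply: (h1 a b s (rem b t)) => //; apply: IH.
  exact: path_sorted ss.
move=> q; have := hst q; rewrite (permP pt) /=; have [aq|qa] := leP a q.
  by rewrite (le_trans ba aq) leq_add2l.
move=> _; rewrite (_ : cnt s q = 0%N) //; apply/eqP; rewrite -leqn0 leqNgt -has_count.
by apply/hasPn => x /sa ax; rewrite -ltNge; apply: lt_le_trans ax.
Qed.

Lemma count_dom (RR : realDomainType) (phi : rat -> RR) s t :
  (forall q, (cnt s q <= cnt t q)%N) ->
  (forall x y, x <= y -> phi y <= phi x) -> (forall x, 0 <= phi x) ->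
  \sum_(w <- s) phi w <= \sum_(w <- t) phi w.
Proof.
move=> hst h1 h2; have ps := permEl (perm_sort <=%R s).
rewrite -(perm_big _ ps) /=.
apply: (count_dom_ind (Rel := fun s t => \sum_(w <- s) phi w <= \sum_(w <- t) phi w)).
- by move=> t'; rewrite big_nil; apply: sumr_ge0.
- move=> a b s' t' t'' ba pt IH; rewrite (perm_big _ pt) !big_cons.
  by apply: lerD => //; apply: h1.
- by apply: sort_sorted; apply: le_total.
- by move=> q; rewrite (permP ps).
Qed.

Lemma count_le_size s t : (forall q, (cnt s q <= cnt t q)%N) -> (size s <= size t)%N.
Proof.
move=> h; have := @count_dom int (fun=> 1) s t h (fun _ _ _ => lexx _) (fun=> ler01).
by rewrite !big_const_seq !count_predT !iter_addr_0 ler_nat.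
Qed.

Lemma count_perm s t : (forall q, cnt s q = cnt t q) -> perm_eq s t.
Proof.
move=> h; have ps := permEl (perm_sort <=%R s).
suff : perm_eq (sort <=%R s) t by apply: perm_trans; rewrite perm_sym.
suff : size t = size s -> perm_eq (sort <=%R s) t.
  apply; apply/eqP; rewrite eqn_leq; apply/andP; split;
  by apply: count_le_size => q; rewrite h.
move=> e; move: (perm_size ps) h; rewrite -{}e => e.
have : sorted <=%R (sort <=%R s) by apply: sort_sorted; apply: le_total.
have h' q : cnt (sort <=%R s) q = cnt s q by rewrite (permP ps).
move: h'; move: (sort _ s) e => {ps} r e h' sr h.
have {h' h} : forall q, cnt r q = cnt t q by move=> q; rewrite h' h.
elim: r t e sr => [|a r IH] t e sr h; first by rewrite perm_sym -(size0nil (esym e)).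
have ra x : x \in r -> a <= x.
  by move: sr => /=; rewrite (path_sortedE (@le_trans _ _)) => /andP[/allP h' _]; apply: h'.
have ta x : x \in t -> a <= x.
  move=> xt; have : has (fun w => w <= x) (a :: r).
    by rewrite has_count h -has_count; apply/hasP; exists x.
  move=> /hasP[y]; rewrite inE => /orP[/eqP ->//|/ra ay]; exact: le_trans.
have at_ : a \in t.
  have /hasP[b bt ba] : has (fun w => w <= a) t by rewrite has_count -h /= lexx.
  by rewrite (_ : a = b) //; apply/eqP; rewrite eq_le ba andbT ta.
rewrite perm_sym (perm_trans (perm_to_rem at_)) // perm_cons perm_sym; apply: IH.
- by rewrite size_rem // -e.
- exact: path_sorted sr.
- by move=> q; have := h q; rewrite (permP (perm_to_rem at_)) /= => /addnI.
Qed.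

End CountingFunctions.

Section Spectrum.
Variables (K : closedFieldType) (T : Type).
Implicit Types (W : rat -> set (fn K T)) (V : set (fn K T)).

(** The weights with their multiplicities; by [count_perm], the dimensions determine them up to
    order. *)
Definition is_spectrum W s := forall q : rat, count (fun w => w <= q) s = vdim (W q).

Definition spectrum W : seq rat := xget [::] [set s | is_spectrum W s].

Lemma spectrumP W s : is_spectrum W s -> is_spectrum W (spectrum W) /\ perm_eq (spectrum W) s.
Proof.
move=> hs; have h : is_spectrum W (spectrum W).
  by apply: (@xgetPex _ [::] [set s | is_spectrum W s]); exists s.
by split=> //; apply: count_perm => q; rewrite h hs.
Qed.

(** For a free family that need not be adapted, an inequality remains: its vectors of weight at most
    q are free in [W q]. *)
Lemma free_count_le V W d (b : 'I_d -> fn K T) (q : rat) : filt V W -> fg [set 0] V ->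
  (forall i, V (b i)) -> (forall i, b i <> 0) -> free_mod [set 0] b ->
  (count (fun w : rat => (w <= q)%R) [seq weight W (b i) | i <- enum 'I_d] <= vdim (W q))%N.
Proof.
move=> hf fgV bV b0 fb; case: (hf) => h1 h2 _ _ _.
rewrite count_map -size_filter; set us := seq.filter _ _.
have uus : uniq us by rewrite filter_uniq ?enum_uniq.
have usE i : (i \in us) = (weight W (b i) <= q) by rewrite mem_filter mem_enum andbT.
apply: (@free_seq_le _ _ [set 0] (W q) _ us b) => //.
- exact: subsp_set0.
- by apply: fg_sub fgV; apply: h2.
- by move=> i; rewrite usE => h; apply/(weightP hf).
- move=> c hc i; rewrite usE => iw.
  have /rowP/(_ i) : \row_j (if j \in us then c j else 0) = 0 :> 'rV[K]_d.
    apply: fb; rewrite (_ : \sum_j _ = \sum_(j <- us) c j *: b j) //.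
    rewrite [RHS]big_uniq // [RHS]big_mkcond /=.
    by apply: eq_bigr => j _; rewrite mxE; case: ifP => // _; rewrite scale0r.
  by rewrite !mxE usE iw.
Qed.

End Spectrum.

Section Angles.
Variable RR : realType.
Implicit Types (n : nat).

Definition avg n (a : 'I_n -> RR) := (\sum_i a i) / n%:R.

Lemma sum_dev n (a : 'I_n -> RR) : (0 < n)%N -> \sum_i (a i - avg a) = 0.
Proof.
move=> n0; rewrite sumrB sumr_const card_ord /avg -[_ *+ n]mulr_natr divfK ?subrr //.
by rewrite pnatr_eq0 -lt0n.
Qed.

Lemma sum_sqr_dev n (a : 'I_n -> RR) : (0 < n)%N ->
  \sum_i (a i - avg a) ^+ 2 = \sum_i a i ^+ 2 - n%:R * avg a ^+ 2.
Proof.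
move=> n0; have := sum_dev a n0; set t := avg a => h.
rewrite (eq_bigr (fun i => a i ^+ 2 - t ^+ 2 - 2 * t * (a i - t))); last by move=> i _; ring.
by rewrite sumrB -mulr_sumr h mulr0 subr0 sumrB sumr_const card_ord -[_ *+ n]mulr_natl.
Qed.

Lemma cauchy_schwarz n (x y : 'I_n -> RR) :
  (\sum_i x i * y i) ^+ 2 <= (\sum_i x i ^+ 2) * (\sum_i y i ^+ 2).
Proof.
set p := \sum_i x i ^+ 2; set q := \sum_i y i ^+ 2; set r := \sum_i _.
have h t u : 0 <= t ^+ 2 * p + 2 * t * u * r + u ^+ 2 * q.
  rewrite /p /q /r !mulr_sumr -!big_split /=; apply: sumr_ge0 => i _.
  by rewrite (_ : _ + _ = (t * x i + u * y i) ^+ 2) ?sqr_ge0 //; ring.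
have p0 : 0 <= p by apply: sumr_ge0 => i _; apply: sqr_ge0.
have [pz|pn] := eqVneq p 0.
  have [rz|rn] := eqVneq r 0; first by rewrite rz pz expr0n /= mul0r.
  have q0 : 0 <= q by apply: sumr_ge0 => i _; apply: sqr_ge0.
  have := h (- (q + 1) / (2 * r)) 1; rewrite pz mulr0 add0r !expr1n mulr1 mul1r.
  have -> : 2 * (- (q + 1) / (2 * r)) * r = - (q + 1) by field.
  by lra.
have := h (- r) p; rewrite (_ : _ + _ = p * (p * q - r ^+ 2)); last by ring.
by rewrite pmulr_rge0 ?subr_ge0 // lt_neqAle eq_sym pn.
Qed.

(** With A, B the sums of squared deviations and S the mixed sum, A + B - 2 S is at most the sum of
    the (a_i - b_i)^2, hence at most c e n. Moreover A + B >= 2 sqrt(A B) >= 2 v n. *)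
Lemma angle_close n (a b : 'I_n -> RR) (c e v : RR) : (0 < n)%N -> 0 < v ->
  (forall i, `|a i - b i| <= c) -> \sum_i `|a i - b i| <= e * n%:R ->
  v * n%:R <= \sum_i (a i - avg a) ^+ 2 -> v * n%:R <= \sum_i (b i - avg b) ^+ 2 ->
  let t := (\sum_i (a i - avg a) * (b i - avg b)) /
    Num.sqrt ((\sum_i (a i - avg a) ^+ 2) * (\sum_i (b i - avg b) ^+ 2)) in
  1 - c * e / (2 * v) <= t <= 1.
Proof.
move=> n0 v0 hc he hva hvb; set A := \sum_i (a i - _) ^+ 2 in hva *.
set B := \sum_i (b i - _) ^+ 2 in hvb *; set S := \sum_i (_ * _) => /=.
have nR : 0 < n%:R :> RR by rewrite ltr0n.
have vn : 0 < v * n%:R by rewrite mulr_gt0.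
have A0 : 0 < A by apply: lt_le_trans hva.
have B0 : 0 < B by apply: lt_le_trans hvb.
set g := Num.sqrt (A * B).
have g2 : g ^+ 2 = A * B by rewrite sqr_sqrtr // mulr_ge0 // ltW.
have g0 : 0 < g by rewrite sqrtr_gt0 mulr_gt0.
have gv : v * n%:R <= g.
  rewrite -(@ler_pXn2r _ 2) ?nnegrE ?(ltW g0) ?(ltW vn) // g2 expr2.
  by apply: ler_pM => //; apply: ltW.
have gAB : 2 * g <= A + B.
  rewrite -(@ler_pXn2r _ 2) ?nnegrE //; [|by rewrite mulr_ge0 // ltW|by rewrite addr_ge0 // ltW].
  rewrite exprMn g2 -subr_ge0 (_ : _ - _ = (A - B) ^+ 2) ?sqr_ge0 //; ring.
have c0 : 0 <= c by apply: le_trans (hc (Ordinal n0)).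
have dAB : A + B - 2 * S <= c * (e * n%:R).
  have -> : A + B - 2 * S = \sum_i ((a i - b i) - avg (fun i => a i - b i)) ^+ 2.
    rewrite /A /B /S mulr_sumr -big_split -sumrB /=; apply: eq_bigr => i _.
    by rewrite /avg sumrB; ring.
  rewrite sum_sqr_dev //; apply: le_trans (_ : \sum_i c * `|a i - b i| <= _).
    apply: le_trans (_ : \sum_i (a i - b i) ^+ 2 <= _).
      by rewrite gerBl mulr_ge0 ?sqr_ge0 ?ler0n.
    apply: ler_sum => i _; rewrite -[_ ^+ 2]ger0_norm ?sqr_ge0 // normrX expr2.
    exact: ler_wpM2r.
  by rewrite -mulr_sumr; apply: ler_wpM2l.
apply/andP; split; last first.
  rewrite ler_pdivrMr // mul1r; have [S0|/ltW S0] := leP S 0; first exact: le_trans (ltW g0).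
  by rewrite -(@ler_pXn2r _ 2) ?nnegrE ?(ltW g0) // g2; apply: cauchy_schwarz.
rewrite ler_pdivlMr // mulrBl mul1r.
have hce : 0 <= c * e.
  apply: mulr_ge0 => //; rewrite -(pmulr_lge0 _ nR); apply: le_trans he.
  by apply: sumr_ge0 => i _; apply: normr_ge0.
have : c * e / (2 * v) * (v * n%:R) <= c * e / (2 * v) * g.
  by apply: ler_wpM2l => //; rewrite divr_ge0 // mulr_ge0 // ltW.
have -> : c * e / (2 * v) * (v * n%:R) = c * (e * n%:R) / 2 by field; rewrite gt_eqF.
lra.
Qed.

(** Continuity of acos at 1. Capping y at pi / 2 keeps it where cos is decreasing, and a radius of
    at most 1 keeps t in the domain of acos. *)
Lemma acos_small (eta : RR) : 0 < eta -> exists2 dl : RR, 0 < dl &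
  forall t, 1 - dl <= t <= 1 -> acos t <= eta.
Proof.
move=> eta0; pose y := Num.min eta (pi / 2).
have pi0 := pi_gt0 RR.
have y0 : 0 < y by rewrite lt_min eta0 divr_gt0.
have ypi : y <= pi.
  rewrite ge_min; apply/orP; right; lra.
have cy : cos y < 1.
  rewrite -(cos0 RR) ltr_cos //; rewrite in_itv /=; apply/andP; split=> //; exact: ltW.
exists (Num.min (1 - cos y) 1); first by rewrite lt_min subr_gt0 cy ltr01.
move=> t /andP[t1 t2].
have tc : cos y <= t.
  apply: le_trans t1; rewrite lerBrDr -lerBrDl ge_min lexx //.
have t0 : -1 <= t.
  apply: le_trans t1; rewrite lerBrDl -lerBrDr; apply: (@le_trans _ _ 1); last lra.
  by rewrite ge_min lexx orbT.
have hI : -1 <= t <= 1 by rewrite t0 t2.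
apply: (@le_trans _ _ y); last by rewrite ge_min lexx.
rewrite leNgt; apply/negP => lt.
have : cos (acos t) < cos y.
  have yI : y \in `[0, pi] by rewrite in_itv /= (ltW y0) ypi.
  have aI : acos t \in `[0, pi] by rewrite in_itv /= acos_ge0 // acos_lepi.
  by rewrite ltr_cos.
by rewrite acosK ?in_itv //= ltNge tc.
Qed.

End Angles.

(** * Asymptotics of the weights *)

Section Approximations.
Variables (K : closedFieldType) (T : Type) (RR : realType).
Variables (R : nat -> set (fn K T)).
Hypothesis hR : section_ring R.
Variable F : nat -> int -> set (fn K T).
Hypothesis hF : admissible R F.

Local Notation N r := (vdim (R r)).
Local Notation cnt s q := (count (fun w : rat => (w <= q)%R) s).

Lemma vdim_set0 : vdim [set 0 : fn K T] = 0%N.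
Proof.
rewrite /vdim (@qdim_seq _ _ _ _ _ [::] (fun _ : nat => 0)) //; try exact: subsp_set0.
by move=> v -> ; exists (fun=> 0); rewrite big_nil subr0.
Qed.

(** Linear bounds on the weights of F. The upper one is asked in degree 1 only, as R_1 generates R
    and F is multiplicative. *)
Definition slopes (lo hi : int) := [/\ 0 <= hi, lo <= 0, R 1 `<=` F 1 hi &
  forall k, (0 < k)%N -> F k (lo * k%:Z) = [set 0]].

Lemma slopes_exist : exists lo hi, slopes lo hi.
Proof.
case: hF => _ _ h3 [C [C0 h4]]; have [i0 hi0] := h3 1%N.
exists C, (`|i0|)%:Z; split=> //; first exact: ltW.
by rewrite hi0 //; lia.
Qed.

Lemma F_mul a b i j u v : F a i u -> F b j v -> F (a + b)%N (i + j) (u * v).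
Proof. by case: hF => _ h _ _; apply: h. Qed.

Lemma F_prod a k (u : 'I_k.+1 -> fn K T) (i : 'I_k.+1 -> int) :
  (forall j, F a (i j) (u j)) -> F (a * k.+1)%N (\sum_j i j) (\prod_j u j).
Proof.
elim: k u i => [|k IH] u i h; first by rewrite muln1 !big_ord1.
rewrite !(big_ord_recl k.+1) mulnS; apply: F_mul => //.
exact: (IH (fun j => u (lift ord0 j)) (fun j => i (lift ord0 j))).
Qed.

Lemma pow_F m k q : (0 < k)%N -> pow k (Fw F m) q `<=` F (m * k)%N (Num.floor q).
Proof.
case: k => // k _; apply: span_min; first exact: (F_sub hF).
move=> _ [u [a [hu ha ->]]].
apply: (F_mono hF _ (F_prod hu)).
rewrite -(floor_int (\sum_j _)); apply: le_floor; apply: le_trans ha.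
by rewrite rmorph_sum; apply: ler_sum => j _; apply: floor_le.
Qed.

Section Slopes.
Variables (lo hi : int).
Hypothesis hs : slopes lo hi.

Let hi0 : 0 <= hi. Proof. by case: hs. Qed.

Lemma R_F r : (0 < r)%N -> R r `<=` F r (hi * r%:Z).
Proof.
case: r => // r _; move=> v /(sr_gen hR) -/(_ isT); move: v.
apply: span_min; first exact: (F_sub hF).
case: hs => _ _ h1 _; move=> _ [u [a [hu _ ->]]].
have := F_prod (i := fun=> hi) (fun j => h1 _ (hu j)).
by rewrite mul1n sumr_const card_ord -mulr_natr natz.
Qed.

Lemma pow_hi m k : (0 < m)%N -> (0 < k)%N ->
  pow k (Fw F m) (hi * (m * k)%:Z)%:~R = R (m * k)%N.
Proof.
move=> m0 k0; apply/seteqP; split; first exact: (pow_Fw_R hR hF).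
rewrite (sr_prods hR) ?muln_gt0 ?m0 //.
apply: span_min; first exact: subsp_pow.
move=> _ [u [a [hu _ ->]]].
apply: (@pow_prod _ _ _ _ _ (fun=> (hi * m%:Z)%:~R)).
  by move=> j; rewrite Fw_int; apply: R_F.
by rewrite sumr_const card_ord PoszM mulrA [in X in _ <= X]intrM -mulr_natr.
Qed.

Lemma pow_lo m k : (0 < m)%N -> (0 < k)%N ->
  pow k (Fw F m) (lo * (m * k)%:Z)%:~R = [set 0].
Proof.
move=> m0 k0; case: hs => _ _ _ h; apply/seteqP; split; last first.
  by move=> _ ->; apply: (subsp0 (subsp_pow _ _ _)).
by move=> v /(pow_F k0); rewrite floor_int h // muln_gt0 m0.
Qed.

Definition wts m k : seq rat := spectrum (pow k (Fw F m)).

Lemma wtsP m x d w k : (0 < m)%N -> filt_gens F m x d w ->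
  is_spectrum (pow k (Fw F m)) (wts m k) /\
  perm_eq (wts m k) [seq (mwt d w u)%:~R | u <- [seq u <- monos d k | chi_std x d w u]].
Proof.
move=> m0 hx; apply: spectrumP => q; rewrite (pow_count hR hF m0 hx).
by rewrite count_map count_filter; apply: eq_count => u /=; rewrite andbC.
Qed.

Lemma wts_count m k q : (0 < m)%N -> cnt (wts m k) q = vdim (pow k (Fw F m) q).
Proof.
by move=> m0; have [x [d [w hx]]] := filt_gens_exist hR hF m0; apply: (wtsP _ m0 hx).1.
Qed.

Lemma wts_size m k : (0 < m)%N -> (0 < k)%N -> size (wts m k) = N (m * k)%N.
Proof.
move=> m0 k0; have [x [d [w hx]]] := filt_gens_exist hR hF m0.
rewrite (perm_size (wtsP k m0 hx).2) size_map size_filter (R_count hR hF m0 hx k0).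
exact: eq_count.
Qed.

Lemma wts_bounds m k a : (0 < m)%N -> (0 < k)%N -> a \in wts m k ->
  (lo * (m * k)%:Z)%:~R <= a <= (hi * (m * k)%:Z)%:~R.
Proof.
move=> m0 k0 aw; apply/andP; split.
  rewrite leNgt; apply/negP => /ltW al.
  have := wts_count k (lo * (m * k)%:Z)%:~R m0; rewrite pow_lo // vdim_set0 => e.
  suff : has (fun w : rat => w <= (lo * (m * k)%:Z)%:~R) (wts m k) by rewrite has_count e.
  by apply/hasP; exists a.
have := wts_count k (hi * (m * k)%:Z)%:~R m0; rewrite pow_hi // -(wts_size m0 k0) => /eqP.
by rewrite -all_count => /allP/(_ _ aw).
Qed.

Variable s0 : fn K T.
Hypotheses (s01 : R 1 s0) (s0n : s0 <> 0).

Lemma s0_exp_R c : R c (s0 ^+ c).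
Proof. by have := sr_exp hR c s01; rewrite mul1n. Qed.

Lemma s0_exp_neq0 c : s0 ^+ c <> 0.
Proof. exact: (sr_exp_neq0 hR s01). Qed.

Lemma mul_inj r s v c : R r s -> s <> 0 -> R c v -> s * v = 0 -> v = 0.
Proof. by move=> hs_ sn hv /(sr_dom hR hs_ hv)[]. Qed.

Lemma vdim_mul_le r s c (V V' : set (fn K T)) : R r s -> s <> 0 ->
  is_subspace V -> is_subspace V' -> V `<=` R c -> fg [set 0] V' ->
  (forall v, V v -> V' (s * v)) -> (vdim V <= vdim V')%N.
Proof.
move=> hs_ sn hV hV' VR fgV' h.
apply: (fg_inj (f := fun v => s * v) hV hV' _ h _ fgV').2.
  by move=> a u v; rewrite mulrDr -fn_scalerAr.
by move=> v /VR hv; apply: (mul_inj hs_ sn hv).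
Qed.

Lemma N_mono r r' : (r <= r')%N -> (N r <= N r')%N.
Proof.
move=> rr'; apply: (vdim_mul_le (s0_exp_R (r' - r)) (@s0_exp_neq0 _) (sr_sub hR r)
  (sr_sub hR r') (c := r)) => //; first exact: (sr_fg hR).
by move=> v hv; have := sr_mul hR (s0_exp_R (r' - r)) hv; rewrite subnK.
Qed.

Lemma N_gt0 r : (0 < N r)%N.
Proof.
rewrite lt0n; apply/eqP => e.
have := @vdim_eq_sub _ _ [set 0] (R r) (@subsp_set0 _ _) (sr_sub hR r).
rewrite vdim_set0 e => /(_ _ (sr_fg hR r) (leqnn 0)) h.
apply: (@s0_exp_neq0 r); apply: h; last exact: s0_exp_R.
by move=> _ ->; apply: (subsp0 (sr_sub hR r)).
Qed.

(* The Hilbert function of a downset of monomials grows no faster than that of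
   all of them. *)
Lemma N_ratio : exists d, forall j j', (0 < j)%N -> (j <= j')%N ->
  (N j' * j ^ d <= N j * j' ^ d)%N.
Proof.
have [x [d [w hx]]] := filt_gens_exist hR hF (ltn0Sn 0).
exists d => j j' j0 /subnK <-; elim: (j' - j)%N => [//|t IH].
rewrite addSn; set k := (t + j)%N in IH *.
have k0 : (0 < k)%N by rewrite /k; lia.
have step : (k.+1 * N k.+1 <= (k + d) * N k)%N.
  have NE i : (0 < i)%N -> N i = count (chi_std x d w) (monos d i).
    by move=> i0; rewrite -{1}[i]mul1n (R_count hR hF _ hx).
  by rewrite !NE //; apply: downset_count_le; apply: D_down.
have bern : ((k + d) * k ^ d <= k.+1 * k.+1 ^ d)%N.
  elim: (d) => [|d' IHd]; first by rewrite !expn0; lia.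
  by rewrite !expnS; nia.
rewrite -(@leq_pmul2l (k.+1 * k ^ d)) ?muln_gt0 ?expn_gt0 ?k0 //.
apply: (@leq_trans (((k + d) * N k) * k ^ d * j ^ d)).
  have -> : (k.+1 * k ^ d * (N k.+1 * j ^ d) = (k.+1 * N k.+1) * (k ^ d * j ^ d))%N by ring.
  by rewrite -[in leqRHS]mulnA leq_mul2r step orbT.
apply: (@leq_trans ((N j * k ^ d) * ((k + d) * k ^ d))).
  rewrite (_ : (_ * _ * _ * _ = (N k * j ^ d) * ((k + d) * k ^ d))%N); last by ring.
  by rewrite leq_mul2r IH orbT.
apply: (@leq_trans ((N j * k ^ d) * (k.+1 * k.+1 ^ d))).
  by rewrite leq_mul2l bern orbT.
by rewrite leq_eqVlt; apply/orP; left; apply/eqP; ring.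
Qed.

(** Each of the k blocks of q factors lies in F at level m q, and is multiplied by s0^c, of weight
    at most hi c. *)
Lemma pow_compare m q c k y v : (0 < q)%N -> pow (q * k) (Fw F m) y v ->
  pow k (Fw F (m * q + c)%N) (y + (hi * (c * k)%:Z)%:~R) (s0 ^+ (c * k) * v).
Proof.
move=> q0; rewrite -pow_pow.
apply: (span_min (V := [set v | pow k (Fw F (m * q + c)%N)
  (y + (hi * (c * k)%:Z)%:~R) (s0 ^+ (c * k) * v)])).
  exact/subsp_mull/subsp_pow.
move=> _ [u [a [hu ha ->]]] /=.
have -> : s0 ^+ (c * k) * \prod_j u j = \prod_(j < k) (s0 ^+ c * u j).
  by rewrite big_split /= prodr_const card_ord exprM.
apply: (@pow_prod _ _ _ _ _ (fun j => a j + (hi * c%:Z)%:~R)).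
  move=> j; rewrite /Fw floorDrz ?intr_int // floor_int addrC addnC.
  have := pow_F q0 (hu j); case: (c) => [|c'] /=.
    by rewrite add0n mulr0 add0r expr0 mul1r.
  by apply: F_mul; apply: R_F => //; apply: s0_exp_R.
by rewrite big_split /= lerD // sumr_const card_ord PoszM mulrA [in X in _ <= X]intrM -mulr_natr.
Qed.

(* Counting the weights from the slope [hi] downwards makes the terms nonnegative,
   hence the mass monotone. *)
Definition total_mass m k : RR := \sum_(a <- wts m k) ((hi * (m * k)%:Z)%:~R - ratr a).

Local Notation mass := total_mass.

(** The natural scale r dim R_r of the mass, at level r = m k: there are dim R_r weights, each of
    size O(r). *)
Definition mass_unit m k : RR := (m * k)%:R * (N (m * k)%N)%:R.

Local Notation dens := mass_unit.

Lemma dens_gt0 m k : (0 < m)%N -> (0 < k)%N -> 0 < dens m k.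
Proof. by move=> m0 k0; rewrite mulr_gt0 ?ltr0n ?muln_gt0 ?m0 // N_gt0. Qed.

Lemma mass_bounds m k : (0 < m)%N -> (0 < k)%N ->
  0 <= mass m k <= (hi - lo)%:~R * dens m k.
Proof.
move=> m0 k0; apply/andP; split.
  rewrite /total_mass big_seq; apply: sumr_ge0 => a /(wts_bounds m0 k0)/andP[_ ah].
  by rewrite subr_ge0 -[X in _ <= X](ratr_int RR) ler_rat.
rewrite /total_mass /mass_unit mulrA -(wts_size m0 k0).
apply: (@le_trans _ _ (\sum_(a <- wts m k) (hi - lo)%:~R * (m * k)%:R)); last first.
  by rewrite big_const_seq count_predT iter_addr_0 -[X in X <= _]mulr_natr.
rewrite big_seq [X in _ <= X]big_seq; apply: ler_sum => a /(wts_bounds m0 k0)/andP[la _].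
have : ratr ((lo * (m * k)%:Z)%:~R) <= ratr a :> RR by rewrite ler_rat.
rewrite ratr_int !intrM intrB mulrBl => h.
by rewrite lerD2l lerN2.
Qed.

(* Multiplication by s0 ^ (c * k), of weight at most hi * (c * k), embeds the
   first filtered space into the second one. *)
Lemma mass_le m q c k : (0 < m)%N -> (0 < q)%N -> (0 < k)%N ->
  mass m (q * k) <= mass (m * q + c) k.
Proof.
move=> m0 q0 k0; have M0 : (0 < m * q + c)%N by rewrite addn_gt0 muln_gt0 m0 q0.
(* Truncation at 0 makes the summand nonnegative and nonincreasing on all rationals, as [count_dom]
   asks; it changes nothing on the actual weights. *)
pose phi (x : rat) : RR := Num.max ((hi * ((m * q + c) * k)%:Z)%:~R - ratr x) 0.
pose sh : rat := (hi * (c * k)%:Z)%:~R.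
have phiE (a : rat) : a <= (hi * ((m * q + c) * k)%:Z)%:~R ->
    phi a = (hi * ((m * q + c) * k)%:Z)%:~R - ratr a.
  move=> h; rewrite /phi max_l // subr_ge0 -[X in _ <= X](ratr_int RR) ler_rat //.
have -> : mass m (q * k) = \sum_(b <- [seq a + sh | a <- wts m (q * k)]) phi b.
  have qk0 : (0 < q * k)%N by rewrite muln_gt0 q0.
  rewrite big_map /total_mass big_seq [RHS]big_seq; apply: eq_bigr => a.
  move=> /(wts_bounds m0 qk0)/andP[_ ah].
  have e : hi * ((m * q + c) * k)%:Z = hi * (m * (q * k))%:Z + hi * (c * k)%:Z.
    by rewrite -mulrDr -PoszD mulnDl mulnA.
  rewrite phiE ?e; last by rewrite intrD lerD2r.
  by rewrite intrD rmorphD /= /sh ratr_int opprD addrACA subrr addr0.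
have -> : mass (m * q + c) k = \sum_(b <- wts (m * q + c) k) phi b.
  rewrite /total_mass big_seq [RHS]big_seq; apply: eq_bigr => a.
  by move=> /(wts_bounds M0 k0)/andP[_ ah]; rewrite phiE.
apply: count_dom => [y|x y xy|x].
- rewrite count_map wts_count // (eq_count (a2 := fun a : rat => a <= y - sh)); last first.
    by move=> a /=; rewrite lerBrDr.
  rewrite wts_count //.
  apply: (vdim_mul_le (s0_exp_R (c * k)) (@s0_exp_neq0 _) (c := (m * (q * k))%N)).
  + exact: subsp_pow.
  + exact: subsp_pow.
  + exact: (pow_Fw_R hR hF).
  + exact: fg_sub (@pow_Fw_R _ _ _ hR _ hF _ _ _) (sr_fg hR _).
  + by move=> v /(pow_compare (c := c) q0); rewrite subrK.
- rewrite /phi ge_max !le_max lexx orbT andbT; apply/orP; left.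
  by rewrite lerD2l lerN2 ler_rat.
- by rewrite /phi le_max lexx orbT.
Qed.

End Slopes.
End Approximations.

Lemma bernoulli_le (RR : realDomainType) (x : RR) d : 0 <= x <= 1 ->
  1 - d%:R * (1 - x) <= x ^+ d.
Proof.
move=> /andP[x0 x1]; elim: d => [|d IH]; first by rewrite mul0r subr0 expr0.
rewrite exprS; apply: (@le_trans _ _ (x * (1 - d%:R * (1 - x)))); last exact: ler_wpM2l.
rewrite -natr1 -subr_ge0 [X in 0 <= X](_ : _ = d%:R * (1 - x) ^+ 2); last by ring.
by rewrite mulr_ge0 ?sqr_ge0.
Qed.

Lemma limn_einf_gt0 (RR : realType) (u : nat -> RR) : (forall m, 0 <= u m) ->
  limn_einf (fun m => (u m)%:E) <> 0%E ->
  exists c m0, 0 < c /\ forall m, (m0 <= m)%N -> c <= u m.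
Proof.
move=> u0; rewrite limn_einf_lim.
rewrite (cvg_lim _ (ereal_nondecreasing_cvgn (nondecreasing_einfs _))) // => h.
have e0 n : (0%E <= einfs (fun m => (u m)%:E) n)%E.
  by apply: le_ereal_inf_tmp => _ [m _ <-]; rewrite lee_fin.
have : (0%E < ereal_sup (range (einfs (fun m => (u m)%:E))))%E.
  rewrite lt_neqAle; apply/andP; split; first by apply/eqP => e; apply: h.
  by apply: le_trans (e0 0%N) _; apply: ereal_sup_ubound; exists 0%N.
move=> /ereal_sup_gt[_ [m0 _ <-]].
have ub m : (m0 <= m)%N -> (einfs (fun m => (u m)%:E) m0 <= (u m)%:E)%E.
  by move=> mm; apply: ereal_inf_lbound; exists m.
case: (einfs _ m0) ub => [c||] ub //; last by have := ub m0 (leqnn _).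
by rewrite lte_fin => c0; exists c, m0; split=> // m /ub; rewrite lee_fin.
Qed.

Lemma limn_esup_le (RR : realType) (u : nat -> RR) (c : RR) (l0 : nat) :
  (forall l, (l0 <= l)%N -> u l <= c) -> (limn_esup (fun l => (u l)%:E) <= c%:E)%E.
Proof.
move=> h; rewrite limn_esup_lim.
rewrite (cvg_lim _ (ereal_nonincreasing_cvgn (nonincreasing_esups _))) //.
apply: ge_ereal_inf; exists (esups (fun l => (u l)%:E) l0); first by exists l0.
by apply: ge_ereal_sup => _ [l ll <-]; rewrite lee_fin; apply: h.
Qed.

Lemma fsbig_count (RR : realType) (s : seq int) (g : int -> RR) :
  \sum_(i \in [set: int]) (g i * (count_mem i s)%:R) = \sum_(a <- s) g a.
Proof.
rewrite -(big_undup_iterop_count _ s xpredT g) /=.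
rewrite (fsbig_seq _ _ (undup_uniq s)) -(@fsbig_widen _ _ _ _ [set` undup s] setT) //.
  apply: eq_fsbigr => i _; rewrite mulr_natr /=.
  by elim: (count_mem i s) => // -[//|n] IH; rewrite mulrS IH.
move=> i [_ /=]; rewrite mem_undup => /negP hi.
by rewrite /preimage /= (count_memPn hi) mulr0.
Qed.

Section Asymptotics.
Variables (K : closedFieldType) (T : Type) (RR : realType).
Variables (R : nat -> set (fn K T)).
Hypothesis hR : section_ring R.
Variable F : nat -> int -> set (fn K T).
Hypothesis hF : admissible R F.

Local Notation N r := (vdim (R r)).
Local Notation wts := (wts F).
Local Notation dens := (mass_unit RR R).

Definition wts_var m k : RR := \sum_(a <- wts m k)
  (ratr a - (\sum_(b <- wts m k) ratr b) / (N (m * k)%N)%:R) ^+ 2.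

Local Notation var := wts_var.

(** For large k, [h0_count] gives the eigenvalues of T_k: they are the opposites of the weights and
    have the same variance. *)
Lemma trace_T2E m : (0 < m)%N -> exists k0, forall k, (k0 <= k)%N ->
  @trace_T2 _ _ RR (approx_filtration R F m) k = var m k.
Proof.
move=> m0; have [x [d [w hx]]] := filt_gens_exist hR hF m0.
have [k0 hk0] := h0_count hR hF m0 hx; exists k0.+1 => k kk.
have k_gt0 : (0 < k)%N by lia.
pose s := [seq mwt d w u | u <- [seq u <- monos d k | chi_std x d w u]].
have h0E i : h0 (approx_filtration R F m) k i = count_mem i s.
  rewrite hk0; last lia.
  by rewrite count_map count_filter; apply: eq_count => u /=; rewrite andbC.
have sN : size s = N (m * k)%N.
  by rewrite size_map size_filter (R_count hR hF m0 hx k_gt0).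
have id_ : @trace_id _ _ RR (approx_filtration R F m) k = (N (m * k)%N)%:R.
  rewrite /trace_id; under eq_fsbigr do rewrite h0E -[_%:R]mul1r.
  by rewrite fsbig_count big_const_seq count_predT iter_addr_0 sN.
have T_ : @trace_T _ _ RR (approx_filtration R F m) k = \sum_(a <- s) (- a)%:~R.
  by rewrite /trace_T; under eq_fsbigr do rewrite h0E; rewrite fsbig_count.
rewrite /trace_T2; under eq_fsbigr do rewrite h0E.
rewrite fsbig_count id_ T_ /wts_var.
have wE (g : rat -> RR) : \sum_(a <- wts m k) g a = \sum_(a <- s) g a%:~R.
  by rewrite (perm_big _ (wtsP hR hF k m0 hx).2) /s !big_map.
rewrite !wE; apply: eq_bigr => a _; rewrite -sqrrN; congr (_ ^+ 2).
rewrite opprB addrC ratr_int intrN opprK; congr (_ + _).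
rewrite -mulNr -sumrN; congr (_ / _); apply: eq_bigr => b _.
by rewrite intrN ratr_int.
Qed.

Lemma norm_gt0 n : filtration_L2norm RR n R F <> 0%E ->
  exists c m0, 0 < c /\ forall m, (m0 <= m)%N -> exists k0, forall k, (k0 <= k)%N ->
    c * (m * k)%:R ^+ (n + 2) <= var m k.
Proof.
move=> /limn_einf_gt0[|c [m0 [c0 hc]]]; first by move=> m; apply: sqrtr_ge0.
exists (c ^+ 2 / 2), m0.+1; split; first by rewrite divr_gt0 ?exprn_gt0.
move=> m mm; have m_gt0 : (0 < m)%N by lia.
have [k1 hk1] := trace_T2E m_gt0; have := hc m (ltnW mm); rewrite /tc_L2norm.
set g := fun k => _; move=> cl.
have l0 : c ^+ 2 <= lim (g @ \oo).
  have lpos : 0 < lim (g @ \oo).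
    by rewrite -sqrtr_gt0; apply: lt_le_trans cl.
  rewrite -(sqr_sqrtr (ltW lpos)); apply: lerXn2r => //; rewrite nnegrE ?sqrtr_ge0 //.
  exact: ltW.
(* On a divergent sequence [lim] takes its default value 0, so a positive value forces
   convergence. *)
have cg : cvgn g.
  apply: contrapT => /dvgP e; move: l0; rewrite e leNgt => /negP; apply.
  exact: exprn_gt0.
have c2 : 0 < c ^+ 2 / 2 by rewrite divr_gt0 ?exprn_gt0.
have /cvgrPdist_le/(_ _ c2)/near_infty[k2 hk2] := cg.
exists (k1 + k2).+1 => k kk.
have := hk2 k (ltac:(lia)); rewrite ler_norml => /andP[_ h].
rewrite -hk1; last lia.
have mk0 : 0 < (k * m)%:R ^+ (n + 2) :> RR by rewrite exprn_gt0 // ltr0n muln_gt0 m_gt0; lia.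
rewrite [(m * k)%N]mulnC -ler_pdivlMr //.
rewrite /g in h l0; lra.
Qed.

Lemma var_nil m k : wts m k = [::] -> var m k = 0.
Proof. by move=> e; rewrite /wts_var e big_nil. Qed.

(** If R_1 were zero, so would be all R_r with r > 0, and the variances would vanish. *)
Lemma norm_R1 n : filtration_L2norm RR n R F <> 0%E -> exists s, R 1%N s /\ s <> 0.
Proof.
move=> /norm_gt0[c [m0 [c0 h]]]; apply: contrapT => hn.
have [k0 hk] := h m0.+1 (leqnSn _); have := hk k0.+1 (leqnSn _).
rewrite var_nil ?leNgt ?mulr_gt0 ?exprn_gt0 ?ltr0n ?muln_gt0 //.
apply: size0nil; rewrite (wts_size hR hF) //.
have R1 : R 1%N `<=` [set 0].
  by move=> v hv; apply: contrapT => v0; apply: hn; exists v.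
suff -> : R (m0.+1 * k0.+1)%N = [set 0] by exact: vdim_set0.
apply/seteqP; split; last by move=> _ ->; apply: (subsp0 (sr_sub hR _)).
move=> v /(sr_gen hR) -/(_ isT); move: v; apply: span_min; first exact: subsp_set0.
move=> _ [u [a [hu _ ->]]]; rewrite big_ord_recl (R1 _ (hu ord0)) mul0r //.
Qed.

Section Slopes.
Variables (lo hi : int).
Hypothesis hs : slopes R F lo hi.
Variable s0 : fn K T.
Hypotheses (s01 : R 1 s0) (s0n : s0 <> 0).

Local Notation mass := (total_mass RR F hi).
Lemma var_bound n : filtration_L2norm RR n R F <> 0%E ->
  (exists C k0, forall k, (k0 <= k)%N -> (N k <= C * k.+1 ^ n)%N) ->
  exists v m0, 0 < v /\ forall m, (m0 <= m)%N -> exists k0, forall k, (k0 <= k)%N ->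
    v * (m * k)%:R ^+ 2 * (N (m * k)%N)%:R <= var m k.
Proof.
move=> /norm_gt0[c [m0 [c0 h]]] [C [k1 hC]].
(* The factor 2^n turns (m k + 1)^n into (m k)^n, and C + 1 instead of C makes the constant
   positive. *)
pose C' : RR := C.+1%:R * 2 ^+ n; have C'0 : 0 < C' by rewrite mulr_gt0 ?ltr0n ?exprn_gt0.
exists (c / C'), m0.+1; split; first exact: divr_gt0.
move=> m mm; have [k0 hk] := h m (ltnW mm); exists (k0 + k1).+1 => k kk.
have m_gt0 : (0 < m)%N by lia.
apply: le_trans (hk k _); last lia.
have NC : (N (m * k)%N)%:R <= C' * (m * k)%:R ^+ n :> RR.
  rewrite /C' -!natrX -!natrM ler_nat; apply: leq_trans (hC _ _) _; first nia.
  rewrite -mulnA -expnMn; apply: leq_mul => //; apply: leq_exp2r_le; nia.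
have -> : c * (m * k)%:R ^+ (n + 2) = c / C' * (m * k)%:R ^+ 2 * (C' * (m * k)%:R ^+ n).
  by rewrite exprD; field; rewrite gt_eqF.
by apply: ler_wpM2l => //; rewrite mulr_ge0 ?exprn_ge0 // ltW // divr_gt0.
Qed.

(** Both terms are sums over the downset of standard monomials, hence eventually polynomial in k,
    and their ratio is bounded. *)
Lemma mass_cvg m : (0 < m)%N -> cvgn (fun k => mass m k / dens m k).
Proof.
move=> m0; have [x [d [w hx]]] := filt_gens_exist hR hF m0.
have [h1 h2] := hilbert_epoly (fun j => (w j)%:~R : RR) (@D_down _ _ x d w).
have sum1 k : \sum_(u <- monos d k | chi_std x d w u) 1 =
    (count (chi_std x d w) (monos d k))%:R :> RR.
  by rewrite -sum1_count natr_sum.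
apply: (@epoly_ratio_cvg _ _ _ (hi - lo)%:~R 1) => [||k k0].
- have h3 := epolyD (epolyZ (hi * m%:Z)%:~R (epolyM (epoly_id RR) h1)) (epolyZ (-1) h2).
  apply: (epoly_eq (k0 := 1) _ h3) => k k0.
  rewrite /total_mass (perm_big _ (wtsP hR hF k m0 hx).2) big_map big_filter.
  rewrite !mulr_sumr -big_split; apply: eq_bigr => u _ /=.
  rewrite ratr_int mulr1 mulN1r PoszM mulrA intrM; congr (_ - _).
  by rewrite /mwt rmorph_sum; apply: eq_bigr => j _; rewrite /= intrM.
- have h3 := epolyZ m%:R (epolyM (epoly_id RR) h1).
  apply: (epoly_eq (k0 := 1) _ h3) => k k0.
  by rewrite /mass_unit natrM -mulrA sum1 (R_count hR hF m0 hx k0).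
- split; first exact: (dens_gt0 _ hR s01 s0n).
  have /andP[m1 m2] := mass_bounds RR hR hF hs m0 k0; rewrite ger0_norm //.
Qed.

Definition slope m : RR := lim ((fun k => mass m k / dens m k) @ \oo).

Lemma slope_near m e : (0 < m)%N -> 0 < e -> exists k0, forall k, (k0 <= k)%N ->
  (0 < k)%N /\ (slope m - e) * dens m k <= mass m k <= (slope m + e) * dens m k.
Proof.
move=> m0 e0; have /cvgrPdist_le/(_ _ e0)/near_infty[k0 hk0] := mass_cvg m0.
exists k0.+1 => k kk; have k_gt0 : (0 < k)%N by lia.
have dk := dens_gt0 RR hR s01 s0n m0 k_gt0; split=> //.
have := hk0 k (ltnW kk); rewrite -/(slope m) ler_norml => /andP[h1 h2].
by apply/andP; split; [rewrite -ler_pdivlMr //|rewrite -ler_pdivrMr //]; lra.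
Qed.

Lemma slope_bounds m : (0 < m)%N -> 0 <= slope m <= (hi - lo)%:~R.
Proof.
move=> m0; apply/andP; split; apply/ler_addgt0Pr => e e0.
  have [k0 hk0] := slope_near m0 e0; have [k1 /andP[_ h]] := hk0 k0 (leqnn _).
  have /andP[h' _] := mass_bounds RR hR hF hs m0 k1.
  by rewrite -(pmulr_lge0 _ (dens_gt0 RR hR s01 s0n m0 k1)); apply: le_trans h.
have [k0 hk0] := slope_near m0 e0; have [k1 /andP[h _]] := hk0 k0 (leqnn _).
have /andP[_ h'] := mass_bounds RR hR hF hs m0 k1.
rewrite -lerBlDr -(ler_pM2r (dens_gt0 RR hR s01 s0n m0 k1)); exact: le_trans h'.
Qed.

(** The exponent is that of [N_ratio] plus one, for the factor r in r dim R_r. *)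
Lemma dens_ratio : exists d, forall m k m' k', (0 < m * k)%N -> (m * k <= m' * k')%N ->
  ((m * k)%:R / (m' * k')%:R) ^+ d * dens m' k' <= dens m k.
Proof.
have [d hd] := N_ratio hR hF hs; exists d.+1 => m k m' k' j0 jj.
rewrite /mass_unit; move: (m * k)%N (m' * k')%N j0 jj => j j' j0 jj.
have j'0 : (0 < j')%N by apply: leq_trans jj.
have jR : 0 < j'%:R :> RR by rewrite ltr0n.
rewrite exprSr mulrACA mulrA -[_ * _ * _ * _]mulrA.
rewrite [X in X <= _](_ : _ = j%:R * ((N j')%:R * (j%:R / j'%:R) ^+ d)); last first.
  by field; rewrite gt_eqF.
apply: ler_wpM2l; first exact: ler0n.
rewrite expr_div_n mulrA ler_pdivrMr ?exprn_gt0 // -!natrX -!natrM ler_nat.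
exact: hd.
Qed.

(* By [mass_le], slope (m * q + c) >= slope m * (1 - o(1)) as q goes to infinity
   with c < m. *)
Lemma slope_sup : exists Sg : RR, [/\ 0 <= Sg <= (hi - lo)%:~R,
  forall m, (0 < m)%N -> slope m <= Sg &
  forall e, 0 < e -> exists M, forall m, (M <= m)%N -> (0 < m)%N /\ Sg - e <= slope m].
Proof.
pose S := [set slope m | m in [set m | (0 < m)%N]].
have ubS : ubound S (hi - lo)%:~R by move=> _ [m m0 <-]; have /andP[] := slope_bounds m0.
have hS : has_sup S.
  by split; [exists (slope 1), 1%N|exists (hi - lo)%:~R].
have le_sup m : (0 < m)%N -> slope m <= sup S.
  by move=> m0; apply: (sup_upper_bound hS); exists m.
exists (sup S); split=> //.
  apply/andP; split; last by apply: ge_sup => //; case: hS.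
  by apply: le_trans (le_sup 1%N isT); have /andP[] := @slope_bounds 1 isT.
move=> e e0; have e2 : 0 < e / 2 by rewrite divr_gt0.
have [_ [m1 /= m10 <-] h1] := sup_adherent e2 hS.
have [d hd] := dens_ratio.
have [b1 b2] := andP (slope_bounds m10).
(* For m >= Q and c < m1, 1 - th = c / m is less than m1 / Q. Hence the loss d (1 - th) slope m1 in
   Bernoulli's inequality is at most e / 2. *)
pose Q := (Num.trunc (slope m1 * d%:R * m1%:R / (e / 2))).+1.
have hQ : slope m1 * d%:R * m1%:R <= e / 2 * Q%:R.
  by rewrite [e / 2 * _]mulrC -ler_pdivrMr //; apply/ltW/truncnS_gt.
exists (Q + m1)%N => m mm; have m0 : (0 < m)%N by lia.
split=> //; pose q := (m %/ m1)%N; pose c := (m %% m1)%N.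
have mE : m = (m1 * q + c)%N by rewrite mulnC -divn_eq.
have q0 : (0 < q)%N by rewrite divn_gt0 //; lia.
have cm : (c < m1)%N by rewrite ltn_mod.
pose th : RR := (m1 * q)%:R / m%:R.
have mR : 0 < m%:R :> RR by rewrite ltr0n.
have th0 : 0 <= th by rewrite divr_ge0.
have th1 : th <= 1 by rewrite ler_pdivrMr // mul1r ler_nat mE leq_addr.
have key : th ^+ d * slope m1 <= slope m.
  apply/ler_addgt0Pr => e' e'0; have e'2 : 0 < e' / 2 by rewrite divr_gt0.
  have [k1 hk1] := slope_near m10 e'2; have [k2 hk2] := slope_near m0 e'2.
  pose k := (k1 + k2)%N.
  have [qk0 /andP[l1 _]] := hk1 (q * k)%N (leq_trans (leq_addr k2 k1) (leq_pmull k q0)).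
  have [k0 /andP[_ l2]] := hk2 k (leq_addl k1 k2).
  have l3 : mass m1 (q * k) <= mass m k.
    by rewrite [m in mass m k]mE; apply: (mass_le _ hR hF hs s01 s0n).
  have dm := dens_gt0 RR hR s01 s0n m0 k0.
  have lemk : (m1 * (q * k) <= m * k)%N.
    by rewrite mulnA leq_mul2r [X in (_ <= X)%N]mE leq_addr orbT.
  have := hd m1 (q * k)%N m k (ltac:(by rewrite muln_gt0 m10)) lemk.
  rewrite mulnA natrM [(m * k)%:R]natrM invfM mulrACA divff ?pnatr_eq0 -?lt0n // mulr1 -/th => l4.
  (* The comparison of the two units can be multiplied only by a nonnegative factor. *)
  have [neg|pos] := leP (slope m1 - e' / 2) 0.
    have : th ^+ d * slope m1 <= 1 * (e' / 2).
      by apply: ler_pM => //; [apply: exprn_ge0|apply: exprn_ile1|lra].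
    have /andP[p _] := slope_bounds m0; lra.
  have : th ^+ d * (slope m1 - e' / 2) <= slope m + e' / 2.
    rewrite -(ler_pM2r dm); apply: le_trans l2; apply: le_trans l3; apply: le_trans l1.
    by rewrite mulrAC [X in X <= _]mulrC ler_wpM2l // ltW.
  have : th ^+ d * (e' / 2) <= e' / 2 by rewrite ler_piMl ?(ltW e'2) // exprn_ile1.
  rewrite mulrBr; lra.
have bern : 1 - d%:R * (1 - th) <= th ^+ d by apply: bernoulli_le; rewrite th0.
have : d%:R * (1 - th) * slope m1 <= e / 2.
  have -> : 1 - th = c%:R / m%:R.
    have e1 : m%:R = (m1 * q)%:R + c%:R :> RR by rewrite -natrD -mE.
    rewrite /th -{1}(@divff _ (m%:R : RR)) ?gt_eqF // -mulrBl.
    by congr (_ / _); rewrite e1 addrAC subrr add0r.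
  rewrite mulrA mulrAC ler_pdivrMr //.
  apply: (@le_trans _ _ (slope m1 * d%:R * m1%:R)).
    rewrite mulrC mulrA; apply: ler_wpM2l; first exact: mulr_ge0.
    by rewrite ler_nat ltnW.
  apply: (le_trans hQ); apply: ler_wpM2l; first exact: ltW.
  by rewrite ler_nat; apply: leq_trans mm; apply: leq_addr.
have : (1 - d%:R * (1 - th)) * slope m1 <= th ^+ d * slope m1 by apply: ler_wpM2r.
rewrite mulrBl mul1r; lra.
Qed.

End Slopes.
End Asymptotics.

(** * The angle between two approximations *)

(* |a - b| <= (z - a) + (z - b), so the l^1 distance of a and b is controlled by the
   sums of a, b and z. *)
Lemma angle_close_below (RR : realType) n (a b z : 'I_n -> RR) (c Z A S v : RR) :
  (0 < n)%N -> 0 < v -> (forall i, 0 <= a i <= z i) -> (forall i, 0 <= b i <= z i) ->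
  (forall i, z i <= c) -> \sum_i z i <= Z * n%:R ->
  A * n%:R <= \sum_i a i -> A * n%:R <= \sum_i b i ->
  S * n%:R <= \sum_i a i ^+ 2 -> S * n%:R <= \sum_i b i ^+ 2 -> v <= S - Z ^+ 2 ->
  let t := (\sum_i (a i - avg a) * (b i - avg b)) /
    Num.sqrt ((\sum_i (a i - avg a) ^+ 2) * (\sum_i (b i - avg b) ^+ 2)) in
  1 - c * (2 * (Z - A)) / (2 * v) <= t <= 1.
Proof.
move=> n0 v0 ha hb hz hZ hA hB sa sb hv.
have nR : 0 < n%:R :> RR by rewrite ltr0n.
have hvar (f : 'I_n -> RR) : (forall i, 0 <= f i <= z i) -> S * n%:R <= \sum_i f i ^+ 2 ->
    v * n%:R <= \sum_i (f i - avg f) ^+ 2.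
  move=> hf sf; rewrite sum_sqr_dev //.
  have av0 : 0 <= avg f.
    by rewrite divr_ge0 // sumr_ge0 // => i _; have /andP[] := hf i.
  have avZ : avg f <= Z.
    rewrite ler_pdivrMr //; apply: le_trans hZ; apply: ler_sum => i _.
    by have /andP[] := hf i.
  have : avg f ^+ 2 <= Z ^+ 2 by apply: lerXn2r => //; rewrite nnegrE //; apply: le_trans avZ.
  rewrite -(ler_pM2l nR) => h.
  have : v * n%:R <= (S - Z ^+ 2) * n%:R by apply: ler_wpM2r => //; apply: ltW.
  rewrite mulrBl [Z ^+ 2 * _]mulrC; lra.
have hsum : \sum_i `|a i - b i| <= 2 * (Z - A) * n%:R.
  apply: (@le_trans _ _ (\sum_i (2 * z i - a i - b i))).
    apply: ler_sum => i _; have /andP[h1 h2] := ha i; have /andP[h3 h4] := hb i.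
    by rewrite ler_norml; apply/andP; split; lra.
  rewrite !sumrB -mulr_sumr -mulrA mulrBl; lra.
apply: angle_close => //; [|exact: hvar|exact: hvar] => i.
have := hz i; have /andP[h1 h2] := ha i; have /andP[h3 h4] := hb i => h5.
by rewrite ler_norml; apply/andP; split; lra.
Qed.

Section Comparison.
Variables (K : closedFieldType) (T : Type) (RR : realType).
Variables (R : nat -> set (fn K T)).
Hypothesis hR : section_ring R.
Variable F : nat -> int -> set (fn K T).
Hypothesis hF : admissible R F.
Variables (lo hi : int).
Hypothesis hs : slopes R F lo hi.
Variable s0 : fn K T.
Hypotheses (s01 : R 1 s0) (s0n : s0 <> 0).

Local Notation N r := (vdim (R r)).
Local Notation wts := (wts F).
Local Notation mass := (total_mass RR F hi).

Lemma filt_pow_R r P l : (0 < r)%N -> filt (R r) P -> (0 < l)%N ->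
  filt (R (r * l)%N) (pow l P).
Proof.
by move=> r0 hP l0; rewrite (sr_prods hR) ?muln_gt0 ?r0 //; apply: filt_pow.
Qed.

Lemma sum_weights_cnt n (f : 'I_n -> rat) (q : rat) :
  count (fun w : rat => w <= q) [seq f i | i <- enum 'I_n] = #|[pred i | f i <= q]|.
Proof. by rewrite count_map cardE enumT /enum_mem size_filter. Qed.

(** * Weights of a representative at an arbitrary level l = B q + c *)

Section Representative.
Variables (r0 B m t : nat) (P : rat -> set (fn K T)) (h : rat).
Hypotheses (r00 : (0 < r0)%N) (B0 : (0 < B)%N) (m0 : (0 < m)%N) (t0 : (0 < t)%N).
Hypotheses (eM : (r0 * B = m * t)%N) (hP : filt (R r0) P).
Hypotheses (hPB : forall w, pow B P w = pow t (Fw F m) w).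
Hypotheses (h0 : 0 <= h) (hh : R r0 `<=` P h).

Let s := s0 ^+ r0.
Let sR : R r0 s := s0_exp_R hR s01 r0.
Let sXR c : R (r0 * c)%N (s ^+ c). Proof. exact: (sr_exp hR). Qed.
Let sX0 c : s ^+ c <> 0.
Proof. by apply: (sr_exp_neq0 hR sR); apply: s0_exp_neq0 hR _ s01 s0n _. Qed.

Lemma pow_repr q w : pow (B * q) P w = pow (t * q) (Fw F m) w.
Proof. by rewrite -!pow_pow; apply: pow_ext. Qed.

(** Bridges the levels that are not multiples of B; as long as c <= B, the cost c h is bounded
    independently of l. *)
Lemma pow_repr_mul c k x v : pow k P x v -> pow (c + k) P (c%:R * h + x) (s ^+ c * v).
Proof.
apply: pow_mul; have -> : s ^+ c = \prod_(j < c) s by rewrite prodr_const card_ord.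
apply: (@pow_prod _ _ _ _ _ (fun=> h)); first by move=> _; apply: hh.
by rewrite sumr_const card_ord -[h *+ c]mulr_natl.
Qed.

Lemma pow_repr_top q c : (0 < q)%N ->
  R (r0 * (B * q + c))%N `<=` pow (B * q + c) P ((hi * (r0 * (B * q))%:Z)%:~R + c%:R * h).
Proof.
move=> q0; rewrite (sr_prods hR); last by rewrite muln_gt0 r00 addn_gt0 muln_gt0 B0 q0.
apply: span_min; first exact: subsp_pow.
move=> _ [u [a [hu _ ->]]]; rewrite big_split_ord /=; apply: pow_mul.
  rewrite pow_repr mulnA eM -mulnA (pow_hi hR hF hs) ?muln_gt0 ?t0 //.
  rewrite mulnA -eM -mulnA; apply: (sr_prods_sub hR).
  by apply: (@pow_prod _ _ _ _ _ (fun=> 0)); [move=> j; apply: hu|rewrite big1].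
apply: (@pow_prod _ _ _ _ _ (fun=> h)); first by move=> j; apply/hh/hu.
by rewrite sumr_const card_ord -[h *+ c]mulr_natl.
Qed.

Variables (q c c' : nat).
Hypotheses (q0 : (0 < q)%N) (cB : (c + c' = B)%N).
Let l := (B * q + c)%N.
Let l0 : (0 < l)%N. Proof. by rewrite addn_gt0 muln_gt0 B0 q0. Qed.
Let hW : filt (R (r0 * l)%N) (pow l P). Proof. exact: filt_pow_R. Qed.
Variables (n : nat) (b : 'I_n -> fn K T).
Hypotheses (bR : forall i, R (r0 * l)%N (b i)) (b0 : forall i, b i <> 0).

Local Notation alpha i := (weight (pow l P) (b i)).
Local Notation M := (r0 * B)%N.
Local Notation eta i := (weight (pow q.+1 (Fw F M)) (s ^+ c' * b i)).

Hypothesis hcnt : forall x, #|[pred i | alpha i <= x]| = vdim (pow l P x).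

(** A bound on the weights at level l that depends on the representative only through r0, B and h.
    The term B h makes room for the c leftover factors, only known to have weight at most h. *)
Definition repr_top : rat := (hi * (r0 * l)%:Z)%:~R + B%:R * h.

Lemma hi_mono x y : (x <= y)%N -> ((hi * x%:Z)%:~R : rat) <= (hi * y%:Z)%:~R.
Proof. by case: hs => hi0 _ _ _ xy; rewrite ler_int ler_wpM2l. Qed.

(** Multiplication by s^c embeds level B q, where the power of P is one of F at level m, into level
    l, with a shift of the weights by c h. This compares the dimensions, and [count_dom] applies. *)
Lemma repr_sum_le (phi : rat -> RR) : (forall x y, x <= y -> phi y <= phi x) ->
  (forall x, 0 <= phi x) ->
  \sum_(a <- wts m (t * q)) phi (a + c%:R * h) <= \sum_i phi (alpha i).
Proof.
move=> h1 h2.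
have -> : \sum_i phi (alpha i) = \sum_(x <- [seq alpha i | i <- enum 'I_n]) phi x.
  by rewrite big_map big_enum.
have -> : \sum_(a <- wts m (t * q)) phi (a + c%:R * h) =
  \sum_(x <- [seq a + c%:R * h | a <- wts m (t * q)]) phi x by rewrite big_map.
apply: count_dom => // x; rewrite sum_weights_cnt hcnt count_map.
rewrite (eq_count (a2 := fun a : rat => a <= x - c%:R * h)); last first.
  by move=> a /=; rewrite lerBrDr.
rewrite (wts_count hR hF) // -pow_repr.
apply: (vdim_mul_le hR (sXR c) (@sX0 c) (c := (r0 * (B * q))%N)).
- exact: subsp_pow.
- exact: subsp_pow.
- by rewrite pow_repr mulnA eM -mulnA; apply: (pow_Fw_R hR hF).
- by apply: fg_sub (sr_fg hR _); case: hW => _ + _ _ _; apply.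
- by move=> v /(pow_repr_mul (c := c)); rewrite addnC addrC subrK.
Qed.

Lemma alpha_top i : alpha i <= (hi * (r0 * (B * q))%:Z)%:~R + c%:R * h.
Proof. have wP := weightP hW (bR i) (@b0 i).
by apply: (wP _).1; apply: pow_repr_top. Qed.

Lemma c_le_B : c%:R * h <= B%:R * h.
Proof. by apply: ler_wpM2r => //; rewrite ler_nat -cB leq_addr. Qed.

Lemma repr_ge0 i : 0 <= repr_top - alpha i.
Proof.
rewrite subr_ge0; apply: le_trans (alpha_top i) _; rewrite /repr_top lerD ?c_le_B //.
by apply: hi_mono; rewrite leq_mul2l leq_addr orbT.
Qed.

Lemma repr_wts a : (hi * (m * (t * q))%:Z)%:~R - a <= repr_top - (a + c%:R * h).
Proof.
rewrite opprD addrA lerBrDr addrAC lerD2r /repr_top lerD ?c_le_B //.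
by apply: hi_mono; rewrite mulnA -eM -mulnA leq_mul2l leq_addr orbT.
Qed.

Lemma wts_ge0 a : a \in wts m (t * q) -> 0 <= (hi * (m * (t * q))%:Z)%:~R - a.
Proof.
have tq0 : (0 < t * q)%N by rewrite muln_gt0 t0.
by move=> /(wts_bounds hR hF hs m0 tq0)/andP[_]; rewrite subr_ge0.
Qed.

Lemma repr_mass : mass m (t * q) <= \sum_i ratr (repr_top - alpha i).
Proof.
pose phi (x : rat) : RR := Num.max (ratr (repr_top - x)) 0.
have phiE i : phi (alpha i) = ratr (repr_top - alpha i).
  by rewrite /phi max_l // -(rmorph0 (ratr : rat -> RR)) ler_rat repr_ge0.
under [X in _ <= X]eq_bigr do rewrite -phiE.
apply: le_trans (repr_sum_le (phi := phi) _ _).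
- rewrite /total_mass big_seq [X in _ <= X]big_seq; apply: ler_sum => a ha.
  rewrite /phi le_max; apply/orP; left.
  by rewrite -ratr_int -rmorphB ler_rat repr_wts.
- move=> x y xy; rewrite /phi ge_max !le_max lexx orbT andbT; apply/orP; left.
  by rewrite ler_rat lerD2l lerN2.
- by move=> x; rewrite /phi le_max lexx orbT.
Qed.

Lemma repr_mass2 : \sum_(a <- wts m (t * q)) ((hi * (m * (t * q))%:Z)%:~R - ratr a) ^+ 2
  <= \sum_i (ratr (repr_top - alpha i) : RR) ^+ 2.
Proof.
pose phi (x : rat) : RR := (Num.max (ratr (repr_top - x)) 0) ^+ 2.
have phiE i : phi (alpha i) = ratr (repr_top - alpha i) ^+ 2.
  by rewrite /phi max_l // -(rmorph0 (ratr : rat -> RR)) ler_rat repr_ge0.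
under [X in _ <= X]eq_bigr do rewrite -phiE.
apply: le_trans (repr_sum_le (phi := phi) _ _).
- rewrite big_seq [X in _ <= X]big_seq; apply: ler_sum => a ha.
  have g0 := wts_ge0 ha; have g1 := repr_wts a.
  rewrite /phi -ratr_int -rmorphB; apply: lerXn2r; rewrite ?nnegrE.
  + by rewrite -(rmorph0 (ratr : rat -> RR)) ler_rat.
  + by rewrite le_max lexx orbT.
  + by rewrite le_max ler_rat g1.
- have mx0 (x : RR) : 0 <= Num.max x 0 by rewrite le_max lexx orbT.
  move=> x y xy; apply: lerXn2r; rewrite ?nnegrE ?mx0 //.
  rewrite ge_max !le_max lexx orbT andbT; apply/orP; left.
  by rewrite ler_rat lerD2l lerN2.
- by move=> x; apply: sqr_ge0.
Qed.

Let filtM : filt (R (M * q.+1)%N) (pow q.+1 (Fw F M)).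
Proof.
by apply: filt_pow_R => //; rewrite ?muln_gt0 ?r00 //; apply: Fw_filt hF _ _; rewrite muln_gt0 r00.
Qed.

Let lc' : (c' + l = B * q.+1)%N. Proof. by rewrite /l mulnS -cB; lia. Qed.

Let sbR i : R (M * q.+1)%N (s ^+ c' * b i).
Proof. by rewrite -mulnA -lc' mulnDr; apply: (sr_mul hR). Qed.

Let sb0 i : s ^+ c' * b i <> 0.
Proof. by move=> /(sr_dom hR (sXR c') (bR i))[/sX0|/b0]. Qed.

(** Multiplication by s^c' leads to level B (q + 1), where the power of P is contained in that of F
    at level M = r0 B, by multiplicativity of F. One B h bounds c' h, the other comes from
    [repr_top]. *)
Lemma repr_le_cover i :
  repr_top - alpha i <= (hi * (M * q.+1)%:Z)%:~R - eta i + 2 * (B%:R * h).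
Proof.
have le : eta i <= alpha i + c'%:R * h.
  apply: (weightP filtM (sbR i) (@sb0 i) _).1.
  have : pow l P (alpha i) (b i) by exact: (weightP hW (bR i) (@b0 i) (alpha i)).2.
  move=> /(pow_repr_mul (c := c')); rewrite lc' pow_repr -pow_pow addrC.
  by apply: pow_mono => // w v /(pow_F hF t0); rewrite eM.
have hc' : c'%:R * h <= B%:R * h by apply: ler_wpM2r => //; rewrite ler_nat -cB leq_addl.
have : ((hi * (r0 * l)%:Z)%:~R : rat) <= (hi * (M * q.+1)%:Z)%:~R.
  by apply: hi_mono; rewrite -mulnA -lc' leq_mul2l leq_addl orbT.
rewrite /repr_top; lra.
Qed.

Lemma cover_le i : (hi * (M * q.+1)%:Z)%:~R - eta i <= ((hi - lo) * (M * q.+1)%:Z)%:~R.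
Proof.
rewrite mulrBl intrB lerD2l lerN2 leNgt; apply/negP => /ltW le.
apply: (@sb0 i); have := (weightP filtM (sbR i) (@sb0 i) _).2 le.
by rewrite (pow_lo hF hs) ?muln_gt0 ?r00.
Qed.

(** The vectors s^c' b_i are free but in general not a basis, let alone an adapted one, so
    [free_count_le] gives an inequality. *)
Lemma cover_mass : free_mod [set 0] b ->
  \sum_i ratr ((hi * (M * q.+1)%:Z)%:~R - eta i) <= mass M q.+1.
Proof.
move=> fb; have M0 : (0 < M)%N by rewrite muln_gt0 r00.
pose phi (x : rat) : RR := Num.max (ratr ((hi * (M * q.+1)%:Z)%:~R - x)) 0.
have ge0 x : x <= (hi * (M * q.+1)%:Z)%:~R -> phi x = ratr ((hi * (M * q.+1)%:Z)%:~R - x).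
  by move=> hx; rewrite /phi max_l // -(rmorph0 (ratr : rat -> RR)) ler_rat subr_ge0.
have -> : mass M q.+1 = \sum_(a <- wts M q.+1) phi a.
  rewrite /total_mass big_seq [RHS]big_seq; apply: eq_bigr => a.
  by move=> /(wts_bounds hR hF hs M0 (ltn0Sn q))/andP[_ /ge0 ->]; rewrite rmorphB /= ratr_int.
have -> : \sum_i ratr ((hi * (M * q.+1)%:Z)%:~R - eta i) =
    \sum_(x <- [seq eta i | i <- enum 'I_n]) phi x.
  rewrite big_map big_enum /=; apply: eq_bigr => i _; rewrite ge0 //.
  by apply: (weightP filtM (sbR i) (@sb0 i) _).1; rewrite (pow_hi hR hF hs).
apply: count_dom => [x|x y xy|x].
- rewrite (wts_count hR hF) //; apply: (free_count_le _ filtM) => //.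
    exact: (sr_fg hR).
  move=> k hk; apply: fb; apply: (mul_inj hR (sXR c') (@sX0 c') (c := (r0 * l)%N)).
    by apply: (subsp_lin _ (sr_sub hR _)).
  by rewrite -[RHS]hk fn_sumr_scale.
- rewrite /phi ge_max !le_max lexx orbT andbT; apply/orP; left.
  by rewrite ler_rat lerD2l lerN2.
- by rewrite /phi le_max lexx orbT.
Qed.

End Representative.
End Comparison.

Lemma sum_sqr_shift (RR : realFieldType) (s : seq RR) (k : RR) : (0 < size s)%N ->
  \sum_(a <- s) (k - a) ^+ 2 =
  \sum_(a <- s) (a - (\sum_(b <- s) b) / (size s)%:R) ^+ 2 +
  (\sum_(a <- s) (k - a)) ^+ 2 / (size s)%:R.
Proof.
move=> n0; set n : RR := (size s)%:R; have nR : n != 0 by rewrite pnatr_eq0 -lt0n.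
set S := \sum_(b <- s) b.
have sc (c : RR) : \sum_(a <- s) c = n * c.
  by rewrite big_const_seq count_predT iter_addr_0 mulr_natl.
have -> : \sum_(a <- s) (k - a) = n * k - S by rewrite sumrB sc.
have sq (c : RR) : \sum_(a <- s) (c - a) ^+ 2 = n * c ^+ 2 - 2 * c * S + \sum_(a <- s) a ^+ 2.
  rewrite (eq_bigr (fun a => c ^+ 2 - 2 * c * a + a ^+ 2)); last by move=> a _; ring.
  by rewrite big_split sumrB sc -mulr_sumr.
rewrite sq; under [X in _ = X + _]eq_bigr do rewrite -sqrrN opprB.
by rewrite sq; field.
Qed.

(* The constants come from the bounds
   Sg r N (1 - O(e)) <= sum of the weights <= Sg r N (1 + O(e)). *)
Lemma angle_constants (RR : realFieldType) (v La dl : RR) : 0 < v -> 0 <= La -> 0 < dl ->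
  exists e : RR, [/\ 0 < e, e <= 1,
    e * (2 * v + 2 * La ^+ 2 + 4 * La + 2 * La * (La + 3) + (La + 3) ^+ 2) <= v / 2 &
    e * (2 * (2 * La + 1) * (2 * La + 5)) <= dl * v].
Proof.
move=> v0 L0 d0; set C1 := _ + (La + 3) ^+ 2; set C2 := 2 * _ * (2 * La + 5).
have C1p : 0 < C1.
  have : 0 <= La ^+ 2 by apply: sqr_ge0.
  have : 0 <= La * (La + 3) by apply: mulr_ge0 => //; lra.
  have : 0 <= (La + 3) ^+ 2 by apply: sqr_ge0.
  rewrite /C1; lra.
have C2p : 0 < C2 by rewrite /C2 !mulr_gt0 //; lra.
exists (Num.min 1 (Num.min (v / 2 / C1) (dl * v / C2))); split.
- by rewrite !lt_min ltr01 !divr_gt0 // mulr_gt0.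
- by rewrite ge_min lexx.
- by rewrite -ler_pdivlMr // !ge_min lexx orbT.
- by rewrite -ler_pdivlMr // !ge_min lexx !orbT.
Qed.

(** Here x <= r <= y are the levels M q, r0 l and M (q + 1), and nq <= nn <= n1 are the dimensions
    there; e measures how far their ratios are from 1. *)
Lemma squeeze (RR : realFieldType) (x y nq nn n1 r e : RR) :
  0 <= nq -> nq <= nn -> nn <= n1 -> 0 < x -> x <= r -> r <= y -> 0 <= e -> e <= 1 ->
  (1 - e) * y <= x -> (1 - e / 2) * (y * n1) <= x * nq ->
  [/\ x * nq <= r * nn, y * n1 <= (1 + e) * (r * nn), (1 - e) * (r * nn) <= x * nq,
    (1 - 2 * e) * (r ^+ 2 * nn) <= x * (x * nq) & x * (x * nq) <= r ^+ 2 * nn].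
Proof.
move=> q0 qn n1_ x0 xr ry e0 e1 yx ratio.
have nn0 : 0 <= nn by apply: le_trans qn.
have r0 : 0 < r by apply: lt_le_trans xr.
have h1 : x * nq <= r * nn by apply: ler_pM => //; apply: ltW.
have h2 : r * nn <= y * n1 by apply: ler_pM => //; apply: ltW.
have D0 : 0 <= r * nn by apply: mulr_ge0 => //; apply: ltW.
have h3 : (1 - e) * (r * nn) <= x * nq.
  apply: le_trans ratio; apply: (@le_trans _ _ ((1 - e / 2) * (r * nn))).
    by apply: ler_wpM2r => //; lra.
  by apply: ler_wpM2l => //; lra.
split=> //.
- have a0 : 0 < 1 - e / 2 by lra.
  rewrite -(ler_pM2l a0); apply: (le_trans ratio); apply: (le_trans h1).
  have -> : (1 - e / 2) * ((1 + e) * (r * nn)) = r * nn + e * (1 - e) / 2 * (r * nn) by field.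
  by rewrite lerDl mulr_ge0 // divr_ge0 // mulr_ge0 // subr_ge0.
- have h4 : (1 - e) * r <= x by apply: le_trans yx; apply: ler_wpM2l; lra.
  apply: (@le_trans _ _ (((1 - e) * r) * ((1 - e) * (r * nn)))).
    have -> : (1 - e) * r * ((1 - e) * (r * nn)) = (1 - e) ^+ 2 * (r ^+ 2 * nn) by ring.
    apply: ler_wpM2r; first by rewrite mulr_ge0 ?sqr_ge0.
    by rewrite -subr_ge0 (_ : _ - _ = e ^+ 2) ?sqr_ge0 //; ring.
  apply: ler_pM => //; first by apply: mulr_ge0; lra.
  by apply: mulr_ge0 => //; lra.
- rewrite expr2 -mulrA; apply: ler_pM => //; first exact: ltW.
  by apply: mulr_ge0 => //; apply: ltW.
Qed.

(** Here and in the next three lemmas, the nonlinear bounds that [angle_core] needs are supplied as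
    hypotheses, so that linear arithmetic on the products concludes; S is the limit slope and L is
    hi - lo. *)
Lemma numeric_low (RR : realFieldType) (S e L D X : RR) :
  S * ((1 - e) * D) <= S * X -> e * X <= e * D -> S * (e * D) <= L * (e * D) ->
  (S - e * (L + 2)) * D <= (S - 2 * e) * X.
Proof. by move=> *; lra. Qed.

Lemma numeric_low2 (RR : realFieldType) (w e S L Y X : RR) :
  w * ((1 - 2 * e) * Y) <= w * X -> 4 * e * S * X <= 4 * e * L * Y ->
  (w * (1 - 2 * e) - 4 * e * L) * Y <= (w - 4 * e * S) * X.
Proof. by move=> *; lra. Qed.

Lemma numeric_high (RR : realFieldType) (S e L D : RR) :
  S * (e * D) <= L * (e * D) -> e * (e * D) <= e * D ->
  (S + e) * ((1 + e) * D) + e * D <= (S + e * (L + 3)) * D.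
Proof. by move=> *; lra. Qed.

Lemma numeric_gap (RR : realFieldType) (v S e L : RR) :
  e * (2 * v + 2 * L ^+ 2 + 4 * L + 2 * L * (L + 3) + (L + 3) ^+ 2) <= v / 2 ->
  e * S ^+ 2 <= e * L ^+ 2 -> e * (S * (L + 3)) <= e * (L * (L + 3)) ->
  e ^+ 2 * (L + 3) ^+ 2 <= e * (L + 3) ^+ 2 ->
  v / 2 <= (v + S ^+ 2) * (1 - 2 * e) - 4 * e * L - (S + e * (L + 3)) ^+ 2.
Proof. by move=> *; lra. Qed.

Lemma numeric_end (RR : realFieldType) (v S e L r : RR) : v != 0 -> r != 0 ->
  (2 * L + 1) * r * (2 * ((S + e * (L + 3)) * r - (S - e * (L + 2)) * r)) /
    (2 * (v / 2 * r ^+ 2)) = e * (2 * (2 * L + 1) * (2 * L + 5)) / v.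
Proof. by move=> v0 r0; field; rewrite v0 r0. Qed.

Lemma leq_sum4 a b c d q : (a + b + c + d <= q)%N ->
  [/\ (a <= q)%N, (b <= q)%N, (c <= q)%N & (d <= q)%N].
Proof. by move=> h; split; lia. Qed.

Section Angle.
Variables (K : closedFieldType) (T : Type) (RR : realType).
Variables (R : nat -> set (fn K T)).
Hypothesis hR : section_ring R.
Variable F : nat -> int -> set (fn K T).
Hypothesis hF : admissible R F.
Variables (lo hi : int).
Hypothesis hs : slopes R F lo hi.
Variable s0 : fn K T.
Hypotheses (s01 : R 1 s0) (s0n : s0 <> 0).

Local Notation N r := (vdim (R r)).
Local Notation wts := (wts F).
Local Notation mass := (total_mass RR F hi).
Local Notation dens := (mass_unit RR R).
Local Notation var := (wts_var RR R F).
Local Notation slope := (slope RR R F hi).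

Lemma second_moment m k : (0 < m)%N -> (0 < k)%N ->
  \sum_(a <- wts m k) ((hi * (m * k)%:Z)%:~R - ratr a) ^+ 2 =
  var m k + mass m k ^+ 2 / (N (m * k)%N)%:R :> RR.
Proof.
move=> m0 k0; have sz := wts_size hR hF m0 k0.
have := @sum_sqr_shift RR [seq ratr a | a <- wts m k] (hi * (m * k)%:Z)%:~R.
by rewrite size_map sz !big_map => -> //; apply: N_gt0 hR _ s01 s0n _.
Qed.

(** The second moment is the variance plus mass^2 / N, and mass^2 is bounded below by its tangent at
    Sg r N. This avoids squaring Sg - 2 e, whose sign is unknown. *)
Lemma moments_bound (v Sg e : RR) m k : (0 < m)%N -> (0 < k)%N -> 0 <= Sg ->
  (Sg - 2 * e) * dens m k <= mass m k ->
  v * (m * k)%:R ^+ 2 * (N (m * k)%N)%:R <= var m k ->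
  (v + Sg ^+ 2 - 4 * e * Sg) * ((m * k)%:R * dens m k) <=
  \sum_(a <- wts m k) ((hi * (m * k)%:Z)%:~R - ratr a) ^+ 2.
Proof.
move=> m0 k0 S0 hm hv; rewrite second_moment //.
have n0 : 0 < (N (m * k)%N)%:R :> RR by rewrite ltr0n; apply: N_gt0 hR _ s01 s0n _.
have d0 := dens_gt0 RR hR s01 s0n m0 k0.
set x : RR := (m * k)%:R; set dn := dens m k in hm d0 *; set n : RR := (N (m * k)%N)%:R in hv n0 *.
have dE : dn = x * n by [].
have h1 : v * (x * dn) <= var m k by apply: le_trans hv; rewrite dE expr2 !mulrA.
suff : (Sg ^+ 2 - 4 * e * Sg) * (x * dn) <= mass m k ^+ 2 / n.
  by move=> h; rewrite -addrA mulrDl; apply: lerD.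
rewrite ler_pdivlMr // -[_ * _ * n]mulrA (_ : x * dn * n = dn ^+ 2); last by rewrite dE; ring.
have h2 : 0 <= (mass m k - Sg * dn) ^+ 2 by apply: sqr_ge0.
have h3 : 2 * Sg * dn * ((Sg - 2 * e) * dn) <= 2 * Sg * dn * mass m k.
  by apply: ler_wpM2l => //; rewrite !mulr_ge0 // ltW.
apply: (@le_trans _ _ (2 * Sg * dn * mass m k - Sg ^+ 2 * dn ^+ 2)).
  by rewrite lerBrDr; apply: le_trans h3; rewrite le_eqVlt; apply/orP; left; apply/eqP; ring.
rewrite -subr_ge0; apply: le_trans h2 _; rewrite le_eqVlt; apply/orP; left; apply/eqP; ring.
Qed.

Local Notation alpha P l b := (fun i => ratr (weight (pow l P) (b i)) : RR).

Definition cosine n (a b : 'I_n -> RR) : RR :=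
  (\sum_i (a i - avg a) * (b i - avg b)) /
    Num.sqrt ((\sum_i (a i - avg a) ^+ 2) * (\sum_i (b i - avg b) ^+ 2)).

Lemma dev_sub n (a : 'I_n -> RR) c i : (0 < n)%N ->
  (c - a i) - avg (fun i => c - a i) = - (a i - avg a).
Proof.
move=> n0; have -> : avg (fun i => c - a i) = c - avg a.
  rewrite /avg sumrB sumr_const card_ord mulrBl -[c *+ n]mulr_natr mulfK //.
  by rewrite pnatr_eq0 -lt0n.
by ring.
Qed.

Lemma cosine_sub n (a b : 'I_n -> RR) c : (0 < n)%N ->
  cosine (fun i => c - a i) (fun i => c - b i) = cosine a b.
Proof.
move=> n0; rewrite /cosine; congr (_ / Num.sqrt (_ * _)); apply: eq_bigr => i _;
  by rewrite !dev_sub // ?mulrNN // sqrrN.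
Qed.

(** [P] is normalised: the scale and the shift of the flag are already removed, so that the two
    powers agree exactly and not only up to equivalence. *)
Record representative r0 B m t P : Prop := Representative {
  rep_t : (0 < t)%N;
  rep_eq : (r0 * B = m * t)%N;
  rep_filt : filt (R r0) P;
  rep_pow : forall w, pow B P w = pow t (Fw F m) w
}.

(* On R (r0 * l), both filtrations are contained, up to bounded shifts, in the
   pull-back of the approximation of level M = r0 * B under multiplication by a power
   of s0. *)
Lemma angle_core (v eta : RR) mv : 0 < v -> 0 < eta ->
  (forall m, (mv <= m)%N -> exists k0, forall k, (k0 <= k)%N ->
    v * (m * k)%:R ^+ 2 * (N (m * k)%N)%:R <= var m k) ->
  exists M0, forall m m' r0 B t t' P P', (M0 <= m)%N -> (M0 <= m')%N ->
    (0 < r0)%N -> (0 < B)%N ->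
    representative r0 B m t P -> representative r0 B m' t' P' ->
    exists l0, forall l n (b : 'I_n -> fn K T), (l0 <= l)%N ->
      basis_mod [set 0] (R (r0 * l)%N) b -> (forall i, b i <> 0) ->
      (forall x, #|[pred i | weight (pow l P) (b i) <= x]| = vdim (pow l P x)) ->
      (forall x, #|[pred i | weight (pow l P') (b i) <= x]| = vdim (pow l P' x)) ->
      acos (cosine (alpha P l b) (alpha P' l b)) <= eta.
Proof.
move=> v0 eta0 hvar; have [dl dl0 hdl] := acos_small eta0.
have [Sg [/andP[S0 SL] Sub Snear]] := slope_sup RR hR hF hs s01 s0n.
set La : RR := (hi - lo)%:~R in SL.
have La0 : 0 <= La by apply: le_trans SL.
have [e [e0 e1 eC1 eC2]] := angle_constants v0 La0 dl0.
have [M1 hM1] := Snear e e0; have [d hd] := dens_ratio RR hR hF hs.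
exists (M1 + mv)%N => m m' r0 B t t' P P' mM mM' r00 B0 hP hP'.
have M0 : (0 < r0 * B)%N by rewrite muln_gt0 r00.
pose M := (r0 * B)%N.
have low m1 t1 P1 : (M1 + mv <= m1)%N -> representative r0 B m1 t1 P1 ->
    (0 < m1)%N /\ exists q1, forall q, (q1 <= q)%N ->
      (Sg - 2 * e) * dens m1 (t1 * q) <= mass m1 (t1 * q) /\
      v * (m1 * (t1 * q))%:R ^+ 2 * (N (m1 * (t1 * q))%N)%:R <= var m1 (t1 * q).
  move=> le1 [t10 _ _ _].
  have [m10 sl] := hM1 m1 (leq_trans (leq_addr _ _) le1); split=> //.
  have [k1 hk1] := hvar m1 (leq_trans (leq_addl _ _) le1).
  have [k2 hk2] := slope_near hR hF hs s01 s0n m10 e0.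
  exists (k1 + k2)%N => q qq.
  have tq : (q <= t1 * q)%N by apply: leq_pmull.
  have [k0 /andP[h _]] := hk2 (t1 * q)%N (leq_trans (leq_trans (leq_addl k1 k2) qq) tq).
  split; last exact: hk1 (leq_trans (leq_trans (leq_addr k2 k1) qq) tq).
  apply: le_trans h; apply: ler_wpM2r; first by apply/ltW/(dens_gt0 RR hR s01 s0n).
  rewrite mulr2n mulrDl mul1r opprD addrA; exact: lerB.
have [m0 [q1 hq1]] := low _ _ _ mM hP; have [m'0 [q2 hq2]] := low _ _ _ mM' hP'.
have [q3 hq3] := slope_near hR hF hs s01 s0n M0 e0.
have [h1 hh1] : exists h, R r0 `<=` P h by case: (rep_filt hP) => _ _ _.
have [h2 hh2] : exists h, R r0 `<=` P' h by case: (rep_filt hP') => _ _ _.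
(* One bound for both filtrations, so that they share the same [repr_top]; the cosine is then
   unchanged when weights are counted down from it. *)
pose h := `|h1| + `|h2|.
have h0 : 0 <= h by rewrite addr_ge0.
have hh : R r0 `<=` P h.
  move=> u /hh1; case: (rep_filt hP) => _ _ mono _ _; apply: mono.
  by apply: le_trans (ler_norm h1) _; rewrite lerDl.
have hh' : R r0 `<=` P' h.
  move=> u /hh2; case: (rep_filt hP') => _ _ mono _ _; apply: mono.
  by apply: le_trans (ler_norm h2) _; rewrite lerDr.
pose H : RR := ratr (2 * (B%:R * h)).
have H0 : 0 <= H by rewrite -(rmorph0 (ratr : rat -> RR)) ler_rat !mulr_ge0.
(* Makes (d + 1) / (q + 1) at most e / 2, which brings the ratios of the levels M q and M (q + 1),
   and of their mass units, close to 1. Likewise [l1] makes the bounded shift H at most e r. *)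
pose q4 := (Num.trunc (2 * (d%:R + 1) / e)).+1.
pose l1 := (Num.trunc (H / e)).+1.
exists (B * (q1 + q2 + q3 + q4) + l1)%N => l n b ll hb b0 hcnt hcnt'.
pose q := (l %/ B)%N; pose c := (l %% B)%N.
have lE : l = (B * q + c)%N by rewrite mulnC -divn_eq.
have cB : (c + (B - c) = B)%N by rewrite subnKC // ltnW // ltn_mod.
have qq : (q1 + q2 + q3 + q4 <= q)%N.
  by rewrite leq_divRL // mulnC; apply: leq_trans ll; apply: leq_addr.
have q0 : (0 < q)%N by apply: leq_trans qq; rewrite /q4 addnS.
have [qq1 qq2 qq3 qq4] := leq_sum4 qq.
have nE : n = N (r0 * l)%N.
  by rewrite /vdim (qdimE _ _ hb) //; [exact: subsp_set0|exact: (sr_sub hR)].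
have n0 : (0 < n)%N by rewrite nE; apply: N_gt0 hR _ s01 s0n _.
have [bR fb _] := (basis_modP b (@subsp_set0 _ _) (sr_sub hR _)).1 hb.
have bR' i : R (r0 * (B * q + c))%N (b i) by rewrite -lE.
pose a i : RR := ratr (repr_top hi r0 B h q c - weight (pow l P) (b i)).
pose a' i : RR := ratr (repr_top hi r0 B h q c - weight (pow l P') (b i)).
pose s := s0 ^+ r0.
pose et i := weight (pow q.+1 (Fw F M)) (s ^+ (B - c) * b i).
(* The covering filtration, also counted from its top, and raised by H so as to dominate both a and
   a'. *)
pose z i : RR := ratr ((hi * (M * q.+1)%:Z)%:~R - et i) + H.
have -> : cosine (alpha P l b) (alpha P' l b) = cosine a a'.
  rewrite -(cosine_sub _ _ (ratr (repr_top hi r0 B h q c)) n0).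
  by congr cosine; apply/funext => i; rewrite /a /a' rmorphB.
apply: hdl.
pose x : RR := (M * q)%:R; pose y : RR := (M * q.+1)%:R; pose r : RR := (r0 * l)%:R.
have Mql : (M * q <= r0 * l)%N by rewrite /M -mulnA leq_mul2l lE leq_addr orbT.
have lMq : (r0 * l <= M * q.+1)%N.
  by rewrite /M -mulnA leq_mul2l lE mulnS addnC leq_add2r -[leqRHS]cB leq_addr orbT.
have xr : x <= r by rewrite ler_nat.
have ry : r <= y by rewrite ler_nat.
have x0 : 0 < x by rewrite ltr0n muln_gt0 M0.
have y0 : 0 < y by rewrite ltr0n muln_gt0 M0.
have r_gt0 : 0 < r by apply: lt_le_trans xr.
have xyE : x / y = 1 - (q.+1)%:R^-1.
  rewrite /x /y !natrM -natr1; field.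
  by rewrite natr1 !pnatr_eq0 -!lt0n r00 B0.
have qinv : (d%:R + 1) * (q.+1)%:R^-1 <= e / 2.
  rewrite ler_pdivrMr ?ltr0n //.
  have : 2 * (d%:R + 1) / e < q.+1%:R.
    apply: lt_le_trans (truncnS_gt _) _; rewrite ler_nat -/q4; exact: leqW.
  by rewrite ltr_pdivrMr // => /ltW; rewrite mulrAC ler_pdivlMr // [_ * 2]mulrC [_ * e]mulrC.
have qi0 : 0 <= (q.+1)%:R^-1 :> RR by rewrite invr_ge0.
have dq0 : 0 <= d%:R * (q.+1)%:R^-1 :> RR by apply: mulr_ge0.
rewrite mulrDl mul1r in qinv.
have yx : (1 - e) * y <= x.
  rewrite -ler_pdivlMr // xyE lerD2l lerN2.
  apply: le_trans (_ : e / 2 <= _); last by rewrite ler_pdivrMr // ler_peMr ?ler1n // ltW.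
  by apply: le_trans qinv; rewrite lerDr.
have ratio : (1 - e / 2) * dens M q.+1 <= dens M q.
  apply: le_trans (hd M q M q.+1 _ _); [|by rewrite muln_gt0 M0|by rewrite leq_mul2l leqnSn orbT].
  apply: ler_wpM2r; first by apply/ltW/(dens_gt0 RR hR s01 s0n).
  have bern := @bernoulli_le RR (x / y) d _.
  apply: le_trans (bern _).
    rewrite xyE opprB addrCA subrr addr0 lerD2l lerN2.
    by apply: le_trans qinv; rewrite lerDl.
  rewrite divr_ge0 ?(ltW x0) ?(ltW y0) //= ler_pdivrMr // mul1r; exact: le_trans ry.
have nq0 : 0 <= (N (M * q)%N)%:R :> RR by [].
have nqn : (N (M * q)%N)%:R <= n%:R :> RR.
  by rewrite ler_nat nE; apply: (N_mono hR s01 s0n).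
have nn1 : n%:R <= (N (M * q.+1)%N)%:R :> RR.
  by rewrite ler_nat nE; apply: (N_mono hR s01 s0n).
have [sq1 sq2 sq3 sq4 sq5] := squeeze nq0 nqn nn1 x0 xr ry (ltW e0) e1 yx ratio.
have nR : 0 < n%:R :> RR by rewrite ltr0n.
have D0 : 0 <= r * n%:R by rewrite mulr_ge0 // ltW.
have Hr : H <= e * r.
  have : H / e < r.
    apply: lt_le_trans (truncnS_gt _) _; rewrite ler_nat -/l1.
    apply: leq_trans (leq_pmull l r00); apply: leq_trans ll; apply: leq_addl.
  by rewrite ltr_pdivrMr // mulrC; apply: ltW.
have y2x : y <= 2 * x.
  by rewrite /x /y -natrM ler_nat mulnS mul2n -addnn leq_add2r leq_pmulr.
have fam m1 t1 P1 : (0 < m1)%N -> representative r0 B m1 t1 P1 ->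
    R r0 `<=` P1 h ->
    (forall x, #|[pred i | weight (pow l P1) (b i) <= x]| = vdim (pow l P1 x)) ->
    (Sg - 2 * e) * dens m1 (t1 * q) <= mass m1 (t1 * q) ->
    v * (m1 * (t1 * q))%:R ^+ 2 * (N (m1 * (t1 * q))%N)%:R <= var m1 (t1 * q) ->
    let f i : RR := ratr (repr_top hi r0 B h q c - weight (pow l P1) (b i)) in
    [/\ forall i, 0 <= f i <= z i, (Sg - e * (La + 2)) * r * n%:R <= \sum_i f i &
      ((v + Sg ^+ 2) * (1 - 2 * e) - 4 * e * La) * r ^+ 2 * n%:R <= \sum_i f i ^+ 2].
  move=> m10 [t10 e1_ fP pP] hhP hc lm lv f.
  have MqE : (m1 * (t1 * q) = M * q)%N by rewrite mulnA -e1_.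
  have tq0 : (0 < t1 * q)%N by rewrite muln_gt0 t10.
  have fE i : f i = ratr (repr_top hi r0 B h q c - weight (pow (B * q + c) P1) (b i)).
    by rewrite /f {1}lE.
  have hc' x1 : #|[pred i | weight (pow (B * q + c) P1) (b i) <= x1]| =
      vdim (pow (B * q + c) P1 x1).
    by rewrite -lE.
  split.
  - move=> i; rewrite fE; apply/andP; split.
      rewrite -(rmorph0 (ratr : rat -> RR)) ler_rat.
      exact: (repr_ge0 hR hF hs r00 B0 m10 t10 e1_ fP pP h0 hhP q0 cB bR' b0).
    rewrite /z /H -rmorphD ler_rat.
    exact: (repr_le_cover hR hF hs s01 s0n r00 B0 m10 t10 e1_ fP pP h0 hhP q0 cB bR' b0).
  - under eq_bigr do rewrite fE.
    apply: le_trans (repr_mass RR hR hF hs s01 s0n r00 B0 m10 t10 e1_ fP pP h0 hhP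
      q0 cB bR' b0 hc').
    apply: le_trans lm; rewrite /mass_unit MqE -mulrA -/x.
    have A1 : Sg * ((1 - e) * (r * n%:R)) <= Sg * (x * (N (M * q)%N)%:R) by apply: ler_wpM2l.
    have A2 : e * (x * (N (M * q)%N)%:R) <= e * (r * n%:R) by apply: ler_wpM2l => //; apply: ltW.
    have A3 : Sg * (e * (r * n%:R)) <= La * (e * (r * n%:R)).
      by apply: ler_wpM2r => //; apply: mulr_ge0 => //; apply: ltW.
    exact: numeric_low A1 A2 A3.
  - under eq_bigr do rewrite fE.
    apply: le_trans (repr_mass2 RR hR hF hs s01 s0n r00 B0 m10 t10 e1_ fP pP h0 hhP
      q0 cB bR' b0 hc').
    apply: le_trans (moments_bound m10 tq0 S0 lm lv).
    rewrite /mass_unit MqE -/x -mulrA.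
    have A1 : (v + Sg ^+ 2) * ((1 - 2 * e) * (r ^+ 2 * n%:R)) <=
        (v + Sg ^+ 2) * (x * (x * (N (M * q)%N)%:R)).
      by apply: ler_wpM2l => //; rewrite addr_ge0 ?sqr_ge0 // ltW.
    have X0 : 0 <= x * (x * (N (M * q)%N)%:R) by rewrite !mulr_ge0 // ltW.
    have A2 : 4 * e * Sg * (x * (x * (N (M * q)%N)%:R)) <= 4 * e * La * (r ^+ 2 * n%:R).
      apply: ler_pM => //; first by rewrite !mulr_ge0 // ltW.
      by apply: ler_wpM2l => //; rewrite mulr_ge0 // ltW.
    exact: numeric_low2 A1 A2.
have [lm1 lv1] := hq1 q qq1; have [lm2 lv2] := hq2 q qq2.
have [fa1 fa2 fa3] := fam m t P m0 hP hh hcnt lm1 lv1.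
have [fb1 fb2 fb3] := fam m' t' P' m'0 hP' hh' hcnt' lm2 lv2.
have zle i : z i <= (2 * La + 1) * r.
  have h3 : ratr ((hi * (M * q.+1)%:Z)%:~R - et i) <= La * y.
    have -> : La * y = ratr ((hi - lo) * (M * q.+1)%:Z)%:~R by rewrite ratr_int intrM.
    rewrite ler_rat.
    exact: (cover_le hR hF hs s01 s0n r00 B0 m0 (rep_t hP) (rep_eq hP) h0 q0 cB bR' b0).
  have A1 : La * y <= La * (2 * r).
    by apply: ler_wpM2l => //; apply: le_trans y2x _; rewrite ler_pM2l.
  have A2 : e * r <= r by rewrite ler_piMl // ltW.
  apply: le_trans (lerD h3 Hr) _; apply: le_trans (lerD A1 A2) _.
  by rewrite le_eqVlt; apply/orP; left; apply/eqP; ring.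
have zsum : \sum_i z i <= (Sg + e * (La + 3)) * r * n%:R.
  rewrite big_split /= sumr_const card_ord.
  have := cover_mass RR hR hF hs s01 s0n r00 B0 m0 (rep_t hP) (rep_eq hP) h0 q0 cB bR' b0 fb.
  have [_ /andP[_ ms]] := hq3 q.+1 (leqW qq3).
  move=> /le_trans/(_ ms) h3; rewrite -[H *+ n]mulr_natr -mulrA.
  have slM := Sub _ M0.
  have A1 : (slope M + e) * dens M q.+1 <= (Sg + e) * ((1 + e) * (r * n%:R)).
    apply: ler_pM => //.
    + have /andP[p _] := slope_bounds RR hR hF hs s01 s0n M0; apply: addr_ge0 => //; exact: ltW.
    + by apply/ltW/(dens_gt0 RR hR s01 s0n).
    + by rewrite lerD2r.
  have A2 : H * n%:R <= e * (r * n%:R) by rewrite mulrA; apply: ler_wpM2r.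
  have A3 : Sg * (e * (r * n%:R)) <= La * (e * (r * n%:R)).
    by apply: ler_wpM2r => //; apply: mulr_ge0 => //; apply: ltW.
  have A4 : e * (e * (r * n%:R)) <= e * (r * n%:R).
    by apply: ler_wpM2l; [exact: ltW|rewrite ler_piMl].
  apply: (le_trans (lerD h3 A2)); apply: (le_trans (lerD A1 (lexx _))).
  exact: numeric_high A3 A4.
have vpos : 0 < v / 2 * r ^+ 2 by rewrite mulr_gt0 ?exprn_gt0 // divr_gt0.
have gap : v / 2 * r ^+ 2 <= ((v + Sg ^+ 2) * (1 - 2 * e) - 4 * e * La) * r ^+ 2 -
    ((Sg + e * (La + 3)) * r) ^+ 2.
  rewrite exprMn -mulrBl; apply: ler_wpM2r; first exact: sqr_ge0.
  have B1 : e * Sg ^+ 2 <= e * La ^+ 2.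
    by apply: ler_wpM2l; [exact: ltW|apply: lerXn2r].
  have B2 : e * (Sg * (La + 3)) <= e * (La * (La + 3)).
    by apply: ler_wpM2l; [exact: ltW|apply: ler_wpM2r => //; apply: addr_ge0].
  have B3 : e ^+ 2 * (La + 3) ^+ 2 <= e * (La + 3) ^+ 2.
    by apply: ler_wpM2r; [exact: sqr_ge0|rewrite expr2 ler_piMl // ltW].
  exact: numeric_gap eC1 B1 B2 B3.
have := angle_close_below n0 vpos fa1 fb1 zle zsum fa2 fb2 fa3 fb3 gap.
move=> /= /andP[h3 h4]; apply/andP; split; last exact: h4.
apply: le_trans h3; rewrite lerD2l lerN2.
rewrite (_ : _ / _ = e * (2 * (2 * La + 1) * (2 * La + 5)) / v); last first.
  by apply: numeric_end; rewrite gt_eqF.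
by rewrite ler_pdivrMr.
Qed.

End Angle.

(** * The Cauchy property *)

Section Membership.
Variables (K : closedFieldType) (T : Type) (RR : realType).
Variables (R : nat -> set (fn K T)).
Hypothesis hR : section_ring R.
Variable F : nat -> int -> set (fn K T).
Hypothesis hF : admissible R F.

Local Notation N r := (vdim (R r)).
Local Notation var := (wts_var RR R F).

Lemma var_cst m k (q : rat) : (0 < m)%N -> (0 < k)%N ->
  (forall a, a \in wts F m k -> a = q) -> var m k = 0.
Proof.
move=> m0 k0 h; have sz := wts_size hR hF m0 k0.
have e : wts F m k = nseq (N (m * k)%N) q.
  by rewrite -sz; apply/all_pred1P/allP => a /h ->; rewrite /= eqxx.
rewrite /wts_var e big_nseq; have [->//|n0] := posnP (N (m * k)%N).
rewrite [X in _ - X / _](_ : _ = (N (m * k)%N)%:R * ratr q); last first.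
  by rewrite big_nseq iter_addr_0 mulr_natl.
rewrite mulrAC divff ?mul1r ?subrr ?expr0n /=; last by rewrite pnatr_eq0 -lt0n.
by rewrite iter_addr_0 mul0rn.
Qed.

(** With a single jump q, all weights of the k-th power equal k q, and the variance vanishes. *)
Lemma two_jumps m k s : (0 < m)%N -> (0 < k)%N -> R m s -> s <> 0 -> var m k != 0 ->
  (1 < size (jumps (Fw F m)))%N.
Proof.
move=> m0 k0 ms s0; apply: contraR; rewrite -leqNgt => szJ; apply/eqP.
have hf := Fw_filt hF m0; have [_ _ hJ] := filt_jumps hf.
pose q := weight (Fw F m) s.
have wq v : R m v -> v <> 0 -> weight (Fw F m) v = q.
  move=> mv v0; have := hJ v mv v0; have := hJ s ms s0; rewrite -/q.
  by case: (jumps _) szJ => [|a [|]] //= _; rewrite !inE => /eqP -> /eqP ->.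
have low w v : Fw F m w v -> w < q -> v = 0.
  move=> wv wq'; apply: contrapT => v0; have mv : R m v by apply: (F_R hF wv).
  by have := (weightP hf mv v0 w).1 wv; rewrite wq // leNgt wq'.
have top v : R m v -> Fw F m q v.
  move=> mv; have [->|/eqP v0] := eqVneq v 0; first exact: (subsp0 (F_sub hF _ _)).
  by apply: (weightP hf mv v0 q).2; rewrite wq.
apply: (var_cst (q := k%:R * q)) => // a aw; apply/eqP; rewrite eq_le; apply/andP; split.
  have := wts_count hR hF k (k%:R * q) m0.
  rewrite (_ : pow k (Fw F m) (k%:R * q) = R (m * k)%N); last first.
    apply/seteqP; split; first exact: (pow_Fw_R hR hF).
    rewrite (sr_prods hR) ?muln_gt0 ?m0 //; apply: span_min; first exact: subsp_pow.
    move=> _ [u [b [hu _ ->]]]; apply: (@pow_prod _ _ _ _ _ (fun=> q)).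
      by move=> j; apply: top.
    by rewrite sumr_const card_ord -[q *+ k]mulr_natl.
  by rewrite -(wts_size hR hF m0 k0) => /eqP; rewrite -all_count => /allP/(_ _ aw).
rewrite leNgt; apply/negP => lt.
have := wts_count hR hF k a m0; rewrite (_ : pow k (Fw F m) a = [set 0]).
  rewrite vdim_set0 => e; suff : has (fun w : rat => w <= a) (wts F m k) by rewrite has_count e.
  by apply/hasP; exists a.
apply/seteqP; split; last by move=> _ ->; apply: (subsp0 (subsp_pow _ _ _)).
apply: span_min; first exact: subsp_set0.
move=> _ [u [b [hu hb ->]]].
have [j bj] : exists j, b j < q.
  apply: contrapT => hn; move: lt; rewrite ltNge => /negP; apply; apply: le_trans hb.
  rewrite (_ : k%:R * q = \sum_(j < k) q); last by rewrite sumr_const card_ord -[q *+ k]mulr_natl.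
  apply: ler_sum => j _; rewrite leNgt; apply/negP => h; apply: hn; by exists j.
by rewrite (bigD1 j) //= (low _ _ (hu j) bj) mul0r.
Qed.

Lemma two_jumps_free m : (0 < m)%N -> (1 < size (jumps (Fw F m)))%N ->
  exists u v, [/\ R m u, R m v & forall a b : K, a *: u + b *: v = 0 -> a = 0 /\ b = 0].
Proof.
move=> m0; have hf := Fw_filt hF m0; have [sJ jE hJ] := filt_jumps hf.
case: (jumps _) sJ jE hJ => [|a [|b J]] //= /andP[ab _] jE _ _.
have sub (w : rat) : is_subspace (Fw F m w) := F_sub hF m (Num.floor w).
have [u [hu hu']] : jump (Fw F m) a by apply/jE; rewrite mem_head.
have [v [hv hv']] : jump (Fw F m) b by apply/jE; rewrite !inE eqxx orbT.
exists u, v; split; [exact: (F_R hF hu)|exact: (F_R hF hv)|move=> c d e].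
have u0 : u <> 0 by move=> u0; apply: (hu' (a - 1)); [lra|rewrite u0; apply: (subsp0 (sub _))].
have d0 : d = 0.
  apply/eqP; apply: contrapT => /negP d0; apply: (hv' a ab).
  have -> : v = - (d^-1 * c) *: u.
    have : d^-1 *: (c *: u + d *: v) = 0 by rewrite e scaler0.
    by rewrite scalerDr !scalerA mulVf // scale1r addrC scaleNr => /eqP; rewrite addr_eq0 => /eqP.
  by apply: (subspZ _ (sub _)).
split=> //; move: e; rewrite d0 scale0r addr0 => e; apply/eqP; apply: contrapT => /negP c0.
by apply: u0; rewrite -[u]scale1r -(mulVf c0) -scalerA e scaler0.
Qed.

(* A quadratic form in u, v is a product of linear forms. *)
Lemma vdim_double m u v : R m u -> R m v ->
  (forall a b : K, a *: u + b *: v = 0 -> a = 0 /\ b = 0) -> (2 < N (m * 2)%N)%N.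
Proof.
move=> mu mv fr.
have lin a b : R m (a *: u + b *: v).
  by apply: (subspD (sr_sub hR _)); apply: (subspZ _ (sr_sub hR _)).
have key c0 c1 c2 : c0 *: (u * u) + c1 *: (u * v) + c2 *: (v * v) = 0 ->
    [/\ c0 = 0, c1 = 0 & c2 = 0].
  move=> e; have [c2z|c2n] := eqVneq c2 0.
    have : u * (c0 *: u + c1 *: v) = 0.
      by rewrite mulrDr -!fn_scalerAr -[RHS]e c2z scale0r addr0.
    move=> /(sr_dom hR mu (lin _ _))[u0|/fr[]] //.
    have /fr[] : 1 *: u + 0 *: v = 0 by rewrite u0 scaler0 scale0r addr0.
    by move=> /eqP; rewrite oner_eq0.
  (* The linear factors come from the roots al and be of c2 T^2 + c1 T + c0, whose sum is - c1 /
     c2. *)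
  have [al hal] := GRing.solve_monicpoly 2 (fun i => if i == 0%N then - c0 / c2 else - c1 / c2) isT.
  rewrite !big_ord_recl big_ord0 /= expr0 mulr1 expr1 addr0 in hal.
  pose be := - c1 / c2 - al.
  have : (- al *: u + 1 *: v) * (- be *: u + 1 *: v) = 0.
    have := congr1 (fun f => c2^-1 *: f) e; rewrite scaler0 => <-.
    rewrite !scale1r mulrDl !mulrDr -!fn_scalerAl -!fn_scalerAr !scalerDr !scalerA.
    rewrite [v * u]mulrC addrA -[_ + _ + - be *: _]addrA -scalerDl mulVf // scale1r.
    congr (_ *: _ + _ *: _ + _); last by rewrite /be; field.
    have -> : c0 = - c2 * (al ^+ 2 + c1 / c2 * al) by rewrite hal; field.
    by rewrite /be; field.
  have one a : (- a *: u + 1 *: v) <> 0 by move=> /fr[_ /eqP]; rewrite oner_eq0.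
  by move=> /(sr_dom hR (lin _ _) (lin _ _))[/one|/one].
pose b (i : 'I_3) : fn K T :=
  if i == 0 :> nat then u * u else if i == 1 :> nat then u * v else v * v.
apply: (qdim_free_le (U := [set 0]) (b := b) (@subsp_set0 _ _) (sr_sub hR _) (sr_fg hR _)).
  by move=> i; rewrite muln2 -addnn /b; case: ifP => _; [|case: ifP => _]; apply: (sr_mul hR).
move=> c /=; rewrite !big_ord_recl big_ord0 addr0 addrA /b /= => /key[h0 h1 h2].
apply/rowP => i; rewrite mxE; case: i => -[|[|[|//]]] hi.
- by rewrite -[RHS]h0; congr (c _ _); apply: val_inj.
- by rewrite -[RHS]h1; congr (c _ _); apply: val_inj.
- by rewrite -[RHS]h2; congr (c _ _); apply: val_inj.
Qed.

(** Positive variance gives two jumps for large m, hence two independent vectors in some R_m and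
    three independent products in R_(2 m). The dimension is then at least 3 in every higher degree
    too. *)
Lemma approx_flag_weighted n : filtration_L2norm RR n R F <> 0%E ->
  exists m0, forall m, (m0 <= m)%N -> (0 < m)%N /\ Delta R m (approx_flag R F m).
Proof.
move=> nF; have [s [s1 s0]] := norm_R1 hR hF nF.
have [c [m0 [c0 h]]] := norm_gt0 hR hF nF.
have J m : (m0 < m)%N -> (1 < size (jumps (Fw F m)))%N.
  move=> mm; have [k0 hk0] := h m (ltnW mm).
  have := hk0 k0.+1 (leqnSn _) => hv; have m_gt0 : (0 < m)%N by apply: leq_ltn_trans mm.
  apply: (two_jumps m_gt0 (ltn0Sn k0) (s0_exp_R hR s1 m)); first exact: s0_exp_neq0 hR _ s1 s0 _.
  rewrite gt_eqF //; apply: lt_le_trans hv.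
  by rewrite mulr_gt0 ?exprn_gt0 // ltr0n muln_gt0 m_gt0.
have [u [v [hu hv fr]]] := two_jumps_free (ltn0Sn m0) (J m0.+1 (ltnSn _)).
exists (m0.+1 * 2)%N => m mm; have m_gt0 : (0 < m)%N by apply: leq_trans mm.
split=> //; apply: flag_of_weighted.
- exact: Fw_filt.
- exact: (sr_sub hR).
- exact: (sr_fg hR).
- by apply: leq_trans (vdim_double hu hv fr) _; apply: (N_mono hR s1 s0).
- by apply: J; lia.
Qed.

Lemma filt_rescale (V : set (fn K T)) W (c nu : rat) : 0 < c ->
  filt V W -> filt V (fun w => W (c * w + nu)).
Proof.
move=> c0 [h1 h2 h3 [hi h4] [S h5]]; split=> //.
- by move=> w w' ww'; apply: h3; rewrite lerD2r ler_pM2l.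
- by exists ((hi - nu) / c); rewrite mulrC divfK ?gt_eqF // subrK.
- exists [seq (s - nu) / c | s <- S] => w v /h5 h v0; have [s [sS sw sv]] := h v0.
  exists ((s - nu) / c); split; first exact: map_f.
    by rewrite ler_pdivrMr // mulrC lerBlDr.
  by rewrite mulrC divfK ?gt_eqF // subrK.
Qed.

Lemma weight_rescale (V : set (fn K T)) W (c nu : rat) v : 0 < c -> filt V W -> V v -> v <> 0 ->
  weight W v = c * weight (fun w => W (c * w + nu)) v + nu.
Proof.
move=> c0 hf Vv v0; have h1 := weightP hf Vv v0.
have h2 := weightP (filt_rescale nu c0 hf) Vv v0.
apply/eqP; rewrite eq_le; apply/andP; split; first by apply/h1/h2.
rewrite -lerBrDr mulrC -ler_pdivlMr //; apply/h2.
by rewrite mulrC divfK ?gt_eqF // subrK; apply/h1.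
Qed.

Lemma veronese_mapE r k p :
  veronese_map R r k p = flag_of (R (r * k)%N) (pow k (flag_filtration p)).
Proof. by []. Qed.

Lemma limit_pt_repr m r0 p : (0 < m)%N -> limit_pt R m (approx_flag R F m) (r0, p) ->
  (0 < r0)%N /\ filt (R r0) (flag_filtration p) /\
  exists B t c nu, [/\ (0 < B)%N, 0 < c &
    representative R F r0 B m t (fun w => flag_filtration p (c * w + nu))].
Proof.
move=> m0 [/= r00 /weighted_flag_filt hp [t [B [t0 B0 e]]]].
rewrite !veronese_mapE => hE; split=> //; split=> //.
have hf := Fw_filt hF m0; set mu := mean (R m) (Fw F m).
have e1 w : flag_filtration (approx_flag R F m) w = Fw F m (1 * w + mu).
  by rewrite (flag_filtration_flag_of w hf) mul1r.
have eW w : pow t (flag_filtration (approx_flag R F m)) w = pow t (Fw F m) (w + t%:R * mu).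
  by rewrite (pow_ext t _ e1) pow_rescale // mul1r.
have hW1 : filt (R (m * t)%N) (pow t (flag_filtration (approx_flag R F m))).
  apply: (filt_pow_R hR) => //.
  rewrite (_ : flag_filtration _ = fun w => Fw F m (1 * w + mu)); last exact/funext.
  exact: filt_rescale.
have hW2 : filt (R (m * t)%N) (pow B (flag_filtration p)).
  by rewrite e; apply: (filt_pow_R hR).
rewrite -e in hE; have [c [nu [c0 h]]] := flag_equiv_filt hW1 hW2 hE.
have BR : B%:R != 0 :> rat by rewrite pnatr_eq0 -lt0n.
(* The shift is divided by B because the B-th power repeats it B times; the term in t mu undoes the
   centering of [approx_flag]. *)
exists B, t, c, ((nu - c * (t%:R * mu)) / B%:R); split=> //; split=> //.
  exact: filt_rescale.
move=> w; rewrite pow_rescale //.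
have -> : c * w + B%:R * ((nu - c * (t%:R * mu)) / B%:R) = c * (w - t%:R * mu) + nu.
  by field.
by rewrite h eW subrK.
Qed.

Lemma representative_mul r0 B m t P b : (0 < b)%N -> representative R F r0 B m t P ->
  representative R F r0 (B * b) m (t * b) P.
Proof.
move=> b0 [t0 e hP pP]; split=> //; first by rewrite muln_gt0 t0.
  by rewrite !mulnA e.
by move=> w; rewrite -!pow_pow; apply: pow_ext.
Qed.

Lemma cosine_scale n (a b x y : 'I_n -> RR) c d : 0 < c -> 0 < d ->
  (forall i, x i = c * (a i - avg a)) -> (forall i, y i = d * (b i - avg b)) ->
  (\sum_i x i * y i) / Num.sqrt ((\sum_i x i ^+ 2) * (\sum_i y i ^+ 2)) = cosine a b.
Proof.
move=> c0 d0 hx hy; rewrite /cosine.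
have -> : \sum_i x i * y i = (c * d) * \sum_i (a i - avg a) * (b i - avg b).
  by rewrite mulr_sumr; apply: eq_bigr => i _; rewrite hx hy mulrACA.
have -> : (\sum_i x i ^+ 2) * (\sum_i y i ^+ 2) =
    (c * d) ^+ 2 * ((\sum_i (a i - avg a) ^+ 2) * (\sum_i (b i - avg b) ^+ 2)).
  under eq_bigr do rewrite hx exprMn; under [X in _ * X]eq_bigr do rewrite hy exprMn.
  by rewrite -!mulr_sumr exprMn mulrACA.
have cd0 : 0 < c * d by rewrite mulr_gt0.
by rewrite sqrtrM ?sqr_ge0 // sqrtr_sqr gtr0_norm // -mulf_div divff ?mul1r // gt_eqF.
Qed.

Section Distance.
Variables (r0 l : nat) (p : flag K T) (c nu : rat).
Hypotheses (r00 : (0 < r0)%N) (l0 : (0 < l)%N) (c0 : 0 < c).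
Hypothesis hp : filt (R r0) (flag_filtration p).
Variables (n : nat) (b : 'I_n -> fn K T).
Hypotheses (n0 : (0 < n)%N) (hb : basis_mod [set 0] (R (r0 * l)%N) b).
Hypothesis ab : adapted b (veronese_map R r0 l p).

Local Notation W := (pow l (flag_filtration p)).
Local Notation W' := (pow l (fun w => flag_filtration p (c * w + nu))).

Let hW : filt (R (r0 * l)%N) W := filt_pow_R hR r00 hp l0.
Let bn i : b i <> 0 := @adapted_neq0 _ _ _ _ _ (sr_sub hR _) hb i.
Let bR i : R (r0 * l)%N (b i).
Proof. by have [h _ _] := (basis_modP b (@subsp_set0 _ _) (sr_sub hR _)).1 hb. Qed.

Lemma weight_repr i : weight W (b i) = c * weight W' (b i) + l%:R * nu.
Proof.
rewrite (weight_rescale (l%:R * nu) c0 hW (bR i) (@bn i)).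
by congr (_ * weight _ _ + _); apply/funext => w; rewrite pow_rescale.
Qed.

Lemma repr_count x : #|[pred i | weight W' (b i) <= x]| = vdim (W' x).
Proof.
rewrite pow_rescale // -(adapted_count hW (sr_sub hR _) hb ab).
by apply: eq_card => i; rewrite !inE weight_repr lerD2r ler_pM2l.
Qed.

(** The subtracted [mean] is the average weight of the adapted basis. Centering removes the shift nu
    and leaves the factor c, which the cosine does not see. *)
Lemma vweight_repr i : ratr (vweight (veronese_map R r0 l p) (b i)) =
  ratr c * (ratr (weight W' (b i)) - avg (fun j => ratr (weight W' (b j)))) :> RR.
Proof.
rewrite veronese_mapE (vweight_flag_of hW (bR i) (@bn i)).
have nR : n%:R != 0 :> rat by rewrite pnatr_eq0 -lt0n.
have := adapted_trace hW (sr_sub hR _) (sr_fg hR _) hb ab.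
move/(congr1 (fun x => x / n%:R)); rewrite [RHS]mulrAC divff // mul1r => <-.
have -> : avg (fun j => ratr (weight W' (b j))) = ratr ((\sum_j weight W' (b j)) / n%:R) :> RR.
  by rewrite /avg fmorph_div /= ratr_nat rmorph_sum.
rewrite -rmorphB -rmorphM /=; congr ratr.
under eq_bigr do rewrite weight_repr.
by rewrite weight_repr big_split /= -mulr_sumr sumr_const card_ord -mulr_natl; field.
Qed.

End Distance.

Lemma dist_small (eta : RR) n : 0 < eta -> filtration_L2norm RR n R F <> 0%E ->
  (exists C k0, forall k, (k0 <= k)%N -> (N k <= C * k.+1 ^ n)%N) ->
  exists M0, forall m m', (0 < m)%N -> (0 < m')%N -> (M0 <= m)%N -> (M0 <= m')%N ->
    (dist_inf RR R (approx_pt R F m) (approx_pt R F m') <= eta%:E)%E.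
Proof.
move=> eta0 nF hN; have [s [s1 s0]] := norm_R1 hR hF nF.
have [lo [hi hs]] := slopes_exist hF.
have [v [mv [v0 hv]]] := var_bound hR hF nF hN.
have [M0 hM0] := angle_core hR hF hs s1 s0 v0 eta0 hv.
exists M0 => m m' m0 m'0 mM m'M.
(* The estimate is proved for all representatives, hence for those selected by [get]; on an empty
   set [get] returns the default value 0. *)
rewrite /dist_inf; set S := [set d | _].
have [[d Sd]|hn] := pselect (exists d, S d); last first.
  rewrite getPN; first by rewrite lee_fin ltW.
  by move=> d Sd; apply: hn; exists d.
have : S (get S) by apply: getPex; exists d.
move: (get S) => {d Sd} d [r0 [p [q [hp hq ->]]]].
have [r00 [fp [B [t [c [nu [B0 c0 rp]]]]]]] := limit_pt_repr m0 hp.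
have [_ [fq [B' [t' [c' [nu' [B'0 c'0 rq]]]]]]] := limit_pt_repr m'0 hq.
(* The product B B' serves for both points, as [angle_core] asks for a common B. *)
have BB0 : (0 < B * B')%N by rewrite muln_gt0 B0.
have rp' := representative_mul B'0 rp.
have := representative_mul B0 rq; rewrite [(B' * B)%N]mulnC => rq'.
have [l0 hl0] := hM0 _ _ _ _ _ _ _ _ mM m'M r00 BB0 rp' rq'.
apply: (limn_esup_le (l0 := l0)) => l ll; rewrite /tits_dist.
set S' := [set r | _].
have [[x Sx]|hn] := pselect (exists x, S' x); last first.
  by rewrite getPN; [exact: ltW|move=> x Sx; apply: hn; exists x].
have : S' (get S') by apply: getPex; exists x.
move: (get S') => {x Sx} x [k [b [hb ab ab' ->]]].
have kE : k = N (r0 * l.+1)%N.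
  by rewrite /vdim (qdimE _ _ hb) //; [exact: subsp_set0|exact: (sr_sub hR)].
have k0 : (0 < k)%N by rewrite kE; apply: N_gt0 hR _ s1 s0 _.
rewrite !rmorph_sum /=.
under eq_bigr do rewrite rmorphM /=.
under [X in Num.sqrt (X * _)]eq_bigr do rewrite rmorphXn /=.
under [X in Num.sqrt (_ * X)]eq_bigr do rewrite rmorphXn /=.
rewrite (cosine_scale (c := ratr c) (d := ratr c') _ _
  (fun i => vweight_repr nu r00 (ltn0Sn l) c0 fp k0 hb ab i)
  (fun i => vweight_repr nu' r00 (ltn0Sn l) c'0 fq k0 hb ab' i)) ?ltr0q //.
apply: (hl0 l.+1 k b (leqW ll) hb).
- by move=> i; apply: (adapted_neq0 (sr_sub hR _) hb).
- exact: (repr_count nu r00 (ltn0Sn l) c0 fp hb ab).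
- exact: (repr_count nu' r00 (ltn0Sn l) c'0 fq hb ab').
Qed.

End Membership.

Section SectionRing.
Variables (K : closedFieldType) (N : nat) (X : set 'rV[K]_N.+1).
Hypotheses (varX : projective_variety X) (pnL : projectively_normal X).

Lemma section_ring_H0 : section_ring (H0 X).
Proof.
split.
- exact: subsp_H0.
- exact: H0_one.
- by move=> a b u v; apply: H0_mul.
- by move=> a b u v; apply: (H0_domain varX).
- exact: (fg_H0 varX).
- move=> k /pnL h v /h; apply: span_mono => _ [u [hu ->]].
  by exists u, (fun=> 0); split=> //; rewrite big1.
pose dil (a : K) (y : {x | X x}) : {x | X x} := match pselect (a != 0) with
  | left a0 => exist _ (a *: sval y) (variety_scale varX (svalP y) a0)
  | right _ => y end.
exists dil => k s a y hs a0; apply: (H0_scale hs a0).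
by rewrite /dil; case: pselect.
Qed.

End SectionRing.

Theorem theorem1p2 (RR : realType) (K : closedFieldType)
    (charK : [pchar K] =i pred0)
    (N n : nat) (X : set 'rV[K]_N.+1)
    (varX : projective_variety X) (normX : normal_variety X)
    (dimX : variety_dim X n) (pnL : projectively_normal X)
    (F : nat -> int -> set (fn K {x | X x}))
    (admF : admissible (H0 X) F)
    (nfgF : ~ finitely_generated F)
    (normF : filtration_L2norm RR n (H0 X) F <> 0%E) :
  exists m0 : nat,
    (forall m, (m0 <= m)%N ->
       Delta (H0 X) m (approx_flag (H0 X) F m) /\
       Delta_inf (H0 X) (approx_pt (H0 X) F m)) /\
    (forall eps : RR, 0 < eps -> exists M : nat, (m0 <= M)%N /\
       forall m m', (M <= m)%N -> (M <= m')%N ->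
         (dist_inf RR (H0 X) (approx_pt (H0 X) F m) (approx_pt (H0 X) F m')
            < eps%:E)%E).
Proof.
have hR := section_ring_H0 varX pnL.
have [m0 hm0] := approx_flag_weighted hR admF normF.
exists m0; split=> [m mm|eps eps0].
  have [m_gt0 hD] := hm0 m mm; split=> //.
  by exists m, (approx_flag (H0 X) F m).
(* Half of eps, since [dist_small] gives a weak inequality and a strict one is wanted. *)
have eps2 : 0 < eps / 2 by rewrite divr_gt0.
have [M0 hM0] := dist_small hR admF eps2 normF (vdim_H0_growth varX dimX.2).
exists (m0 + M0)%N; split=> [|m m' mm mm']; first exact: leq_addr.
have le_l x : (m0 + M0 <= x)%N -> (m0 <= x)%N by apply: leq_trans; apply: leq_addr.
have le_r x : (m0 + M0 <= x)%N -> (M0 <= x)%N by apply: leq_trans; apply: leq_addl.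
apply: le_lt_trans (hM0 m m' _ _ (le_r _ mm) (le_r _ mm')) _.
- by have [] := hm0 m (le_l _ mm).
- by have [] := hm0 m' (le_l _ mm').
- by rewrite lte_fin ltr_pdivrMr // ltr_pMr // ltr1n.
Qed.
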